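(* For every $T$ with $3\cdot10^{12}<T\le\exp(6.7\cdot10^{12})$ and every $\sigma\in[0.9927,1]$, $$N(\sigma,T)\le 1.62\cdot10^{11}\; T^{1.448(1-\sigma)}.$$
   Context: $\zeta$ is the Riemann zeta function and $N(\sigma,T)=\#\{\rho=\beta+i\gamma:\ \zeta(\rho)=0,\ 0<\gamma<T,\ \sigma<\beta<1\}$ (so $N(1,T)=0$). *)

(* Defs.v *)
From HB Require Import structures.
From mathcomp Require Import all_boot all_order all_algebra.
From mathcomp Require Import complex.
From mathcomp Require Import all_classical all_reals all_analysis.
Set Implicit Arguments.
Unset Strict Implicit.
Unset Printing Implicit Defensive.
Import Order.TTheory GRing.Theory Num.Theory.
Import numFieldNormedType.Exports.

Local Open Scope classical_set_scope.
Local Open Scope ring_scope.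
Local Open Scope complex_scope.

(* [R[i]^o] is the complex field as a normed space over itself: limits are those
   of the complex modulus and derivatives along 1 are complex derivatives. *)
Notation Cplx R := ((R[i])^o) (only parsing).

Definition expC (R : realType) (z : Cplx R) : Cplx R :=
  (expR (complex.Re z) * cos (complex.Im z)) +i*
  (expR (complex.Re z) * sin (complex.Im z)).

(* n ^ (- s) = exp (- s log n); only meant for n > 0. *)
Definition dirichlet_term (R : realType) (s : Cplx R) (n : nat) : Cplx R :=
  expC (- (s * (ln (n%:R : R))%:C)).

(* The Riemann zeta function is the analytic continuation to C minus {1} of the
   sum of the n ^ (- s), n >= 1, Re s > 1. By the identity theorem this
   determines zeta everywhere but at the pole s = 1, where its value is
   irrelevant to zeros with positive imaginary part. *)
Definition is_riemann_zeta (R : realType) (zeta : Cplx R -> Cplx R) : Prop :=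
  (forall s : Cplx R, s != 1 -> derivable zeta s 1) /\
  (forall s : Cplx R, 1 < complex.Re s ->
     series (fun k => dirichlet_term s k.+1) @ \oo --> zeta s).

Definition zeta_zeros (R : realType) (zeta : Cplx R -> Cplx R)
    (sigma T : R) : set (Cplx R) :=
  [set rho | zeta rho = 0 /\ 0 < complex.Im rho < T
             /\ sigma < complex.Re rho < 1].

(* Cardinality of the set of zeros (without multiplicity), +oo if infinite; a
   real upper bound on it thus includes finiteness. *)
Definition Nzeros (R : realType) (zeta : Cplx R -> Cplx R)
    (sigma T : R) : \bar R :=
  counting (zeta_zeros zeta sigma T).

(* Main.v *)
Require Import Defs.
From mathcomp Require Import all_boot all_order all_algebra.
From mathcomp Require Import complex cyclic.
From mathcomp Require Import all_classical all_reals all_analysis.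
From mathcomp Require Import zify ring lra.
Import Order.TTheory GRing.Theory Num.Theory.
Import numFieldNormedType.Exports.
Set Implicit Arguments.
Unset Strict Implicit.
Unset Printing Implicit Defensive.
Local Open Scope ring_scope.
Local Open Scope complex_scope.

(* Proof idea: a log-free zero-density theorem in the manner of Selberg and Graham.
   Let rho be a zero with Re rho >= 1 - eta and T1 <= Im rho <= T. Multiply the zeta
   series by Psi (n) Theta (n), where Psi is a divisor sum of smoothly truncated Moebius
   values, so that Psi (n) = [n = 1] for n <= z1, and Theta is a divisor sum of Selberg
   weights of level y. Since the Euler-Maclaurin approximation of zeta is uniformly small
   beyond a power of T (van der Corput's method), the sum of Psi (n) Theta (n) n ^ (- rho)
   over z1 < n <= N is close to - 1. Halasz's inequality, with a geometrically averaged
   cutoff that makes the off-diagonal terms decay quadratically in the distance of the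
   zeros, bounds the number of well-spaced zeros: the mean square of Psi is bounded (the
   upper bound sieve of Barban and Vehov) and Selberg's weights save the remaining
   logarithm of T. A Jensen-type inequality bounds the number of zeros close to one
   another. The parameters are chosen in finitely many ranges of ln T; each range is
   reduced to a smaller height, down to exp 18, where Jensen's inequality alone suffices. *)

(** The exponent is where the argument is tight. With L = ln T every length is a power of T: the
    sums have length N = T^n, and two zeros with real parts at least 1 - eta correlate with weight
    T^(2 eta (n + k2)), so 2 (n + k2) must stay below 1.448. In the last range n + k2 = 0.718, of
    which 0.5888 is twice the exponent al of the length T^al from which the approximation of zeta is
    used; al = 1, a sum of length T, would give an exponent above 4. This is why differencing is
    carried to the third order. Below ln T = 6000 the exponent may exceed 1.448, since the excess is
    a bounded factor. In units of 10^9 the coefficient is 27 + 95 up to ln T = 6000, plus 3 for each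
    of six reductions of ln T by the factor 50; the sum 140 is below 162. The bound for zeros close
    to one another contains ln ln T, replaced by a constant valid up to ln T = 6.7 10^12, whence the
    upper limit on T. Zeta is given only by its derivative off 1 and its series for Re s > 1; its
    values further left are reached through the maximum principle alone. *)

Section ComplexModulus.
Variable R : realType.
Implicit Types z w : R[i].

Definition cabs z : R := Normc.normc z.

Lemma cabsE z : cabs z = Num.sqrt (complex.Re z ^+ 2 + complex.Im z ^+ 2).
Proof. by case: z. Qed.

Lemma cabs0 : cabs 0 = 0. Proof. exact: Normc.normc0. Qed.
Lemma cabs1 : cabs 1 = 1. Proof. exact: Normc.normc1. Qed.
Lemma cabsM z w : cabs (z * w) = cabs z * cabs w. Proof. exact: Normc.normcM. Qed.
Lemma cabsV z : cabs z^-1 = (cabs z)^-1. Proof. exact: Normc.normcV. Qed.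
Lemma cabsN z : cabs (- z) = cabs z. Proof. exact: normcN. Qed.
Lemma cabsD z w : cabs (z + w) <= cabs z + cabs w. Proof. exact: le_normcD. Qed.
Lemma cabsB z w : cabs (z - w) <= cabs z + cabs w.
Proof. by rewrite -[cabs w]cabsN; exact: cabsD. Qed.
Lemma cabs_subC z w : cabs (z - w) = cabs (w - z).
Proof. by rewrite -cabsN opprB. Qed.
Lemma cabs_ge0 z : 0 <= cabs z. Proof. by rewrite cabsE sqrtr_ge0. Qed.
Lemma cabs_eq0 z : (cabs z == 0) = (z == 0).
Proof.
apply/eqP/eqP => [|->]; last exact: cabs0.
exact: Normc.eq0_normc.
Qed.
Lemma cabs_gt0 z : (0 < cabs z) = (z != 0).
Proof. by rewrite lt_def cabs_ge0 andbT cabs_eq0. Qed.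
Lemma cabsX z n : cabs (z ^+ n) = cabs z ^+ n.
Proof. by elim: n => [|n IH]; rewrite ?expr0 ?cabs1 // !exprS cabsM IH. Qed.
Lemma cabs_real (x : R) : cabs (x%:C) = `|x|.
Proof. by rewrite cabsE /= expr0n addr0 sqrtr_sqr. Qed.
Lemma cabs_prod (I : Type) (s : seq I) (P : pred I) (F : I -> R[i]) :
  cabs (\prod_(i <- s | P i) F i) = \prod_(i <- s | P i) cabs (F i).
Proof. by elim/big_rec2: _ => [|i x y _ <-]; rewrite ?cabs1 ?cabsM. Qed.
Lemma cabs_sum (I : Type) (s : seq I) (P : pred I) (F : I -> R[i]) :
  cabs (\sum_(i <- s | P i) F i) <= \sum_(i <- s | P i) cabs (F i).
Proof.
elim/big_rec2: _ => [|i x y _ H]; rewrite ?cabs0 //.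
by apply: (le_trans (cabsD _ _)); rewrite lerD2l.
Qed.
Lemma cabs_ler_sub z w : cabs z - cabs w <= cabs (z - w).
Proof. by rewrite lerBlDr -[in leLHS](subrK w z) cabsD. Qed.
Lemma Re_le_cabs z : `|complex.Re z| <= cabs z.
Proof. by rewrite cabsE -sqrtr_sqr ler_wsqrtr // lerDl sqr_ge0. Qed.
Lemma Im_le_cabs z : `|complex.Im z| <= cabs z.
Proof. by rewrite cabsE -sqrtr_sqr ler_wsqrtr // lerDr sqr_ge0. Qed.
Lemma ReleC z : complex.Re z <= cabs z.
Proof. exact: le_trans (ler_norm _) (Re_le_cabs z). Qed.
Lemma cabs_le_ReIm z : cabs z <= `|complex.Re z| + `|complex.Im z|.
Proof.
rewrite cabsE -[leRHS](@ger0_norm _ (_ + _)) ?addr_ge0 // -sqrtr_sqr ler_wsqrtr //.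
rewrite sqrrD !real_normK ?num_real //.
by rewrite addrAC lerDl mulrn_wge0 // mulr_ge0.
Qed.
Lemma cabsJ z : cabs (z^*)%C = cabs z.
Proof. by rewrite !cabsE; case: z => a b /=; rewrite sqrrN. Qed.
Lemma mulcJ z : z * (z^*)%C = (cabs z ^+ 2)%:C.
Proof.
rewrite cabsE sqr_sqrtr ?addr_ge0 ?sqr_ge0 //; case: z => a b /=; simpc.
by congr (_ +i* _); ring.
Qed.
Lemma ReD z w : complex.Re (z + w) = complex.Re z + complex.Re w.
Proof. by case: z w => a b [c d]. Qed.
Lemma ImD z w : complex.Im (z + w) = complex.Im z + complex.Im w.
Proof. by case: z w => a b [c d]. Qed.
Lemma ReN z : complex.Re (- z) = - complex.Re z. Proof. by case: z. Qed.
Lemma ImN z : complex.Im (- z) = - complex.Im z. Proof. by case: z. Qed.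
Lemma ReMr z (x : R) : complex.Re (z * x%:C) = complex.Re z * x.
Proof. by case: z => a b; simpc. Qed.
Lemma ImMr z (x : R) : complex.Im (z * x%:C) = complex.Im z * x.
Proof. by case: z => a b; simpc. Qed.
Lemma complex_ext z w :
  complex.Re z = complex.Re w -> complex.Im z = complex.Im w -> z = w.
Proof. by case: z w => a b [c d] /= -> ->. Qed.
End ComplexModulus.

(** * Elementary inequalities for the exponential, sine and cosine *)

Section RealInequalities.
Variable R : realType.
Implicit Types x y : R.

Lemma mean_value (f df : R -> R) (a b : R) : a < b ->
  (forall x, a <= x <= b -> is_derive x 1 f (df x)) ->
  exists2 c, a < c < b & f b - f a = df c * (b - a).
Proof.
move=> ab H.
have [||c] := @MVT R f df a b ab.
- move=> x; rewrite in_itv /= => /andP[ax xb]; apply: H.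
  by rewrite (ltW ax) (ltW xb).
- apply: derivable_within_continuous => x; rewrite in_itv /= => xab.
  by case: (H x xab).
by rewrite in_itv /= => cab E; exists c.
Qed.

Lemma expR_taylor1 x : `|x| <= 1 / 2 -> `|expR x - 1 - x| <= 2 * x ^+ 2.
Proof.
rewrite ler_norml => /andP[x1 x2].
have h0 : 0 <= expR x - 1 - x by have := expR_ge1Dx x; lra.
rewrite ger0_norm //.
have h1 : 1 - x <= (expR x)^-1 by rewrite -expRN; exact: (expR_ge1Dx (- x)).
have h2 : expR x * (1 - x) <= 1.
  by rewrite -[leRHS](mulfV (lt0r_neq0 (expR_gt0 x))) ler_pM2l // expR_gt0.
have : (expR x - 1 - x) * (1 - x) <= x ^+ 2 by nra.
move=> h3; have : 2^-1 <= 1 - x by lra.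
nra.
Qed.

Lemma sin_le_norm x : `|sin x| <= `|x|.
Proof.
wlog x0 : x / 0 <= x.
  move=> H; have [|/ltW x0] := leP 0 x; first exact: H.
  by rewrite -normrN -sinN -(normrN x); apply: H; rewrite oppr_ge0.
have [->|xn0] := eqVneq x 0; first by rewrite sin0.
have xp : 0 < x by rewrite lt_def xn0.
have [c _] := mean_value xp (fun y _ => is_derive_sin y).
rewrite sin0 !subr0 => ->; rewrite normrM ler_piMl //.
exact: cos_max.
Qed.

Lemma cos_taylor1 x : `|cos x - 1| <= x ^+ 2 / 2.
Proof.
have {1}-> : x = (x / 2) *+ 2 by rewrite mulr2n; lra.
rewrite cos_mulr2n cos2sin2 ler_norml.
have h := sin_le_norm (x / 2).
have : sin (x / 2) ^+ 2 <= (x / 2) ^+ 2.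
  by rewrite -[leLHS]real_normK ?num_real // -[leRHS]real_normK ?num_real // lerXn2r ?nnegrE.
have : 0 <= sin (x / 2) ^+ 2 by exact: sqr_ge0.
have -> : (x / 2) ^+ 2 = x ^+ 2 / 4 by field.
move: (sin _ ^+ 2) (x ^+ 2) => s y h1 h2; rewrite [(1 - s) *+ 2]mulr2n; apply/andP; split; lra.
Qed.

Lemma sin_taylor1 x : `|sin x - x| <= `|x| ^+ 3 / 2.
Proof.
wlog x0 : x / 0 <= x.
  move=> H; have [|/ltW x0] := leP 0 x; first exact: H.
  have := H (- x); rewrite sinN -opprD !normrN; apply.
  by rewrite oppr_ge0.
have [->|xn0] := eqVneq x 0; first by rewrite sin0 subr0 normr0 expr0n mul0r.
have xp : 0 < x by rewrite lt_def xn0.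
have [c /andP[c0 cx]] :=
  @mean_value (fun x => sin x - x) (fun x => cos x - 1) _ _ xp _.
rewrite sin0 !subr0 => ->; rewrite normrM (ger0_norm x0).
have := cos_taylor1 c => h.
have : c ^+ 2 <= x ^+ 2 by nra.
move=> h2; have : `|cos c - 1| <= x ^+ 2 / 2 by lra.
move=> h3; rewrite [leRHS](_ : _ = x ^+ 2 / 2 * x); last by field.
by apply: ler_wpM2r.
Qed.
End RealInequalities.
Arguments cabs {R} z : simpl never.

(** * Complex differentiability and the complex exponential *)

Section ComplexDifferentiability.
Variable R : realType.
Implicit Types (z w h : R[i]) (f g : R[i] -> R[i]).

(* Complex differentiability in epsilon-delta form, with the real-valued modulus. *)
Definition cdiff f z := exists l : R[i], forall e : R, 0 < e ->
  exists2 d : R, 0 < d & forall h, cabs h < d ->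
    cabs (f (z + h) - f z - l * h) <= e * cabs h.

Lemma derivable_cdiff (f : Cplx R -> Cplx R) (z : Cplx R) :
  derivable f z 1 -> cdiff f z.
Proof.
move=> /cvg_ex[l /= Hl]; exists l => e e0.
have e0' : 0 < e%:C by rewrite ltcR.
move: Hl => /cvgrPdist_le /(_ _ e0') /nbhs_ballP[d /= d0 Hd].
have dr : d = (complex.Re d)%:C by rewrite RRe_real // gtr0_real.
exists (complex.Re d); first by rewrite -ltcR -dr.
move=> h hd.
have [->|h0] := eqVneq h 0.
  by rewrite addr0 subrr mulr0 subrr cabs0 mulr0.
have := Hd h; rewrite /ball /= sub0r normrN.
have nE (x : R[i]) : `|x| = (cabs x)%:C by rewrite normc_def cabsE.
rewrite nE dr ltcR => /(_ hd h0).
rewrite [`|_|]nE lecR => H.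
have -> : f (z + h) - f z - l * h = - ((l - h^-1 * (f (h * 1 + z) - f z)) * h).
  rewrite (mulr1 h) (addrC h z); move: (f (z + h)) (f z) => A B.
  by move: A B l {H Hd} => /= A B l; field.
by rewrite cabsN cabsM ler_wpM2r ?cabs_ge0.
Qed.

Lemma cdiff_ext f g z : (forall w, f w = g w) -> cdiff f z -> cdiff g z.
Proof. by move=> /funext ->. Qed.

Lemma cdiff_cst (c : R[i]) z : cdiff (fun=> c) z.
Proof.
exists 0 => e e0; exists 1 => // h _.
by rewrite subrr mul0r subr0 cabs0 mulr_ge0 ?cabs_ge0 // ltW.
Qed.

Lemma cdiff_affine (a b : R[i]) z : cdiff (fun w => a + b * w) z.
Proof.
exists b => e e0; exists 1 => // h _.
rewrite [X in cabs X](_ : _ = 0) ?cabs0; last by ring.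
by rewrite mulr_ge0 ?cabs_ge0 // ltW.
Qed.

Lemma cdiff_cont f z (e : R) : cdiff f z -> 0 < e ->
  exists2 d : R, 0 < d & forall h, cabs h < d -> cabs (f (z + h) - f z) <= e.
Proof.
move=> [l Hl] e0; have [d d0 Hd] := Hl 1 ltr01.
have k0 : 0 < 1 + cabs l by rewrite ltr_wpDr ?cabs_ge0.
exists (Num.min d (e / (1 + cabs l))); first by rewrite lt_min d0 divr_gt0.
move=> h; rewrite lt_min => /andP[hd]; rewrite ltr_pdivlMr // => he.
have -> : f (z + h) - f z = (f (z + h) - f z - l * h) + l * h by rewrite subrK.
apply: (le_trans (cabsD _ _)); rewrite cabsM.
have := Hd _ hd; have := cabs_ge0 h; nra.
Qed.

Lemma cdiffD f g z : cdiff f z -> cdiff g z -> cdiff (fun w => f w + g w) z.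
Proof.
move=> [l Hl] [m Hm]; exists (l + m) => e e0.
have e2 : 0 < e / 2 by rewrite divr_gt0.
have [d d0 Hd] := Hl _ e2; have [d' d'0 Hd'] := Hm _ e2.
exists (Num.min d d'); first by rewrite lt_min d0.
move=> h; rewrite lt_min => /andP[/Hd h1 /Hd' h2].
rewrite [X in cabs X](_ : _ = (f (z + h) - f z - l * h) + (g (z + h) - g z - m * h)).
  by apply: (le_trans (cabsD _ _)); lra.
by ring.
Qed.

Lemma cdiffN f z : cdiff f z -> cdiff (fun w => - f w) z.
Proof.
move=> [l Hl]; exists (- l) => e e0; have [d d0 Hd] := Hl _ e0; exists d => // h /Hd.
rewrite -cabsN; congr (cabs _ <= _); ring.
Qed.

Lemma cdiffB f g z : cdiff f z -> cdiff g z -> cdiff (fun w => f w - g w) z.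
Proof. by move=> df /cdiffN; exact: cdiffD. Qed.

Lemma cdiff_sum (I : Type) (s : seq I) (F : I -> R[i] -> R[i]) z :
  (forall i, cdiff (F i) z) -> cdiff (fun w => \sum_(i <- s) F i w) z.
Proof.
move=> H; elim: s => [|i s IH].
  by apply: cdiff_ext (cdiff_cst 0 z) => w; rewrite big_nil.
by apply: cdiff_ext (cdiffD (H i) IH) => w; rewrite big_cons.
Qed.

(* A product with a factor vanishing at the point only needs the other factor
   to be continuous there. *)
Lemma cdiffM_cont f g z : cdiff f z -> f z = 0 ->
  (exists l : R[i], forall e : R, 0 < e ->
     exists2 d : R, 0 < d & forall h, h != 0 -> cabs h < d -> cabs (g (z + h) - l) <= e) ->
  cdiff (fun w => f w * g w) z.
Proof.
move=> [l Hl] f0 [m Hm]; exists (l * m) => e e0.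
have k0 : 0 < 1 + cabs l + cabs m by rewrite !ltr_wpDr ?cabs_ge0.
pose e1 := Num.min 1 (e / (1 + cabs l + cabs m)).
have e10 : 0 < e1 by rewrite lt_min ltr01 divr_gt0.
have e11 : e1 <= 1 by rewrite ge_min lexx.
have e1e : e1 * (1 + cabs l + cabs m) <= e by rewrite -ler_pdivlMr // ge_min lexx orbT.
have [d d0 Hd] := Hl _ e10; have [d' d'0 Hd'] := Hm _ e10.
exists (Num.min d d'); first by rewrite lt_min d0.
move=> h; rewrite lt_min => /andP[/Hd h1 hd'].
have [->|hn0] := eqVneq h 0.
  by rewrite addr0 subrr mulr0 subrr cabs0 mulr0.
have h2 := Hd' _ hn0 hd'.
rewrite f0 mul0r subr0; rewrite f0 subr0 in h1.
rewrite [X in cabs X](_ : _ = (f (z + h) - l * h) * (g (z + h) - m)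
   + (f (z + h) - l * h) * m + l * h * (g (z + h) - m)); last by ring.
apply: (le_trans (cabsD _ _)); rewrite !cabsM.
apply: (@le_trans _ _ (e1 * cabs h * e1 + e1 * cabs h * cabs m + cabs l * cabs h * e1)).
  apply: lerD; last by rewrite ler_wpM2l ?mulr_ge0 ?cabs_ge0.
  apply: (le_trans (cabsD _ _)); rewrite !cabsM; apply: lerD.
    by apply: ler_pM; rewrite ?cabs_ge0.
  by rewrite ler_wpM2r ?cabs_ge0.
have ch := cabs_ge0 h; have cl := cabs_ge0 l; have cm := cabs_ge0 m.
have : e1 * e1 <= e1 by nra.
move=> ee; rewrite [leLHS](_ : _ = (e1 * e1 + e1 * cabs m + cabs l * e1) * cabs h); last by ring.
apply: ler_wpM2r => //; nra.
Qed.

Lemma cdiffM f g z : cdiff f z -> cdiff g z -> cdiff (fun w => f w * g w) z.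
Proof.
move=> df dg.
have dF : cdiff (fun w => f w - f z) z by apply: cdiffB (cdiff_cst _ _).
have H1 : cdiff (fun w => (f w - f z) * g w) z.
  apply: cdiffM_cont => //; first by rewrite subrr.
  by exists (g z) => e e0; have [d d0 Hd] := cdiff_cont dg e0; exists d => // h _; exact: Hd.
have H2 : cdiff (fun w => f z * g w) z.
  have [l Hl] := dg; exists (f z * l) => e e0.
  have k0 : 0 < 1 + cabs (f z) by rewrite ltr_wpDr ?cabs_ge0.
  have [d d0 Hd] := Hl (e / (1 + cabs (f z))) (divr_gt0 e0 k0).
  exists d => // h /Hd.
  rewrite mulrAC ler_pdivlMr // => H.
  rewrite -!mulrBr -mulrA -mulrBr cabsM.
  by apply: le_trans H; rewrite mulrC ler_wpM2l ?cabs_ge0 // lerDr.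
by apply: cdiff_ext (cdiffD H1 H2) => w; rewrite mulrBl subrK.
Qed.

Lemma cdiffX f n z : cdiff f z -> cdiff (fun w => f w ^+ n) z.
Proof.
move=> df; elim: n => [|n IH].
  by apply: cdiff_ext (cdiff_cst 1 z) => w; rewrite expr0.
by apply: cdiff_ext (cdiffM df IH) => w; rewrite exprS.
Qed.

Lemma cdiff_prod (I : Type) (s : seq I) (F : I -> R[i] -> R[i]) z :
  (forall i, cdiff (F i) z) -> cdiff (fun w => \prod_(i <- s) F i w) z.
Proof.
move=> H; elim: s => [|i s IH].
  by apply: cdiff_ext (cdiff_cst 1 z) => w; rewrite big_nil.
by apply: cdiff_ext (cdiffM (H i) IH) => w; rewrite big_cons.
Qed.

Lemma cdiff_comp f g z : cdiff g z -> cdiff f (g z) -> cdiff (f \o g) z.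
Proof.
move=> dg [l Hl]; have dg' := dg; case: dg' => m Hm; exists (l * m) => e e0.
have k0 : 0 < 1 + cabs l + cabs m by rewrite !ltr_wpDr ?cabs_ge0.
pose e1 := Num.min 1 (e / (1 + cabs l + cabs m)).
have e10 : 0 < e1 by rewrite lt_min ltr01 divr_gt0.
have e11 : e1 <= 1 by rewrite ge_min lexx.
have e1e : e1 * (1 + cabs l + cabs m) <= e by rewrite -ler_pdivlMr // ge_min lexx orbT.
have [d d0 Hd] := Hl _ e10; have [d' d'0 Hd'] := Hm _ e10.
have d20 : 0 < d / 2 by rewrite divr_gt0.
have [d'' d''0 Hd''] := cdiff_cont dg d20.
exists (Num.min d' d''); first by rewrite lt_min d'0.
move=> h; rewrite lt_min => /andP[/Hd' h1 /Hd'' h2].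
pose k := g (z + h) - g z.
have kd : cabs k < d by apply: le_lt_trans h2 _; lra.
have := Hd _ kd; rewrite [g z + k]addrC subrK => h3 /=.
rewrite [X in cabs X](_ : _ = (f (g (z + h)) - f (g z) - l * k) + l * (k - m * h)); last by rewrite /k; ring.
apply: (le_trans (cabsD _ _)); rewrite cabsM.
have hk : cabs k <= (e1 + cabs m) * cabs h.
  rewrite -[k](subrK (m * h)) mulrDl; apply: (le_trans (cabsD _ _)).
  by rewrite cabsM lerD2r.
have ch := cabs_ge0 h; have cl := cabs_ge0 l; have cm := cabs_ge0 m.
apply: (@le_trans _ _ (e1 * ((e1 + cabs m) * cabs h) + cabs l * (e1 * cabs h))).
  apply: lerD; last by rewrite ler_wpM2l.
  by apply: (le_trans h3); rewrite ler_wpM2l // ltW.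
have : e1 * e1 <= e1 by nra.
move=> ee; rewrite [leLHS](_ : _ = (e1 * e1 + e1 * cabs m + cabs l * e1) * cabs h); last by ring.
apply: ler_wpM2r => //; nra.
Qed.

Lemma cdiff_inv z : z != 0 -> cdiff (fun w => w^-1) z.
Proof.
move=> z0; exists (- (z ^- 2)) => e e0.
have c0 : 0 < cabs z by rewrite cabs_gt0.
(* The remainder is h^2 / (z^2 (z + h)), and the first bound on h gives |z + h| >= |z| / 2. *)
pose d := Num.min (cabs z / 2) (e * cabs z ^+ 3 / 2).
exists d; first by rewrite lt_min !divr_gt0 // mulr_gt0 // exprn_gt0.
move=> h; rewrite lt_min => /andP[h1 h2].
have zh : cabs z / 2 <= cabs (z + h).
  have := cabs_ler_sub z (- h); rewrite cabsN opprK => ?; lra.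
have zh0 : z + h != 0 by rewrite -cabs_gt0; lra.
rewrite [X in cabs X](_ : _ = h ^+ 2 / (z ^+ 2 * (z + h))); last by field; rewrite ?z0 ?zh0.
rewrite cabsM cabsV cabsM !cabsX expr2 -mulrA mulrC ler_wpM2r ?cabs_ge0 //.
have c3 : 0 < cabs z ^+ 2 by rewrite exprn_gt0.
rewrite ler_pdivrMr ?mulr_gt0 //; last by apply: lt_le_trans zh; rewrite divr_gt0.
apply: (@le_trans _ _ (e * (cabs z ^+ 2 * (cabs z / 2)))).
  by apply: ltW; apply: lt_le_trans h2 _; rewrite exprS; nra.
by rewrite ler_wpM2l ?(ltW e0) // ler_wpM2l // ltW.
Qed.

Lemma cdiffV f z : cdiff f z -> f z != 0 -> cdiff (fun w => (f w)^-1) z.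
Proof. by move=> df f0; exact: (cdiff_comp df (cdiff_inv f0)). Qed.

Lemma expCD z w : expC (z + w) = expC z * expC w :> R[i].
Proof.
case: z w => a b [c d]; rewrite /expC /= expRD cosD sinD; simpc.
by congr (_ +i* _); ring.
Qed.
Lemma expC0 : expC (0 : R[i]) = 1 :> R[i].
Proof. by rewrite /expC /= expR0 cos0 sin0 mulr1 mulr0. Qed.
Lemma cabs_expC z : cabs (expC z) = expR (complex.Re z).
Proof.
rewrite cabsE /expC /= !exprMn -mulrDr cos2Dsin2 mulr1 sqrtr_sqr.
by rewrite ger0_norm ?expR_ge0.
Qed.
Lemma expC_neq0 z : expC z != 0 :> R[i].
Proof. by rewrite -cabs_gt0 cabs_expC expR_gt0. Qed.
Lemma expCN z : expC (- z) = (expC z)^-1 :> R[i].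
Proof.
by apply: (mulIf (expC_neq0 z)); rewrite mulVf ?expC_neq0 // -expCD addNr expC0.
Qed.
Lemma expC_real (x : R) : expC (x%:C) = (expR x)%:C.
Proof. by rewrite /expC /= cos0 sin0 mulr1 mulr0. Qed.

Lemma expC_taylor1 h : cabs h <= 1 / 2 ->
  cabs (expC h - 1 - h) <= 8 * cabs h ^+ 2.
Proof.
case: h => a b; set h := a +i* b => hh.
have ha : `|a| <= cabs h := Re_le_cabs h.
have hb : `|b| <= cabs h := Im_le_cabs h.
have a2 : `|a| <= 1 / 2 by lra.
have e1 := expR_taylor1 a2.
have c1 := cos_taylor1 b.
have s1 := sin_taylor1 b.
have s2 := sin_le_norm b.
have aa : a ^+ 2 <= cabs h ^+ 2 by rewrite -(real_normK (num_real a)) lerXn2r ?nnegrE ?cabs_ge0.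
have bb : b ^+ 2 <= cabs h ^+ 2 by rewrite -(real_normK (num_real b)) lerXn2r ?nnegrE ?cabs_ge0.
have ep : `|expR a| <= 2.
  rewrite ger0_norm ?expR_ge0 //; have := e1; rewrite ler_norml => /andP[_].
  have : a ^+ 2 <= 1 / 4 by have := cabs_ge0 h; nra.
  by move: a2; rewrite ler_norml => /andP[_]; lra.
apply: (le_trans (cabs_le_ReIm _)); rewrite /h /expC /=.
have hge := cabs_ge0 h.
have -> : expR a * cos b - 1 - a = (expR a - 1 - a) + expR a * (cos b - 1) by ring.
have -> : expR a * sin b - 0 - b = (sin b - b) + (expR a - 1 - a) * sin b + a * sin b by ring.
apply: (@le_trans _ _ ((2 * a ^+ 2 + 2 * (b ^+ 2 / 2)) + (`|b| ^+ 3 / 2 + 2 * a ^+ 2 * 1 + cabs h * cabs h))).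
  apply: lerD.
    apply: (le_trans (ler_normD _ _)); apply: lerD => //.
    by rewrite normrM; apply: ler_pM.
  apply: (le_trans (ler_normD _ _)); apply: lerD.
    apply: (le_trans (ler_normD _ _)); apply: lerD => //.
    by rewrite normrM; apply: ler_pM => //; exact: sin_max.
  by rewrite normrM; apply: ler_pM => //; apply: le_trans hb.
have b3 : `|b| ^+ 3 <= cabs h ^+ 2.
  rewrite exprS; rewrite real_normK ?num_real //.
  have : 0 <= b ^+ 2 by exact: sqr_ge0.
  have : 0 <= `|b| by []. nra.
have : cabs h * cabs h = cabs h ^+ 2 by rewrite expr2.
have := sqr_ge0 (cabs h).
move=> H0 ->; rewrite -/h; move: H0 aa bb b3.
by move: (cabs h ^+ 2) (`|b| ^+ 3) (a ^+ 2) (b ^+ 2) => H B A C; clear; lra.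
Qed.

Lemma cdiff_expC z : cdiff (@expC R) z.
Proof.
exists (expC z) => e e0.
have k0 : 0 < 8 * cabs (expC z) by rewrite mulr_gt0 ?cabs_gt0 ?expC_neq0.
exists (Num.min (1 / 2) (e / (8 * cabs (expC z)))); first by rewrite lt_min divr_gt0 // divr_gt0.
move=> h; rewrite lt_min => /andP[h1]; rewrite ltr_pdivlMr // => h2.
rewrite expCD [X in cabs X](_ : _ = expC z * (expC h - 1 - h)); last by ring.
rewrite cabsM; have := expC_taylor1 (ltW h1); have := cabs_ge0 h.
have := cabs_ge0 (expC z); move: h2; move: (cabs (expC z)) (cabs h) (cabs (_ - _)) => x y t.
move=> h2 x0 y0 ht.
apply: (@le_trans _ _ (x * (8 * y ^+ 2))); first by rewrite ler_wpM2l.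
nra.
Qed.
End ComplexDifferentiability.

(** * Goursat's argument and the maximum principle *)

Section Goursat.
Variable R : realType.
Implicit Types (F : R[i] -> R[i]) (N n j : nat) (x y a b X Y : R).

Definition hline F N x y X : R[i] := \sum_(k < N) F ((x + k%:R / N%:R * X) +i* y).
Definition vline F N x y Y : R[i] := \sum_(k < N) F (x +i* (y + k%:R / N%:R * Y)).

(* Left Riemann sums of the integral of F along the boundary of
   [a, a + X] x [b, b + Y]: opposite sides are sampled at matching points, so that
   the sums are additive under subdivision and vanish on affine functions. *)
Definition rsum F N a b X Y : R[i] :=
  (hline F N a b X - hline F N a (b + Y) X) * (X / N%:R)%:C +
  (0 +i* 1) * ((vline F N (a + X) b Y - vline F N a b Y) * (Y / N%:R)%:C).

(** Doubling the number of samples puts the samples of a side exactly onto those of its two halves;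
    this makes the sums additive without error. *)
Lemma half_index (k N : nat) X : (0 < N)%N ->
  k%:R / (N + N)%:R * X = k%:R / N%:R * (X / 2) /\
  (N + k)%:R / (N + N)%:R * X = X / 2 + k%:R / N%:R * (X / 2) :> R.
Proof.
move=> N0; have Nn : N%:R != 0 :> R by rewrite pnatr_eq0 -lt0n.
have N2 : N%:R + N%:R != 0 :> R by rewrite -natrD pnatr_eq0 -lt0n addn_gt0 N0.
by rewrite !natrD; split; field; rewrite ?Nn ?N2.
Qed.

Lemma hline_split F N x y X : (0 < N)%N ->
  hline F (N + N) x y X = hline F N x y (X / 2) + hline F N (x + X / 2) y (X / 2).
Proof.
move=> N0; rewrite /hline big_split_ord /=; congr (_ + _); apply: eq_bigr => k _ /=.
  by rewrite (half_index k X N0).1.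
by rewrite (half_index k X N0).2 addrA.
Qed.

Lemma vline_split F N x y Y : (0 < N)%N ->
  vline F (N + N) x y Y = vline F N x y (Y / 2) + vline F N x (y + Y / 2) (Y / 2).
Proof.
move=> N0; rewrite /vline big_split_ord /=; congr (_ + _); apply: eq_bigr => k _ /=.
  by rewrite (half_index k Y N0).1.
by rewrite (half_index k Y N0).2 addrA.
Qed.

(** Each interior segment is sampled at the same points by the two rectangles that share it, with
    opposite signs. *)
Lemma rsum_split F N a b X Y : (0 < N)%N ->
  rsum F (N + N) a b X Y =
  rsum F N a b (X / 2) (Y / 2) + rsum F N (a + X / 2) b (X / 2) (Y / 2) +
  (rsum F N a (b + Y / 2) (X / 2) (Y / 2) +
   rsum F N (a + X / 2) (b + Y / 2) (X / 2) (Y / 2)).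
Proof.
move=> N0; rewrite /rsum !hline_split // !vline_split //.
have e (u v : R) : u + v / 2 + v / 2 = u + v by field.
rewrite !e.
have d (u : R) : u / (N + N)%:R = u / 2 / N%:R.
  rewrite natrD; field.
  by rewrite -natrD !pnatr_eq0 -!lt0n addn_gt0 N0.
by rewrite !d; ring.
Qed.

(** The values on opposite sides differ by the constants - m i Y and m X, so the products with X and
    i Y cancel exactly, without discretisation error. *)
Lemma rsum_affine (l m : R[i]) N a b X Y : (0 < N)%N ->
  rsum (fun w => l + m * w) N a b X Y = 0.
Proof.
move=> N0; have Nn : N%:R != 0 :> R by rewrite pnatr_eq0 -lt0n.
rewrite /rsum /hline /vline -!sumrB.
rewrite (eq_bigr (fun=> m * (0 -i* Y))); last first.
  move=> k _; rewrite opprD addrACA subrr add0r -mulrBr; congr (m * _).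
  by apply: complex_ext; rewrite ?(ReD, ReN, ImD, ImN) /=; ring.
rewrite [in X in _ + X](eq_bigr (fun=> m * (X +i* 0))); last first.
  move=> k _; rewrite opprD addrACA subrr add0r -mulrBr; congr (m * _).
  by apply: complex_ext; rewrite ?(ReD, ReN, ImD, ImN) /=; ring.
rewrite !sumr_const card_ord -(mulr_natl (m * (0 -i* Y)) N) -(mulr_natl (m * (X +i* 0)) N).
have natC : N%:R = (N%:R : R)%:C :> R[i] by rewrite rmorph_nat.
rewrite natC; case: m => m1 m2; simpc.
by congr (_ +i* _); field.
Qed.

Lemma rsumD F G N a b X Y :
  rsum (fun w => F w + G w) N a b X Y = rsum F N a b X Y + rsum G N a b X Y.
Proof. by rewrite /rsum /hline /vline !big_split /=; ring. Qed.

Lemma rsum_bound F N a b X Y (E : R) : 0 <= X -> 0 <= Y -> (0 < N)%N ->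
  (forall x y, a <= x <= a + X -> b <= y <= b + Y -> cabs (F (x +i* y)) <= E) ->
  cabs (rsum F N a b X Y) <= 2 * (X + Y) * E.
Proof.
move=> X0 Y0 N0 H; have Np : 0 < N%:R :> R by rewrite ltr0n.
have t01 (k : 'I_N) (Z : R) : 0 <= Z -> 0 <= k%:R / N%:R * Z <= Z.
  move=> Z0; rewrite mulr_ge0 //= ?divr_ge0 //; apply: ler_piMl => //.
  by rewrite ler_pdivrMr // mul1r ler_nat ltnW.
have Hh y : b <= y <= b + Y -> cabs (hline F N a y X) <= N%:R * E.
  move=> hy; apply: (le_trans (cabs_sum _ _ _)).
  rewrite mulr_natl -[in leRHS](card_ord N) -sumr_const; apply: ler_sum => k _; apply: H => //.
  by have := t01 k X X0; rewrite lerDl lerD2l.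
have Hv x : a <= x <= a + X -> cabs (vline F N x b Y) <= N%:R * E.
  move=> hx; apply: (le_trans (cabs_sum _ _ _)).
  rewrite mulr_natl -[in leRHS](card_ord N) -sumr_const; apply: ler_sum => k _; apply: H => //.
  by have := t01 k Y Y0; rewrite lerDl lerD2l.
have ci : cabs (0 +i* 1 : R[i]) = 1 by rewrite cabsE /= expr0n expr1n add0r sqrtr1.
apply: (le_trans (cabsD _ _)); rewrite !cabsM ci mul1r !cabs_real.
rewrite !ger0_norm ?divr_ge0 //.
have S (u v : R[i]) Z : 0 <= Z -> cabs u <= N%:R * E -> cabs v <= N%:R * E ->
    cabs (u - v) * (Z / N%:R) <= 2 * Z * E.
  move=> Z0 hu hv; rewrite mulrA ler_pdivrMr //.
  have := cabsB u v; have := cabs_ge0 (u - v); nra.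
rewrite mulrDr mulrDl; apply: lerD.
  by apply: S => //; apply: Hh; rewrite ?lexx ?lerDl ?Y0.
by apply: S => //; apply: Hv; rewrite ?lexx ?lerDl ?X0.
Qed.

Section Subdivision.
Variables (P : nat -> R -> R -> Prop) (a b X Y : R).
Hypotheses (X0 : 0 < X) (Y0 : 0 < Y).
Hypothesis P_quarters : forall j x y,
  P j.+1 x y -> P j.+1 (x + X / 2 ^+ j.+1) y ->
  P j.+1 x (y + Y / 2 ^+ j.+1) -> P j.+1 (x + X / 2 ^+ j.+1) (y + Y / 2 ^+ j.+1) -> P j x y.
Hypothesis P_local : forall p q, a <= p <= a + X -> b <= q <= b + Y ->
  exists2 d : R, 0 < d & forall j x y, x <= p <= x + X / 2 ^+ j ->
    y <= q <= y + Y / 2 ^+ j -> (X + Y) / 2 ^+ j < d -> P j x y.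

Let bad j (p : R * R) := ~ P j p.1 p.2.

Let move_to j (p : R * R) (s : bool * bool) : R * R :=
  (p.1 + (if s.1 then X / 2 ^+ j.+1 else 0), p.2 + (if s.2 then Y / 2 ^+ j.+1 else 0)).

Let bad_step j p : bad j p -> exists s, bad j.+1 (move_to j p s).
Proof.
move=> B; apply: contrapT => /forallNP H; apply: B.
have {}H s : P j.+1 (move_to j p s).1 (move_to j p s).2 by have := H s => /contrapT.
have := H (true, true); have := H (false, true); have := H (true, false).
by have := H (false, false); rewrite /= !addr0; exact: P_quarters.
Qed.

(** A bad rectangle has a bad quarter, so along a sequence of bad rectangles the default of [xget]
    is never taken. *)
Let Fixpoint corner j : R * R := if j is j'.+1 then
   move_to j' (corner j') (xget (false, false) [set s | bad j'.+1 (move_to j' (corner j') s)]%classic)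
  else (a, b).

(** A compactness argument: if [P] failed for the whole rectangle, bad quarters could be chosen for
    ever. Their lower left corners increase coordinatewise to the suprema, a point lying in all
    chosen rectangles, and [P_local] at that point contradicts badness at a small scale. *)
Lemma bisection : P 0 a b.
Proof.
apply: contrapT => B0.
have B j : bad j (corner j).
  elim: j => [//|j IH] /=; have := bad_step IH.
  exact: (xgetPex (false, false)).
have pos (Z : R) j : 0 < Z -> 0 < Z / 2 ^+ j by move=> Z0; rewrite divr_gt0 ?exprn_gt0.
have halve (Z : R) j : Z / 2 ^+ j = Z / 2 ^+ j.+1 + Z / 2 ^+ j.+1.
  by rewrite exprS; field; rewrite expf_neq0.
have st j : (corner j).1 <= (corner j.+1).1 /\ (corner j.+1).1 + X / 2 ^+ j.+1 <= (corner j).1 + X / 2 ^+ j /\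
   (corner j).2 <= (corner j.+1).2 /\ (corner j.+1).2 + Y / 2 ^+ j.+1 <= (corner j).2 + Y / 2 ^+ j.
  rewrite (halve X j) (halve Y j) /=; set s := xget _ _.
  have := pos X j.+1 X0; have := pos Y j.+1 Y0.
  by case: s => [[] []] /=; move: (X / _) (Y / _) => x y; lra.
have mono j m : (corner j).1 <= (corner (j + m)).1 /\ (corner (j + m)).1 + X / 2 ^+ (j + m) <= (corner j).1 + X / 2 ^+ j /\
   (corner j).2 <= (corner (j + m)).2 /\ (corner (j + m)).2 + Y / 2 ^+ (j + m) <= (corner j).2 + Y / 2 ^+ j.
  elim: m => [|m IH]; first by rewrite addn0 !lexx.
  by have := st (j + m)%N; rewrite addnS; lra.
have ub1 j m : (corner m).1 <= (corner j).1 + X / 2 ^+ j.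
  have [jm|mj] := leqP j m.
    by have := mono j (m - j)%N; rewrite subnKC // => ?; have := pos X m X0; lra.
  by have := mono m (j - m)%N; rewrite subnKC 1?ltnW // => ?; have := pos X j X0; lra.
have ub2 j m : (corner m).2 <= (corner j).2 + Y / 2 ^+ j.
  have [jm|mj] := leqP j m.
    by have := mono j (m - j)%N; rewrite subnKC // => ?; have := pos Y m Y0; lra.
  by have := mono m (j - m)%N; rewrite subnKC 1?ltnW // => ?; have := pos Y j Y0; lra.
pose A1 := range (fun j => (corner j).1); pose A2 := range (fun j => (corner j).2).
have hs1 : has_sup A1.
  split; first by exists (corner 0).1; exists 0%N.
  by exists ((corner 0).1 + X / 2 ^+ 0) => _ [m _ <-].
have hs2 : has_sup A2.
  split; first by exists (corner 0).2; exists 0%N.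
  by exists ((corner 0).2 + Y / 2 ^+ 0) => _ [m _ <-].
pose p1 := sup A1; pose p2 := sup A2.
have in1 j : (corner j).1 <= p1 <= (corner j).1 + X / 2 ^+ j.
  apply/andP; split; first by apply: sup_upper_bound => //; exists j.
  by apply: ge_sup; [case: hs1|move=> _ [m _ <-]].
have in2 j : (corner j).2 <= p2 <= (corner j).2 + Y / 2 ^+ j.
  apply/andP; split; first by apply: sup_upper_bound => //; exists j.
  by apply: ge_sup; [case: hs2|move=> _ [m _ <-]].
have XY : 0 < X + Y by rewrite addr_gt0.
have [||d d0 Hd] := P_local (p := p1) (q := p2).
- by have := in1 0%N; rewrite /= expr0 divr1.
- by have := in2 0%N; rewrite /= expr0 divr1.
have [j Hj] : exists j, (X + Y) / 2 ^+ j < d.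
  exists (Num.truncn ((X + Y) / d)).
  rewrite ltr_pdivrMr ?exprn_gt0 // mulrC -ltr_pdivrMr //.
  apply: lt_le_trans (truncnS_gt _) _.
  by rewrite -natrX ler_nat ltn_expl.
exact: B j (Hd _ _ _ (in1 j) (in2 j) Hj).
Qed.
End Subdivision.

(** Continuity bounds F near each point, and bounds on four quarters give one on the whole. *)
Lemma cdiff_bounded F a b X Y : 0 < X -> 0 < Y ->
  (forall x y, a <= x <= a + X -> b <= y <= b + Y -> cdiff F (x +i* y)) ->
  exists B : R, forall x y, a <= x <= a + X -> b <= y <= b + Y -> cabs (F (x +i* y)) <= B.
Proof.
move=> X0 Y0 dF.
have := @bisection (fun j u v => exists B : R, forall x y,
  u <= x <= u + X / 2 ^+ j -> v <= y <= v + Y / 2 ^+ j -> cabs (F (x +i* y)) <= B) a b X Y X0 Y0.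
rewrite !expr0 !divr1; apply.
  move=> j u v [B1 H1] [B2 H2] [B3 H3] [B4 H4].
  have h (Z : R) : Z / 2 ^+ j = Z / 2 ^+ j.+1 + Z / 2 ^+ j.+1.
    by rewrite exprS; field; rewrite expf_neq0.
  exists (Num.max (Num.max B1 B2) (Num.max B3 B4)) => x y; rewrite (h X) (h Y) !addrA.
  move=> /andP[x1 x2] /andP[y1 y2].
  have [xx|/ltW xx] := leP x (u + X / 2 ^+ j.+1); have [yy|/ltW yy] := leP y (v + Y / 2 ^+ j.+1).
  - by rewrite !le_max H1 ?x1 ?y1.
  - by rewrite !le_max H3 ?x1 ?yy ?orbT.
  - by rewrite !le_max H2 ?xx ?y1 ?orbT.
  - by rewrite !le_max H4 ?xx ?yy ?orbT.
move=> p q hp hq; have [d d0 Hd] := cdiff_cont (dF _ _ hp hq) (ltr01 : 0 < 1 :> R).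
exists d => // j u v hu hv hd; exists (cabs (F (p +i* q)) + 1) => x y hx hy.
have k : cabs ((x - p) +i* (y - q)) < d.
  apply: le_lt_trans hd; apply: (le_trans (cabs_le_ReIm _)); rewrite mulrDl; apply: lerD => /=.
    by rewrite ler_norml; move: hu hx; lra.
  by rewrite ler_norml; move: hv hy; lra.
have := Hd _ k; rewrite (_ : (p +i* q) + _ = x +i* y); last by simpc; rewrite !subrKC.
have := cabs_ler_sub (F (x +i* y)) (F (p +i* q)); lra.
Qed.

(** Near a point F is affine up to e times the distance and affine functions have zero sums, so a
    small rectangle of half perimeter D contributes at most a multiple of e D^2, a tolerance that
    scales like the area, by 1/4 per level. The claim given to [bisection] concerns all large n
    because passing to quarters lowers n by one. *)
Lemma goursat F a b X Y (kappa : R) : 0 < X -> 0 < Y -> 0 < kappa ->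
  (forall x y, a <= x <= a + X -> b <= y <= b + Y -> cdiff F (x +i* y)) ->
  exists n, cabs (rsum F (2 ^ n) a b X Y) <= kappa.
Proof.
move=> X0 Y0 k0 dF.
have := @bisection (fun j u v => exists n0, forall n, (n0 <= n)%N ->
    cabs (rsum F (2 ^ n) u v (X / 2 ^+ j) (Y / 2 ^+ j)) <= kappa / 4 ^+ j) a b X Y X0 Y0.
rewrite !expr0 !divr1 => H; have [||n0 /(_ n0)] := H; last by exists n0; auto.
  move=> j u v [n1 H1] [n2 H2] [n3 H3] [n4 H4].
  exists (n1 + n2 + n3 + n4).+1 => -[//|n] nn.
  rewrite expnS mul2n -addnn rsum_split ?expn_gt0 //.
  have h (Z : R) : Z / 2 ^+ j / 2 = Z / 2 ^+ j.+1 by rewrite exprS; field; rewrite expf_neq0.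
  rewrite !h.
  have -> : kappa / 4 ^+ j = kappa / 4 ^+ j.+1 + kappa / 4 ^+ j.+1 + (kappa / 4 ^+ j.+1 + kappa / 4 ^+ j.+1).
    by rewrite exprS; field; rewrite expf_neq0.
  apply: (le_trans (cabsD _ _)); apply: lerD; apply: (le_trans (cabsD _ _)); apply: lerD.
  - by apply: H1; lia.
  - by apply: H2; lia.
  - by apply: H3; lia.
  - by apply: H4; lia.
move=> p1 p2 hp1 hp2; have [l Hl] := dF _ _ hp1 hp2.
have XY : 0 < X + Y by rewrite addr_gt0.
pose e := kappa / (4 * (X + Y) ^+ 2).
have e0 : 0 < e by rewrite divr_gt0 // mulr_gt0 ?exprn_gt0.
have [d d0 Hd] := Hl _ e0.
exists d => // j u v in1 in2 Hj; exists 0%N => n _.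
have Xj : 0 < X / 2 ^+ j by rewrite divr_gt0 ?exprn_gt0.
have Yj : 0 < Y / 2 ^+ j by rewrite divr_gt0 ?exprn_gt0.
pose q : R[i] := p1 +i* p2.
pose G := fun w => (F w - F q - l * (w - q)).
have -> : rsum F (2 ^ n) u v (X / 2 ^+ j) (Y / 2 ^+ j) =
          rsum G (2 ^ n) u v (X / 2 ^+ j) (Y / 2 ^+ j).
  have n2 : (0 < 2 ^ n)%N by rewrite expn_gt0.
  have RA := rsum_affine (F q - l * q) l u v (X / 2 ^+ j) (Y / 2 ^+ j) n2.
  rewrite -[RHS]addr0 -RA -rsumD; congr (rsum _ _ _ _ _ _); apply/funext => w; rewrite /G; ring.
pose D := X / 2 ^+ j + Y / 2 ^+ j.
have De : D = (X + Y) / 2 ^+ j by rewrite /D mulrDl.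
have -> : kappa / 4 ^+ j = 4 * D * (e * D).
  have h4 : 4 ^+ j = 2 ^+ j * 2 ^+ j :> R by rewrite -exprMn -natrM.
  rewrite De /e h4; field.
  by rewrite expf_neq0 //= lt0r_neq0.
apply: (@le_trans _ _ (2 * D * (e * D))); last first.
  have D0 : 0 < D by rewrite addr_gt0.
  have : 0 < D * (e * D) by apply: mulr_gt0 => //; apply: mulr_gt0.
  by move: (e * D) => t; nra.
apply: rsum_bound; rewrite ?expn_gt0 ?(ltW Xj) ?(ltW Yj) //.
move=> x y hx hy.
have := Hd ((x - p1) +i* (y - p2)).
have hk : cabs ((x - p1) +i* (y - p2)) <= D.
  apply: (le_trans (cabs_le_ReIm _)); apply: lerD => /=.
    by rewrite ler_norml; move: hx in1; lra.
  by rewrite ler_norml; move: hy in2; lra.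
have -> : (p1 +i* p2) + ((x - p1) +i* (y - p2)) = x +i* y by simpc; rewrite !subrKC.
move=> /(_ _) H'; rewrite /G.
have -> : (x +i* y) - q = (x - p1) +i* (y - p2) by rewrite /q; simpc.
apply: le_trans (H' _) _; first by apply: le_lt_trans Hj; rewrite -De.
by apply: ler_wpM2l => //; exact: ltW.
Qed.

(** In the variable w = ln (z - c) circles about c become vertical segments of height 2 pi. The
    horizontal sides cancel by periodicity, so [goursat] says that the means of f over a tiny circle
    and over the circle of radius r nearly agree; the former is nearly f c. *)
Lemma max_modulus_center (f : R[i] -> R[i]) (c : R[i]) (r M : R) : 0 < r ->
  (forall z, cabs (z - c) <= r -> cdiff f z) ->
  (forall z, cabs (z - c) = r -> cabs (f z) <= M) ->
  cabs (f c) <= M.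
Proof.
move=> r0 df HM; apply/ler_addgt0Pr => e e0.
have e2 : 0 < e / 2 by rewrite divr_gt0.
have dc : cdiff f c by apply: df; rewrite subrr cabs0 ltW.
have [d d0 Hd] := cdiff_cont dc e2.
pose u2 := ln r; pose u1 := Num.min (u2 - 1) (ln (d / 2)).
have X0 : 0 < u2 - u1 by have : u1 <= u2 - 1 by [rewrite ge_min lexx]; lra.
have Y0 : 0 < pi *+ 2 :> R by rewrite mulrn_wgt0 // pi_gt0.
pose F w := f (c + expC w).
have k0 : 0 < e / 2 * (pi *+ 2) by rewrite mulr_gt0.
have [x y /andP[_ hx] _|n] := @goursat F u1 0 (u2 - u1) (pi *+ 2) _ X0 Y0 k0.
  apply: (@cdiff_comp _ f (fun w => c + expC w)).
    by apply: cdiffD; [exact: cdiff_cst|exact: cdiff_expC].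
  apply: df; rewrite addrC addKr cabs_expC /=.
  by rewrite -[leRHS](lnK (r0 : r \is Num.pos)) ler_expR; move: hx; rewrite -/u2; lra.
set N := (2 ^ n)%N; have N0 : 0 < N%:R :> R by rewrite ltr0n expn_gt0.
rewrite /rsum.
have -> : hline F N u1 0 (u2 - u1) = hline F N u1 (0 + pi *+ 2) (u2 - u1).
  apply: eq_bigr => k _; rewrite /F; congr (f (c + _)).
  by rewrite /expC /= cosD2pi sinD2pi.
rewrite subrr mul0r add0r subrKC !cabsM cabs_real.
have -> : cabs (0 +i* 1 : R[i]) = 1 by rewrite cabsE /= expr0n expr1n add0r sqrtr1.
rewrite mul1r ger0_norm ?divr_ge0 ?(ltW Y0) // mulrA ler_pdivrMr // mulrAC ler_pM2r //.
move=> H.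
have Hu2 : cabs (vline F N u2 0 (pi *+ 2)) <= N%:R * M.
  apply: (le_trans (cabs_sum _ _ _)).
  rewrite mulr_natl -[in leRHS](card_ord N) -sumr_const; apply: ler_sum => k _; apply: HM.
  by rewrite addrC addKr cabs_expC /= lnK.
have Hu1 : cabs (vline F N u1 0 (pi *+ 2) - N%:R * f c) <= N%:R * (e / 2).
  rewrite !mulr_natl -[N in f c *+ N]card_ord -sumr_const /vline -sumrB.
  apply: (le_trans (cabs_sum _ _ _)).
  rewrite -[in leRHS](card_ord N) -sumr_const; apply: ler_sum => k _; apply: Hd.
  rewrite cabs_expC /=; apply: (@le_lt_trans _ _ (expR (ln (d / 2)))).
    by rewrite ler_expR ge_min lexx orbT.
  by rewrite lnK ?posrE ?divr_gt0 //; lra.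
rewrite -(ler_pM2l N0).
have -> : N%:R * cabs (f c) = cabs (N%:R * f c).
  by rewrite cabsM; congr (_ * _); rewrite -(rmorph_nat (real_complex R)) cabs_real ger0_norm.
set A := vline _ _ u1 _ _ in Hu1 H; set B := vline _ _ u2 _ _ in Hu2 H.
rewrite [N%:R * f c](_ : _ = - (A - N%:R * f c) - (B - A) + B); last by ring.
apply: (le_trans (cabsD _ _)); have := cabsB (- (A - N%:R * f c)) (B - A).
by rewrite cabsN; lra.
Qed.
End Goursat.

(** * Complex powers and Euler-Maclaurin summation *)

Section RealDerivatives.
Variable R : realType.
Implicit Types (f g : R -> R) (x a b k : R).

Lemma is_derive_mul f g x a b : is_derive x 1 f a -> is_derive x 1 g b ->
  is_derive x 1 (fun t => f t * g t) (a * g x + f x * b).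
Proof.
by move=> H1 H2; rewrite addrC [a * _]mulrC; exact: (@is_deriveM _ _ f g x 1 a b).
Qed.

Lemma is_derive_scale f x a k : is_derive x 1 f a ->
  is_derive x 1 (fun t => k * f t) (k * a).
Proof. by move=> H; exact: (@is_deriveZ _ _ _ f k x 1 a). Qed.

Lemma is_derive_comp f g x a b : is_derive (g x) 1 f a -> is_derive x 1 g b ->
  is_derive x 1 (fun t => f (g t)) (a * b).
Proof. by move=> H1 H2; exact: (@is_derive1_comp _ f g x a b). Qed.
End RealDerivatives.

Section ComplexPowers.
Variable R : realType.
Implicit Types (s : R[i]) (x y a b t : R).

(* [cpw x s] is x ^ (- s). *)
Definition cpw x s : R[i] := expC (- (s * (ln x)%:C)).

Lemma cabs_cpw x s : cabs (cpw x s) = expR (- (complex.Re s * ln x)).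
Proof. by rewrite cabs_expC ReN ReMr. Qed.

Lemma cpwM x y s : 0 < x -> 0 < y -> cpw (x * y) s = cpw x s * cpw y s.
Proof.
move=> x0 y0; rewrite /cpw lnM ?posrE // -expCD; congr (expC _).
by rewrite rmorphD /=; ring.
Qed.

Lemma cpwD x s (w : R[i]) : cpw x (s + w) = cpw x s * cpw x w.
Proof. by rewrite /cpw -expCD; congr (expC _); ring. Qed.

Lemma cpw_1 s : cpw 1 s = 1. Proof. by rewrite /cpw ln1 mulr0 oppr0 expC0. Qed.
Lemma cpwN x s : cpw x (- s) = (cpw x s)^-1.
Proof. by rewrite /cpw mulNr !expCN. Qed.

Lemma cpw_real x y : cpw x (y%:C) = (expR (- (y * ln x)))%:C.
Proof. by rewrite /cpw -rmorphM -rmorphN expC_real. Qed.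

Lemma cpw1 x : 0 < x -> cpw x 1 = (x^-1)%:C.
Proof.
move=> x0; rewrite (_ : 1 = 1%:C) // cpw_real mul1r expRN lnK ?posrE //.
Qed.

Lemma expC_conj (z : R[i]) : expC ((z^*)%C) = ((expC z)^*)%C :> R[i].
Proof. by case: z => u v; rewrite /expC /= cosN sinN mulrN. Qed.

Lemma cpwJ x s : cpw x ((s^*)%C) = ((cpw x s)^*)%C.
Proof. by rewrite /cpw -expC_conj rmorphN rmorphM /= oppr0. Qed.

Lemma cdiff_cpw x s : cdiff (cpw x) s.
Proof.
apply: (@cdiff_comp _ (@expC R) (fun s => - (s * (ln x)%:C))); last exact: cdiff_expC.
by apply: cdiff_ext (cdiff_affine 0 (- (ln x)%:C) s) => w; ring.
Qed.

Lemma cabs_cpw_le x y s : 0 < x -> x <= y -> 0 <= complex.Re s ->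
  cabs (cpw y s) <= cabs (cpw x s).
Proof.
move=> x0 xy s0; rewrite !cabs_cpw ler_expR lerN2 ler_wpM2l //.
by rewrite ler_ln ?posrE // (lt_le_trans x0 xy).
Qed.

Definition rderiv (f : R -> R[i]) x (l : R[i]) :=
  is_derive x 1 (fun t => complex.Re (f t)) (complex.Re l) /\
  is_derive x 1 (fun t => complex.Im (f t)) (complex.Im l).

Lemma rderiv_linear (f : R -> R[i]) x l (c d e : R[i]) : rderiv f x l ->
  rderiv (fun t => c * f t + d + e * t%:C) x (c * l + e).
Proof.
move=> [H1 H2]; case: c e => c1 c2 [e1 e2]; split.
  have -> : (fun t => complex.Re ((c1 +i* c2) * f t + d + (e1 +i* e2) * t%:C)) =
     (fun t => c1 * complex.Re (f t) - c2 * complex.Im (f t) + complex.Re d + e1 * t).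
    by apply/funext => t; case: (f t) d => u v [d1 d2] /=; simpc; rewrite /=; ring.
  have -> : complex.Re ((c1 +i* c2) * l + (e1 +i* e2)) = c1 * complex.Re l - c2 * complex.Im l + 0 + e1 * 1.
    by case: l {H1 H2} => u v /=; ring.
  exact: is_deriveD.
have -> : (fun t => complex.Im ((c1 +i* c2) * f t + d + (e1 +i* e2) * t%:C)) =
     (fun t => c1 * complex.Im (f t) + c2 * complex.Re (f t) + complex.Im d + e2 * t).
  by apply/funext => t; case: (f t) d => u v [d1 d2] /=; simpc; rewrite /=; ring.
have -> : complex.Im ((c1 +i* c2) * l + (e1 +i* e2)) = c1 * complex.Im l + c2 * complex.Re l + 0 + e2 * 1.
  by case: l {H1 H2} => u v /=; ring.
exact: is_deriveD.
Qed.

Lemma rderiv_mvt (f df : R -> R[i]) a b (M : R) : a <= b ->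
  (forall x, a <= x <= b -> rderiv f x (df x)) ->
  (forall x, a <= x <= b -> cabs (df x) <= M) ->
  cabs (f b - f a) <= M * (b - a).
Proof.
rewrite le_eqVlt => /predU1P[->|ab] H HM.
  by rewrite !subrr cabs0 mulr0.
pose w := f b - f a.
have [w0|w0] := eqVneq w 0.
  rewrite -/w w0 cabs0 mulr_ge0 ?subr_ge0 ?(ltW ab) //.
  by apply: le_trans (HM a _); rewrite ?cabs_ge0 // lexx ltW.
(* Projecting f on the direction of w = f b - f a reduces the claim to the real mean value
   theorem. *)
pose g t := complex.Re w * complex.Re (f t) + complex.Im w * complex.Im (f t).
have [x xab|c /andP[ac cb] E] := @mean_value R g
   (fun t => complex.Re w * complex.Re (df t) + complex.Im w * complex.Im (df t)) a b ab.
  by have [H1 H2] := H x xab; apply: is_deriveD; apply: is_deriveZ.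
have cab : a <= c <= b by rewrite !ltW.
have gw : g b - g a = cabs w ^+ 2.
  rewrite cabsE sqr_sqrtr ?addr_ge0 ?sqr_ge0 // /g /w !(ReD, ImD, ReN, ImN); ring.
have CS : complex.Re w * complex.Re (df c) + complex.Im w * complex.Im (df c) <= cabs w * cabs (df c).
  rewrite -(cabsJ w) -cabsM; apply: le_trans (ReleC _).
  by case: (w) (df c) => u v [p q] /=; rewrite mulNr opprK.
have wp : 0 < cabs w by rewrite cabs_gt0.
rewrite -/w -(ler_pM2l wp) -expr2 -gw E mulrA ler_wpM2r ?subr_ge0 ?(ltW ab) //.
by apply: (le_trans CS); rewrite ler_wpM2l ?(ltW wp) // HM.
Qed.

Lemma rderiv_cpw s x : 0 < x -> rderiv (fun t => cpw t s) x (- s * cpw x (s + 1)).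
Proof.
move=> x0; rewrite cpwD cpw1 //.
have dl : is_derive x 1 (@ln R) x^-1 by exact: is_derive1_ln.
case: s => u v.
have dE : is_derive x 1 (fun t => expR (- u * ln t)) (expR (- u * ln x) * (- u * x^-1)).
  by apply: is_derive_comp; apply: is_derive_scale.
split.
  have -> : (fun t : R => complex.Re (cpw t (u +i* v))) =
    (fun t => expR (- u * ln t) * cos (- v * ln t)).
    by apply/funext => t; rewrite /cpw /expC /=; congr (expR _ * cos _); ring.
  have dC : is_derive x 1 (fun t => cos (- v * ln t)) (- sin (- v * ln x) * (- v * x^-1)).
    by apply: is_derive_comp; apply: is_derive_scale.
  refine (is_derive_eq (is_derive_mul dE dC) _).
  rewrite /cpw /expC /= ?(mulr0, mul0r, subr0, addr0, add0r, oppr0, mulNr).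
  ring.
have -> : (fun t : R => complex.Im (cpw t (u +i* v))) =
    (fun t => expR (- u * ln t) * sin (- v * ln t)).
  by apply/funext => t; rewrite /cpw /expC /=; congr (expR _ * sin _); ring.
have dS : is_derive x 1 (fun t => sin (- v * ln t)) (cos (- v * ln x) * (- v * x^-1)).
  by apply: is_derive_comp; apply: is_derive_scale.
refine (is_derive_eq (is_derive_mul dE dS) _).
rewrite /cpw /expC /= ?(mulr0, mul0r, subr0, addr0, add0r, oppr0, mulNr).
ring.
Qed.

Lemma cpw_dist s a b : 0 < a -> a <= b -> 0 <= complex.Re s + 1 ->
  cabs (cpw b s - cpw a s) <= cabs s * cabs (cpw a (s + 1)) * (b - a).
Proof.
move=> a0 ab s0; apply: (@rderiv_mvt (fun x => cpw x s) (fun x => - s * cpw x (s + 1))) => // x /andP[ax xb].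
  by apply: rderiv_cpw; apply: lt_le_trans ax.
by rewrite cabsM cabsN ler_wpM2l ?cabs_ge0 // cabs_cpw_le // ReD.
Qed.

(* The integral of x ^ (- s) over [a, b]. *)
Definition pint s a b : R[i] := (cpw b (s - 1) - cpw a (s - 1)) / (1 - s).

Lemma rderiv_pint s a x (c : R[i]) : s != 1 -> 0 < x ->
  rderiv (fun t => pint s a t - c * t%:C) x (cpw x s - c).
Proof.
move=> s1 x0; have s1' : 1 - s != 0 by rewrite subr_eq0 eq_sym.
have := @rderiv_linear _ _ _ (1 - s)^-1 (- cpw a (s - 1) / (1 - s)) (- c)
  (@rderiv_cpw (s - 1) x x0).
have -> : (fun t => (1 - s)^-1 * cpw t (s - 1) + - cpw a (s - 1) / (1 - s) + - c * t%:C) =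
  (fun t => pint s a t - c * t%:C).
  by apply/funext => t; rewrite /pint; ring.
congr (rderiv _ _ _); rewrite subrK mulNr; congr (_ - _).
by field.
Qed.

Lemma cabs_pint_le s a b : s != 1 -> 0 < a -> a <= b -> 0 <= complex.Re s ->
  cabs (pint s a b) <= cabs (cpw a s) * (b - a).
Proof.
move=> s1 a0 ab s0.
have := @rderiv_mvt (fun t => pint s a t - 0 * t%:C) (fun x => cpw x s - 0) a b (cabs (cpw a s)) ab.
rewrite !mul0r !subr0 /pint subrr mul0r subr0; apply=> x /andP[ax xb].
  by apply: rderiv_pint => //; apply: lt_le_trans ax.
by rewrite subr0 cabs_cpw_le.
Qed.

Lemma pint_rect s a b : s != 1 -> 0 < a -> a <= b -> 0 <= complex.Re s ->
  cabs (pint s a b - cpw b s * (b - a)%:C) <= cabs s * cabs (cpw a (s + 1)) * (b - a) ^+ 2.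
Proof.
move=> s1 a0 ab s0.
have := @rderiv_mvt (fun t => pint s a t - cpw b s * t%:C) (fun x => cpw x s - cpw b s) a b
  (cabs s * cabs (cpw a (s + 1)) * (b - a)) ab.
have -> : pint s a a = 0 by rewrite /pint subrr mul0r.
rewrite sub0r opprK.
have -> : cabs s * cabs (cpw a (s + 1)) * (b - a) ^+ 2 =
  cabs s * cabs (cpw a (s + 1)) * (b - a) * (b - a) by ring.
rewrite (_ : pint s a b - cpw b s * b%:C + cpw b s * a%:C = pint s a b - cpw b s * (b - a)%:C); last first.
  by rewrite rmorphB /=; ring.
apply=> x /andP[ax xb].
  by apply: rderiv_pint => //; apply: lt_le_trans ax.
have x0 : 0 < x by apply: lt_le_trans ax.
rewrite cabs_subC; apply: (le_trans (cpw_dist x0 xb _)); first by rewrite addr_ge0.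
apply: ler_pM; rewrite ?subr_ge0 ?mulr_ge0 ?cabs_ge0 //; last lra.
by rewrite ler_wpM2l ?cabs_ge0 // cabs_cpw_le // ReD addr_ge0 //.
Qed.
End ComplexPowers.

Section EulerMaclaurin.
Variable R : realType.
Implicit Types (s z w : R[i]) (M N k n : nat).

Definition zsum s N : R[i] := \sum_(n < N) cpw n.+1%:R s.

(* The partial sum of the zeta series with its first Euler-Maclaurin correction. *)
Definition zapprox N s : R[i] := zsum s N - cpw N%:R (s - 1) / (1 - s).

Definition npow (sigma : R) n : R := expR (- (sigma * ln n%:R)).

Lemma cabs_cpwn s n : cabs (cpw n%:R s) = npow (complex.Re s) n.
Proof. exact: cabs_cpw. Qed.

Lemma npow_gt0 (sigma : R) n : 0 < npow sigma n. Proof. exact: expR_gt0. Qed.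
Lemma npow1 (sigma : R) : npow sigma 1 = 1.
Proof. by rewrite /npow ln1 mulr0 oppr0 expR0. Qed.

Lemma npowS (sigma : R) n : (0 < n)%N -> npow (sigma + 1) n = npow sigma n / n%:R.
Proof.
by move=> n0; rewrite /npow mulrDl mul1r opprD expRD [expR (- ln _)]expRN lnK // posrE ltr0n.
Qed.

(** The right side is sigma times the integral of x^(- sigma - 1) over [n, n + 1]; the proof avoids
    the integral through 1 / (n + 1) <= ln ((n + 1) / n) and exp u >= 1 + u. *)
Lemma npow_telescope (sigma : R) n : (0 < n)%N -> 0 < sigma ->
  sigma * npow (sigma + 1) n.+1 <= npow sigma n - npow sigma n.+1.
Proof.
move=> n0 s0; rewrite npowS // lerBrDr.
have n0' : 0 < n%:R :> R by rewrite ltr0n.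
have l1 : n.+1%:R^-1 <= ln n.+1%:R - ln n%:R :> R.
  have : ln (1 + - n.+1%:R^-1) <= - n.+1%:R^-1 :> R.
    by apply: le_ln1Dx; rewrite ltrN2 invf_lt1 ?ltr0n // ltr1n ltnS.
  have -> : 1 + - n.+1%:R^-1 = n%:R / n.+1%:R :> R.
    by rewrite -natr1; field; rewrite natr1 pnatr_eq0.
  by rewrite ln_div ?posrE ?ltr0n // lerNr opprB.
have -> : npow sigma n = npow sigma n.+1 * expR (sigma * (ln n.+1%:R - ln n%:R)).
  by rewrite /npow -expRD; congr expR; ring.
have e1 : 1 + sigma * n.+1%:R^-1 <= expR (sigma * (ln n.+1%:R - ln n%:R)).
  apply: le_trans (expR_ge1Dx _); rewrite lerD2l ler_wpM2l // ltW //.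
have p0 := npow_gt0 sigma n.+1.
apply: (le_trans _ (ler_wpM2l (ltW p0) e1)).
by rewrite [leRHS](_ : _ = sigma * (npow sigma n.+1 / n.+1%:R) + npow sigma n.+1) //; ring.
Qed.

Lemma zapproxS s N : (0 < N)%N ->
  zapprox N.+1 s - zapprox N s = cpw N.+1%:R s - pint s N%:R N.+1%:R.
Proof. by move=> N0; rewrite /zapprox /zsum big_ord_recr /= /pint; ring. Qed.

Lemma zapprox_step s N : (0 < N)%N -> s != 1 -> 0 <= complex.Re s ->
  cabs (zapprox N.+1 s - zapprox N s) <= cabs s * npow (complex.Re s + 1) N.
Proof.
move=> N0 s1 s0; rewrite zapproxS //.
have N0' : 0 < N%:R :> R by rewrite ltr0n.
have := @pint_rect R s N%:R N.+1%:R s1 N0' _ s0.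
have -> : N.+1%:R - N%:R = 1 :> R by rewrite -natrB // subSnn.
rewrite mulr1 expr1n mulr1 cabs_cpwn ReD cabs_subC; apply.
by rewrite ler_nat.
Qed.

(** The first step is at most |s| M^(- sigma) and the later ones telescope to |s| M^(- sigma) /
    sigma; with sigma >= 1/2 this makes the factor 3. *)
Lemma zapprox_dist s M k : (0 < M)%N -> s != 1 -> 1 / 2 <= complex.Re s ->
  cabs (zapprox (M + k) s - zapprox M s) <= 3 * cabs s * npow (complex.Re s) M.
Proof.
move=> M0 s1 s0; set g := npow (complex.Re s).
have sp : 0 < complex.Re s by lra.
suff H j : cabs (zapprox (M + j.+1) s - zapprox M s) <=
    cabs s * (g M + (g M - g (M + j)%N) / complex.Re s).
  have c0 := cabs_ge0 s; have gM := npow_gt0 (complex.Re s) M.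
  case: k => [|j]; first by rewrite addn0 subrr cabs0 !mulr_ge0 // ltW.
  apply: (le_trans (H j)); rewrite (mulrC 3) -mulrA ler_wpM2l //.
  have gj := npow_gt0 (complex.Re s) (M + j).
  have : (g M - g (M + j)%N) / complex.Re s <= g M * 2.
    by rewrite ler_pdivrMr //; rewrite -/g in gM gj; nra.
  by lra.
elim: j => [|j IH].
  rewrite addn0 subrr mul0r addr0 addn1; apply: (le_trans (zapprox_step _ _ _)) => //; first lra.
  rewrite ler_wpM2l ?cabs_ge0 // npowS // ler_pdivrMr ?ltr0n //.
  by rewrite ler_peMr ?(ltW (npow_gt0 _ _)) // ler1n.
rewrite -[X in cabs X](subrKA (zapprox (M + j.+1) s)).
apply: (le_trans (cabsD _ _)); rewrite addnS.
have st : cabs (zapprox (M + j.+1).+1 s - zapprox (M + j.+1) s) <=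
    cabs s * ((g (M + j)%N - g (M + j.+1)%N) / complex.Re s).
  apply: (le_trans (zapprox_step _ _ _)) => //; [by rewrite addnS|lra|].
  rewrite ler_wpM2l ?cabs_ge0 // ler_pdivlMr // mulrC addnS.
  by apply: npow_telescope => //; rewrite addn_gt0 M0.
apply: (le_trans (lerD st IH)); rewrite -mulrDr ler_wpM2l ?cabs_ge0 //.
by rewrite !mulrBl addnS; lra.
Qed.

Lemma cdiff_zapprox N s : s != 1 -> cdiff (zapprox N) s.
Proof.
move=> s1; apply: cdiffB; first by apply: cdiff_sum => i; exact: cdiff_cpw.
apply: cdiffM.
  apply: (@cdiff_comp _ (cpw N%:R) (fun s => s - 1)); last exact: cdiff_cpw.
  by apply: cdiff_ext (cdiff_affine (- 1) 1 s) => w; ring.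
apply: cdiffV; last by rewrite subr_eq0 eq_sym.
by apply: cdiff_ext (cdiff_affine 1 (- 1) s) => w; ring.
Qed.

Lemma neq1_Im s : 0 < complex.Im s -> s != 1.
Proof. by case: s => a b /= b0; rewrite eq_complex /= (gt_eqF b0) andbF. Qed.

Lemma zapprox1_le s : 0 < complex.Im s -> cabs (zapprox 1 s) <= 1 + (complex.Im s)^-1.
Proof.
move=> s0; rewrite /zapprox /zsum big_ord_recr big_ord0 /= add0r !cpw_1 div1r.
apply: (le_trans (cabsB _ _)); rewrite cabs1 lerD2l cabsV lef_pV2 ?posrE //.
  by have := Im_le_cabs (1 - s); rewrite ImD ImN /= sub0r normrN gtr0_norm.
by rewrite cabs_gt0 subr_eq0 eq_sym neq1_Im.
Qed.

Section Zeta.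
Variables (zeta : Cplx R -> Cplx R) (zetaP : is_riemann_zeta zeta).

Lemma cdiff_zeta s : s != 1 -> cdiff zeta s.
Proof. by move=> s1; apply: derivable_cdiff; exact: zetaP.1. Qed.

Lemma zeta_zsum s (e : R) N0 : 1 < complex.Re s -> 0 < e ->
  exists2 N, (N0 <= N)%N & cabs (zeta s - zsum s N) <= e /\ npow (complex.Re s - 1) N <= e.
Proof.
move=> s1 e0; have e0' : 0 < e%:C by rewrite ltcR.
have /cvgrPdist_le /(_ _ e0') [N1 _ H] := zetaP.2 s s1.
have sp : 0 < complex.Re s - 1 by lra.
pose K := expR (- ln e / (complex.Re s - 1)).
pose t := Num.truncn K; pose N := (N0 + N1 + t.+1)%N.
exists N; first by rewrite /N; lia.
have N0' : 0 < N%:R :> R by rewrite ltr0n /N; lia.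
split.
  have := H N _; rewrite /= /N.
  have nE (x : R[i]) : `|x| = (cabs x)%:C by rewrite normc_def cabsE.
  rewrite nE lecR /zsum => /(_ _) HH; have := HH _.
  rewrite /series /= big_mkord; apply; lia.
rewrite /npow -[leRHS]lnK ?posrE // ler_expR lerNl mulrC -ler_pdivrMr //.
rewrite -[leLHS]expRK ler_ln ?posrE ?expR_gt0 //.
have /ltW := truncnS_gt K; rewrite -/t => /le_trans; apply.
by rewrite ler_nat /N; lia.
Qed.

(** Let N tend to infinity in [zapprox_dist]: right of Re s = 1 the correction N^(1 - s) / (1 - s)
    tends to 0. *)
Lemma zeta_right s M : 1 < complex.Re s -> (0 < M)%N ->
  cabs (zeta s - zapprox M s) <= 3 * cabs s * npow (complex.Re s) M.
Proof.
move=> s1 M0; apply/ler_addgt0Pr => e e0.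
have s1' : s != 1 by apply: contraTneq s1 => ->; rewrite /= ltxx.
have c0 : 0 < cabs (1 - s) by rewrite cabs_gt0 subr_eq0 eq_sym.
have d0 : 0 < 1 + (cabs (1 - s))^-1 by rewrite addr_gt0 ?invr_gt0.
have [N MN [H1 H2]] := @zeta_zsum s (e / (1 + (cabs (1 - s))^-1)) M s1 (divr_gt0 e0 d0).
have H3 := @zapprox_dist s M (N - M) M0 s1'; rewrite subnKC // in H3.
have s2 : 1 / 2 <= complex.Re s by lra.
have {}H3 := H3 s2.
have -> : zeta s - zapprox M s = (zapprox N s - zapprox M s) +
   ((zeta s - zsum s N) + cpw N%:R (s - 1) / (1 - s)) by rewrite [zapprox N s]/zapprox; ring.
apply: (le_trans (cabsD _ _)); apply: lerD => //.
apply: (le_trans (cabsD _ _)); rewrite cabsM cabsV cabs_cpwn ReD ReN /=.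
set t := e / _ in H1 H2.
have : npow (complex.Re s - 1) N / cabs (1 - s) <= t / cabs (1 - s).
  by rewrite ler_pM2r ?invr_gt0.
have : t + t / cabs (1 - s) = e by rewrite -{1}[t]mulr1 -mulrDr /t divfK // lt0r_neq0.
by move=> <- ?; apply: lerD.
Qed.

Let h N z : R[i] := zeta z - zapprox N z.

Let vanishes (c : R[i]) (r : R) := forall e : R, 0 < e ->
  exists N0, forall N z, (N0 <= N)%N -> cabs (z - c) <= r -> cabs (h N z) <= e.

(** The angle that remains after rotation lies between 0 and pi / 8 < 1/2. There are seventeen
    rotations rather than sixteen because the argument ranges over the closed interval from - pi to
    pi. *)
Lemma unit_rotation (z : R[i]) : cabs z = 1 -> exists k : 'I_17,
  cabs (z * expC (0 +i* ((8 - k%:R) * (pi / 8))) - 1) <= 1 / 2.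
Proof.
move=> z1.
have zz : complex.Re z ^+ 2 + complex.Im z ^+ 2 = 1.
  have := z1; rewrite cabsE => /(congr1 (fun x => x ^+ 2)).
  by rewrite sqr_sqrtr ?addr_ge0 ?sqr_ge0 // expr1n.
have z11 : -1 <= complex.Re z <= 1 by rewrite -ler_norml -z1 Re_le_cabs.
have [phi pphi [cphi sphi]] : exists2 phi : R, - pi <= phi <= pi &
    cos phi = complex.Re z /\ sin phi = complex.Im z.
  have sq : sin (acos (complex.Re z)) = `|complex.Im z|.
    rewrite sin_acos // -sqrtr_sqr; congr Num.sqrt; rewrite -zz; ring.
  have pp := pi_gt0 R.
  have b1 := acos_ge0 z11; have b2 := acos_lepi z11.
  have [i0|i0] := leP 0 (complex.Im z).
    exists (acos (complex.Re z)); first by apply/andP; split; lra.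
    by rewrite acosK ?in_itv //= sq ger0_norm.
  exists (- acos (complex.Re z)); first by apply/andP; split; lra.
  by rewrite cosN sinN acosK ?in_itv //= sq ltr0_norm // opprK.
have pp := pi_gt0 R.
have p4 : pi < 4 :> R by have := @pihalf_lt2 R; lra.
pose t := (phi + pi) * 8 / pi.
have t0 : 0 <= t by rewrite /t !mulr_ge0 ?invr_ge0 ?(ltW pp) //; lra.
have t16 : t <= 16 by rewrite /t ler_pdivrMr //; lra.
have kl : (Num.truncn t < 17)%N.
  by rewrite truncn_lt_nat //; apply: le_lt_trans t16 _; rewrite ltr_nat.
exists (Ordinal kl) => /=.
have /andP[k1 k2] := truncn_itv t0; move: k1 k2; rewrite -natr1.
set k := (Num.truncn t)%:R => k1 k2.
pose psi := phi + (8 - k) * (pi / 8).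
have pn : pi != 0 :> R by rewrite lt0r_neq0.
have aux (p : R) : p != 0 -> phi = (phi + p) * 8 / p * (p / 8) - p by move=> p0; field.
have tphi : phi = t * (pi / 8) - pi := aux _ pn.
have ps : psi = (t - k) * (pi / 8) by rewrite /psi tphi; field.
have ps0 : 0 <= psi by rewrite ps mulr_ge0 ?divr_ge0 ?(ltW pp) //; lra.
have ps1 : psi <= 1 / 2 by rewrite ps; nra.
have -> : z * expC (0 +i* ((8 - k) * (pi / 8))) = cos psi +i* sin psi.
  rewrite /expC /= expR0 !mul1r /psi cosD sinD cphi sphi; case: (z) => a b /=; simpc.
  by congr (_ +i* _); ring.
rewrite cabsE -[leRHS]ger0_norm -?sqrtr_sqr ?ler_wsqrtr ?divr_ge0 // ReD ImD ReN ImN /=.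
have := cos2Dsin2 psi; have := cos_taylor1 psi; rewrite ler_norml => /andP[c1 _].
have : psi ^+ 2 <= 1 / 4 by nra.
move: c1; move: (psi ^+ 2) => q; move: (cos psi) (sin psi) => C S; nra.
Qed.

(** Quantitative analytic continuation. For z in the larger disc take the product of seventeen
    rotated copies of h about z, on the circle about z through c. At each point of the circle some
    copy is evaluated within |z - c| / 2 <= r of c, where h is small, and the others are at most B.
    The maximum principle at z bounds |h z|^17 by e1 B^16. *)
Lemma vanishes_step c r : 0 < r -> 4 * r < complex.Im c -> 1 / 2 <= complex.Re c - 4 * r ->
  vanishes c r -> vanishes c (2 * r).
Proof.
move=> r0 ic rc V.
have dom z : cabs (z - c) <= 4 * r -> complex.Im c - 4 * r <= complex.Im z /\ 1 / 2 <= complex.Re z.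
  have := Im_le_cabs (z - c); have := Re_le_cabs (z - c).
  by rewrite ReD ImD ReN ImN !ler_norml; lra.
have dom0 z : cabs (z - c) <= 4 * r -> 0 < complex.Im z by move=> /dom[]; lra.
(* B does not depend on N, since [zapprox N z] stays within 3 |z| of [zapprox 1 z]. *)
have [B [B1 HB]] : exists B : R, 1 <= B /\ forall N z, (0 < N)%N -> cabs (z - c) <= 4 * r -> cabs (h N z) <= B.
  have r8 : 0 < 8 * r by rewrite mulr_gt0.
  have [x y _ /andP[y1 _]|B0 HB0] := @cdiff_bounded R zeta (complex.Re c - 4 * r) (complex.Im c - 4 * r) (8 * r) (8 * r) r8 r8.
    by apply: cdiff_zeta; apply: neq1_Im => /=; lra.
  pose B2 := 1 + (complex.Im c - 4 * r)^-1 + 3 * (cabs c + 4 * r).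
  exists (1 + `|B0| + `|B2|); split; first by rewrite -addrA lerDl addr_ge0.
  move=> N z N0 zc; have [z1 z2] := dom _ zc; have z3 := dom0 _ zc.
  apply: (le_trans (cabsB _ _)).
  have : cabs (zeta z) <= B0.
    have := Im_le_cabs (z - c); have := Re_le_cabs (z - c).
    rewrite ReD ImD ReN ImN !ler_norml => ? ?.
    have -> : z = complex.Re z +i* complex.Im z by case: (z).
    by apply: HB0; lra.
  have := ler_norm B0; have := ler_norm B2.
  have : cabs (zapprox N z) <= B2.
    have e : zapprox N z = zapprox 1 z + (zapprox (1 + (N - 1)) z - zapprox 1 z).
      by rewrite subrKC subnKC.
    rewrite e; apply: (le_trans (cabsD _ _)); rewrite /B2; apply: lerD.
      apply: (le_trans (zapprox1_le z3)); rewrite lerD2l lef_pV2 ?posrE //; lra.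
    apply: (le_trans (zapprox_dist _ _ _ _)) => //; first exact: neq1_Im.
    rewrite npow1 mulr1 ler_pM2l // -[z](subrK c) addrC.
    by apply: (le_trans (cabsD _ _)); rewrite lerD2l.
  by lra.
move=> e e0.
pose e1 := Num.min e (e ^+ 17 / B ^+ 16).
have Bp : 0 < B by lra.
have e10 : 0 < e1 by rewrite lt_min e0 divr_gt0 ?exprn_gt0.
have [N0 H0] := V _ e10; exists N0.+1 => N z N0N zc.
have NN : (N0 <= N)%N by lia. have Np : (0 < N)%N by lia.
have [zr|rz] := leP (cabs (z - c)) r.
  by apply: (le_trans (H0 _ _ NN zr)); rewrite ge_min lexx.
have Rp : 0 < cabs (z - c) by lra.
pose E (k : 'I_17) : R[i] := expC (0 +i* ((8 - k%:R) * (pi / 8))).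
have cE (k : 'I_17) : cabs (E k) = 1 by rewrite cabs_expC /= expR0.
pose F w := \prod_(k < 17) h N (z + (w - z) * E k).
have inD (k : 'I_17) w : cabs (w - z) <= cabs (z - c) -> cabs (z + (w - z) * E k - c) <= 4 * r.
  move=> wz; rewrite (_ : _ - c = (z - c) + (w - z) * E k); last by ring.
  by apply: (le_trans (cabsD _ _)); rewrite cabsM cE mulr1; lra.
have Fz : F z = h N z ^+ 17.
  by rewrite /F; under eq_bigr do rewrite subrr mul0r addr0; rewrite prodr_const card_ord.
have : cabs (F z) <= e1 * B ^+ 16.
  apply: (@max_modulus_center R F z (cabs (z - c))) => // w wz.
    apply: cdiff_prod => k.
    apply: (@cdiff_comp _ (h N) (fun w => z + (w - z) * E k)).
      by apply: cdiff_ext (cdiff_affine (z - z * E k) (E k) w) => u; ring.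
    have i0 := neq1_Im (dom0 _ (inD k w wz)).
    by apply: cdiffB; [exact: cdiff_zeta|exact: cdiff_zapprox].
  have cz0 : c - z != 0 by rewrite -cabs_gt0 cabs_subC.
  have [|k0 Hk0] := @unit_rotation ((w - z) / (c - z)).
    by rewrite cabsM cabsV [cabs (c - z)]cabs_subC wz mulfV // lt0r_neq0.
  rewrite /F cabs_prod (bigD1 k0) //=; apply: ler_pM; rewrite ?cabs_ge0 //.
  - by apply: prodr_ge0 => k _; exact: cabs_ge0.
  - apply: H0 => //.
    have -> : z + (w - z) * E k0 - c = (c - z) * ((w - z) / (c - z) * E k0 - 1) by field.
    by rewrite cabsM [cabs (c - z)]cabs_subC; nra.
  - have -> : B ^+ 16 = \prod_(k < 17 | k != k0) B by rewrite prodr_const cardC1 card_ord.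
    apply: ler_prod => k _; rewrite cabs_ge0 /=; apply: HB => //; apply: inD; lra.
rewrite Fz cabsX => HF.
have : cabs (h N z) ^+ 17 <= e ^+ 17.
  apply: (le_trans HF); rewrite -ler_pdivlMr ?exprn_gt0 //.
  by rewrite ge_min lexx orbT.
by rewrite ler_pXn2r ?nnegrE ?cabs_ge0 ?(ltW e0).
Qed.

(** Uniform convergence holds in a disc about 2 + i Im s by [zeta_right]. Each doubling of the
    radius r lets the centre move left by r, which reaches s after finitely many steps. The two
    bounds on r keep the discs of radius 4 r in the upper half plane and in Re z >= 1/2. *)
Lemma zeta_zapprox s M : 0 < complex.Im s -> 9 / 10 <= complex.Re s -> (0 < M)%N ->
  cabs (zeta s - zapprox M s) <= 3 * cabs s * npow (complex.Re s) M.
Proof.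
move=> si sr M0; have [/zeta_right|s2] := ltP 1 (complex.Re s); first exact.
pose r := Num.min (complex.Im s / 8) (1 / 16).
have r0 : 0 < r by rewrite lt_min divr_gt0 // divr_gt0.
have r1 : r <= complex.Im s / 8 by rewrite ge_min lexx.
have r2 : r <= 1 / 16 by rewrite ge_min lexx orbT.
pose c k : R[i] := (2 - k%:R * r) +i* complex.Im s.
have V0 : vanishes (c 0%N) r.
  move=> e e0; have K0 : 0 <= 3 * (cabs (c 0%N) + 1) by rewrite mulr_ge0 ?addr_ge0 ?cabs_ge0.
  exists (Num.truncn (3 * (cabs (c 0%N) + 1) / e)).+1 => N z NN zc.
  have zre : 1 < complex.Re z.
    by have := Re_le_cabs (z - c 0%N); rewrite ReD ReN ler_norml /= mul0r subr0; lra.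
  have Np : (0 < N)%N by lia.
  have Np' : 0 < N%:R :> R by rewrite ltr0n.
  apply: (le_trans (zeta_right zre Np)).
  have zb : cabs z <= cabs (c 0%N) + 1.
    by rewrite -[z](subrK (c 0%N)) addrC; apply: (le_trans (cabsD _ _)); rewrite lerD2l; lra.
  apply: (@le_trans _ _ (3 * (cabs (c 0%N) + 1) / N%:R)).
    apply: ler_pM; rewrite ?mulr_ge0 ?cabs_ge0 ?(ltW (npow_gt0 _ _)) //.
      by rewrite ler_pM2l.
    rewrite -[N%:R^-1]lnK ?posrE ?invr_gt0 // lnV ?posrE // ler_expR lerN2 ler_peMl ?(ltW zre) //.
    by rewrite ln_ge0 // ler1n.
  rewrite ler_pdivrMr // [leRHS]mulrC -ler_pdivrMr //.
  by apply: (le_trans (ltW (truncnS_gt _))); rewrite ler_nat.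
have Vk k : 3 / 4 <= 2 - k%:R * r -> vanishes (c k) r.
  elim: k => [//|k IH]; rewrite -natr1 => Hk.
  have Hk' : 3 / 4 <= 2 - k%:R * r by lra.
  have := @vanishes_step (c k) r r0 _ _ (IH Hk'); rewrite /= => V e e0.
  have [||N0 HN] := V _ _ e e0; [lra|lra|].
  exists N0 => N z NN zc; apply: HN => //.
  rewrite (_ : z - c k = (z - c k.+1) + (- r)%:C); last first.
    by rewrite /c -natr1; apply: complex_ext; rewrite !(ReD, ImD, ReN, ImN) /=; ring.
  by apply: (le_trans (cabsD _ _)); rewrite cabs_real normrN gtr0_norm //; lra.
pose k := Num.truncn ((2 - complex.Re s) / r).
have q0 : 0 <= (2 - complex.Re s) / r by rewrite divr_ge0 ?(ltW r0) //; lra.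
have /andP[] := truncn_itv q0; rewrite -/k -natr1 ler_pdivlMr // ltr_pdivrMr // => k1 k2.
have VV : vanishes (c k) r by apply: Vk; lra.
have sc : cabs (s - c k) <= r.
  apply: (le_trans (cabs_le_ReIm _)); rewrite !(ReD, ImD, ReN, ImN) /= subrr normr0 addr0.
  by rewrite ler_norml; lra.
apply/ler_addgt0Pr => e e0; have [N0 HN] := VV _ e0.
have := HN (M + N0)%N s (leq_addl _ _) sc.
have := @zapprox_dist s M N0 M0 (neq1_Im si).
rewrite /h => /(_ _) H1 H2.
rewrite -(subrKA (zapprox (M + N0) s)) addrC.
apply: (le_trans (cabsD _ _)); apply: lerD => //; apply: H1; lra.
Qed.
End Zeta.
End EulerMaclaurin.

(** * Counting the zeros of a function in a disc *)

Section ZeroCounting.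
Variable R : realType.
Implicit Types (z w h : R[i]) (f g : R[i] -> R[i]).

Definition ccont f z := forall e : R, 0 < e ->
  exists2 d : R, 0 < d & forall h, cabs h < d -> cabs (f (z + h) - f z) <= e.

Lemma cdiff_ccont f z : cdiff f z -> ccont f z.
Proof. by move=> df e; exact: cdiff_cont. Qed.

Lemma ccontM f g z : ccont f z -> ccont g z -> ccont (fun w => f w * g w) z.
Proof.
move=> cf cg e e0.
have k0 : 0 < 1 + cabs (f z) + cabs (g z) by rewrite !ltr_wpDr ?cabs_ge0.
pose e1 := Num.min 1 (e / (1 + cabs (f z) + cabs (g z))).
have e10 : 0 < e1 by rewrite lt_min ltr01 divr_gt0.
have e11 : e1 <= 1 by rewrite ge_min lexx.
have e1e : e1 * (1 + cabs (f z) + cabs (g z)) <= e by rewrite -ler_pdivlMr // ge_min lexx orbT.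
have [d d0 Hd] := cf _ e10; have [d' d'0 Hd'] := cg _ e10.
exists (Num.min d d'); first by rewrite lt_min d0.
move=> h; rewrite lt_min => /andP[/Hd h1 /Hd' h2].
rewrite [X in cabs X](_ : _ = (f (z + h) - f z) * (g (z + h) - g z) +
  (f (z + h) - f z) * g z + f z * (g (z + h) - g z)); last by ring.
apply: (le_trans (cabsD _ _)); rewrite cabsM.
apply: (@le_trans _ _ (e1 * e1 + e1 * cabs (g z) + cabs (f z) * e1)).
  apply: lerD; last by rewrite ler_wpM2l ?cabs_ge0.
  apply: (le_trans (cabsD _ _)); rewrite !cabsM; apply: lerD.
    by apply: ler_pM; rewrite ?cabs_ge0.
  by rewrite ler_wpM2r ?cabs_ge0.
by have := cabs_ge0 (f z); have := cabs_ge0 (g z); nra.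
Qed.

Lemma ccontX f n z : ccont f z -> ccont (fun w => f w ^+ n) z.
Proof.
move=> cf; elim: n => [|n IH].
  by move=> e e0; exists 1 => // h _; rewrite !expr0 subrr cabs0 ltW.
by move=> e /(ccontM cf IH) [d d0 H]; exists d => // h /H; rewrite !exprS.
Qed.

(** The power trick: constants disappear on taking m-th roots. *)
Lemma expr_lim_le (a b x y : R) : 0 < a -> 0 <= x -> 0 <= y ->
  (forall m, a * x ^+ m <= b * y ^+ m) -> x <= y.
Proof.
move=> a0 x0 y0 H; rewrite leNgt; apply/negP => yx.
have [y00|yn0] := eqVneq y 0.
  by have := H 1%N; rewrite !expr1 y00 mulr0; nra.
have yp : 0 < y by rewrite lt_def yn0.
have q1 : 0 < x / y - 1 by rewrite subr_gt0 ltr_pdivlMr // mul1r.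
have B m : 1 + m%:R * (x / y - 1) <= (x / y) ^+ m.
  elim: m => [|m IH]; first by rewrite mul0r addr0 expr0.
  rewrite exprS -natr1; have : 0 <= m%:R :> R by [].
  move: IH q1; have -> : x / y = 1 + (x / y - 1) by rewrite subrKC.
  move: (x / y - 1) => p; rewrite [1 + p - 1]addrC addKr.
  move: ((1 + p) ^+ m) m%:R => u v H1 p0 v0.
  have : 0 <= (1 + p) * (u - (1 + v * p)) by rewrite mulr_ge0 //; lra.
  have : 0 <= v * (p * p) by rewrite !mulr_ge0 // ltW.
  by lra.
have Hq m : a * (x / y) ^+ m <= b.
  by rewrite expr_div_n mulrA ler_pdivrMr ?exprn_gt0.
have k := truncnS_gt (b / a / (x / y - 1)).
set n := (Num.truncn _).+1 in k; move: k; rewrite ltr_pdivrMr // => k.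
have := Hq n; rewrite -ler_pdivlMl // [a^-1 * b]mulrC.
have := B n; lra.
Qed.

(** Jensen's inequality in product form: f divided by the product P of the z - x over its zeros x is
    compared at c and on the circle. At a zero only the continuity of f / P is at hand, so the
    maximum principle is applied to f (f / P)^m, which is differentiable there because its first
    factor vanishes ([cdiffM_cont]); [expr_lim_le] then removes the extra factor. *)
Lemma zero_count (f : R[i] -> R[i]) (c : R[i]) (s : seq R[i]) (r r' M : R) :
  0 < r -> r < r' -> uniq s ->
  (forall z, cabs (z - c) <= r' -> cdiff f z) ->
  (forall z, cabs (z - c) = r' -> cabs (f z) <= M) ->
  (forall z, z \in s -> f z = 0 /\ cabs (z - c) <= r) ->
  cabs (f c) <= M * (r / (r' - r)) ^+ size s.
Proof.
move=> r0 rr' us df HM Hs.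
have r'0 : 0 < r' by lra.
have M0 : 0 <= M.
  by apply: le_trans (HM (c + r'%:C) _); rewrite ?cabs_ge0 // addrC addKr cabs_real gtr0_norm.
have rr0 : 0 < r' - r by lra.
have [fc0|fcn0] := eqVneq (f c) 0.
  by rewrite fc0 cabs0 mulr_ge0 ?exprn_ge0 ?divr_ge0 // ltW.
have fcp : 0 < cabs (f c) by rewrite cabs_gt0.
pose P (t : seq R[i]) z := \prod_(x <- t) (z - x).
have dP t z : cdiff (P t) z.
  apply: cdiff_prod => x; apply: cdiff_ext (cdiff_affine (- x) 1 z) => w; ring.
have Pn0 t z : z \notin t -> P t z != 0.
  move=> zt; rewrite /P prodf_seq_neq0; apply/allP => x xt /=.
  by rewrite subr_eq0; apply: contraNneq zt => ->.
pose F m z := f z * (f z / P s z) ^+ m.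
have dF m z : cabs (z - c) <= r' -> cdiff (F m) z.
  move=> zc; have [zs|zs] := boolP (z \in s); last first.
    by apply: cdiffM; [exact: df|apply: cdiffX; apply: cdiffM; [exact: df|apply: cdiffV => //; exact: Pn0]].
  have [fz0 _] := Hs _ zs.
  have [l Hl] := df _ zc.
  (* The continuous extension of the difference quotient, with the derivative as its value at z. *)
  pose k w := if w == z then l else f w / (w - z).
  have ck : ccont k z.
    move=> e e0; have [d d0 Hd] := Hl _ e0; exists d => // h hd.
    rewrite /k eqxx; case: eqP => [_|/eqP hz]; first by rewrite subrr cabs0 ltW.
    have h0 : h != 0 by apply: contraNneq hz => ->; rewrite addr0.
    have -> : z + h - z = h by rewrite addrC addKr.
    have := Hd _ hd; rewrite fz0 subr0.
    have -> : f (z + h) - l * h = (f (z + h) / h - l) * h by field.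
    by rewrite cabsM ler_pM2r // cabs_gt0.
  pose t := rem z s.
  have zt : z \notin t by rewrite /t mem_rem_uniqF.
  have Ps w : P s w = (w - z) * P t w by rewrite /P (perm_big _ (perm_to_rem zs)) big_cons.
  pose G w := (k w * (P t w)^-1) ^+ m.
  have cG : ccont G z.
    apply: ccontX; apply: ccontM => //; apply: cdiff_ccont; apply: cdiffV => //; exact: Pn0.
  have FE w : F m w = f w * (f w / P s w) ^+ m by [].
  apply: cdiffM_cont; [exact: df|exact: fz0|].
  exists (G z) => e e0; have [d d0 Hd] := cG _ e0; exists d => // h h0 /Hd.
  rewrite {1}/G /k (_ : (z + h == z) = false); last first.
    by apply/negbTE; rewrite -subr_eq0 addrC addKr.
  by rewrite Ps invfM mulrA.
have Pc t : all (fun z => cabs (z - c) <= r) t -> cabs (P t c) <= r ^+ size t.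
  elim: t => [|x t IH] /=; first by rewrite /P big_nil cabs1.
  move=> /andP[xc /IH H]; rewrite /P big_cons cabsM exprS.
  by apply: ler_pM; rewrite ?cabs_ge0 // cabs_subC.
have Pr z t : cabs (z - c) = r' -> all (fun z => cabs (z - c) <= r) t ->
    (r' - r) ^+ size t <= cabs (P t z).
  move=> zr; elim: t => [|x t IH] /=; first by rewrite /P big_nil cabs1.
  move=> /andP[xc /IH H]; rewrite /P big_cons cabsM exprS.
  apply: ler_pM => //; [exact: ltW|by rewrite exprn_ge0 // ltW|].
  have := cabs_ler_sub (z - c) (x - c); rewrite zr opprB subrKA; lra.
have sa : all (fun z => cabs (z - c) <= r) s by apply/allP => z /Hs[].
have cs : c \notin s by apply/negP => /Hs[f0 _]; rewrite f0 eqxx in fcn0.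
have Pcp : 0 < cabs (P s c) by rewrite cabs_gt0 Pn0.
have : cabs (f c) / r ^+ size s <= M / (r' - r) ^+ size s.
  apply: (@expr_lim_le (cabs (f c)) M).
  - exact: fcp.
  - by rewrite divr_ge0 ?cabs_ge0 // exprn_ge0 // ltW.
  - by rewrite divr_ge0 // exprn_ge0 // ltW.
  move=> m; apply: (@le_trans _ _ (cabs (F m c))).
    rewrite /F cabsM cabsX cabsM cabsV ler_wpM2l ?cabs_ge0 //.
    apply: lerXn2r; rewrite ?nnegrE ?divr_ge0 ?cabs_ge0 ?exprn_ge0 ?(ltW r0) //.
    by rewrite ler_wpM2l ?cabs_ge0 // lef_pV2 ?posrE ?exprn_gt0 // Pc.
  apply: (@max_modulus_center R (F m) c r') => // [z zc|z zr]; first exact: dF.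
  have pz := Pr _ _ zr sa; have pp : 0 < (r' - r) ^+ size s by rewrite exprn_gt0.
  rewrite /F cabsM cabsX cabsM cabsV; apply: ler_pM; rewrite ?exprn_ge0 ?divr_ge0 ?cabs_ge0 ?HM //.
  apply: lerXn2r; rewrite ?nnegrE ?divr_ge0 ?cabs_ge0 ?(ltW pp) //.
  apply: ler_pM; rewrite ?invr_ge0 ?cabs_ge0 ?HM //.
  by rewrite lef_pV2 ?posrE // (lt_le_trans pp).
rewrite ler_pdivrMr ?exprn_gt0 // => /le_trans; apply.
by rewrite expr_div_n mulrA mulrAC.
Qed.
End ZeroCounting.

(** * Sieve weights *)

Lemma sum_multiples (V : nmodType) (K p : nat) (F : nat -> V) : (0 < p)%N ->
  \sum_(1 <= d < K.+1 | (p %| d)%N) F d = \sum_(1 <= k < (K %/ p).+1) F (p * k)%N.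
Proof.
move=> p0; elim: K => [|K IH]; first by rewrite div0n !big_geq.
rewrite big_mkcond big_nat_recr //= -big_mkcond IH divnS //.
have [pK|] := boolP (p %| K.+1)%N; last by rewrite add0n addr0.
rewrite add1n [RHS]big_nat_recr //=; congr (_ + F _).
have := divnK pK; rewrite divnS // pK add1n => <-; exact: mulnC.
Qed.

(** * The Moebius function and sums coprime to a modulus *)

Section Mobius.
Variable R : realType.
Implicit Types (d e k m n p K : nat) (x y : R).

Lemma sum_multiples_support K p (F : nat -> R) : (0 < p)%N ->
  (forall d, (K < d)%N -> F d = 0) ->
  \sum_(1 <= d < K.+1 | (p %| d)%N) F d = \sum_(1 <= k < K.+1) F (p * k)%N.
Proof.
move=> p0 F0; rewrite sum_multiples // [RHS](big_cat_nat (n := (K %/ p).+1)) //=; last first.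
  by rewrite ltnS leq_div.
have -> : \sum_((K %/ p).+1 <= k < K.+1) F (p * k)%N = 0; last by rewrite addr0.
rewrite big_nat_cond big1 // => k /andP[/andP[k1 _] _].
by apply: F0; rewrite mulnC -ltn_divLR.
Qed.

Definition sqf m := (0 < m)%N && all (fun p => ~~ (p ^ 2 %| m)%N) (primes m).

Lemma sqf_gt0 m : sqf m -> (0 < m)%N. Proof. by case/andP. Qed.
Lemma sqfP m : reflect ((0 < m)%N /\ forall p, prime p -> ~~ (p ^ 2 %| m)%N) (sqf m).
Proof.
apply: (iffP andP) => [[m0 /allP H]|[m0 H]]; split=> //.
  move=> p pp; apply/negP => pm.
  have pin : p \in primes m by rewrite mem_primes pp m0 (dvdn_trans _ pm) // expnS dvdn_mulr.
  by have := H p pin; rewrite pm.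
by apply/allP => p; rewrite mem_primes => /andP[/H].
Qed.

Lemma sqf_mul p m : prime p -> ~~ (p %| m)%N -> sqf (p * m) = sqf m.
Proof.
move=> pp pm; have p0 := prime_gt0 pp.
apply/sqfP/sqfP => -[m0 H]; split; rewrite ?muln_gt0 ?p0 //.
- by move: m0; rewrite muln_gt0 => /andP[].
- by move=> q qq; apply: contra (H q qq) => qm; rewrite dvdn_mull.
- move=> q qq; have [->|qp] := eqVneq q p; first by rewrite expnS expn1 dvdn_pmul2l.
  rewrite Gauss_dvdr ?H // coprimeXl // prime_coprime // dvdn_prime2 //.
Qed.

Lemma sqf_mul0 p m : prime p -> (p %| m)%N -> ~~ sqf (p * m).
Proof.
move=> pp pm; apply/negP => /sqfP[_ /(_ p pp)]; apply/negP; rewrite negbK.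
by rewrite expnS expn1 dvdn_mul.
Qed.

Definition mu m : R := if sqf m then (-1) ^+ size (primes m) else 0.

Lemma mu1 : mu 1 = 1. Proof. by rewrite /mu /= expr0. Qed.

Lemma muM p m : prime p -> (0 < m)%N -> mu (p * m) = if (p %| m)%N then 0 else - mu m.
Proof.
move=> pp m0; rewrite /mu; have [pm|pm] := boolP (p %| m)%N.
  by rewrite (negbTE (sqf_mul0 pp pm)).
rewrite sqf_mul //; case: ifP => _; last by rewrite oppr0.
have : perm_eq (primes (p * m)) (p :: primes m).
  apply: uniq_perm; rewrite ?primes_uniq //=.
    by rewrite mem_primes (negbTE pm) !andbF primes_uniq.
  by move=> q; rewrite (primesM _ (prime_gt0 pp) m0) (primes_prime pp) !inE.
by move=> /perm_size ->; rewrite /= exprS mulN1r.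
Qed.

Lemma mu_sqr m : mu m ^+ 2 = (sqf m)%:R.
Proof. by rewrite /mu; case: ifP => _; rewrite ?expr0n //= -exprM mulnC exprM sqrrN expr1n expr1n. Qed.

Lemma mu_le1 m : `|mu m| <= 1.
Proof. by rewrite /mu; case: ifP => _; rewrite ?normr0 // normrX normrN1 expr1n. Qed.

Lemma mu_nsqf m : ~~ sqf m -> mu m = 0. Proof. by rewrite /mu => /negbTE ->. Qed.

Lemma sqf_ind (P : nat -> Prop) : P 1%N ->
  (forall p m, prime p -> ~~ (p %| m)%N -> sqf m -> P m -> P (p * m)%N) ->
  forall m, sqf m -> P m.
Proof.
move=> P1 IH m; elim/ltn_ind: m => m IHm sm; have m0 := sqf_gt0 sm.
have [->//|m1] := eqVneq m 1%N.
have m1' : (1 < m)%N by rewrite ltn_neqAle eq_sym m1.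
have pp := pdiv_prime m1'; have := pdiv_dvd m; move: pp; set p := pdiv m => pp.
move=> /dvdnP[q]; rewrite mulnC => qE; rewrite qE in sm m0 IHm *.
have pq : ~~ (p %| q)%N by apply/negP => /(sqf_mul0 pp); rewrite sm.
have q0 : (0 < q)%N by move: m0; rewrite muln_gt0 => /andP[].
apply: IH => //; first by rewrite sqf_mul in sm.
apply: IHm; last by rewrite sqf_mul in sm.
by rewrite -[ltnLHS]mul1n ltn_pmul2r // prime_gt1.
Qed.

Lemma sum_divisors_split K p n (F : nat -> R) : prime p -> (0 < n)%N -> (p * n <= K)%N ->
  \sum_(1 <= d < K.+1 | (d %| p * n)%N) F d =
  \sum_(1 <= d < K.+1 | (d %| n)%N && ~~ (p %| d)%N) F d + \sum_(1 <= d < K.+1 | (d %| n)%N) F (p * d)%N.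
Proof.
move=> pp n0 pK; rewrite (bigID (fun d => (p %| d)%N)) /= addrC; congr (_ + _).
  apply: eq_bigl => d; have [pd|pd] := boolP (p %| d)%N; rewrite ?andbF ?andbT //=.
  by rewrite Gauss_dvdr // coprime_sym prime_coprime.
pose G d := if (d %| p * n)%N then F d else 0.
transitivity (\sum_(1 <= d < K.+1 | (p %| d)%N) G d).
  by rewrite /G -big_mkcondr; apply: eq_bigl => d; rewrite andbC.
rewrite sum_multiples_support ?prime_gt0 //.
  by rewrite /G [RHS]big_mkcond; apply: eq_bigr => d _; rewrite dvdn_pmul2l ?prime_gt0.
move=> d Kd; rewrite /G; case: ifP => // /dvdn_leq.
by rewrite muln_gt0 n0 prime_gt0 // => /(_ isT); lia.
Qed.

(** For a prime p dividing n the terms of d and p d cancel. The range of d is bounded by a K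
    independent of n so that such sums can be interchanged later. *)
Lemma sum_mu K n : (0 < n)%N -> (n <= K)%N ->
  \sum_(1 <= d < K.+1 | (d %| n)%N) mu d = (n == 1%N)%:R.
Proof.
move=> n0 nK; have [->|n1] := eqVneq n 1%N.
  rewrite big_mkcond big_nat_recl; last by lia.
  have -> : \sum_(1 <= i < K) (if (i.+1 %| 1)%N then mu i.+1 else 0) = 0.
    rewrite big_nat_cond big1 // => d /andP[/andP[d1 _] _].
    by rewrite dvdn1 ifF //; apply/negbTE; lia.
  by rewrite dvd1n mu1; exact: addr0.
have n1' : (1 < n)%N by rewrite ltn_neqAle eq_sym n1.
have pp := pdiv_prime n1'; have := pdiv_dvd n; move: pp; set p := pdiv n => pp.
move=> /dvdnP[q]; rewrite mulnC => qE; rewrite qE in n0 nK *.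
have q0 : (0 < q)%N by move: n0; rewrite muln_gt0 => /andP[].
rewrite sum_divisors_split //.
have -> : \sum_(1 <= d < K.+1 | (d %| q)%N) mu (p * d) = - \sum_(1 <= d < K.+1 | (d %| q)%N && ~~ (p %| d)%N) mu d.
  rewrite -sumrN [LHS]big_mkcond [RHS]big_mkcond; apply: eq_big_nat => d /andP[d1 _].
  by rewrite muM //; case: (d %| q)%N (p %| d)%N => [] [].
by rewrite subrr.
Qed.

Lemma muM_sqf m k : sqf m -> (0 < k)%N -> mu (m * k) = if coprime m k then mu m * mu k else 0.
Proof.
move=> sm k0; elim/sqf_ind: m / sm => [|p m pp pm sm IH].
  by rewrite mul1n coprime1n mu1 mul1r.
have m0 := sqf_gt0 sm.
rewrite -mulnA muM // ?muln_gt0 ?m0 // Euclid_dvdM // (negbTE pm) /= IH coprimeMl (prime_coprime _ pp).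
rewrite muM // (negbTE pm).
by case: (p %| k)%N => //=; case: ifP => _; rewrite ?oppr0 // mulNr.
Qed.

Lemma totient_sqf p m : prime p -> ~~ (p %| m)%N ->
  (totient (p * m))%:R = (p%:R - 1) * (totient m)%:R :> R.
Proof.
move=> pp pm; rewrite totient_coprime ?prime_coprime // totient_prime // natrM.
by rewrite -subn1 natrB // prime_gt0.
Qed.

Lemma totient_gt0R m : (0 < m)%N -> 0 < (totient m)%:R :> R.
Proof. by rewrite ltr0n totient_gt0. Qed.

Section CoprimeSums.
Variables (K : nat) (phi : R -> R) (B : R).
Hypothesis phi0 : forall x, x < 1 -> phi x = 0.

Definition cop_sum m y := \sum_(1 <= k < K.+1 | coprime m k) mu k / k%:R * phi (y / k%:R).

(** Split off the multiples p k, where mu (p k) = - mu k for k prime to p. Since phi vanishes below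
    1 and y <= K, the cut at K loses nothing. *)
Lemma cop_sum_rec p m y : prime p -> ~~ (p %| m)%N -> y <= K%:R ->
  cop_sum m y = cop_sum (p * m) y - p%:R^-1 * cop_sum (p * m) (y / p%:R).
Proof.
move=> pp pm yK; have p0 := prime_gt0 pp; have p0' : p%:R != 0 :> R by rewrite pnatr_eq0 -lt0n.
rewrite /cop_sum (bigID (fun k => (p %| k)%N)) /= addrC; congr (_ + _).
  by apply: eq_bigl => k /=; rewrite coprimeMl (prime_coprime _ pp) andbC.
pose G k := if coprime m k then mu k / k%:R * phi (y / k%:R) else 0.
transitivity (\sum_(1 <= k < K.+1 | (p %| k)%N) G k).
  by rewrite /G -big_mkcondr; apply: eq_bigl => k; rewrite andbC.
rewrite sum_multiples_support //; last first.
  move=> k Kk; have k0 : 0 < k%:R :> R by rewrite ltr0n; lia.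
  rewrite /G phi0 ?mulr0 ?if_same // ltr_pdivrMr // mul1r.
  by apply: le_lt_trans yK _; rewrite ltr_nat.
rewrite mulr_sumr -sumrN [RHS]big_mkcond /= big_nat_cond [RHS]big_nat_cond.
apply: eq_bigr => k /andP[/andP[k1 _] _].
have k0 : k%:R != 0 :> R by rewrite pnatr_eq0; lia.
rewrite /G coprimeMr coprimeMl coprime_sym (prime_coprime _ pp) pm /= (prime_coprime _ pp) muM //.
case: (coprime m k); rewrite ?andbF //=; case: (p %| k)%N => /=; rewrite ?mul0r // natrM.
have -> : y / (p%:R * k%:R) = y / p%:R / k%:R by rewrite invfM mulrA.
by rewrite invfM; ring.
Qed.

(** By [cop_sum_rec] the sum for p m at y is the sum for m at y plus 1/p times the sum for p m at y
    / p. Iteration gives a geometric series, which ends since the argument falls below 1; each prime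
    costs 1 / (1 - 1/p), together m / phi(m). *)
Lemma cop_sum_bound m y : (forall x, x <= K%:R -> `|cop_sum 1 x| <= B) ->
  sqf m -> y <= K%:R -> `|cop_sum m y| <= B * (m%:R / (totient m)%:R).
Proof.
move=> HB sm; elim/sqf_ind: m / sm y => [|p m pp pm sm IH] y yK.
  by rewrite divr1 mulr1; exact: HB.
have p1 : 1 < p%:R :> R by rewrite ltr1n prime_gt1.
have tm := totient_gt0R (sqf_gt0 sm).
rewrite totient_sqf // natrM.
set C := B * _; have CE : B * (m%:R / (totient m)%:R) + p%:R^-1 * C = C.
  rewrite /C; field; rewrite !lt0r_neq0 //; lra.
have [n yn] : exists n, y < 2 ^+ n.
  exists (Num.truncn y).+1; apply: lt_trans (truncnS_gt _) _.
  by rewrite -natrX ltr_nat ltn_expl.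
elim: n y yn yK => [|n IHn] y yn yK.
  rewrite /cop_sum big_nat_cond big1 ?normr0.
    have B0 : 0 <= B by apply: le_trans (HB y yK).
    apply: mulr_ge0 => //; apply: divr_ge0; first exact: mulr_ge0.
    by apply: mulr_ge0 => //; rewrite subr_ge0 ltW.
  move=> k /andP[/andP[k1 _] _]; rewrite phi0 ?mulr0 //.
  rewrite ltr_pdivrMr ?mul1r ?ltr0n //; apply: lt_le_trans yn _.
  by rewrite expr0 ler1n.
have -> : cop_sum (p * m) y = cop_sum m y + p%:R^-1 * cop_sum (p * m) (y / p%:R).
  by rewrite (cop_sum_rec pp pm yK) subrK.
apply: (le_trans (ler_normD _ _)); rewrite -CE; apply: lerD; first exact: IH.
rewrite normrM ger0_norm ?invr_ge0 //; apply: ler_wpM2l; first by rewrite invr_ge0.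
have p0 : 0 < p%:R :> R by lra.
have p2 : 2 <= p%:R :> R by rewrite ler_nat prime_gt1.
apply: IHn; rewrite ?ltr_pdivrMr ?ler_pdivrMr //.
  apply: lt_le_trans yn _; rewrite exprS mulrC ler_wpM2l // exprn_ge0.
by apply: le_trans yK _; rewrite ler_peMr // ltW.
Qed.
End CoprimeSums.
End Mobius.

(** * Harmonic sums and logarithmic sums of the Moebius function *)

Section HarmonicSums.
Variable R : realType.
Implicit Types (d e k m n p K j a : nat) (x y v : R).

Definition harm n : R := \sum_(1 <= j < n.+1) j%:R^-1.

Lemma harmS n : harm n.+1 = harm n + n.+1%:R^-1.
Proof. by rewrite /harm big_nat_recr. Qed.
Lemma harm0 : harm 0 = 0. Proof. by rewrite /harm big_geq. Qed.
Lemma harm_ge0 n : 0 <= harm n.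
Proof. by apply: sumr_ge0 => j _; rewrite invr_ge0. Qed.

Lemma ln_succ_bounds n : (0 < n)%N ->
  n.+1%:R^-1 <= ln n.+1%:R - ln n%:R :> R /\ ln n.+1%:R - ln n%:R <= n%:R^-1 :> R.
Proof.
move=> n0; have n0' : 0 < n%:R :> R by rewrite ltr0n.
split.
  have : ln (1 + - n.+1%:R^-1) <= - n.+1%:R^-1 :> R.
    by apply: le_ln1Dx; rewrite ltrN2 invf_lt1 ?ltr0n // ltr1n ltnS.
  have -> : 1 + - n.+1%:R^-1 = n%:R / n.+1%:R :> R.
    by rewrite -natr1; field; rewrite natr1 pnatr_eq0.
  by rewrite ln_div ?posrE ?ltr0n // lerNr opprB.
have : ln (1 + n%:R^-1) <= n%:R^-1 :> R.
  by apply: le_ln1Dx; apply: lt_le_trans (ltrN10 _) _; rewrite invr_ge0.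
have -> : 1 + n%:R^-1 = n.+1%:R / n%:R :> R.
  by rewrite -natr1; field; rewrite pnatr_eq0 -lt0n.
by rewrite ln_div ?posrE ?ltr0n.
Qed.

Lemma harm_lower a n : (a <= n)%N -> ln n.+1%:R - ln a.+1%:R <= harm n - harm a.
Proof.
move=> /subnK <-; elim: (n - a)%N => [|k IH]; first by rewrite add0n !subrr.
have aux (A B c h g i : R) : A - c <= h - g -> B - A <= i -> B - c <= h + i - g by lra.
by rewrite addSn harmS; have [_] := @ln_succ_bounds (k + a).+1 isT; exact: aux IH.
Qed.

Lemma harm_upper a n : (0 < a <= n)%N -> harm n - harm a <= ln n%:R - ln a%:R.
Proof.
move=> /andP[a0] /subnK <-; elim: (n - a)%N => [|k IH]; first by rewrite add0n !subrr.
have ka : (0 < k + a)%N by lia.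
have aux (A B c h g i : R) : h - g <= A - c -> i <= B - A -> h + i - g <= B - c by lra.
by rewrite addSn harmS; have [+ _] := ln_succ_bounds ka; exact: aux IH.
Qed.

Lemma harm_le n : harm n <= 1 + ln n%:R.
Proof.
case: n => [|n]; first by rewrite harm0 ln0 ?addr0.
have h1 : harm 1 = 1 by rewrite harmS harm0 add0r invr1.
by have := @harm_upper 1 n.+1 isT; rewrite h1 ln1; lra.
Qed.

Lemma ln_le_harm n : ln n.+1%:R <= harm n.
Proof. by have := @harm_lower 0 n isT; rewrite ln1 harm0; lra. Qed.

Lemma sum_inv_sqr n : \sum_(1 <= j < n.+1) (j%:R ^- 2) <= 2 :> R.
Proof.
suff H : \sum_(1 <= j < n.+2) (j%:R ^- 2) <= 2 - n.+1%:R^-1 :> R.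
  apply: le_trans (_ : \sum_(1 <= j < n.+2) (j%:R ^- 2) <= _).
    by rewrite [leRHS]big_nat_recr //= lerDl invr_ge0 exprn_ge0.
  by apply: (le_trans H); rewrite gerBl invr_ge0.
elim: n => [|n IH]; first by rewrite big_nat1 expr1n invr1; lra.
rewrite big_nat_recr //=; apply: (le_trans (lerD IH (lexx _))).
have h : n.+1%:R^-1 - n.+2%:R^-1 = (n.+1%:R * n.+2%:R)^-1 :> R.
  rewrite -[n.+2%:R]natr1; field.
  have n0 : 0 <= n%:R :> R by [].
  by apply/andP; split; rewrite lt0r_neq0 //; lra.
have : (n.+2%:R ^+ 2)^-1 <= (n.+1%:R * n.+2%:R)^-1 :> R.
  by rewrite lef_pV2 ?posrE ?exprn_gt0 ?mulr_gt0 ?ltr0n // expr2 ler_pM2r ?ltr0n // ler_nat.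
have aux (a b c d : R) : a - b = c -> d <= c -> 2 - a + d <= 2 - b by lra.
exact: aux h.
Qed.

Definition lnp x : R := if x < 1 then 0 else ln x.

Lemma lnp_lt1 x : x < 1 -> lnp x = 0. Proof. by rewrite /lnp => ->. Qed.
Lemma lnp_ge1 x : 1 <= x -> lnp x = ln x. Proof. by rewrite /lnp leNgt => /negbTE ->. Qed.
Lemma sum_over_divisors K (F : nat -> nat -> R) (n : nat) : (n <= K)%N ->
  \sum_(1 <= k < K.+1) \sum_(1 <= j < K.+1 | (k * j <= n)%N) F k (k * j)%N =
  \sum_(1 <= m < n.+1) \sum_(1 <= k < K.+1 | (k %| m)%N) F k m.
Proof.
move=> nK; rewrite [RHS](exchange_big_dep xpredT) //=; apply: eq_big_nat => k /andP[k0 _].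
pose G m := if (m <= n)%N then F k m else 0.
transitivity (\sum_(1 <= j < K.+1) G (k * j)%N); first by rewrite big_mkcond.
rewrite -sum_multiples_support //; last first.
  by move=> d Kd; rewrite /G ifF //; apply/negbTE; lia.
rewrite [LHS](big_cat_nat (n := n.+1)) //=.
rewrite [X in _ + X]big_nat_cond [X in _ + X]big1 ?addr0; last first.
  by move=> d /andP[/andP[d1 _] _]; rewrite /G ifF //; apply/negbTE; lia.
rewrite big_mkcond [RHS]big_mkcond; apply: eq_big_nat => d /andP[_ dn].
by rewrite /G; case: ifP => // _; rewrite ifT //; lia.
Qed.

Lemma sum_le_div K n k (F : nat -> R) : (0 < k)%N -> (n <= K)%N ->
  \sum_(1 <= j < K.+1 | (k * j <= n)%N) F j = \sum_(1 <= j < (n %/ k).+1) F j.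
Proof.
move=> k0 nK; rewrite [RHS](big_nat_widen _ _ K.+1); last first.
  by rewrite ltnS (leq_trans (leq_div _ _)).
by apply: eq_bigl => j; rewrite /= ltnS leq_divRL // mulnC.
Qed.

Lemma sum_mu_indicator K n (F : nat -> R) : (0 < n <= K)%N ->
  \sum_(1 <= m < n.+1) \sum_(1 <= k < K.+1 | (k %| m)%N) mu R k * F m = F 1%N.
Proof.
move=> /andP[n0 nK]; rewrite (eq_big_nat _ _ (F2 := fun m => (m == 1%N)%:R * F m)).
  rewrite big_nat_recl //= mul1r big_nat_cond big1 ?addr0 // => m /andP[/andP[m1 _] _].
  by rewrite (_ : (m.+1 == 1%N) = false) ?mul0r //; lia.
by move=> m /andP[m0 mn]; rewrite -mulr_suml sum_mu //; lia.
Qed.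

Lemma sum_mu_div K n : (0 < n <= K)%N ->
  \sum_(1 <= k < K.+1) mu R k * (n %/ k)%:R = 1.
Proof.
move=> n0K; have /andP[n0 nK] := n0K.
apply: (etrans _ (@sum_mu_indicator K n (fun=> 1) n0K)).
rewrite -(@sum_over_divisors K (fun k _ => mu R k * 1) n nK); apply: eq_big_nat => k /andP[k0 kK].
by rewrite sum_le_div // sumr_const_nat subn1 mulr1 mulr_natr.
Qed.

Lemma sum_mu_harm K n : (0 < n <= K)%N ->
  \sum_(1 <= k < K.+1) mu R k / k%:R * harm (n %/ k) = 1.
Proof.
move=> n0K; have /andP[n0 nK] := n0K.
rewrite -[RHS]invr1 -[RHS](@sum_mu_indicator K n (fun m => m%:R^-1) n0K).
rewrite -(@sum_over_divisors K (fun k m => mu R k / m%:R) n nK); apply: eq_big_nat => k /andP[k0 kK].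
rewrite sum_le_div // /harm mulr_sumr; apply: eq_big_nat => j /andP[j0 _].
by rewrite natrM invfM mulrA.
Qed.

(** Multiply by n and replace n / k by its integer part: this leaves 1 plus the fractional parts,
    and k = 1 has none, so at most n - 1 terms remain. *)
Lemma sum_mu_inv K n : (0 < n <= K)%N ->
  `|\sum_(1 <= k < n.+1) mu R k / k%:R| <= 1.
Proof.
move=> n0K; have /andP[n0 nK] := n0K.
have n0' : 0 < n%:R :> R by rewrite ltr0n.
rewrite -(ler_pM2l n0') mulr1 -{1}[n%:R]gtr0_norm // -normrM.
have E : n%:R * \sum_(1 <= k < n.+1) mu R k / k%:R =
  1 + \sum_(1 <= k < n.+1) mu R k * (n%:R / k%:R - (n %/ k)%:R).
  have -> : \sum_(1 <= k < n.+1) mu R k * (n%:R / k%:R - (n %/ k)%:R) =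
     \sum_(1 <= k < n.+1) mu R k * (n%:R / k%:R) - 1.
    transitivity (\sum_(1 <= k < n.+1) mu R k * (n%:R / k%:R) - \sum_(1 <= k < n.+1) mu R k * (n %/ k)%:R).
      by rewrite -sumrB; apply: eq_bigr => k _; rewrite mulrBr.
    congr (_ - _); have := @sum_mu_div K n n0K; rewrite (big_cat_nat (n := n.+1)) //= => S1.
    apply: (etrans _ S1).
    rewrite [X in _ = _ + X]big_nat_cond [X in _ = _ + X]big1 ?addr0 //.
    by move=> k /andP[/andP[k1 _] _]; rewrite divn_small // mulr0.
  by rewrite subrKC mulr_sumr; apply: eq_bigr => k _; ring.
rewrite E big_nat_recl //= mu1 divn1 divr1 subrr mulr0 add0r.
apply: (le_trans (ler_normD _ _)); rewrite normr1.
rewrite [leRHS](_ : n%:R = 1 + (n.-1)%:R); last by rewrite addrC natr1 prednK.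
rewrite lerD2l; apply: (le_trans (ler_norm_sum _ _ _)).
rewrite [leRHS](_ : _ = \sum_(1 <= i < n) (1 : R)); last by rewrite sumr_const_nat subn1.
apply: ler_sum_nat => k /andP[k1 kn].
rewrite normrM -[leRHS]mulr1; apply: ler_pM; rewrite ?mu_le1 //.
have k0 : 0 < k.+1%:R :> R by rewrite ltr0n.
have -> : n%:R / k.+1%:R - (n %/ k.+1)%:R = (n %% k.+1)%:R / k.+1%:R :> R.
  by rewrite {1}(divn_eq n k.+1) natrD natrM; field; rewrite lt0r_neq0.
by rewrite ger0_norm ?divr_ge0 // ler_pdivrMr // mul1r ler_nat ltnW // ltn_mod.
Qed.

Definition mu_log K x := \sum_(1 <= k < K.+1) mu R k / k%:R * lnp (x / k%:R).

(* Comparing ln (x / k) with the harmonic sum up to x / k, whose sum against mu (k) / k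
   is 1. *)
Lemma mu_log_bound K x : 1 <= x -> x <= K%:R -> `|mu_log K x - 1| <= 2.
Proof.
move=> x1 xK; have x0 : 0 <= x by lra. have xp : 0 < x by lra.
set n := Num.truncn x.
have /andP[nx xn] := truncn_itv x0; rewrite -/n in nx xn.
have n0 : (0 < n)%N by rewrite truncn_gt0.
have nK : (n <= K)%N by rewrite -(ler_nat R); lra.
have n0K : (0 < n <= K)%N by rewrite n0.
have np : 0 < n%:R :> R by rewrite ltr0n.
pose g := harm n - ln x.
have g0 : 0 <= g.
  rewrite subr_ge0; apply: le_trans (ln_le_harm n).
  by rewrite ler_ln ?posrE ?ltr0n // ltW.
have g1 : g <= 1.
  have : ln n%:R <= ln x by rewrite ler_ln ?posrE.
  by have := harm_le n; rewrite /g; lra.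
(* [r k] measures how far harm (n / k) - ln (x / k) is from its value g at k = 1. It is at most k /
   x, so against mu k / k it contributes at most n / x <= 1; the term with g contributes at most 1
   by [sum_mu_inv]. *)
pose r k := harm (n %/ k) - g - ln (x / k%:R).
have rb k : (0 < k <= n)%N -> `|r k| <= k%:R / x.
  move=> /andP[k0 kn]; have kp : 0 < k%:R :> R by rewrite ltr0n.
  set a := (n %/ k)%N.
  have a0 : (0 < a)%N by rewrite divn_gt0.
  have an : (a <= n)%N by rewrite leq_div.
  have ap : 0 < a%:R :> R by rewrite ltr0n.
  have xa : x / k%:R < a.+1%:R.
    rewrite ltr_pdivrMr //; apply: lt_le_trans xn _; rewrite -natrM ler_nat.
    by rewrite -ltn_divLR // ltnS.
  have E : r k = ln k%:R - (harm n - harm a).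
    by rewrite /r /g -/a ln_div ?posrE //; ring.
  have l1 : ln (k%:R * a.+1%:R / x) <= k%:R / x.
    have e : k%:R * a.+1%:R / x = 1 + (k%:R * a.+1%:R - x) / x by field; rewrite lt0r_neq0.
    rewrite e; apply: (le_trans (le_ln1Dx _)).
      apply: lt_le_trans (ltrN10 _) _; rewrite divr_ge0 ?(ltW xp) // subr_ge0.
      by move: xa; rewrite ltr_pdivrMr // => /ltW; rewrite mulrC.
    rewrite ler_pM2r ?invr_gt0 // lerBlDr -natr1 mulrDr mulr1 addrC lerD2l -natrM.
    by apply: le_trans nx; rewrite ler_nat mulnC leq_trunc_div.
  rewrite E ler_norml; apply/andP; split.
    have Hu : harm n - harm a <= a.+1%:R^-1 + ln k%:R.
      have [an'|an'] := leqP n a.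
        have -> : n = a by apply/eqP; rewrite eqn_leq an' an.
        by rewrite subrr addr_ge0 ?invr_ge0 ?ln_ge0 // ler1n.
      have := @harm_upper a.+1 n; rewrite an' => /(_ isT); rewrite harmS.
      have : ln n%:R - ln a.+1%:R <= ln k%:R :> R.
        rewrite -ln_div ?posrE ?ltr0n // ler_ln ?posrE ?divr_gt0 ?ltr0n //.
        rewrite ler_pdivrMr ?ltr0n //; move: xa; rewrite ltr_pdivrMr // => xa.
        by apply: (le_trans nx); rewrite mulrC ltW.
      by move: (a.+1%:R^-1) (ln a.+1%:R) => u v; lra.
    have : a.+1%:R^-1 <= k%:R / x.
      by rewrite -[leRHS]invrK lef_pV2 ?posrE ?invr_gt0 ?divr_gt0 ?ltr0n // invf_div ltW.
    by move: Hu; move: (a.+1%:R^-1) => u; lra.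
  have Hl := harm_lower an.
  have : ln (k%:R * a.+1%:R / x) = ln k%:R + ln a.+1%:R - ln x.
    by rewrite ln_div ?posrE ?mulr_gt0 ?ltr0n // lnM ?posrE ?ltr0n.
  have : ln x <= ln n.+1%:R by rewrite ler_ln ?posrE ?ltr0n // ltW.
  move: l1 Hl; move: (ln (_ / x)) (ln a.+1%:R) (ln n.+1%:R) => u v w; lra.
have cutE (F : nat -> R) : (forall k, (n < k)%N -> F k = 0) ->
   \sum_(1 <= k < K.+1) F k = \sum_(1 <= k < n.+1) F k.
  move=> F0; rewrite (big_cat_nat (n := n.+1)) //= [X in _ + X]big_nat_cond [X in _ + X]big1 ?addr0 //.
  by move=> k /andP[/andP[k1 _] _]; exact: F0.
have -> : mu_log K x - 1 = - (g * (\sum_(1 <= k < n.+1) mu R k / k%:R) +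
    \sum_(1 <= k < n.+1) mu R k / k%:R * r k).
  apply/eqP; rewrite subr_eq addrC -subr_eq opprK eq_sym; apply/eqP.
  transitivity (\sum_(1 <= k < n.+1) mu R k / k%:R * harm (n %/ k)).
    symmetry; apply: (etrans _ (@sum_mu_harm K n n0K)); symmetry; apply: cutE => k nk.
    by rewrite divn_small // harm0 mulr0.
  rewrite /mu_log cutE; last first.
    move=> k nk; rewrite lnp_lt1 ?mulr0 // ltr_pdivrMr ?mul1r ?ltr0n; last by apply: leq_ltn_trans nk.
    by apply: lt_le_trans xn _; rewrite ler_nat.
  rewrite mulr_sumr -!big_split /=; apply: eq_big_nat => k /andP[k0 kn].
  have kp : 0 < k%:R :> R by rewrite ltr0n.
  rewrite lnp_ge1; last first.
    by rewrite ler_pdivlMr // mul1r; apply: le_trans nx; rewrite ler_nat.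
  by rewrite /r; ring.
rewrite normrN; apply: (le_trans (ler_normD _ _)).
have -> : 2 = 1 + 1 :> R by ring.
apply: lerD.
  by rewrite normrM ger0_norm //; have := sum_mu_inv n0K; have := normr_ge0 (\sum_(1 <= k < n.+1) mu R k / k%:R); nra.
apply: (le_trans (ler_norm_sum _ _ _)).
apply: (@le_trans _ _ (\sum_(1 <= k < n.+1) x^-1)).
  apply: ler_sum_nat => k /andP[k0 kn]; have kp : 0 < k%:R :> R by rewrite ltr0n.
  rewrite !normrM normfV (gtr0_norm kp).
  have := rb k; rewrite k0 => /(_ kn) H.
  apply: (@le_trans _ _ (1 / k%:R * (k%:R / x))); last by rewrite div1r mulKf // lt0r_neq0.
  apply: ler_pM; [exact: divr_ge0|exact: normr_ge0| |exact: H].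
  by rewrite ler_pM2r ?invr_gt0 // mu_le1.
by rewrite sumr_const_nat subn1 -[leLHS]mulr_natr ler_pdivrMl // mulr1.
Qed.
End HarmonicSums.

(** * Quadratic forms attached to divisor sums; the sieve of Barban and Vehov *)

Section QuadraticForms.
Variable R : realType.
Implicit Types (d e k m n p j r : nat) (x : R).

Variable K : nat.

(** The mean value over n of the square of the divisor sum of [l]: the integers divisible by both d
    and e have density 1 / lcm. *)
Definition lcm_form (l : nat -> R) :=
  \sum_(1 <= d < K.+1) \sum_(1 <= e < K.+1) l d * l e / (lcmn d e)%:R.

Lemma gcd_totient d e : (0 < d <= K)%N -> (0 < e)%N ->
  (gcdn d e)%:R = \sum_(1 <= m < K.+1 | (m %| d)%N && (m %| e)%N) (totient m)%:R :> R.
Proof.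
move=> /andP[d0 dK] e0; set g := gcdn d e.
have g0 : (0 < g)%N by rewrite gcdn_gt0 d0.
have gd : (g <= d)%N by rewrite dvdn_leq // dvdn_gcdl.
have E : g = (\sum_(1 <= m < K.+1 | m %| g) totient m)%N.
  rewrite -{1}(sum_totient_dvd g) -(big_mkord (fun m => m %| g)%N totient) big_ltn_cond // dvd0n.
  rewrite (gtn_eqF g0) [RHS](big_cat_nat (n := g.+1)) //=; last by lia.
  rewrite [X in (_ = _ + X)%N]big_nat_cond [X in (_ = _ + X)%N]big1 ?addn0 //.
  by move=> m /andP[/andP[gm _] /dvdn_leq]; lia.
rewrite {1}E natr_sum; apply: eq_bigl => m; exact: dvdn_gcd.
Qed.

(** Selberg's diagonalisation: 1 / lcm = gcd / (d e), and the gcd is the sum of phi(m) over its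
    divisors m. *)
Lemma lcm_form_diag (l : nat -> R) : lcm_form l =
  \sum_(1 <= m < K.+1) (totient m)%:R * (\sum_(1 <= d < K.+1 | (m %| d)%N) l d / d%:R) ^+ 2.
Proof.
transitivity (\sum_(1 <= d < K.+1) \sum_(1 <= e < K.+1) \sum_(1 <= m < K.+1)
   (totient m)%:R * ((if (m %| d)%N then l d / d%:R else 0) * (if (m %| e)%N then l e / e%:R else 0))).
  apply: eq_big_nat => d /andP[d0 dK]; apply: eq_big_nat => e /andP[e0 eK].
  have d0' : d%:R != 0 :> R by rewrite pnatr_eq0 -lt0n.
  have e0' : e%:R != 0 :> R by rewrite pnatr_eq0 -lt0n.
  have l0 : (lcmn d e)%:R != 0 :> R by rewrite pnatr_eq0 -lt0n lcmn_gt0 d0.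
  have -> : l d * l e / (lcmn d e)%:R = (gcdn d e)%:R * (l d / d%:R * (l e / e%:R)).
    have h : (lcmn d e)%:R * (gcdn d e)%:R = d%:R * e%:R :> R by rewrite -!natrM muln_lcm_gcd.
    apply: (mulIf l0); rewrite divfK //.
    rewrite [RHS](_ : _ = l d * l e * ((lcmn d e)%:R * (gcdn d e)%:R) / (d%:R * e%:R)); last by field; rewrite ?d0' ?e0'.
    by rewrite h mulfK // mulf_neq0.
  rewrite (@gcd_totient d e) ?d0 // mulr_suml big_mkcond /=; apply: eq_bigr => m _.
  by case: (m %| d)%N; case: (m %| e)%N => /=; rewrite ?(mulr0, mul0r).
transitivity (\sum_(1 <= d < K.+1) \sum_(1 <= m < K.+1) \sum_(1 <= e < K.+1)
   (totient m)%:R * ((if (m %| d)%N then l d / d%:R else 0) * (if (m %| e)%N then l e / e%:R else 0))).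
  by apply: eq_bigr => d _; exact: exchange_big.
rewrite exchange_big /=; apply: eq_bigr => m _.
rewrite [in RHS]big_mkcond /= expr2 mulr_suml mulr_sumr; apply: eq_bigr => d _.
by rewrite mulr_sumr mulr_sumr; apply: eq_bigr => e _.
Qed.

Lemma lcm_form_ge0 (l : nat -> R) : 0 <= lcm_form l.
Proof. by rewrite lcm_form_diag; apply: sumr_ge0 => m _; rewrite mulr_ge0 // sqr_ge0. Qed.

Lemma sqf_dvd m n : (m %| n)%N -> sqf n -> sqf m.
Proof.
move=> mn /sqfP[n0 H]; apply/sqfP; split; first exact: dvdn_gt0 mn.
by move=> p pp; apply: contra (H p pp) => /dvdn_trans; apply.
Qed.

Lemma prod_sqr_ge n : (1 <= n)%N -> 1 / 2 <= \prod_(2 <= j < n.+1) (1 - j%:R ^- 2) :> R.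
Proof.
case: n => // n _.
have -> : \prod_(2 <= j < n.+2) (1 - j%:R ^- 2) = (n.+2)%:R / (2 * n.+1%:R) :> R.
  elim: n => [|n IH]; first by rewrite big_geq // mulr1 divff.
  rewrite big_nat_recr //= IH -[n.+3%:R]natr1 -[n.+2%:R]natr1 -[n.+1%:R]natr1; field.
  have n0 : 0 <= n%:R :> R by [].
  by rewrite !lt0r_neq0 //; lra.
have n0 : 0 < n.+1%:R :> R by rewrite ltr0n.
by rewrite ler_pdivlMr ?mulr_gt0 // -[n.+2%:R]natr1; lra.
Qed.

(** For squarefree m the ratio is the product over p | m of (1 + 1/p) / (1 - 1/p^2). The numerators
    multiply out to the sum of 1/d, and the denominators are at least the product over all integers
    from 2, hence at least 1/2. *)
Lemma totient_ratio_le m : sqf m -> (m <= K)%N ->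
  m%:R / (totient m)%:R <= 2 * \sum_(1 <= d < K.+1 | (d %| m)%N) d%:R^-1 :> R.
Proof.
move=> sm mK; have m0 := sqf_gt0 sm.
pose w m : R := \prod_(2 <= j < K.+1 | prime j && (j %| m)%N) (1 - j%:R ^- 2).
have f0 j : (2 <= j)%N -> 0 <= 1 - j%:R ^- 2 :> R.
  by move=> j2; rewrite subr_ge0 invf_le1 ?exprn_gt0 ?ltr0n ?(ltn_trans _ j2) // exprn_ege1 // ler1n (ltn_trans _ j2).
have w2 : 1 / 2 <= w m.
  have K1 : (1 <= K)%N by lia.
  apply: (le_trans (prod_sqr_ge K1)); rewrite /w [leRHS]big_mkcond /=.
  rewrite big_nat_cond [leRHS]big_nat_cond; apply: ler_prod => j /andP[/andP[j2 _] _].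
  rewrite f0 //=; case: ifP => // _; by rewrite gerBl invr_ge0 exprn_ge0.
suff : m%:R / (totient m)%:R * w m <= \sum_(1 <= d < K.+1 | (d %| m)%N) d%:R^-1.
  have : 0 <= m%:R / (totient m)%:R :> R by rewrite divr_ge0.
  by move: (m%:R / _) (\sum_(_ <= _ < _ | _) _) => u v; nra.
elim/sqf_ind: m / sm mK {m0 w2} => [|p m pp pm sm IH] mK.
  have -> : w 1%N = 1.
    rewrite /w big_nat_cond big1 // => j /andP[/andP[j2 _] /andP[_]].
    by rewrite dvdn1 => /eqP j1; move: j2; rewrite j1.
  rewrite big_mkcond big_nat_recl //.
  have t1 : totient 1 = 1%N by [].
  rewrite dvd1n t1 divr1 mulr1 invr1 lerDl; apply: sumr_ge0 => d _; case: ifP => // _; by rewrite invr_ge0.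
have p0 : 0 < p%:R :> R by rewrite ltr0n prime_gt0.
have p1 : 1 < p%:R :> R by rewrite ltr1n prime_gt1.
have m0 := sqf_gt0 sm; have tm := totient_gt0R R m0.
have mK' : (m <= K)%N by apply: leq_trans mK; rewrite leq_pmull // prime_gt0.
have pK : (p <= K)%N by apply: leq_trans mK; rewrite leq_pmulr.
have wp : w (p * m)%N = (1 - p%:R ^- 2) * w m.
  rewrite /w big_mkcond (bigD1_seq p) ?iota_uniq ?mem_index_iota ?prime_gt1 ?ltnS //=.
  rewrite pp dvdn_mulr // big_mkcond [in RHS]big_mkcond /=; congr (_ * _).
  apply: eq_bigr => j _; have [->|jp] := eqVneq j p; first by rewrite (negbTE pm) andbF.
  case pj : (prime j) => //=; by rewrite Euclid_dvdM // dvdn_prime2 // (negbTE jp).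
rewrite totient_sqf // natrM wp sum_divisors_split //.
have -> : \sum_(1 <= d < K.+1 | (d %| m)%N && ~~ (p %| d)%N) d%:R^-1 = \sum_(1 <= d < K.+1 | (d %| m)%N) d%:R^-1 :> R.
  apply: eq_bigl => d; case dm : (d %| m)%N => //=; apply: contra pm => /dvdn_trans; exact.
have -> : \sum_(1 <= d < K.+1 | (d %| m)%N) (p * d)%:R^-1 = p%:R^-1 * \sum_(1 <= d < K.+1 | (d %| m)%N) d%:R^-1 :> R.
  by rewrite mulr_sumr; apply: eq_bigr => d _; rewrite natrM invfM.
have -> : p%:R * m%:R / ((p%:R - 1) * (totient m)%:R) * ((1 - p%:R ^- 2) * w m) =
   (1 + p%:R^-1) * (m%:R / (totient m)%:R * w m) by field; rewrite !lt0r_neq0 //; lra.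
have := IH mK'; have : 0 < p%:R^-1 :> R by rewrite invr_gt0.
by move: (p%:R^-1) (_ * w m) (\sum_(_ <= _ < _ | _) _) => u v t; nra.
Qed.

Lemma sum_inv_totient Z : (Z <= K)%N ->
  \sum_(1 <= m < Z.+1) (sqf m)%:R / (totient m)%:R <= 4 * harm R Z.
Proof.
move=> ZK.
apply: (@le_trans _ _ (\sum_(1 <= m < Z.+1) \sum_(1 <= d < K.+1 | (d %| m)%N) 2 * (d%:R^-1 * m%:R^-1))).
  apply: ler_sum_nat => m /andP[m0 mZ].
  have m0' : 0 < m%:R :> R by rewrite ltr0n.
  have mK : (m <= K)%N by lia.
  have [sm|_] := boolP (sqf m); last first.
    by rewrite mul0r; apply: sumr_ge0 => d _; rewrite !mulr_ge0 ?invr_ge0.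
  have tm := totient_gt0R R m0.
  have -> : true%:R / (totient m)%:R = m%:R / (totient m)%:R * m%:R^-1 :> R by rewrite mulrAC mulfV ?lt0r_neq0.
  rewrite -mulr_sumr -mulr_suml mulrA ler_wpM2r ?invr_ge0 //; exact: totient_ratio_le.
rewrite -(@sum_over_divisors R K (fun d m => 2 * (d%:R^-1 * m%:R^-1)) Z ZK).
apply: (@le_trans _ _ (\sum_(1 <= d < K.+1) 2 * (d%:R ^- 2) * harm R Z)); last first.
  rewrite -mulr_suml -mulr_sumr; have := sum_inv_sqr R K; have := harm_ge0 R Z.
  by move: (harm R Z) (\sum_(_ <= _ < _) _) => u v; nra.
apply: ler_sum_nat => d /andP[d0 dK]; rewrite sum_le_div //.
apply: (@le_trans _ _ (\sum_(1 <= j < (Z %/ d).+1) 2 * d%:R ^- 2 * j%:R^-1)).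
  apply: ler_sum => j _; by rewrite natrM expr2 !invfM !mulrA lexx.
rewrite -mulr_sumr ler_wpM2l ?mulr_ge0 ?invr_ge0 ?exprn_ge0 //.
rewrite /harm [leRHS](big_cat_nat (n := (Z %/ d).+1)) //=; last by rewrite ltnS leq_div.
by rewrite lerDl; apply: sumr_ge0 => j _; rewrite invr_ge0.
Qed.

Section BarbanVehov.
Variables z1 z2 : nat.
Hypotheses (z10 : (0 < z1)%N) (z12 : (z1 < z2)%N) (z2K : (z2 <= K)%N).

Let rho : R := z2%:R / z1%:R.
Let z1p : 0 < z1%:R :> R. Proof. by rewrite ltr0n. Qed.
Let z2p : 0 < z2%:R :> R. Proof. by rewrite ltr0n; lia. Qed.
Let rho1 : 1 < rho. Proof. by rewrite ltr_pdivlMr // mul1r ltr_nat. Qed.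
Let rho0 : 0 < rho. Proof. exact: lt_trans rho1. Qed.
Let lrho : 0 < ln rho. Proof. by rewrite ln_gt0. Qed.

(** As a function of d, [bv_phi (z2 / d)] is ln (z2 / z1) for d <= z1 and falls logarithmically to 0
    at d = z2. *)
Definition bv_phi x : R := lnp x - lnp (x / (z2%:R / z1%:R)).

(* mu (d) truncated smoothly between z1 and z2. *)
Definition bv_weight d : R := mu R d * bv_phi (z2%:R / d%:R) / ln (z2%:R / z1%:R).

Lemma bv_phi0 x : x < 1 -> bv_phi x = 0.
Proof.
move=> x1; rewrite /bv_phi !lnp_lt1 ?subrr // ltr_pdivrMr // mul1r.
exact: lt_trans x1 rho1.
Qed.

Lemma bv_phi_bounds x : 0 <= bv_phi x <= ln rho.
Proof.
have [x1|x1] := ltP x 1; first by rewrite bv_phi0 // lexx ltW.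
have x0 : 0 < x by lra.
rewrite /bv_phi (lnp_ge1 x1) -/rho; have [xr|xr] := ltP (x / rho) 1.
  by rewrite (lnp_lt1 xr) subr0 ln_ge0 //= ler_ln ?posrE // ltW // -[rho]mul1r -ltr_pdivrMr.
by rewrite (lnp_ge1 xr) ln_div ?posrE // opprB addrCA subrr addr0 lexx ltW.
Qed.

Lemma bv_weight_le1 d : `|bv_weight d| <= 1.
Proof.
have /andP[p0 p1] := bv_phi_bounds (z2%:R / d%:R).
rewrite /bv_weight -/rho -mulrA normrM -[leRHS]mulr1; apply: ler_pM; rewrite ?mu_le1 //.
by rewrite ger0_norm ?divr_ge0 ?(ltW lrho) // ler_pdivrMr // mul1r.
Qed.

Lemma bv_weight_small d : (0 < d <= z1)%N -> bv_weight d = mu R d.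
Proof.
move=> /andP[d0 dz]; have dp : 0 < d%:R :> R by rewrite ltr0n.
have dz' : d%:R <= z1%:R :> R by rewrite ler_nat.
have d2 : d%:R <= z2%:R :> R by rewrite ler_nat; lia.
rewrite /bv_weight /bv_phi -/rho.
have -> : z2%:R / d%:R / rho = z1%:R / d%:R.
  by rewrite /rho; field; rewrite !lt0r_neq0.
rewrite !lnp_ge1 ?ler_pdivlMr ?mul1r // -ln_div ?posrE ?divr_gt0 //.
have -> : z2%:R / d%:R / (z1%:R / d%:R) = rho by rewrite /rho; field; rewrite !lt0r_neq0.
by rewrite mulfK // lt0r_neq0.
Qed.

Lemma bv_weight_large d : (z2 < d)%N -> bv_weight d = 0.
Proof.
move=> zd; rewrite /bv_weight bv_phi0 ?mulr0 ?mul0r // ltr_pdivrMr ?mul1r ?ltr_nat //.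
by rewrite ltr0n; lia.
Qed.

Definition bv_sum n := \sum_(1 <= d < K.+1 | (d %| n)%N) bv_weight d.

Lemma bv_sum_small n : (0 < n <= z1)%N -> bv_sum n = (n == 1%N)%:R.
Proof.
move=> /andP[n0 nz]; rewrite -(@sum_mu R K n) //; last by lia.
rewrite /bv_sum big_mkcond [RHS]big_mkcond; apply: eq_big_nat => d /andP[d0 _].
by case: ifP => // dn; rewrite bv_weight_small // d0 (leq_trans (dvdn_leq n0 dn)).
Qed.

(** After diagonalisation the inner sum for m is mu m / (m ln rho) times a sum coprime to m, at most
    4 m / phi(m): in the difference of the two logarithmic sums the main terms 1 cancel and the
    errors are at most 2 each. What remains is the sum of 1 / phi(m) up to z2, and 64 = 4^2 * 4. *)
Lemma bv_form_bound : lcm_form bv_weight <= 64 * harm R z2 / ln rho ^+ 2.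
Proof.
rewrite lcm_form_diag.
have HB x : x <= K%:R -> `|@cop_sum R K bv_phi 1 x| <= 4.
  move=> xK.
  have -> : @cop_sum R K bv_phi 1 x = mu_log K x - mu_log K (x / rho).
    rewrite /cop_sum /mu_log -sumrB; under eq_bigl do rewrite coprime1n.
    by apply: eq_bigr => k _; rewrite /bv_phi -/rho mulrBr; congr (_ - _ * lnp _); ring.
  have A0 (u : R) : u < 1 -> mu_log K u = 0.
    move=> u1; rewrite /mu_log big_nat_cond big1 // => k /andP[/andP[k1 _] _].
    rewrite lnp_lt1 ?mulr0 // ltr_pdivrMr ?ltr0n // mul1r.
    by apply: (lt_le_trans u1); rewrite ler1n.
  have [x1|x1] := ltP x 1.
    rewrite !A0 ?subrr ?normr0 // ltr_pdivrMr // mul1r; exact: lt_trans x1 rho1.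
  have := mu_log_bound x1 xK; rewrite ler_norml => /andP[a1 a2].
  have [xr|xr] := ltP (x / rho) 1.
    by rewrite (A0 _ xr) subr0 ler_norml; apply/andP; split; lra.
  have xrK : x / rho <= K%:R.
    apply: le_trans xK; rewrite ler_pdivrMr // ler_peMr //; first lra.
    exact: ltW.
  have := mu_log_bound xr xrK; rewrite ler_norml => /andP[b1 b2].
  by rewrite ler_norml; apply/andP; split; lra.
apply: (@le_trans _ _ (\sum_(1 <= m < K.+1 | (m <= z2)%N) 16 / ln rho ^+ 2 * ((sqf m)%:R / (totient m)%:R))); last first.
  rewrite -mulr_sumr [leRHS](_ : _ = 16 / ln rho ^+ 2 * (4 * harm R z2)); last by ring.
  rewrite ler_wpM2l ?divr_ge0 ?exprn_ge0 ?(ltW lrho) //.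
  apply: le_trans (sum_inv_totient z2K).
  by rewrite [leRHS](@big_nat_widen _ _ _ 1 z2.+1 K.+1) // ltnS.
rewrite [leRHS]big_mkcond /=; apply: ler_sum_nat => m /andP[m0 mK].
have m0' : 0 < m%:R :> R by rewrite ltr0n.
have tm := totient_gt0R R m0.
have [sm|sm] := boolP (sqf m); last first.
  rewrite big1 ?expr0n ?mulr0 /=; last first.
    move=> d md; rewrite /bv_weight mu_nsqf ?mul0r //.
    by apply: contra sm; exact: sqf_dvd.
  by case: ifP => // _; rewrite mul0r mulr0.
rewrite sum_multiples_support //; last first.
  by move=> d Kd; rewrite bv_weight_large ?mul0r //; lia.
have -> : \sum_(1 <= k < K.+1) bv_weight (m * k) / (m * k)%:R =
    mu R m / m%:R / ln rho * @cop_sum R K bv_phi m (z2%:R / m%:R).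
  rewrite /cop_sum [in RHS]big_mkcond mulr_sumr; apply: eq_big_nat => k /andP[k0 _].
  have k0' : 0 < k%:R :> R by rewrite ltr0n.
  rewrite /bv_weight muM_sqf //; case: ifP => _; last by rewrite !mul0r mulr0.
  rewrite !natrM -/rho; have -> : z2%:R / (m%:R * k%:R) = z2%:R / m%:R / k%:R :> R by rewrite invfM mulrA.
  by field; rewrite !lt0r_neq0.
have [mz|mz] := leqP m z2; last first.
  rewrite /cop_sum big_nat_cond big1 ?mulr0 ?expr0n ?mulr0 //= => k /andP[/andP[k1 _] _].
  rewrite bv_phi0 ?mulr0 // ltr_pdivrMr ?ltr0n // mul1r ltr_pdivrMr //.
  by rewrite -natrM ltr_nat; apply: (leq_trans mz); rewrite leq_pmull.
have zmK : z2%:R / m%:R <= K%:R :> R.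
  rewrite ler_pdivrMr // -natrM ler_nat; apply: (leq_trans z2K); exact: leq_pmulr.
have := @cop_sum_bound R K bv_phi 4 bv_phi0 m (z2%:R / m%:R) HB sm zmK.
set C := cop_sum _ _ _ _ => HC.
rewrite exprMn !exprMn mu_sqr sm mul1r.
have C2 : C ^+ 2 <= (4 * (m%:R / (totient m)%:R)) ^+ 2.
  by rewrite -(real_normK (num_real C)) lerXn2r ?nnegrE ?mulr_ge0 ?divr_ge0.
have -> : 16 / ln rho ^+ 2 * (1 / (totient m)%:R) =
   (totient m)%:R * (m%:R^-1 ^+ 2 * (ln rho)^-1 ^+ 2 * (4 * (m%:R / (totient m)%:R)) ^+ 2).
  by field; rewrite !lt0r_neq0.
by rewrite ler_wpM2l ?(ltW tm) // ler_wpM2l // mulr_ge0 // sqr_ge0.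
Qed.
End BarbanVehov.
End QuadraticForms.

(** * Selberg's weights *)

Section SelbergWeights.
Variable R : realType.
Implicit Types (d e k m n p j r : nat).

Lemma sqf_square_quotient n : (0 < n)%N -> exists2 k, (0 < k <= n)%N & (k ^ 2 %| n)%N && sqf (n %/ k ^ 2).
Proof.
move=> n0; have ex : exists k, (k ^ 2 %| n)%N by exists 1%N.
have ub k : (k ^ 2 %| n)%N -> (k <= n)%N by move=> /(dvdn_leq n0); nia.
case: (ex_maxnP ex ub) => k kn kmax; have k0 : (0 < k)%N.
  by rewrite lt0n; apply: contraL kn => /eqP ->; rewrite dvd0n -lt0n.
have k2 : (0 < k ^ 2)%N by rewrite expn_gt0 k0.
exists k; first by rewrite k0 ub.
rewrite kn /=; apply/sqfP; split; first by rewrite divn_gt0 // dvdn_leq.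
move=> p pp; apply/negP => H.
have /kmax : ((p * k) ^ 2 %| n)%N by rewrite expnMn -(divnK kn) dvdn_mul.
by rewrite leqNgt ltn_Pmull // prime_gt1.
Qed.

Definition sqf_harm n : R := \sum_(1 <= r < n.+1) (sqf r)%:R / r%:R.

Lemma sqf_harm_mono m n : (m <= n)%N -> sqf_harm m <= sqf_harm n.
Proof.
move=> mn; rewrite /sqf_harm [leRHS](big_cat_nat (n := m.+1)) //= lerDl.
by apply: sumr_ge0 => r _; rewrite divr_ge0.
Qed.

Lemma sqf_harm_ge1 n : (0 < n)%N -> 1 <= sqf_harm n.
Proof.
move=> n0; apply: le_trans (sqf_harm_mono n0).
by rewrite /sqf_harm big_nat1 divr1.
Qed.

(** Every m is k^2 times a squarefree number, and the sum of 1 / k^2 is at most 2. *)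
Lemma harm_le_sqf_harm n : harm R n <= 2 * sqf_harm n.
Proof.
apply: (@le_trans _ _ (\sum_(1 <= k < n.+1) k%:R ^- 2 * sqf_harm n)); last first.
  rewrite -mulr_suml ler_wpM2r ?sum_inv_sqr //.
  by apply: sumr_ge0 => r _; rewrite divr_ge0.
apply: (@le_trans _ _ (\sum_(1 <= m < n.+1) \sum_(1 <= k < n.+1 | (k ^ 2 %| m)%N) (sqf (m %/ k ^ 2))%:R / m%:R)).
  apply: ler_sum_nat => m /andP[m0 mn].
  have [k /andP[k0 km] /andP[kd ks]] := sqf_square_quotient m0.
  rewrite big_mkcond (bigD1_seq k) ?iota_uniq ?mem_index_iota ?k0 ?(leq_ltn_trans km) //=.
  by rewrite kd ks mul1r lerDl; apply: sumr_ge0 => j _; case: ifP => // _; rewrite divr_ge0.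
rewrite (exchange_big_dep_nat xpredT) //=; apply: ler_sum_nat => k /andP[k0 kn].
have k2 : (0 < k ^ 2)%N by rewrite expn_gt0 k0.
rewrite (@sum_multiples R n (k ^ 2) (fun m => (sqf (m %/ k ^ 2))%:R / m%:R)) //.
apply: (@le_trans _ _ (k%:R ^- 2 * sqf_harm (n %/ k ^ 2))).
  rewrite /sqf_harm mulr_sumr; apply: ler_sum => j _.
  by rewrite mulKn // natrM natrX invfM; rewrite mulrCA lexx.
by rewrite ler_wpM2l ?invr_ge0 ?exprn_ge0 // sqf_harm_mono // leq_div.
Qed.

Variables (K y : nat).
Hypotheses (y0 : (0 < y)%N) (yK : (y <= K)%N).

(** Selberg's weights with 1/r in place of the optimal 1 / phi(r). After diagonalisation the terms
    are phi(m) / m^2 <= 1/m over squarefree m, which add up to [sqf_harm y] again. *)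
Definition selberg_weight e : R :=
  mu R e * (e%:R / sqf_harm y * \sum_(1 <= r < y.+1 | (e %| r)%N) (sqf r)%:R / r%:R).

Let S0 : 0 < sqf_harm y. Proof. by rewrite (lt_le_trans ltr01) // sqf_harm_ge1. Qed.

Lemma selberg_weight1 : selberg_weight 1 = 1.
Proof.
rewrite /selberg_weight mu1 !mul1r; under eq_bigl do rewrite dvd1n.
by rewrite mulVf // lt0r_neq0.
Qed.

Lemma selberg_weight_large e : (y < e)%N -> selberg_weight e = 0.
Proof.
move=> ye; rewrite /selberg_weight big_nat_cond big1 ?mulr0 // => r /andP[/andP[r0 ry]].
by move=> /(dvdn_leq r0); lia.
Qed.

Lemma selberg_weight_le1 e : (0 < e)%N -> `|selberg_weight e| <= 1.
Proof.
move=> e0; have e0' : 0 < e%:R :> R by rewrite ltr0n.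
rewrite /selberg_weight normrM -[leRHS]mulr1; apply: ler_pM; rewrite ?mu_le1 //.
have T0 : 0 <= \sum_(1 <= r < y.+1 | (e %| r)%N) (sqf r)%:R / r%:R :> R.
  by apply: sumr_ge0 => r _; rewrite divr_ge0.
rewrite ger0_norm ?mulr_ge0 ?divr_ge0 ?invr_ge0 ?(ltW S0) //.
rewrite mulrAC ler_pdivrMr // mul1r (@sum_multiples R y e (fun r => (sqf r)%:R / r%:R)) //.
apply: le_trans (sqf_harm_mono (leq_div y e)).
rewrite /sqf_harm mulr_sumr; apply: ler_sum => j _.
rewrite natrM invfM mulrCA [e%:R * _]mulrA divff ?lt0r_neq0 // mul1r ler_wpM2r ?invr_ge0 // ler_nat.
have [s|] := boolP (sqf (e * j)); last by [].
by rewrite (@sqf_dvd j _ _ s) // dvdn_mull.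
Qed.

(** Dual Moebius inversion: e = m k and r = m q reduce it to [sum_mu], as mu (m k) = mu m mu k for
    divisors m k of a squarefree r. *)
Lemma sum_mu_between m r : (0 < m)%N -> (m %| r)%N -> sqf r -> (r <= K)%N ->
  \sum_(1 <= e < K.+1 | (m %| e)%N && (e %| r)%N) mu R e = (r == m)%:R * mu R m.
Proof.
move=> m0 /dvdnP[q ->] sr rK; have r0 := sqf_gt0 sr.
have q0 : (0 < q)%N by move: r0; rewrite muln_gt0 => /andP[].
have qK : (q <= K)%N by apply: leq_trans rK; rewrite leq_pmulr.
rewrite big_mkcondr /= (@sum_multiples_support R K m (fun e => if (e %| q * m)%N then mu R e else 0)) //; last first.
  by move=> d Kd; case: ifP => // /(dvdn_leq r0); lia.
transitivity (\sum_(1 <= k < K.+1 | (k %| q)%N) mu R m * mu R k).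
  rewrite [RHS]big_mkcond; apply: eq_big_nat => k /andP[k0 _].
  rewrite [(q * m)%N]mulnC dvdn_pmul2l //; case: ifP => // kq.
  have smk : sqf (m * k) by apply: (sqf_dvd _ sr); rewrite mulnC dvdn_mul.
  rewrite muM_sqf //; last by apply: (sqf_dvd _ smk); exact: dvdn_mulr.
  case: ifP => // /negbT cmk; exfalso; move: cmk; rewrite /coprime => /eqP g1.
  have g0 : (1 < gcdn m k)%N by have := gcdn_gt0 m k; rewrite m0; lia.
  have pp := pdiv_prime g0; move/sqfP: smk => [_ /(_ _ pp)/negP]; apply.
  rewrite expnS expn1 dvdn_mul // (dvdn_trans (pdiv_dvd _)) ?dvdn_gcdl ?dvdn_gcdr //.
rewrite -mulr_sumr sum_mu // mulrC; congr (_%:R * _).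
by rewrite -{2}[m]mul1n eqn_pmul2r.
Qed.

(** By [sum_mu_between] the diagonal variables collapse to mu m / (m S) for m <= y, with S =
    [sqf_harm y]. *)
Lemma selberg_form_bound : lcm_form K selberg_weight <= (sqf_harm y)^-1.
Proof.
have H m : (0 < m)%N -> \sum_(1 <= e < K.+1 | (m %| e)%N) selberg_weight e / e%:R =
    (m <= y)%N%:R * (sqf m)%:R * mu R m / m%:R / sqf_harm y.
  move=> m0.
  transitivity (\sum_(1 <= e < K.+1 | (m %| e)%N) \sum_(1 <= r < y.+1)
      (if (e %| r)%N then mu R e else 0) * ((sqf r)%:R / r%:R / sqf_harm y)).
    rewrite big_nat_cond [RHS]big_nat_cond; apply: eq_bigr => e /andP[/andP[e0 _] _].
    have e0' : e%:R != 0 :> R by rewrite pnatr_eq0 -lt0n.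
    rewrite /selberg_weight big_mkcond /= !mulr_sumr mulr_suml; apply: eq_bigr => r _.
    case: ifP => _; last by rewrite !(mul0r, mulr0).
    by move: (_ / r%:R) => t; field; rewrite e0' lt0r_neq0.
  rewrite exchange_big /=.
  transitivity (\sum_(1 <= r < y.+1) (r == m)%:R * ((sqf m)%:R * mu R m / m%:R / sqf_harm y)).
    apply: eq_big_nat => r /andP[r0 ry]; rewrite -mulr_suml.
    have [sr|nsr] := boolP (sqf r); last first.
      rewrite !mul0r mulr0; have [rm|] := eqVneq r m; last by rewrite mul0r.
      by rewrite -rm (negbTE nsr) !mul0r mulr0.
    rewrite -big_mkcondr /=; have [mr|mr] := boolP (m %| r)%N; last first.
      rewrite big1 ?mul0r; last by move=> e /andP[me /(dvdn_trans me)]; rewrite (negbTE mr).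
      have [rm|] := eqVneq r m; last by rewrite mul0r.
      by move: mr; rewrite rm dvdnn.
    rewrite sum_mu_between //; last by lia.
    have [rm|] := eqVneq r m; last by rewrite !mul0r.
    by rewrite -rm sr !mul1r !mulrA.
  rewrite -mulr_suml -!mulrA; congr (_ * _).
  have [my|my] := leqP m y.
    rewrite (bigD1_seq m) ?iota_uniq ?mem_index_iota ?m0 ?ltnS //= eqxx big1 ?addr0 //.
    by move=> r /negbTE ->.
  rewrite big_nat_cond big1 // => r /andP[/andP[_ ry] _].
  by rewrite (_ : (r == m) = false) //; apply/eqP; lia.
rewrite lcm_form_diag.
apply: (@le_trans _ _ (\sum_(1 <= m < y.+1) (sqf m)%:R / m%:R * (sqf_harm y) ^- 2)); last first.
  by rewrite -mulr_suml -/(sqf_harm y) expr2 invfM mulrA mulfV ?mul1r // lt0r_neq0.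
rewrite [leRHS](@big_nat_widen _ _ _ 1 y.+1 K.+1) // [leRHS]big_mkcond.
apply: ler_sum_nat => m /andP[m0 mK]; rewrite H // ltnS.
case: leqP => my; last by rewrite !mul0r expr0n mulr0.
have m0' : 0 < m%:R :> R by rewrite ltr0n.
rewrite !exprMn mu_sqr /=; case: (sqf m); last by rewrite !(expr2, mulr0n, mul0r, mulr0) ?mul0r.
have tm : (totient m)%:R <= m%:R :> R.
  rewrite ler_nat totient_count_coprime; apply: (@leq_trans (\sum_(0 <= d < m) 1)).
    by apply: leq_sum => i _; case: coprime.
  by rewrite sum_nat_const_nat muln1 subn0.
have h : (totient m)%:R * m%:R^-1 ^+ 2 <= m%:R^-1 :> R.
  by rewrite expr2 mulrA ler_piMl ?invr_ge0 ?(ltW m0') // ler_pdivrMr // mul1r.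
by rewrite !expr1n !mul1r mulrA -[_ ^- 2]exprVn ler_wpM2r ?sqr_ge0.
Qed.

Lemma selberg_form_le1 : lcm_form K selberg_weight <= 1.
Proof. by apply: (le_trans selberg_form_bound); rewrite invf_le1 ?S0 // sqf_harm_ge1. Qed.

Lemma selberg_form_le_ln : (1 < y)%N -> lcm_form K selberg_weight <= 2 / ln y%:R.
Proof.
move=> y1; apply: (le_trans selberg_form_bound).
have ly : 0 < ln y%:R :> R by rewrite ln_gt0 // ltr1n.
rewrite -[2 / _]invf_div lef_pV2 ?posrE ?divr_gt0 // ler_pdivrMr //.
rewrite mulrC; apply: le_trans (harm_le_sqf_harm y); apply: le_trans (ln_le_harm R y).
by rewrite ler_ln ?posrE ?ltr0n // ler_nat.
Qed.

End SelbergWeights.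

(** * Chebyshev's lower bound for the number of primes *)

Section PrimeCount.
Variable R : realType.
Implicit Types (d e k m n p j r N Y : nat).

Lemma central_binS n : (n.+1 * 'C(n.+1.*2, n.+1) = 2 * (n.*2).+1 * 'C(n.*2, n))%N.
Proof.
have h1 := @bin_fact n.+1.*2 n.+1; have h2 := @bin_fact n.*2 n.
have := h1 _; have := h2 _; rewrite -!addnn !addnK !leq_addr => /(_ isT) e2 /(_ isT) e1.
rewrite addSn addnS !factS -e2 in e1.
have f0 : (0 < n`!)%N by exact: fact_gt0.
rewrite -addSnnS addSn.
move: e1; rewrite addSn; move: 'C(_, n.+1) 'C(_, n) (n`!) f0 => a b f f0 e1.
by apply/eqP; rewrite -(eqn_pmul2r (_ : 0 < n.+1 * (f * f))%N) ?muln_gt0 ?f0 //; apply/eqP; nia.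
Qed.

Lemma central_bin_ge n : (0 < n)%N -> (4 ^ n <= n.*2 * 'C(n.*2, n))%N.
Proof.
elim: n => // -[|n] IH _; first by rewrite (binS 1 0) binn.
have := IH isT; have := central_binS n.+1; rewrite (expnS 4 n.+1) -!muln2.
by move: ('C(_, n.+2)) ('C(_, n.+1)) (4 ^ n.+1)%N => a b c; nia.
Qed.

(** In Legendre's formula each power p^k <= 2 n contributes at most 1 to the exponent, and larger
    powers contribute nothing. *)
Lemma logn_central_bin p n : prime p -> (0 < n)%N -> (p ^ logn p 'C(n.*2, n) <= n.*2)%N.
Proof.
move=> pp n0; have n2 : (0 < n.*2)%N by rewrite double_gt0.
have p1 := prime_gt1 pp.
suff H : (logn p 'C(n.*2, n) <= trunc_log p n.*2)%N.
  have /andP[h _] := trunc_log_bounds p1 n2.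
  by apply: leq_trans h; rewrite leq_exp2l.
have nn : (n <= n.*2)%N by rewrite -addnn leq_addr.
have E := congr1 (logn p) (bin_fact nn).
have nK : (n.*2 - n = n)%N by rewrite -addnn addnK.
rewrite nK !lognM ?muln_gt0 ?fact_gt0 ?bin_gt0 // !logn_fact // in E.
have W : (\sum_(1 <= k < n.*2.+1) n %/ p ^ k = \sum_(1 <= k < n.+1) n %/ p ^ k)%N.
  rewrite (big_cat_nat (n := n.+1)) //= [X in (_ + X)%N]big_nat_cond [X in (_ + X)%N]big1 ?addn0 //.
  move=> k /andP[/andP[nk _] _]; apply: divn_small; exact: leq_trans nk (ltnW (ltn_expl k p1)).
have : (\sum_(1 <= k < n.*2.+1) n.*2 %/ p ^ k <=
        \sum_(1 <= k < n.*2.+1) (n %/ p ^ k + n %/ p ^ k) + trunc_log p n.*2)%N.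
  have -> : trunc_log p n.*2 = (\sum_(1 <= k < n.*2.+1) (k <= trunc_log p n.*2)%N)%N.
    rewrite -big_mkcond /= sum1_count.
    have tl : (trunc_log p n.*2 < n.*2.+1)%N.
      have /andP[h _] := trunc_log_bounds p1 n2; rewrite ltnS.
      by apply: leq_trans h; apply: ltnW; exact: ltn_expl.
    rewrite /index_iota subSS subn0 (_ : n.*2 = trunc_log p n.*2 + (n.*2 - trunc_log p n.*2))%N; last by lia.
    rewrite iotaD count_cat.
    have -> : trunc_log p (trunc_log p n.*2 + (n.*2 - trunc_log p n.*2)) = trunc_log p n.*2 by congr trunc_log; lia.
    set t := trunc_log p n.*2.
    rewrite (_ : count _ (iota 1 t) = t); last first.
      rewrite -[RHS](size_iota 1 t); apply/eqP; rewrite -all_count; apply/allP => k; rewrite mem_iota; lia.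
    rewrite (_ : count _ (iota (1 + t) _) = 0)%N ?addn0 //.
    by apply/eqP; rewrite -leqn0 leqNgt -has_count; apply/hasPn => k; rewrite mem_iota; lia.
  rewrite -big_split /=; apply: leq_sum => k _.
  have [kt|kt] := leqP k (trunc_log p n.*2).
    have pk : (0 < p ^ k)%N by rewrite expn_gt0 ltnW.
    rewrite -ltnS ltn_divLR // addn1 -addnn.
    have := ltn_ceil n pk; move: (n %/ p ^ k)%N (p ^ k)%N => a b; nia.
  rewrite divn_small //; have /andP[_ h] := trunc_log_bounds p1 n2.
  by apply: (leq_trans h); rewrite leq_exp2l.
by rewrite big_split /= W -E; lia.
Qed.

Definition primepi n : nat := count prime (iota 1 n).

Lemma central_bin_le n : (0 < n)%N -> ('C(n.*2, n) <= n.*2 ^ primepi n.*2)%N.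
Proof.
move=> n0; have b0 : (0 < 'C(n.*2, n))%N by rewrite bin_gt0 -addnn leq_addr.
have n2 : (0 < n.*2)%N by rewrite double_gt0.
rewrite {1}(prod_prime_decomp b0) prime_decompE big_map /=.
apply: (@leq_trans (n.*2 ^ size (primes 'C(n.*2, n)))%N).
  have : all prime (primes 'C(n.*2, n)) by apply/allP => p; rewrite mem_primes => /and3P[].
  elim: (primes _) => [|p s IH] /=; first by rewrite big_nil.
  by move=> /andP[pp sp]; rewrite big_cons expnS leq_mul ?logn_central_bin ?IH.
rewrite leq_pexp2l // /primepi -size_filter uniq_leq_size ?primes_uniq //.
move=> p; rewrite mem_primes mem_filter mem_iota => /and3P[pp _ pC]; rewrite pp prime_gt0 //= add1n ltnS.
apply: leq_trans (logn_central_bin pp n0); rewrite -{1}[p]expn1 leq_exp2l ?prime_gt1 //.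
by rewrite logn_gt0 mem_primes pp b0.
Qed.

(** 1/5 + 1/6 + 1/7 + 1/8 <= ln 8 - ln 4. *)
Lemma ln2_ge : 3 / 5 <= ln 2 :> R.
Proof.
have := @harm_upper R 4 8 isT; rewrite /harm.
rewrite /index_iota /= !big_cons !big_nil.
have -> : ln 8 = ln 2 *+ 3 :> R by rewrite -lnXn // -natrX.
have -> : ln 4 = ln 2 *+ 2 :> R by rewrite -lnXn // -natrX.
by lra.
Qed.

Lemma ln2_le : ln 2 <= 1 :> R.
Proof. by apply: (@le_ln1Dx R 1); lra. Qed.

(** With n = Y / 2 rounded down, 4^n is at most 2 n times the central binomial coefficient, which is
    at most (2 n)^(pi (2 n)). *)
Lemma chebyshev_lower Y : (1 < Y)%N ->
  (Y%:R - 1) * ln 2 <= ((primepi Y)%:R + 1) * ln Y%:R :> R.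
Proof.
move=> Y1; set n := Y./2.
have n0 : (0 < n)%N by rewrite half_gt0.
have n2 : (0 < n.*2)%N by rewrite double_gt0.
have YE := odd_double_half Y; rewrite -/n in YE.
have h : (4 ^ n <= n.*2 ^ (primepi n.*2).+1)%N.
  apply: (leq_trans (central_bin_ge n0)); by rewrite expnS leq_mul2l central_bin_le // orbT.
have h' : n%:R * (2 * ln 2) <= (primepi n.*2).+1%:R * ln n.*2%:R :> R.
  have : ln ((4 ^ n)%N%:R) <= ln ((n.*2 ^ (primepi n.*2).+1)%N%:R) :> R.
    by rewrite ler_ln ?posrE ?ltr0n ?expn_gt0 ?n2 // ler_nat.
  have e4 : ln 4 = 2 * ln 2 :> R by rewrite (_ : 4 = 2 ^+ 2) ?lnXn ?mulr_natl //; rewrite -natrX.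
  rewrite !natrX !lnXn ?ltr0n //.
  by rewrite -[X in X <= _]mulr_natl -[X in _ <= X]mulr_natl e4.
have mono : (primepi n.*2 <= primepi Y)%N.
  by rewrite -YE addnC /primepi iotaD count_cat leq_addr.
have l2 := ln2_ge.
have mono' : (primepi n.*2).+1%:R * ln n.*2%:R <= ((primepi Y)%:R + 1) * ln Y%:R :> R.
  rewrite natr1; apply: ler_pM; rewrite ?ler_nat //; first by rewrite ln_ge0 // ler1n.
  by rewrite ler_ln ?posrE ?ltr0n ?(ltnW Y1) // ler_nat -YE leq_addl.
have Yn : Y%:R <= 2 * n%:R + 1 :> R.
  by rewrite -natrM natr1 ler_nat; lia.
by move: mono' h' Yn; move: (_ * ln n.*2%:R) (_ * ln Y%:R) (ln 2) l2 => a b c; nra.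
Qed.

End PrimeCount.

(** * Mean squares of divisor sums *)

Section DivisorSquares.
Variables (R : realType) (K N : nat) (l : nat -> R).
Hypotheses (lN : forall d, (N < d)%N -> l d = 0) (l1 : forall d, (0 < d)%N -> `|l d| <= 1).
Implicit Types (d e k m n p j r : nat).

Definition div_sum n := \sum_(1 <= d < K.+1 | (d %| n)%N) l d.

Lemma div_sum_prime n p : prime p -> (N < p)%N -> div_sum (n * p) = div_sum n.
Proof.
move=> pp Np; rewrite /div_sum big_mkcond [RHS]big_mkcond; apply: eq_big_nat => d /andP[d0 _].
have [dN|dN] := leqP d N; last by rewrite lN //; do 2 case: ifP.
rewrite Gauss_dvdl // coprime_sym (prime_coprime _ pp).
by apply/negP => /(dvdn_leq d0); lia.
Qed.

(** Each pair (d, e) is counted X / lcm times up to an error of at most 1, and there are at most N^2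
    pairs, with weights at most 1. *)
Lemma sum_div_sum_sqr X : \sum_(1 <= m < X.+1) div_sum m ^+ 2 <= X%:R * lcm_form K l + N%:R ^+ 2.
Proof.
have cnt d e : (0 < d)%N -> (0 < e)%N ->
    \sum_(1 <= m < X.+1) (if (d %| m)%N && (e %| m)%N then 1 else 0) = (X %/ lcmn d e)%:R :> R.
  move=> d0 e0; rewrite -big_mkcond /=; under eq_bigl do rewrite -dvdn_lcm.
  rewrite (@sum_multiples R X (lcmn d e) (fun=> 1)) ?lcmn_gt0 ?d0 //.
  by rewrite sumr_const_nat subn1.
have -> : \sum_(1 <= m < X.+1) div_sum m ^+ 2 =
   \sum_(1 <= d < K.+1) \sum_(1 <= e < K.+1) l d * l e * (X %/ lcmn d e)%:R.
  transitivity (\sum_(1 <= m < X.+1) \sum_(1 <= d < K.+1) \sum_(1 <= e < K.+1)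
     l d * l e * (if (d %| m)%N && (e %| m)%N then 1 else 0)).
    apply: eq_bigr => m _; rewrite /div_sum big_mkcond expr2 mulr_suml; apply: eq_bigr => d _.
    rewrite mulr_sumr; apply: eq_bigr => e _.
    by case: (d %| m)%N; case: (e %| m)%N; rewrite /= ?(mulr1, mulr0, mul0r).
  rewrite exchange_big /=; apply: eq_big_nat => d /andP[d0 _].
  rewrite exchange_big /=; apply: eq_big_nat => e /andP[e0 _].
  by rewrite -mulr_sumr cnt.
apply: (@le_trans _ _ (X%:R * lcm_form K l + \sum_(1 <= d < K.+1) \sum_(1 <= e < K.+1) `|l d| * `|l e|)).
  rewrite /lcm_form mulr_sumr -big_split /=; apply: ler_sum_nat => d /andP[d0 _].
  rewrite mulr_sumr -big_split /=; apply: ler_sum_nat => e /andP[e0 _].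
  set L := lcmn d e; have L0 : (0 < L)%N by rewrite lcmn_gt0 d0.
  have L0' : 0 < L%:R :> R by rewrite ltr0n.
  have f1 : (X %/ L)%:R <= X%:R / L%:R :> R by rewrite ler_pdivlMr // -natrM ler_nat leq_trunc_div.
  have f2 : X%:R / L%:R <= (X %/ L)%:R + 1 :> R.
    by rewrite ler_pdivrMr // natr1 -natrM ler_nat ltnW // ltn_ceil.
  have -> : l d * l e * (X %/ L)%:R = X%:R * (l d * l e / L%:R) + l d * l e * ((X %/ L)%:R - X%:R / L%:R) by ring.
  rewrite lerD2l; apply: le_trans (ler_norm _) _; rewrite normrM [`|l d * l e|]normrM ler_piMr ?mulr_ge0 //.
  by rewrite ler_norml; apply/andP; split; move: (X%:R / _) f1 f2 => u; lra.
rewrite lerD2l.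
have Z : \sum_(1 <= d < K.+1) `|l d| <= N%:R.
  apply: (@le_trans _ _ (\sum_(1 <= d < K.+1 | (d < N.+1)%N) (1 : R))).
    rewrite [leRHS]big_mkcond; apply: ler_sum_nat => d /andP[d0 _].
    case: ltnP => dN; first exact: l1.
    by rewrite lN ?normr0 //; lia.
  apply: (@le_trans _ _ (\sum_(1 <= d < N.+1) (1 : R))); last by rewrite sumr_const_nat subn1.
  have [KN|NK] := leqP K N.
    rewrite [leRHS](big_cat_nat (n := K.+1)) //= big_mkcond -[leLHS]addr0; apply: lerD.
      by apply: ler_sum => d _; case: ifP.
    by apply: sumr_ge0.
  by rewrite [leRHS](@big_nat_widen _ _ _ 1 N.+1 K.+1) //; lia.
have -> : \sum_(1 <= d < K.+1) \sum_(1 <= e < K.+1) `|l d| * `|l e| = (\sum_(1 <= d < K.+1) `|l d|) ^+ 2.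
  by rewrite expr2 mulr_suml; apply: eq_bigr => d _; rewrite mulr_sumr.
by rewrite lerXn2r ?nnegrE // sumr_ge0.
Qed.

(* The integers [n * p] with [n <= N] and [p > N] prime determine [p], and the divisor
   sum does not see [p]; so the mean square over [n <= N^3] controls a logarithmic mean
   square over [n <= N]. *)
Lemma sum_sqr_prime_multiples X :
  \sum_(1 <= n < N.+1) div_sum n ^+ 2 * \sum_(1 <= p < (X %/ n).+1) (prime p && (N < p)%N)%:R <=
  \sum_(1 <= m < X.+1) div_sum m ^+ 2.
Proof.
pose F p m := (prime p && (N < p)%N && (m %/ p <= N)%N)%:R * div_sum m ^+ 2.
apply: (@le_trans _ _ (\sum_(1 <= p < X.+1) \sum_(1 <= n < X.+1 | (p * n <= X)%N) F p (p * n)%N)).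
  rewrite (exchange_big_dep_nat xpredT) //=.
  apply: (@le_trans _ _ (\sum_(1 <= n < X.+1 | (n < N.+1)%N) div_sum n ^+ 2 *
       \sum_(1 <= p < (X %/ n).+1) (prime p && (N < p)%N)%:R)).
    have [XN|NX] := leqP N X; first by rewrite [leLHS](@big_nat_widen _ _ _ 1 N.+1 X.+1).
    rewrite (big_cat_nat (n := X.+1)) //=; last by lia.
    rewrite [X in _ + X]big_nat_cond [X in _ + X]big1 ?addr0; last first.
      by move=> n /andP[/andP[nX _] _]; rewrite divn_small // big_geq ?mulr0.
    by rewrite big_nat_cond [leRHS]big_nat_cond le_eqVlt; apply/orP; left; apply/eqP; apply: eq_bigl => n; lia.
  rewrite big_mkcond; apply: ler_sum_nat => n /andP[n0 nX].
  rewrite ltnS; case: leqP => nN; last first.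
    by apply: sumr_ge0 => p _; rewrite mulr_ge0 ?sqr_ge0.
  rewrite -(@sum_le_div R X X n) // mulr_sumr le_eqVlt; apply/orP; left; apply/eqP.
  transitivity (\sum_(1 <= p < X.+1 | (p * n <= X)%N) div_sum n ^+ 2 * (prime p && (N < p)%N)%:R).
    by apply: eq_bigl => p; rewrite mulnC.
  rewrite big_mkcond [RHS]big_mkcond; apply: eq_big_nat => p /andP[p0 _].
  case: ifP => // _; rewrite /F mulnC mulnK // nN andbT.
  case: andP => [[pp Np]|_]; last by rewrite mul0r mulr0.
  by rewrite div_sum_prime // mulrC.
rewrite (@sum_over_divisors R X F X) //; apply: ler_sum_nat => m /andP[m0 mX].
have [/existsP[p0 pg]|/negP none] := boolP [exists p : 'I_X.+1, prime p && (N < p)%N && (m %/ p <= N)%N && (p %| m)%N].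
  case/andP: (pg) => /andP[/andP[pp Np] mp] pm.
  rewrite big_mkcond (bigD1_seq (p0 : nat)) ?iota_uniq ?mem_index_iota ?prime_gt0 ?ltn_ord //=.
  rewrite pm {1}/F pp Np mp mul1r [X in _ + X]big1 ?addr0 // => q qp.
  case: ifP => // qm; rewrite /F; case: andP => [[/andP[qq Nq] mq]|_]; last by rewrite mul0r.
  exfalso; have : (q %| m %/ p0 * p0)%N by rewrite divnK.
  rewrite Euclid_dvdM // (dvdn_prime2 qq pp) (negbTE qp) orbF => /dvdn_leq.
  by rewrite divn_gt0 ?prime_gt0 // (dvdn_leq m0 pm) => /(_ isT); lia.
rewrite big_nat_cond big1 ?sqr_ge0 // => p /andP[/andP[_ pX] pm].
rewrite /F; case: andP => [[H1 H2]|_]; last by rewrite mul0r.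
by exfalso; apply: none; apply/existsP; exists (Ordinal pX); rewrite /= H1 H2.
Qed.

Lemma ln_le_affine n : (0 < n)%N -> ln n%:R <= n%:R / 1024 + 9 :> R.
Proof.
move=> n0; have n0' : 0 < n%:R :> R by rewrite ltr0n.
have e : 1024 = 2 ^+ 10 :> R by rewrite !exprS expr0; lra.
have c0 : 0 < 1024 :> R by lra.
have l10 : ln (2 ^+ 10) = 10 * ln 2 :> R by rewrite lnXn // mulr_natl.
have -> : ln n%:R = ln (1 + (n%:R / 1024 - 1)) + 10 * ln 2 :> R.
  have -> : 1 + (n%:R / 1024 - 1) = n%:R / 1024 :> R by ring.
  by rewrite -l10 -e ln_div ?posrE // subrK.
have h : ln (1 + (n%:R / 1024 - 1)) <= n%:R / 1024 - 1 :> R.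
  by apply: le_ln1Dx; rewrite ltrBrDr addrC subrr divr_gt0.
by have := ln2_le R; lra.
Qed.

Lemma prime_interval_aux (y u c ly v w : R) : 1 <= y -> 0 <= u -> 3 / 5 <= c ->
  (y - 1) * c <= (u + 1) * ly -> ly <= 3 * v -> v <= w / 1024 + 9 -> w ^+ 2 <= y -> 1000 <= w ->
  y + 1 <= (u - w) * (6 * v).
Proof.
move=> y1 u0 c35 ch h1 h4 h5 h6.
have s0 : (y - 1) * (3 / 5) <= (u + 1) * (3 * v).
  apply: (@le_trans _ _ ((y - 1) * c)); first by rewrite ler_wpM2l // subr_ge0.
  by apply: (le_trans ch); rewrite ler_wpM2l // addr_ge0.
have w0 : 0 <= w by lra.
have s2 : (w + 1) * (3 * v) <= (w + 1) * (3 * (w / 1024 + 9)).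
  by rewrite ler_wpM2l ?addr_ge0 // ler_wpM2l.
have s3 : 1000 * w <= w ^+ 2 by rewrite expr2 ler_wpM2r.
clear ch h1 h4 c35 u0.
have -> : (u - w) * (6 * v) = 2 * ((u + 1) * (3 * v)) - 2 * ((w + 1) * (3 * v)) by ring.
by move: ((u + 1) * (3 * v)) ((w + 1) * (3 * v)) s0 s2 => p q s0 s2; lra.
Qed.

(** Chebyshev's bound up to Y = N^3 / n >= N^2, where ln Y <= 3 ln N. Discarding the primes up to N
    loses at most N, affordable because N >= 1000. *)
Lemma prime_interval_count n : (1000 <= N)%N -> (0 < n <= N)%N ->
  (N ^ 3)%:R / (6 * n%:R * ln N%:R) <= \sum_(1 <= p < (N ^ 3 %/ n).+1) (prime p && (N < p)%N)%:R :> R.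
Proof.
move=> N1000 /andP[n0 nN]; set Y := (N ^ 3 %/ n)%N.
have n0' : 0 < n%:R :> R by rewrite ltr0n.
have N0 : (0 < N)%N by lia.
have YN : (N ^ 2 <= Y)%N by rewrite leq_divRL // expnS mulnC leq_mul2r nN orbT.
have YN3 : (Y <= N ^ 3)%N by exact: leq_div.
have c1 : (primepi Y)%:R - N%:R <= \sum_(1 <= p < Y.+1) (prime p && (N < p)%N)%:R :> R.
  have -> : (primepi Y)%:R = \sum_(1 <= p < Y.+1) (prime p)%:R :> R.
    rewrite /primepi -sum1_count /index_iota subSS subn0 natr_sum big_mkcond; apply: eq_bigr => p _.
    by case: prime.
  rewrite lerBlDr.
  apply: (@le_trans _ _ (\sum_(1 <= p < Y.+1) (prime p && (N < p)%N)%:R + \sum_(1 <= p < Y.+1 | (p < N.+1)%N) 1)).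
    rewrite [X in _ + X]big_mkcond -big_split /=; apply: ler_sum => p _.
    by rewrite ltnS; case: prime => //=; case: leqP => //; rewrite ?(add0r, addr0).
  rewrite lerD2l.
  have NY : (N.+1 <= Y.+1)%N by rewrite ltnS; apply: leq_trans YN; rewrite expnS expn1 leq_pmulr.
  by rewrite -(@big_nat_widen _ _ _ 1 N.+1 Y.+1 xpredT) // sumr_const_nat subn1.
apply: le_trans c1.
have Y1 : (1 < Y)%N by apply: leq_trans YN; nia.
have ch := @chebyshev_lower R Y Y1.
have lY : ln Y%:R <= 3 * ln N%:R :> R.
  rewrite mulr_natl -lnXn ?ltr0n // ler_ln ?posrE ?exprn_gt0 ?ltr0n //; last by lia.
  by rewrite -natrX ler_nat.
have lY0 : 0 < ln Y%:R :> R by rewrite ln_gt0 // ltr1n.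
have lN0 : 0 < ln N%:R :> R by rewrite ln_gt0 // ltr1n; lia.
have lNb := ln_le_affine N0.
have YX : (N ^ 3)%:R / n%:R <= Y%:R + 1 :> R.
  by rewrite ler_pdivrMr // natr1 -natrM ler_nat ltnW // ltn_ceil.
have -> : (N ^ 3)%:R / (6 * n%:R * ln N%:R) = (N ^ 3)%:R / n%:R / (6 * ln N%:R) :> R.
  by field; rewrite !lt0r_neq0.
rewrite ler_pdivrMr ?mulr_gt0 //; apply: (le_trans YX).
have YN' : N%:R ^+ 2 <= Y%:R :> R by rewrite -natrX ler_nat.
have NN : 1000 <= N%:R :> R by rewrite ler_nat.
have Y1' : 1 <= Y%:R :> R by rewrite ler1n ltnW.
exact: (prime_interval_aux Y1' _ (ln2_ge R) ch lY lNb YN' NN).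
Qed.

(** Expanding the square over n <= N directly would leave an error from up to N^2 pairs of divisors.
    Multiplying n by primes moves the sum to m <= N^3, where the error N^2 is only the relative 1 /
    N. *)
Lemma sum_div_sum_sqr_log : (1000 <= N)%N ->
  \sum_(1 <= n < N.+1) div_sum n ^+ 2 / n%:R <= 6 * ln N%:R * (lcm_form K l + N%:R^-1).
Proof.
move=> N1000; have N0 : 0 < N%:R :> R by rewrite ltr0n; lia.
have lN0 : 0 < ln N%:R :> R by rewrite ln_gt0 // ltr1n; lia.
have := le_trans (sum_sqr_prime_multiples (N ^ 3)) (sum_div_sum_sqr (N ^ 3)).
move=> H.
have {H} : \sum_(1 <= n < N.+1) (N ^ 3)%:R / (6 * ln N%:R) * (div_sum n ^+ 2 / n%:R) <=
   (N ^ 3)%:R * lcm_form K l + N%:R ^+ 2.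
  apply: le_trans H; apply: ler_sum_nat => n nN.
  have := prime_interval_count N1000 nN.
  set c := \sum_(_ <= _ < _) _ => hc.
  have n0' : 0 < n%:R :> R by rewrite ltr0n; case/andP: nN.
  have -> : (N ^ 3)%:R / (6 * ln N%:R) * (div_sum n ^+ 2 / n%:R) = div_sum n ^+ 2 * ((N ^ 3)%:R / (6 * n%:R * ln N%:R)).
    by field; rewrite !lt0r_neq0.
  by rewrite ler_wpM2l ?sqr_ge0.
rewrite -mulr_sumr natrX; set S := \sum_(_ <= _ < _) _ => h.
have c0 : 0 < N%:R ^+ 3 / (6 * ln N%:R) :> R by rewrite divr_gt0 ?exprn_gt0 ?mulr_gt0.
rewrite -(ler_pM2l c0); apply: (le_trans h); rewrite le_eqVlt; apply/orP; left; apply/eqP.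
by field; rewrite !lt0r_neq0.
Qed.

End DivisorSquares.

(** * The Cauchy-Schwarz inequality and power means *)

Section SumInequalities.
Variable R : realType.

Lemma sum_cauchy_schwarz (I : Type) (s : seq I) (P : pred I) (x y : I -> R) :
  (\sum_(i <- s | P i) x i * y i) ^+ 2 <= (\sum_(i <- s | P i) x i ^+ 2) * \sum_(i <- s | P i) y i ^+ 2.
Proof.
set A := \sum_(i <- s | P i) x i ^+ 2; set C := \sum_(i <- s | P i) y i ^+ 2.
set B := \sum_(i <- s | P i) x i * y i.
have : 0 <= \sum_(i <- s | P i) \sum_(j <- s | P j) (x i * y j - x j * y i) ^+ 2.
  by apply: sumr_ge0 => i _; apply: sumr_ge0 => j _; rewrite sqr_ge0.
have -> : \sum_(i <- s | P i) \sum_(j <- s | P j) (x i * y j - x j * y i) ^+ 2 = A * C + A * C - (B * B + B * B).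
  transitivity (\sum_(i <- s | P i) (x i ^+ 2 * C + y i ^+ 2 * A - (x i * y i * B + x i * y i * B))).
    apply: eq_bigr => i _; rewrite !mulr_sumr -!big_split /= -sumrB; apply: eq_bigr => j _; ring.
  by rewrite sumrB !big_split /= -!mulr_suml [C * A]mulrC.
by rewrite expr2; lra.
Qed.

Lemma sum_sqr_le n (x : nat -> R) : (\sum_(i < n) x i) ^+ 2 <= n%:R * \sum_(i < n) x i ^+ 2.
Proof.
have := sum_cauchy_schwarz (index_enum 'I_n) xpredT (fun=> 1) (fun i => x i).
under eq_bigr do rewrite mul1r.
by under [X in _ <= X * _]eq_bigr do rewrite expr1n; rewrite sumr_const card_ord.
Qed.

(** Repeated use of [sum_sqr_le]; powers of two are the exponents that iterated differencing
    produces. *)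
Lemma sum_power_mean k n (x : nat -> R) : (forall i, 0 <= x i) ->
  (\sum_(i < n) x i) ^+ (2 ^ k) <= n%:R ^+ (2 ^ k).-1 * \sum_(i < n) x i ^+ (2 ^ k).
Proof.
move=> x0; elim: k => [|k IH]; first by rewrite expr0 mul1r expr1; under [X in _ <= X]eq_bigr do rewrite expr1.
have s0 j : 0 <= \sum_(i < n) x i ^+ j by apply: sumr_ge0 => i _; rewrite exprn_ge0.
rewrite expnSr exprM.
apply: (@le_trans _ _ ((n%:R ^+ (2 ^ k).-1 * \sum_(i < n) x i ^+ (2 ^ k)) ^+ 2)).
  rewrite lerXn2r ?nnegrE ?mulr_ge0 ?exprn_ge0 //; exact: sumr_ge0.
rewrite exprMn; apply: le_trans (ler_wpM2l _ (@sum_sqr_le n (fun i => x i ^+ (2 ^ k)))) _.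
  by rewrite exprn_ge0 // exprn_ge0.
rewrite mulrA -exprM -exprSr; under eq_bigr do rewrite -exprM.
have -> : ((2 ^ k).-1 * 2).+1 = (2 ^ k * 2).-1 by have := expn_gt0 2 k; lia.
by [].
Qed.

Lemma expr_add_le k (x y : R) : 0 <= x -> 0 <= y ->
  (x + y) ^+ (2 ^ k) <= 2 ^+ (2 ^ k).-1 * (x ^+ (2 ^ k) + y ^+ (2 ^ k)).
Proof.
move=> x0 y0; have := @sum_power_mean k 2 (fun i => if i is 0 then x else y).
by rewrite !big_ord_recl !big_ord0 /= !addr0; apply => -[].
Qed.

End SumInequalities.

Section Cis.
Variable R : realType.
Implicit Types (x y : R) (z : R[i]).

Definition cis x : R[i] := cos x +i* sin x.

Lemma cisD x y : cis (x + y) = cis x * cis y.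
Proof. by rewrite /cis cosD sinD; apply/complex_ext => //=; rewrite addrC. Qed.

Lemma cisN x : cis (- x) = (cis x)^*.
Proof. by rewrite /cis cosN sinN. Qed.

Lemma cabs_cis x : cabs (cis x) = 1.
Proof. by rewrite cabsE /= cos2Dsin2 sqrtr1. Qed.

End Cis.

(** * The inequality of Kusmin and Landau *)

Section KusminLandau.
Variable R : realType.
Implicit Types (x y lam : R) (a : nat -> R).

Lemma sin_half_ge x : 0 < x <= 1 / 2 -> 7 / 8 * x <= sin x.
Proof.
move=> /andP[x0 x1]; have := sin_taylor1 x; rewrite (ger0_norm (ltW x0)) ler_norml => /andP[h _].
by have : x ^+ 3 <= x / 4; [rewrite !exprS expr0; nra | lra].
Qed.

Lemma cot_sub x y : sin x != 0 -> sin y != 0 ->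
  cos x / sin x - cos y / sin y = sin (y - x) / (sin x * sin y).
Proof. by move=> sx sy; rewrite sinB; field; rewrite sx sy. Qed.

(** With x n half the difference, cis (a n) = c n (cis (a (n + 1)) - cis (a n)) for c n = - 1/2 -
    (i/2) cot (x n). Partial summation then needs only the total variation of the monotone
    cotangent, which leaves 1 plus the last cotangent, at most 1 + 16 / (7 lam). *)
Lemma kusmin_landau a L lam : 0 < lam ->
  (forall n, (n < L)%N -> lam <= a n.+1 - a n <= 1) ->
  (forall n, (n < L)%N -> a n.+2 - a n.+1 <= a n.+1 - a n) ->
  cabs (\sum_(n < L) cis (a n)) <= 4 / lam.
Proof.
case: L => [|L] l0 H1 H2; first by rewrite big_ord0 cabs0 divr_ge0 // ltW.
pose x n := (a n.+1 - a n) / 2; pose ct n := cos (x n) / sin (x n).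
pose c n : R[i] := (- (1 / 2)) +i* (- (ct n / 2)).
have xb n : (n <= L)%N -> lam / 2 <= x n <= 1 / 2.
  by move=> nL; have /andP[u v] := H1 n nL; rewrite /x; apply/andP; split; lra.
have xs n : (n <= L)%N -> 7 / 8 * x n <= sin (x n).
  by move=> nL; have /andP[u v] := xb n nL; apply: sin_half_ge; apply/andP; split; lra.
have sp n : (n <= L)%N -> 0 < sin (x n).
  by move=> nL; have := xs n nL; have /andP[u _] := xb n nL; lra.
have cE n : (n <= L)%N -> cis (a n) = c n * (cis (a n.+1) - cis (a n)).
  move=> nL; have s0 := lt0r_neq0 (sp n nL).
  have -> : a n.+1 = a n + (x n + x n) by rewrite /x; field.
  rewrite !cisD -{3}[cis (a n)]mulr1 -mulrBr mulrCA -[LHS]mulr1; congr (_ * _).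
  have cs := cos2Dsin2 (x n).
  apply: complex_ext; rewrite /c /ct /=.
    rewrite [RHS](_ : _ = (1 + (cos (x n) ^+ 2 + sin (x n) ^+ 2)) / 2); last by field.
    by rewrite cs; field.
  have -> : cos (x n) * cos (x n) - sin (x n) * sin (x n) - 1 = - (2 * sin (x n) ^+ 2).
    by rewrite -!expr2; lra.
  by field.
have parts m : (m <= L)%N -> \sum_(n < m.+1) cis (a n) =
    c m * cis (a m.+1) - c 0%N * cis (a 0%N) + \sum_(n < m) (c n - c n.+1) * cis (a n.+1).
  elim: m => [|m IH] mL.
    by rewrite big_ord_recl !big_ord0 /= !addr0 [LHS]cE // mulrBr.
  by rewrite big_ord_recr /= IH ?(ltnW mL) // [X in _ + X = _]cE // [in RHS]big_ord_recr /=; ring.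
have ct_mono n : (n < L)%N -> ct n <= ct n.+1.
  move=> nL; have s1 := sp n (ltnW nL); have s2 := sp n.+1 nL.
  rewrite -subr_ge0 /ct cot_sub ?lt0r_neq0 // divr_ge0 //; last by rewrite mulr_ge0 // ltW.
  have h := H2 n (leqW nL).
  have /andP[u1 u2] := xb n (ltnW nL); have /andP[v1 v2] := xb n.+1 nL.
  have xx : x n.+1 <= x n by rewrite /x; lra.
  by apply: sin_ge0_pi; have := pi_ge2 R => ?; apply/andP; split; lra.
have ct0 n : (n <= L)%N -> 0 <= ct n.
  move=> nL; have /andP[u v] := xb n nL; have := cos_taylor1 (x n).
  rewrite ler_norml => /andP[h _]; rewrite divr_ge0 ?(ltW (sp n nL)) //.
  by have : x n ^+ 2 <= x n / 2; [rewrite expr2; nra | lra].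
have ctL : ct L <= 16 / (7 * lam).
  have s1 := sp L (leqnn L); rewrite /ct ler_pdivrMr //; have /andP[u v] := xb L (leqnn L).
  apply: (le_trans (cos_le1 _)); rewrite mulrAC ler_pdivlMr ?mulr_gt0 //.
  by have := xs L (leqnn L); lra.
have cb n : (n <= L)%N -> cabs (c n) <= 1 / 2 + ct n / 2.
  move=> nL; apply: (le_trans (cabs_le_ReIm _)); rewrite /c /= !normrN.
  have h0 : 0 <= ct n / 2 by rewrite divr_ge0 // ct0.
  by rewrite (ger0_norm h0) ger0_norm; lra.
rewrite parts //.
have tele m : (m <= L)%N -> \sum_(n < m) cabs ((c n - c n.+1) * cis (a n.+1)) <= (ct m - ct 0%N) / 2.
  elim: m => [|m IH] mL; first by rewrite big_ord0 subrr mul0r.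
  rewrite big_ord_recr /=; have := IH (ltnW mL); have := ct_mono m mL.
  have -> : cabs ((c m - c m.+1) * cis (a m.+1)) = `|(ct m.+1 - ct m) / 2|.
    rewrite cabsM cabs_cis mulr1 (_ : c m - c m.+1 = 0 +i* ((ct m.+1 - ct m) / 2)).
      by rewrite cabsE /= expr0n add0r sqrtr_sqr.
    by apply: complex_ext; rewrite /c /=; field.
  by move=> d; rewrite ger0_norm ?divr_ge0 ?subr_ge0 //; lra.
have b1 : cabs (c L * cis (a L.+1)) <= 1 / 2 + ct L / 2 by rewrite cabsM cabs_cis mulr1 cb.
have b2 : cabs (c 0%N * cis (a 0%N)) <= 1 / 2 + ct 0%N / 2 by rewrite cabsM cabs_cis mulr1 cb.
have b3 : cabs (\sum_(n < L) (c n - c n.+1) * cis (a n.+1)) <= (ct L - ct 0%N) / 2.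
  by apply: (le_trans (cabs_sum _ _ _)); exact: tele.
apply: (le_trans (cabsD _ _)).
apply: (@le_trans _ _ (1 + ct L)).
  by have := cabsB (c L * cis (a L.+1)) (c 0%N * cis (a 0%N)); lra.
apply: (le_trans (lerD (lexx _) ctL)).
have l1 : lam <= 1 by have /andP[u v] := H1 0%N isT; lra.
rewrite ler_pdivlMr // mulrDl mul1r.
have -> : 16 / (7 * lam) * lam = 16 / 7 by field; rewrite lt0r_neq0.
lra.
Qed.

End KusminLandau.

(** * Van der Corput's differencing and its iteration *)

Section VanDerCorput.
Variable R : realType.
Implicit Types (a : nat -> R) (z : nat -> R[i]) (L H M h j k n : nat).

Definition shifted_corr z L h := \sum_(n < L - h) z (n + h)%N * (z n)^*.

Lemma sum_shift (w : nat -> R[i]) H L j : (j <= H)%N ->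
  (forall n, (H <= n < H + L)%N = false -> w n = 0) ->
  \sum_(m < L + H) w (m + j)%N = \sum_(n < L) w (H + n)%N.
Proof.
move=> jH w0.
rewrite -(big_mkord xpredT (fun m => w (m + j)%N)) -(big_mkord xpredT (fun n => w (H + n)%N)).
rewrite -{1}(addnK j (L + H)%N) -(big_addn 0 (L + H + j) j xpredT w) add0n.
under [RHS]eq_bigr do rewrite addnC.
rewrite -{2}(addnK H L) -(big_addn 0 (L + H) H xpredT w) add0n.
rewrite (big_cat_nat (n := H)) //=; last by lia.
rewrite [X in X + _]big_nat_cond [X in X + _]big1 ?add0r; last first.
  by move=> n /andP[/andP[_ nH] _]; apply: w0; lia.
rewrite (big_cat_nat (n := (L + H)%N)) /=; [|lia|lia].
rewrite [X in _ + X]big_nat_cond [X in _ + X]big1 ?addr0 //.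
by move=> n /andP[/andP[nL _] _]; apply: w0; lia.
Qed.

(** Average the sum over H shifts, apply Cauchy-Schwarz over the L + H <= 2 M starting points, and
    collect the pairs of shifts by their difference h; each of the H rows meets every h at most
    twice. *)
Lemma van_der_corput_ineq z L H M : (0 < H <= M)%N -> (L <= M)%N -> (forall n, cabs (z n) = 1) ->
  cabs (\sum_(n < L) z n) ^+ 2 <=
  2 * M%:R / H%:R * (M%:R + 2 * \sum_(1 <= h < H) cabs (shifted_corr z L h)).
Proof.
move=> /andP[H0 HM] LM z1.
(* Extension by 0, moved by H, so that all shifts [m + j] have natural indices. *)
pose w n := if (H <= n < H + L)%N then z (n - H)%N else 0.
have w0 n : (H <= n < H + L)%N = false -> w n = 0 by rewrite /w => ->.
pose S := \sum_(n < L) z n; pose P := (L + H)%N.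
have wS j : (j <= H)%N -> \sum_(m < P) w (m + j)%N = S.
  move=> jH; rewrite (sum_shift jH w0); apply: eq_bigr => n _.
  by rewrite /w leq_addr ltn_add2l ltn_ord addKn.
pose W m := \sum_(j < H) w (m + j)%N.
have WS : \sum_(m < P) W m = H%:R * S.
  rewrite exchange_big /=; under eq_bigr do rewrite wS ?(ltnW (ltn_ord _)) //.
  by rewrite sumr_const card_ord mulr_natl.
have cs : (H%:R * cabs S) ^+ 2 <= P%:R * \sum_(m < P) cabs (W m) ^+ 2.
  have -> : H%:R * cabs S = cabs (\sum_(m < P) W m).
    by rewrite WS cabsM; congr (_ * _); rewrite -[H%:R in RHS](rmorph_nat (real_complex R)) cabs_real ger0_norm.
  apply: (@le_trans _ _ ((\sum_(m < P) cabs (W m)) ^+ 2)); last exact: (sum_sqr_le P (fun m => cabs (W m))).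
  by rewrite lerXn2r ?nnegrE ?cabs_ge0 ?cabs_sum // sumr_ge0 // => i _; exact: cabs_ge0.
pose t h := if h is 0%N then L%:R else cabs (shifted_corr z L h).
have t0 h : 0 <= t h by case: h => //= h; exact: cabs_ge0.
pose T j j' := \sum_(m < P) w (m + j)%N * (w (m + j')%N)^*.
have TE j h : (j + h < H)%N -> T (j + h)%N j = shifted_corr z L h.
  move=> jhH; rewrite /T; under eq_bigr do rewrite addnA.
  pose v n := w (n + h)%N * (w n)^*.
  under eq_bigr => m _ do rewrite -(_ : v (m + j)%N = w (m + j + h)%N * (w (m + j)%N)^*) //.
  rewrite (@sum_shift v H L j); first last.
  - by move=> n /w0 wn; rewrite /v wn rmorph0 mulr0.
  - by lia.
  rewrite /shifted_corr -(big_mkord xpredT (fun n => v (H + n)%N)) -(big_mkord xpredT (fun n => z (n + h)%N * (z n)^*)).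
  rewrite (big_cat_nat (n := (L - h)%N)) //=; last by lia.
  rewrite [X in _ + X]big_nat_cond [X in _ + X]big1 ?addr0; last first.
    by move=> n /andP[/andP[nL _] _]; rewrite /v /w ifN ?mul0r //; lia.
  apply: eq_big_nat => n /andP[_ nL]; rewrite /v /w.
  by rewrite !ifT; [congr (z _ * (z _)^*); lia|lia|lia].
have TJ j j' : T j' j = (T j j')^*.
  rewrite /T rmorph_sum; apply: eq_bigr => m _; rewrite rmorphM /= mulrC; congr (_ * _).
  exact/esym/conjcK.
have Tb j j' : (j < H)%N -> (j' < H)%N -> cabs (T j j') <= t (maxn (j - j') (j' - j)).
  wlog jj : j j' / (j' <= j)%N => [W0 jH j'H|jH j'H].
    have [jj|jj] := leqP j' j; first exact: W0.
    by rewrite -(cabsJ (T j j')) -TJ maxnC; apply: W0 => //; exact: ltnW.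
  rewrite (_ : maxn _ _ = (j - j')%N); last by lia.
  rewrite -{1}(subnKC jj) TE; last by lia.
  case e : (j - j')%N => [|h] //=.
  rewrite /shifted_corr subn0; apply: (le_trans (cabs_sum _ _ _)).
  under eq_bigr do rewrite cabsM cabsJ !z1 mulr1.
  by rewrite sumr_const card_ord.
have key : \sum_(m < P) cabs (W m) ^+ 2 <= H%:R * (L%:R + 2 * \sum_(1 <= h < H) t h).
  have -> : \sum_(m < P) cabs (W m) ^+ 2 = complex.Re (\sum_(j < H) \sum_(j' < H) T j j').
    transitivity (complex.Re (\sum_(m < P) W m * (W m)^*)).
      by rewrite (raddf_sum (@complex.Re R)); apply: eq_bigr => m _; rewrite mulcJ.
    congr complex.Re; transitivity (\sum_(m < P) \sum_(j < H) \sum_(j' < H) w (m + j)%N * (w (m + j')%N)^*).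
      apply: eq_bigr => m _; rewrite /W rmorph_sum mulr_suml; apply: eq_bigr => j _.
      by rewrite mulr_sumr.
    by rewrite exchange_big; apply: eq_bigr => j _; rewrite exchange_big.
  apply: (le_trans (ReleC _)); apply: (le_trans (cabs_sum _ _ _)).
  set X := (L%:R + _); have -> : H%:R * X = \sum_(j < H) X by rewrite sumr_const card_ord mulr_natl.
  apply: ler_sum => j _; rewrite /X.
  apply: (le_trans (cabs_sum _ _ _)).
  apply: (@le_trans _ _ (\sum_(j' < H) t (maxn (j - j') (j' - j)))).
    by apply: ler_sum => j' _; exact: Tb.
  rewrite -(big_mkord xpredT (fun j' => t (maxn (j - j') (j' - j)))).
  have jH := ltn_ord j.
  rewrite (big_cat_nat (n := j)) //=; last exact: ltnW.
  rewrite (big_ltn jH) addrCA; apply: lerD; first by rewrite subnn.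
  rewrite mulr_natl mulr2n; apply: lerD.
    rewrite big_nat_rev /= add0n.
    apply: (@le_trans _ _ (\sum_(1 <= h < j.+1) t h)).
      rewrite (big_add1 _ _ 0 j.+1) /=; apply: ler_sum_nat => i /andP[_ ij].
      by rewrite -/(t i.+1) (_ : maxn _ _ = i.+1) //; lia.
    rewrite [leRHS](big_cat_nat (n := j.+1)) //= lerDl; exact: sumr_ge0.
  apply: (@le_trans _ _ (\sum_(1 <= h < H - j) t h)).
    rewrite -{1}(addn1 j) addnC big_addn; apply: ler_sum_nat => i /andP[_ ij].
    by rewrite le_eqVlt; apply/orP; left; apply/eqP; congr t; lia.
  rewrite [leRHS](big_cat_nat (n := (H - j)%N)) /=; [|lia|lia].
  rewrite lerDl; exact: sumr_ge0.
have H0' : 0 < H%:R :> R by rewrite ltr0n.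
have key2 : H%:R * cabs S ^+ 2 <= P%:R * (M%:R + 2 * \sum_(1 <= h < H) t h).
  rewrite -(ler_pM2l H0') mulrA -expr2 -exprMn; apply: (le_trans cs).
  rewrite mulrCA ler_wpM2l //; apply: (le_trans key); rewrite ler_wpM2l // lerD2r ler_nat //.
have -> : \sum_(1 <= h < H) cabs (shifted_corr z L h) = \sum_(1 <= h < H) t h.
  by apply: eq_big_nat => -[].
rewrite mulrAC ler_pdivlMr // mulrC; apply: (le_trans key2); rewrite ler_wpM2r //.
  by rewrite addr_ge0 // mulr_ge0 // sumr_ge0.
by rewrite -natrM ler_nat /P; lia.
Qed.

(** The constants produced by the recursion of [vdc_algebra]: [vdc_main] for the term free of lam,
    [vdc_tail] for the other, which starts from the 4 of [kusmin_landau]. They are evaluated for k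
    <= 3 only. *)
Fixpoint vdc_main k : R := if k is k'.+1 then 2 ^+ (2 ^ k').*2.-1 * (1 + 2 ^+ (2 ^ k') * vdc_main k') else 0.
Fixpoint vdc_tail k : R := if k is k'.+1 then 2 ^+ (3 * 2 ^ k').-1 * vdc_tail k' else 4.

Fixpoint diff k a n : R := if k is k'.+1 then diff k' (fun m => a m.+1 - a m) n else a n.

Lemma diffB k a b n : diff k (fun m => a m - b m) n = diff k a n - diff k b n.
Proof.
elim: k a b n => //= k IH a b n; rewrite -IH; congr diff; apply/funext => m; ring.
Qed.

Lemma diff_shift k a h n : diff k (fun m => a (m + h)%N) n = diff k a (n + h)%N.
Proof. by elim: k a n => //= k IH a n; rewrite -(IH (fun m => a m.+1 - a m)). Qed.

Lemma diffS k a n : diff k.+1 a n = diff k a n.+1 - diff k a n.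
Proof.
rewrite /= diffB; congr (_ - _); rewrite -[n.+1]addn1 -diff_shift.
by congr diff; apply/funext => m; rewrite addn1.
Qed.

Lemma diff_shiftB k a h n :
  diff k (fun m => a (m + h)%N - a m) n = \sum_(i < h) diff k.+1 a (n + i)%N.
Proof.
rewrite diffB diff_shift; elim: h => [|h IH]; first by rewrite addn0 subrr big_ord0.
transitivity (\sum_(i < h) diff k.+1 a (n + i)%N + diff k.+1 a (n + h)%N); last by rewrite big_ord_recr.
by rewrite -IH diffS addnS; ring.
Qed.

Lemma vdc_main_ge0 k : 0 <= vdc_main k.
Proof.
by elim: k => //= k IH; rewrite mulr_ge0 ?exprn_ge0 // addr_ge0 // mulr_ge0 ?exprn_ge0.
Qed.

Lemma vdc_tail_ge0 k : 0 <= vdc_tail k.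
Proof. by elim: k => //= k IH; rewrite mulr_ge0 ?exprn_ge0. Qed.

(** The bookkeeping of one differencing step with q + 1 = 2^k: E and F are the constants of order k,
    m and h stand for M and H, and lk and l for the k-th and first powers of the harmonic sum. *)
Lemma vdc_algebra (m h E F lk l lam : R) q : h != 0 -> lam != 0 ->
  (2 * m / h) ^+ q.+1 * (2 ^+ q * (m ^+ q.+1 + 2 ^+ q.+1 *
     (h ^+ q * (h * (E * (m ^+ q.+1 / h ^+ q.+1)) + F * (m ^+ q * lk / (lam * h ^+ q.*2)) * l)))) =
  2 ^+ q.+1.*2.-1 * (1 + 2 ^+ q.+1 * E) * (m ^+ q.+1.*2 / h ^+ q.+1) +
  2 ^+ (3 * q.+1).-1 * F * (m ^+ q.+1.*2.-1 * (l * lk) / (lam * h ^+ q.+1.*2.-1)).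
Proof.
move=> h0 l0.
have -> : (q.+1.*2.-1 = (q + q).+1)%N by lia.
have -> : (q.+1.*2 = (q + q).+2)%N by lia.
have -> : ((3 * q.+1).-1 = (q + q + q).+2)%N by lia.
rewrite -addnn !exprMn !exprVn !exprS !exprD.
have hq : h ^+ q != 0 by rewrite expf_neq0.
by move: (h ^+ q) hq (m ^+ q) (2 ^+ q) => v v0 u t; field; rewrite h0 v0 l0.
Qed.

(* One differencing step with shifts below [H] is followed by steps with shifts below
   [H^2], [H^4] and so on. *)
Lemma vdc k a lam Lam L M H : (L <= M)%N -> (0 < H)%N -> (H ^ (2 ^ k)./2 <= M)%N -> 0 < lam -> 0 <= Lam ->
  (forall n, (n < L)%N -> lam <= diff k.+1 a n <= Lam) ->
  (forall n, (n < L)%N -> diff k.+2 a n <= 0) ->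
  Lam * H%:R ^+ (2 ^ k).-1 <= 1 ->
  cabs (\sum_(n < L) cis (a n)) ^+ (2 ^ k) <=
  vdc_main k * (M%:R ^+ (2 ^ k) / H%:R ^+ (2 ^ k)./2) +
  vdc_tail k * (M%:R ^+ (2 ^ k).-1 * harm R M ^+ k / (lam * H%:R ^+ (2 ^ k).-1)).
Proof.
elim: k a lam Lam L H => [|k IH] a lam Lam L H LM H0 HM l0 L0 H1 H2 HL.
  rewrite /= mul0r add0r !expr0 expr1 !mulr1 mul1r; apply: kusmin_landau => // n nL.
    by have /andP[-> u] := H1 n nL; apply: (le_trans u); rewrite expr0 mulr1 in HL.
  by have := H2 n nL; rewrite /= subr_le0.
set p := (2 ^ k)%N in IH *.
have p0 : (0 < p)%N by rewrite expn_gt0.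
have E2 : (2 ^ k.+1 = p.*2)%N by rewrite expnS mul2n.
rewrite E2 doubleK in HM HL *.
have H0' : 0 < H%:R :> R by rewrite ltr0n.
have HM1 : (H <= M)%N by apply: leq_trans HM; rewrite -{1}[H]expn1 leq_pexp2l.
have M0 : (0 < M)%N by apply: leq_trans HM1.
have M0' : 0 < M%:R :> R by rewrite ltr0n.
have hM := harm_ge0 R M.
set S := \sum_(n < L) cis (a n).
pose X h := cabs (shifted_corr (fun n => cis (a n)) L h).
have X0 h : 0 <= X h by exact: cabs_ge0.
(* B and D / h are the two terms of the bound of order k for the sum with shift h, where lam becomes
   h lam and H becomes H^2. Summing D / h over h produces the next harmonic factor. *)
pose B : R := vdc_main k * (M%:R ^+ p / H%:R ^+ p).
pose D : R := vdc_tail k * (M%:R ^+ p.-1 * harm R M ^+ k / (lam * H%:R ^+ p.-1.*2)).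
have Xb h : (0 < h < H)%N -> X h ^+ p <= B + D / h%:R.
  move=> /andP[h0 hH]; have h0' : 0 < h%:R :> R by rewrite ltr0n.
  have -> : X h = cabs (\sum_(n < L - h) cis (a (n + h)%N - a n)).
    by rewrite /X /shifted_corr; congr cabs; apply: eq_bigr => n _; rewrite cisD cisN.
  have nh n (i : 'I_h) : (n < L - h)%N -> (n + i < L)%N by have := ltn_ord i; lia.
  have hr1 n : (n < L - h)%N -> h%:R * lam <= diff k.+1 (fun m => a (m + h)%N - a m) n <= h%:R * Lam.
    move=> nL; rewrite diff_shiftB; apply/andP; split.
      have -> : h%:R * lam = \sum_(i < h) lam by rewrite sumr_const card_ord mulr_natl.
      apply: ler_sum => i _.
      by have /andP[] := H1 _ (nh n i nL).
    have -> : h%:R * Lam = \sum_(i < h) Lam by rewrite sumr_const card_ord mulr_natl.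
    apply: ler_sum => i _.
    by have /andP[] := H1 _ (nh n i nL).
  have hr2 n : (n < L - h)%N -> diff k.+2 (fun m => a (m + h)%N - a m) n <= 0.
    move=> nL; rewrite diff_shiftB; apply: sumr_le0 => i _; apply: H2; exact: nh.
  have Hcond : ((H ^ 2) ^ p./2 <= M)%N.
    apply: leq_trans HM; rewrite -expnM leq_pexp2l // mul2n.
    by have := odd_double_half p; lia.
  have Lcond : h%:R * Lam * (H ^ 2)%:R ^+ p.-1 <= 1.
    apply: le_trans HL; rewrite natrX -exprM mul2n.
    have -> : (p.*2.-1 = p.-1.*2.+1)%N by lia.
    rewrite exprS mulrCA mulrA ler_wpM2r ?exprn_ge0 ?(ltW H0') // mulrC.
    by rewrite mulrC ler_wpM2r // ler_nat ltnW.
  have Lh : (L - h <= M)%N by lia.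
  have H20 : (0 < H ^ 2)%N by rewrite expn_gt0 H0.
  have := IH _ (h%:R * lam) (h%:R * Lam) _ (H ^ 2)%N Lh H20 Hcond (mulr_gt0 h0' l0) (mulr_ge0 (ltW h0') L0) hr1 hr2 Lcond.
  move/le_trans; apply; apply: lerD.
    (* For k = 0 the exponents [p./2.*2] and [p] differ, but the term has the factor [vdc_main 0] =
       0. *)
    rewrite /B natrX -exprM mul2n; have [k0|k0] := posnP k.
      by rewrite [vdc_main k](_ : _ = 0) ?mul0r // k0.
    have -> : (p./2.*2 = p)%N by rewrite /p -(prednK k0) expnS mul2n doubleK.
    by [].
  rewrite natrX -exprM mul2n /D le_eqVlt; apply/orP; left; apply/eqP.
  by field; rewrite !lt0r_neq0 ?exprn_gt0.
have SX : (\sum_(1 <= h < H) X h) ^+ p <= H%:R ^+ p.-1 * (H%:R * B + D * harm R M).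
  rewrite -{1}(prednK H0) big_add1 /= big_mkord.
  have := sum_power_mean k (H.-1) (x := fun i => X i.+1) (fun i => X0 i.+1).
  move/le_trans; apply; apply: ler_pM; rewrite ?exprn_ge0 ?sumr_ge0 //.
  - by move=> i _; rewrite exprn_ge0.
  - by rewrite lerXn2r ?nnegrE ?(ltW H0') // ler_nat; lia.
  apply: (@le_trans _ _ (\sum_(i < H.-1) (B + D / i.+1%:R))).
    by apply: ler_sum => i _; apply: Xb; have := ltn_ord i; lia.
  have B0 : 0 <= B by rewrite mulr_ge0 ?vdc_main_ge0 ?divr_ge0 ?exprn_ge0 ?(ltW H0') ?(ltW M0').
  have D0 : 0 <= D.
    by rewrite mulr_ge0 ?vdc_tail_ge0 ?divr_ge0 ?mulr_ge0 ?exprn_ge0 ?(ltW H0') ?(ltW M0') ?(ltW l0).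
  rewrite big_split /= sumr_const card_ord -[B *+ _]mulr_natl -mulr_sumr; apply: lerD.
    by rewrite ler_wpM2r // ler_nat; lia.
  rewrite ler_wpM2l // /harm big_add1 /= -(big_mkord xpredT (fun i => i.+1%:R^-1)).
  rewrite [leRHS](big_cat_nat (n := H.-1)) //=; last by lia.
  by rewrite lerDl; apply: sumr_ge0 => i _; rewrite invr_ge0.
have A := van_der_corput_ineq (H := H) (L := L) (M := M) (z := fun n => cis (a n)).
have {}A := A _ LM (fun n => cabs_cis _).
have {}A : cabs S ^+ 2 <= 2 * M%:R / H%:R * (M%:R + 2 * \sum_(1 <= h < H) X h) by apply: A; rewrite H0.
set Y := \sum_(1 <= h < H) X h in A SX.
have Y0 : 0 <= Y by apply: sumr_ge0.
rewrite -mul2n exprM; apply: (@le_trans _ _ ((2 * M%:R / H%:R * (M%:R + 2 * Y)) ^+ p)).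
  by rewrite lerXn2r ?nnegrE ?exprn_ge0 ?cabs_ge0 // mulr_ge0 ?divr_ge0 ?mulr_ge0 ?addr_ge0 ?mulr_ge0 // ltW.
have T2 : (2 * M%:R / H%:R) ^+ p * (M%:R + 2 * Y) ^+ p <=
   (2 * M%:R / H%:R) ^+ p * (2 ^+ p.-1 * (M%:R ^+ p + 2 ^+ p * (H%:R ^+ p.-1 * (H%:R * B + D * harm R M)))).
  rewrite ler_wpM2l ?exprn_ge0 ?divr_ge0 ?mulr_ge0 ?(ltW M0') ?(ltW H0') //.
  apply: (le_trans (expr_add_le k _ _)); rewrite ?(ltW M0') ?mulr_ge0 //.
  by rewrite ler_wpM2l ?exprn_ge0 // lerD2l exprMn ler_wpM2l ?exprn_ge0.
rewrite exprMn; apply: (le_trans T2); rewrite le_eqVlt; apply/orP; left; apply/eqP.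
rewrite /B /D /= -/p.
rewrite exprS; move: (p) p0 => [|q] // _.
by rewrite !mul2n; apply: vdc_algebra; rewrite ?lt0r_neq0.
Qed.

End VanDerCorput.

(** * Differences of the logarithm and the sums of n^(i u) over a block *)

Section LogDifferences.
Variable R : realType.
Implicit Types (F : nat -> R -> R) (k n m M : nat) (x y : R).

(** Induction with the differences F j (x + 1) - F j x in place of F j; the last difference is
    resolved by the mean value theorem. *)
Lemma diff_mean_value k F (t : R) n : 0 < t + n%:R ->
  (forall j x, (j < k)%N -> 0 < x -> is_derive x 1 (F j) (F j.+1 x)) ->
  exists2 xi : R, t + n%:R <= xi <= t + n%:R + k%:R & diff k (fun m => F 0%N (t + m%:R)) n = F k xi.
Proof.
elim: k F => [|k IH] F t0 dF; first by exists (t + n%:R); rewrite ?lexx ?addr0 ?lexx.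
have [j x jk x0|xi /andP[x1 x2] E] := IH (fun j x => F j (x + 1) - F j x) t0.
  move: (dF j x (leqW jk) x0) => d1; have x10 : 0 < x + 1 by rewrite addr_gt0.
  have d2 := dF j (x + 1) (leqW jk) x10.
  have did : is_derive x 1 (fun y : R => y + 1) 1.
    by refine (is_derive_eq (is_deriveD (is_derive_id x 1) (is_derive_cst (1 : R) x 1)) _); rewrite addr0.
  by refine (is_derive_eq (is_deriveB (is_derive_comp (f := F j) (g := fun y => y + 1) d2 did) d1) _); rewrite mulr1.
have xi0 : 0 < xi by apply: lt_le_trans x1.
have [||y /andP[y1 y2] Ey] := @mean_value R (F k) (F k.+1) xi (xi + 1).
- by rewrite ltrDl.
- by move=> y /andP[y1 _]; apply: dF => //; apply: lt_le_trans y1.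
exists y.
  by rewrite -natr1; apply/andP; split; lra.
have e1 : xi + 1 - xi = 1 by rewrite addrC addKr.
rewrite e1 mulr1 in Ey; rewrite -Ey -E /=; congr diff.
by apply/funext => m; rewrite -natr1 addrA.
Qed.

Definition ln_deriv j x : R := if j is j'.+1 then (-1) ^+ j' * j'`!%:R * x^-1 ^+ j else ln x.

Lemma is_derive_ln_deriv j x : 0 < x -> is_derive x 1 (ln_deriv j) (ln_deriv j.+1 x).
Proof.
move=> x0; case: j => [|j] /=.
  by refine (is_derive_eq (is_derive1_ln x0) _); rewrite /= expr0 fact0 !mul1r expr1.
have dinv : is_derive x 1 (fun y : R => y^-1) (- x^-1 ^+ 2).
  by refine (is_derive_eq (is_deriveV (lt0r_neq0 x0) (is_derive_id x 1)) _); rewrite /= exprVn scaleNr; congr (- _); exact: mulr1.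
have dX m : is_derive x 1 (fun y : R => y^-1 ^+ m.+1) (m.+1%:R * x^-1 ^+ m * - x^-1 ^+ 2).
  elim: m => [|m IH]; first by refine (is_derive_eq dinv _); rewrite expr0 !mul1r.
  have := is_derive_mul dinv IH; have -> : (fun t : R => t^-1 * t^-1 ^+ m.+1) = (fun y => y^-1 ^+ m.+2).
    by apply/funext => y; rewrite -exprS.
  move/is_derive_eq; apply.
  by rewrite -[m.+2%:R]natr1 !exprS; ring.
refine (is_derive_eq (is_derive_scale _ (dX j)) _).
rewrite factS natrM !exprS; ring.
Qed.

(** The derivative of order k + 1 of ln has the sign (-1)^k, so the factor (-1)^k makes this
    difference positive and the next one negative, as [vdc] requires. *)
Lemma diff_ln k (u : R) M n : (0 < M)%N -> exists2 xi : R, (M + n)%:R <= xi <= (M + n + k.+1)%:R &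
  diff k.+1 (fun m => (-1) ^+ k * (u * ln (M + m)%:R)) n = u * k`!%:R * xi^-1 ^+ k.+1.
Proof.
move=> M0; have M0' : 0 < M%:R + n%:R :> R by rewrite -natrD ltr0n addn_gt0 M0.
have [j x _ x0|xi xb E] := @diff_mean_value k.+1 (fun j x => (-1) ^+ k * u * ln_deriv j x) M%:R n M0'.
  by apply: is_derive_scale; exact: is_derive_ln_deriv.
exists xi; first by rewrite !natrD.
rewrite (_ : (fun m => _) = (fun m => (-1) ^+ k * u * ln_deriv 0 (M%:R + m%:R))); last first.
  by apply/funext => m; rewrite /= natrD mulrA.
rewrite E /= !mulrA; congr (_ * _ * _).
by rewrite mulrAC -exprD addnn -mul2n exprM sqrrN !expr1n mul1r.
Qed.

Lemma diff_lnS k (u : R) M n : (0 < M)%N -> 0 <= u ->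
  diff k.+2 (fun m => (-1) ^+ k * (u * ln (M + m)%:R)) n <= 0.
Proof.
move=> M0 u0; have [xi /andP[x1 _] E] := diff_ln k.+1 u n M0.
have xi0 : 0 <= xi by apply: le_trans x1; rewrite ler0n.
rewrite (_ : (fun m => _) = (fun m => 0 - (-1) ^+ k.+1 * (u * ln (M + m)%:R))); last first.
  by apply/funext => m; rewrite exprS; ring.
rewrite diffB E; have -> : diff k.+2 (fun=> 0) n = 0 :> R.
  by elim: (k.+2) => //= j <-; congr diff; apply/funext => m; rewrite subrr.
by rewrite sub0r oppr_le0; apply: mulr_ge0; [exact: mulr_ge0|apply: exprn_ge0; rewrite invr_ge0].
Qed.

Lemma cabs_sum_cisN L (a : nat -> R) : cabs (\sum_(n < L) cis (- a n)) = cabs (\sum_(n < L) cis (a n)).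
Proof. by rewrite -cabsJ rmorph_sum; congr cabs; apply: eq_bigr => n _; rewrite cisN; exact: conjcK. Qed.

Lemma log_sum_bound k M L H (u : R) : (0 < M)%N -> (L <= M)%N -> (k <= M)%N -> 0 < u -> (0 < H)%N ->
  (H ^ (2 ^ k)./2 <= M)%N -> u * k`!%:R * H%:R ^+ (2 ^ k).-1 <= M%:R ^+ k.+1 ->
  cabs (\sum_(n < L) cis (u * ln (M + n)%:R)) ^+ (2 ^ k) <=
  vdc_main R k * (M%:R ^+ (2 ^ k) / H%:R ^+ (2 ^ k)./2) +
  vdc_tail R k * (M%:R ^+ (2 ^ k).-1 * harm R M ^+ k * (3 * M%:R) ^+ k.+1 / (u * k`!%:R * H%:R ^+ (2 ^ k).-1)).
Proof.
move=> M0 LM kM u0 H0 HM HL.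
have M0' : 0 < M%:R :> R by rewrite ltr0n.
have f0 : 0 < k`!%:R :> R by rewrite ltr0n fact_gt0.
have H0' : 0 < H%:R :> R by rewrite ltr0n.
pose a n := (-1) ^+ k * (u * ln (M + n)%:R).
have -> : cabs (\sum_(n < L) cis (u * ln (M + n)%:R)) = cabs (\sum_(n < L) cis (a n)).
  rewrite /a -signr_odd; case: odd; last by congr cabs; apply: eq_bigr => n _; rewrite expr0 mul1r.
  by rewrite -(cabs_sum_cisN L (fun n => u * ln (M + n)%:R)); congr cabs; apply: eq_bigr => n _; rewrite expr1 mulN1r.
(* The intermediate point is at most M + n + k + 1 <= 3 M, because n < L <= M and k <= M. *)
pose lam := u * k`!%:R / (3 * M%:R) ^+ k.+1; pose Lam := u * k`!%:R / M%:R ^+ k.+1.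
have l0 : 0 < lam by rewrite divr_gt0 ?exprn_gt0 ?mulr_gt0.
have L0 : 0 <= Lam by rewrite divr_ge0 ?exprn_ge0 ?mulr_ge0 // ltW.
have h1 n : (n < L)%N -> lam <= diff k.+1 a n <= Lam.
  move=> nL; have [xi /andP[x1 x2] ->] := diff_ln k u n M0.
  have Mx : M%:R <= xi by apply: le_trans x1; rewrite ler_nat leq_addr.
  have xM : xi <= 3 * M%:R by apply: (le_trans x2); rewrite -natrM ler_nat; move: (leq_trans nL LM) kM; clear; lia.
  have xi0 : 0 < xi by apply: lt_le_trans Mx.
  rewrite /lam /Lam exprVn; apply/andP; split.
    by rewrite ler_wpM2l ?mulr_ge0 ?(ltW u0) // lef_pV2 ?posrE ?exprn_gt0 ?mulr_gt0 // lerXn2r ?nnegrE ?mulr_ge0 ?(ltW xi0) ?(ltW M0').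
  by rewrite ler_wpM2l ?mulr_ge0 ?(ltW u0) // lef_pV2 ?posrE ?exprn_gt0 // lerXn2r ?nnegrE ?(ltW xi0) ?(ltW M0').
have h2 n : (n < L)%N -> diff k.+2 a n <= 0 by move=> _; apply: diff_lnS => //; exact: ltW.
have h3 : Lam * H%:R ^+ (2 ^ k).-1 <= 1 by rewrite mulrAC ler_pdivrMr ?exprn_gt0 // mul1r.
apply: (le_trans (vdc LM H0 HM l0 L0 h1 h2 h3)); rewrite lerD2l le_eqVlt; apply/orP; left; apply/eqP.
by rewrite /lam; congr (_ * _); field; rewrite !lt0r_neq0 ?exprn_gt0 ?mulr_gt0.
Qed.

Definition vdc_const k : R := vdc_main R k + vdc_tail R k * 3 ^+ k.+1 * 2 ^+ (2 ^ k).-1.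

Lemma vdc_const1 : vdc_const 1 <= 333 ^+ (2 ^ 1)./2.
Proof. by rewrite /vdc_const /= !exprS !expr0; lra. Qed.
Lemma vdc_const2 : vdc_const 2 <= 333 ^+ (2 ^ 2)./2.
Proof. by rewrite /vdc_const /= !exprS !expr0; lra. Qed.
Lemma vdc_const3 : vdc_const 3 <= 333 ^+ (2 ^ 3)./2.
Proof. by rewrite /vdc_const /= !exprS !expr0; lra. Qed.

Lemma harm_ge1 M : (0 < M)%N -> 1 <= harm R M.
Proof. by case: M => // M _; have := @harm_lower R 0 M.+1 isT; rewrite /harm big_nat_recl //= invr1 lerDl => _; apply: sumr_ge0 => i _; rewrite invr_ge0. Qed.

(** H is the integer part of exp h, where exp ((2^k - 1) h) = M^(k + 1) / (u k!) is the largest size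
    for which the last differences stay below 1. The second term of [log_sum_bound] is then of the
    size of the first up to constants and harmonic factors, and a root of order 2^(k - 1) leaves the
    square of the sum. The 2 in 666 = 2 * 333 pays for rounding H down. *)
Lemma log_sum_sqr k M L (u : R) (h := (k.+1%:R * ln M%:R - ln u - ln k`!%:R) / (2 ^ k).-1%:R) :
  (0 < k)%N -> vdc_const k <= 333 ^+ (2 ^ k)./2 ->
  (0 < M)%N -> (L <= M)%N -> (k <= M)%N -> 0 < u ->
  0 <= h -> h * ((2 ^ k)./2)%:R <= ln M%:R ->
  cabs (\sum_(n < L) cis (u * ln (M + n)%:R)) ^+ 2 <= 666 * harm R M * M%:R ^+ 2 * expR (- h).
Proof.
move=> k0 Ck M0 LM kM u0 h0 hM.
set p := (2 ^ k)%N in h h0 hM Ck *.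
have p2 : (1 < p)%N by rewrite /p -(prednK k0) expnS; have := expn_gt0 2 k.-1; lia.
have pe : (p./2.*2 = p)%N by rewrite /p -(prednK k0) expnS mul2n doubleK.
have q0 : (0 < p./2)%N by lia.
have kq : (k <= p./2)%N.
  by rewrite /p -(prednK k0) expnS mul2n doubleK; apply: ltn_expl.
have M0' : 0 < M%:R :> R by rewrite ltr0n.
have f0 : 0 < k`!%:R :> R by rewrite ltr0n fact_gt0.
have p1 : 0 < p.-1%:R :> R by rewrite ltr0n; lia.
set S := \sum_(n < L) _.
have e1 : 1 <= expR h by rewrite -expR0 ler_expR.
pose H := Num.truncn (expR h).
have /andP[HE1 HE2] : H%:R <= expR h < H.+1%:R by apply: truncn_itv; exact: expR_ge0.
have H0 : (0 < H)%N by rewrite truncn_gt0.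
have H0' : 1 <= H%:R :> R by rewrite ler1n.
have HE3 : expR h <= 2 * H%:R by move: HE2; rewrite -natr1; lra.
have eM : expR h ^+ p.-1 = M%:R ^+ k.+1 / (u * k`!%:R).
  rewrite -expRM_natl /h mulrC divfK ?lt0r_neq0 // -addrA -opprD -lnM ?posrE //.
  rewrite expRD expRN lnK ?posrE ?mulr_gt0 // mulr_natl -lnXn // lnK ?posrE ?exprn_gt0 //.
have HM : (H ^ p./2 <= M)%N.
  rewrite -(ler_nat R) natrX; apply: (@le_trans _ _ (expR h ^+ p./2)).
    by rewrite lerXn2r ?nnegrE ?expR_ge0.
  by rewrite -expRM_natl mulrC -[leRHS]lnK ?posrE // ler_expR.
have uf : 0 < u * k`!%:R by rewrite mulr_gt0.
have HL : u * k`!%:R * H%:R ^+ p.-1 <= M%:R ^+ k.+1.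
  rewrite mulrC -ler_pdivlMr // -eM lerXn2r ?nnegrE ?expR_ge0 //.
have B := log_sum_bound M0 LM kM u0 H0 HM HL.
have l1 := harm_ge1 M0; set l := harm R M in l1 B *.
have c0 : 0 <= 333 * l by apply: mulr_ge0; [exact: ler0n|exact: le_trans ler01 l1].
have B2 : cabs S ^+ p <= M%:R ^+ p * (333 * l / H%:R) ^+ p./2.
  apply: (le_trans B).
  have Hp : 0 < H%:R ^+ p./2 :> R by rewrite exprn_gt0 // ltr0n.
  have Hp1 : 0 < H%:R ^+ p.-1 :> R by rewrite exprn_gt0 // ltr0n.
  have lp : 1 <= l ^+ p./2 by rewrite exprn_ege1.
  have t1 : vdc_main R k * (M%:R ^+ p / H%:R ^+ p./2) <= vdc_main R k * (M%:R ^+ p * l ^+ p./2 / H%:R ^+ p./2).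
    rewrite ler_wpM2l ?vdc_main_ge0 // ler_wpM2r ?invr_ge0 ?(ltW Hp) //.
    by rewrite ler_peMr // exprn_ge0 // ltW.
  have t2 : M%:R ^+ p.-1 * l ^+ k * (3 * M%:R) ^+ k.+1 / (u * k`!%:R * H%:R ^+ p.-1) <=
      3 ^+ k.+1 * 2 ^+ p.-1 * (M%:R ^+ p * l ^+ p./2 / H%:R ^+ p./2).
    have -> : M%:R ^+ p.-1 * l ^+ k * (3 * M%:R) ^+ k.+1 / (u * k`!%:R * H%:R ^+ p.-1) =
       3 ^+ k.+1 * M%:R ^+ p.-1 * l ^+ k * (expR h ^+ p.-1 / H%:R ^+ p.-1).
      by rewrite eM exprMn; field; rewrite !lt0r_neq0.
    have r2 : expR h ^+ p.-1 / H%:R ^+ p.-1 <= 2 ^+ p.-1.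
      by rewrite ler_pdivrMr // -exprMn lerXn2r ?nnegrE ?expR_ge0 ?mulr_ge0.
    have r3 : l ^+ k <= l ^+ p./2 by rewrite ler_weXn2l.
    have r4 : M%:R ^+ p.-1 <= M%:R ^+ p / H%:R ^+ p./2 :> R.
      rewrite ler_pdivlMr // -[X in _ <= _ ^+ X](prednK (ltnW p2)) exprSr ler_wpM2l ?exprn_ge0 //.
      by rewrite -natrX ler_nat.
    apply: (@le_trans _ _ (3 ^+ k.+1 * (M%:R ^+ p / H%:R ^+ p./2) * l ^+ p./2 * 2 ^+ p.-1)).
      have l0 : 0 <= l by lra.
      apply: ler_pM; rewrite ?mulr_ge0 ?divr_ge0 ?exprn_ge0 ?expR_ge0 //.
      apply: ler_pM; rewrite ?mulr_ge0 ?exprn_ge0 //.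
      by rewrite ler_wpM2l ?exprn_ge0.
    by rewrite le_eqVlt; apply/orP; left; apply/eqP; field; rewrite !lt0r_neq0.
  apply: (le_trans (lerD t1 (ler_wpM2l (vdc_tail_ge0 R k) t2))).
  set Z := M%:R ^+ p * l ^+ p./2 / H%:R ^+ p./2.
  have -> : M%:R ^+ p * (333 * l / H%:R) ^+ p./2 = 333 ^+ p./2 * Z by rewrite /Z !exprMn exprVn; ring.
  have Z0 : 0 <= Z by rewrite divr_ge0 ?mulr_ge0 ?exprn_ge0 // (le_trans ler01 l1).
  rewrite (_ : _ + _ = vdc_const k * Z); last by rewrite /vdc_const -/p; ring.
  by rewrite ler_wpM2r.
have B3 : cabs S ^+ 2 <= M%:R ^+ 2 * (333 * l / H%:R).
  have x0 : 0 <= M%:R ^+ 2 * (333 * l / H%:R) by apply: mulr_ge0; [apply: exprn_ge0; exact: ler0n|apply: divr_ge0; [exact: c0|exact: ler0n]].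
  rewrite -(ler_pXn2r q0) ?nnegrE ?exprn_ge0 ?cabs_ge0 //.
  by rewrite -exprM mul2n pe exprMn -[X in _ <= X * _]exprM mul2n pe.
apply: (le_trans B3).
have -> : 666 * l * M%:R ^+ 2 * expR (- h) = M%:R ^+ 2 * (333 * l * (2 * expR (- h))) by ring.
apply: ler_wpM2l; first by apply: exprn_ge0; exact: ler0n.
apply: (ler_wpM2l c0).
rewrite expRN -[2]invrK -invfM lef_pV2 ?posrE ?ltr0n //; last by rewrite mulr_gt0 ?expR_gt0 ?invr_gt0.
by rewrite ler_pdivrMl.
Qed.

End LogDifferences.

(** * The best order of differencing, and its effect on the approximation of zeta *)

Section BlockBound.
Variable R : realType.
Implicit Types (M L N n k m : nat).

Lemma ln6_le : ln 6 <= 61 / 25 :> R.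
Proof.
have := @harm_lower R 3 7 isT; rewrite /harm /index_iota /= !big_cons !big_nil => h.
have e8 : ln 8 = 3 * ln 2 :> R by rewrite mulr_natl -lnXn // -natrX.
have e4 : ln 4 = 2 * ln 2 :> R by rewrite mulr_natl -lnXn // -natrX.
have e6 : ln 6 = 2 * ln 2 + ln (1 + 1 / 2) :> R.
  have p0 : (0 : R) < 1 + 1 / 2 by lra.
  by rewrite (_ : 6 = 4 * (1 + 1 / 2) :> R) ?lnM ?posrE ?e4 //; lra.
have h2 : ln (1 + 1 / 2) <= 1 / 2 :> R by apply: le_ln1Dx; lra.
by rewrite e8 e4 in h; rewrite e6; lra.
Qed.

(** 61/175 covers the loss ln k! / (2^k - 1) for k = 1, 2, 3, and 666 / (1 - 61/175) < 1024. *)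
Lemma exp_sum_saving_aux (l m P h S : R) : 0 <= l -> 0 <= S -> 0 < m -> P - 61 / 175 <= h ->
  S ^+ 2 <= 666 * l * m ^+ 2 * expR (- h) -> S ^+ 2 <= 1024 * l * m ^+ 2 * expR (- P).
Proof.
move=> l0 S0 m0 hP /le_trans; apply.
have -> : 1024 * l * m ^+ 2 * expR (- P) = l * m ^+ 2 * (1024 * expR (- P)) by ring.
have -> : 666 * l * m ^+ 2 * expR (- h) = l * m ^+ 2 * (666 * expR (- h)) by ring.
apply: ler_wpM2l; first by rewrite mulr_ge0 // exprn_ge0 // ltW.
have eP := expR_gt0 (- P).
have : expR (- h) <= expR (61 / 175) * expR (- P) by rewrite -expRD ler_expR; lra.
have e1 : expR (61 / 175) * (1 - 61 / 175) <= 1 :> R.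
  have := expR_ge1Dx (- (61 / 175) : R); rewrite expRN => h1.
  have e0 := expR_gt0 (61 / 175 : R).
  by have := ler_wpM2l (ltW e0) h1; rewrite mulfV ?lt0r_neq0.
by move: (expR (61 / 175)) e1 => c; nra.
Qed.

Let best_saving (x y P : R) := [\/ P <= 2 * x - y, 3 * P <= 3 * x - y | 7 * P <= 4 * x - y].

(** This and the next two lemmas: where order k is the best of the three, an admissible P is bounded
    by the saving of order k whichever alternative it satisfies. With x = ln M and y = ln u, the
    orders 1 and 2 meet at y = 3 x / 2, the orders 2 and 3 at y = 9 x / 4. *)
Lemma saving_order1 (x y P : R) : best_saving x y P -> x < y -> 2 * y <= 3 * x ->
  [/\ P - 61 / 175 <= 2 * x - y, 0 <= 2 * x - y & 2 * x - y <= x].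
Proof. by move=> b ? ?; split; case: b => ?; lra. Qed.

Lemma saving_order2 (x y P l : R) : best_saving x y P -> 3 * x < 2 * y -> 4 * y <= 9 * x -> 1 <= P ->
  3 / 5 <= l <= 1 ->
  [/\ P - 61 / 175 <= (3 * x - y - l) / 3, 0 <= (3 * x - y - l) / 3 & (3 * x - y - l) / 3 * 2 <= x].
Proof. by move=> b ? ? ? /andP[? ?]; split; case: b => ?; lra. Qed.

Lemma saving_order3 (x y P l : R) : best_saving x y P -> 0 <= x -> 9 * x < 4 * y -> 1 <= P -> 0 <= l <= 61 / 25 ->
  [/\ P - 61 / 175 <= (4 * x - y - l) / 7, 0 <= (4 * x - y - l) / 7 & (4 * x - y - l) / 7 * 4 <= x].
Proof. by move=> b ? ? ? /andP[? ?]; split; case: b => ?; lra. Qed.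

(* The saving exponent D / 2 is that of the first, second and third applications of the
   differencing step, whichever is best for u = M^tau. *)
Lemma exp_sum_saving M L (u D tau : R) : (3 <= M)%N -> (L <= M)%N -> 0 < u ->
  M%:R <= u ^+ 2 -> ln u <= tau * ln M%:R -> D <= 1 -> 1 <= D * ln M%:R ->
  [\/ D <= 2 - tau, 3 * D <= 3 - tau | 7 * D <= 4 - tau] ->
  cabs (\sum_(n < L) cis (u * ln (M + n)%:R)) ^+ 2 <= 1024 * harm R M * M%:R ^+ 2 * expR (- (D * ln M%:R)).
Proof.
move=> M3 LM u0 Mu ut D1 Dx Dt.
have M0 : (0 < M)%N by apply: leq_trans M3.
have M0' : 0 < M%:R :> R by rewrite ltr0n.
have l1 := harm_ge1 R M0; have l0 : 0 <= harm R M by apply: le_trans l1.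
have f1 : ln 1`!%:R = 0 :> R by exact: ln1.
have f2 : ln 2`!%:R = ln 2 :> R by [].
have f3 : ln 3`!%:R = ln 6 :> R by [].
have l6 := ln6_le; have l2 := ln2_le R; have l20 := ln2_ge R.
have xy : ln M%:R <= 2 * ln u by rewrite mulr_natl -lnXn // ler_ln ?posrE ?exprn_gt0.
set x := ln M%:R in ut Dx xy *.
have x0 : 0 <= x by rewrite ln_ge0 // ler1n.
set S := cabs _; have S0 : 0 <= S by exact: cabs_ge0.
have Dt' : [\/ D * x <= 2 * x - ln u, 3 * (D * x) <= 3 * x - ln u | 7 * (D * x) <= 4 * x - ln u].
  case: Dt => h; [apply: Or31|apply: Or32|apply: Or33]; have := ler_wpM2r x0 h; lra.
have Dx1 : D * x <= x by rewrite ler_piMl.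
have [yx|xy1] := leP (ln u) x.
  apply: (@exp_sum_saving_aux _ _ _ x) => //; first by lra.
  have h1 : u * 0`!%:R * 1%:R ^+ (2 ^ 0).-1 <= M%:R ^+ 1.
    by rewrite expr0 expr1 fact0 !mulr1 -ler_ln ?posrE.
  have := @log_sum_bound R 0 M L 1 u M0 LM isT u0 isT M0 h1.
  rewrite /= expr1 !expr0 mul0r add0r fact0 expr1 !mulr1 !mul1r -/S => hS.
  have eM : expR (- x) = M%:R^-1 by rewrite expRN lnK ?posrE.
  rewrite eM; have -> : 666 * harm R M * M%:R ^+ 2 / M%:R = 666 * harm R M * M%:R.
    by field; rewrite lt0r_neq0.
  apply: (@le_trans _ _ ((4 * (3 * M%:R / u)) ^+ 2)).
    have c0 : 0 <= 4 * (3 * M%:R / u) by rewrite mulr_ge0 // divr_ge0 ?(ltW u0) // mulr_ge0.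
    by rewrite lerXn2r.
  have -> : (4 * (3 * M%:R / u)) ^+ 2 = 144 * M%:R ^+ 2 / u ^+ 2 by field; rewrite lt0r_neq0.
  rewrite ler_pdivrMr ?exprn_gt0 //.
  have : M%:R * M%:R <= M%:R * u ^+ 2 by rewrite ler_wpM2l // ltW.
  have -> : 666 * harm R M * M%:R * u ^+ 2 = 666 * (harm R M * (M%:R * u ^+ 2)) by ring.
  have : 0 <= M%:R * u ^+ 2 by rewrite mulr_ge0 ?exprn_ge0 // ltW.
  move: (M%:R * u ^+ 2) => q q0 hq; have hl : q <= harm R M * q by rewrite ler_peMl.
  by rewrite expr2; move: (harm R M * q) hl => v hl; lra.
have [y15|y15] := leP (2 * ln u) (3 * x).
  have := @log_sum_sqr R 1 M L u isT (vdc_const1 R) M0 LM M0 u0; rewrite f1 (_ : (2 ^ 1).-1 = 1)%N // (_ : (2 ^ 1)./2 = 1)%N // subr0 divr1 mulr1 -/x -/S.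
  have [a1 a2 a3] := saving_order1 Dt' xy1 y15.
  by move=> H; exact: (exp_sum_saving_aux l0 S0 M0' a1 (H a2 a3)).
have [y22|y22] := leP (4 * ln u) (9 * x).
  have := @log_sum_sqr R 2 M L u isT (vdc_const2 R) M0 LM (ltnW M3) u0; rewrite f2 (_ : (2 ^ 2).-1 = 3)%N // (_ : (2 ^ 2)./2 = 2)%N // -/x -/S.
  have l2b : 3 / 5 <= ln (2 : R) <= 1 by rewrite l20 l2.
  have [a1 a2 a3] := saving_order2 Dt' y15 y22 Dx l2b.
  by move=> H; exact: (exp_sum_saving_aux l0 S0 M0' a1 (H a2 a3)).
have := @log_sum_sqr R 3 M L u isT (vdc_const3 R) M0 LM M3 u0; rewrite f3 (_ : (2 ^ 3).-1 = 7)%N // (_ : (2 ^ 3)./2 = 4)%N // -/x -/S.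
have l6b : 0 <= ln (6 : R) <= 61 / 25 by rewrite l6 ln_ge0 // ler1n.
have [a1 a2 a3] := saving_order3 Dt' x0 y22 Dx l6b.
by move=> H; exact: (exp_sum_saving_aux l0 S0 M0' a1 (H a2 a3)).
Qed.

Lemma sum_by_parts_bound L (f : nat -> R) (b : nat -> R[i]) (B : R) :
  (forall n, 0 <= f n) -> (forall n, (n.+1 < L)%N -> f n.+1 <= f n) ->
  (forall j, (j <= L)%N -> cabs (\sum_(n < j) b n) <= B) ->
  cabs (\sum_(n < L) (f n)%:C * b n) <= f 0%N * B.
Proof.
case: L => [|L] f0 fm bB.
  by rewrite big_ord0 cabs0 mulr_ge0 // (le_trans _ (bB 0%N isT)) // cabs_ge0.
have H j : (j <= L)%N -> \sum_(n < j.+1) (f n)%:C * b n =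
    (f j)%:C * (\sum_(n < j.+1) b n) + \sum_(n < j) (f n - f n.+1)%:C * \sum_(i < n.+1) b i.
  elim: j => [|j IH] jL; first by rewrite !big_ord_recl !big_ord0 /= !addr0.
  have e1 : \sum_(n < j.+2) b n = \sum_(n < j.+1) b n + b j.+1 by rewrite big_ord_recr.
  have e2 : \sum_(n < j.+1) (f n - f n.+1)%:C * \sum_(i < n.+1) b i =
      \sum_(n < j) (f n - f n.+1)%:C * \sum_(i < n.+1) b i + (f j - f j.+1)%:C * \sum_(i < j.+1) b i.
    by rewrite big_ord_recr.
  rewrite big_ord_recr IH ?(ltnW jL) // e1 e2 /= !rmorphB /=; ring.
rewrite H //; apply: (le_trans (cabsD _ _)).
have B0 : 0 <= B by apply: le_trans (bB 0%N isT); exact: cabs_ge0.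
have h1 : cabs ((f L)%:C * (\sum_(n < L.+1) b n)) <= f L * B.
  by rewrite cabsM cabs_real ger0_norm // ler_wpM2l // bB.
have h2 j : (j <= L)%N -> cabs (\sum_(n < j) (f n - f n.+1)%:C * \sum_(i < n.+1) b i) <= (f 0%N - f j) * B.
  elim: j => [|j IH] jL; first by rewrite big_ord0 cabs0 subrr mul0r.
  rewrite big_ord_recr /=; apply: (le_trans (cabsD _ _)).
  have h3 : cabs ((f j - f j.+1)%:C * \sum_(i < j.+1) b i) <= (f j - f j.+1) * B.
    have fj : 0 <= f j - f j.+1 by rewrite subr_ge0 fm.
    by rewrite cabsM cabs_real ger0_norm // ler_wpM2l // bB // ltnW.
  by have := IH (ltnW jL); lra.
by have := h2 L (leqnn L); lra.
Qed.

Lemma zapprox_sub (s : R[i]) M k : zapprox (M + k) s - zapprox M s =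
  \sum_(n < k) cpw (M + n).+1%:R s - pint s M%:R (M + k)%:R.
Proof. by rewrite /zapprox /zsum big_split_ord /= /pint; ring. Qed.

Lemma cpw_cis n (s : R[i]) : cpw n%:R s = (npow (complex.Re s) n)%:C * cis (- (complex.Im s * ln n%:R)).
Proof.
rewrite /cpw /expC /npow /cis ReN ReMr ImN ImMr.
by apply: complex_ext; rewrite /=; ring.
Qed.

Lemma npow_le (a b : R) n : (0 < n)%N -> a <= b -> npow b n <= npow a n.
Proof.
move=> n0 ab; rewrite /npow ler_expR lerN2 ler_wpM2r //; rewrite ln_ge0 // ler1n //.
Qed.

Lemma npow_anti (a : R) m n : (0 < m <= n)%N -> 0 <= a -> npow a n <= npow a m.
Proof.
move=> /andP[m0 mn] a0; rewrite /npow ler_expR lerN2 ler_wpM2l //.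
by rewrite ler_ln ?posrE ?ltr0n ?(leq_trans m0) // ler_nat.
Qed.

Lemma npowD (a b : R) n : npow (a + b) n = npow a n * npow b n.
Proof. by rewrite /npow -expRD; congr expR; ring. Qed.

Lemma npowM (a : R) m n : (0 < m)%N -> (0 < n)%N -> npow a (m * n) = npow a m * npow a n.
Proof. by move=> m0 n0; rewrite /npow natrM lnM ?posrE ?ltr0n // -expRD; congr expR; ring. Qed.

Lemma npow_1r n : (0 < n)%N -> npow 1 n = n%:R^-1 :> R.
Proof. by move=> n0; rewrite /npow mul1r expRN lnK // posrE ltr0n. Qed.

Lemma power_block_sum (s : R[i]) m L (B a kap : R) : (0 < m)%N -> 1 - kap <= complex.Re s -> kap <= 1 ->
  kap <= a -> (L <= m)%N ->
  (forall j, (j <= m)%N -> cabs (\sum_(n < j) cis (`|complex.Im s| * ln (m + n)%:R)) <= B * m%:R * npow a m) ->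
  cabs (\sum_(n < L) cpw (m + n)%:R s) <= B * npow (a - kap) m.
Proof.
move=> m0 s1 k1 ka Lm H.
have s0 : 0 <= complex.Re s by lra.
have H' j : (j <= L)%N -> cabs (\sum_(n < j) cis (- (complex.Im s * ln (m + n)%:R))) <= B * m%:R * npow a m.
  move=> jL; apply: le_trans (H j (leq_trans jL Lm)).
  have [t0|t0] := leP 0 (complex.Im s); first by rewrite ger0_norm // (cabs_sum_cisN j (fun n => complex.Im s * ln (m + n)%:R)).
  rewrite (ler0_norm (ltW t0)); set A := cabs _; set C := cabs _.
  suff -> : C = A by [].
  by congr cabs; apply: eq_bigr => n _; rewrite mulNr.
have e : \sum_(n < L) cpw (m + n)%:R s =
   \sum_(n < L) (npow (complex.Re s) (m + n))%:C * cis (- (complex.Im s * ln (m + n)%:R)).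
  by apply: eq_bigr => n _; exact: cpw_cis.
rewrite e; have := @sum_by_parts_bound L (fun n => npow (complex.Re s) (m + n)) (fun n => cis (- (complex.Im s * ln (m + n)%:R))) _ _ _ H'.
move=> P; apply: (le_trans (P _ _)).
- by move=> n; rewrite ltW // npow_gt0.
- by move=> n _; apply: npow_anti => //; rewrite addnS leqnSn addn_gt0 m0.
have B0 : 0 <= B * m%:R * npow a m by apply: le_trans (H 0%N isT); exact: cabs_ge0.
rewrite addn0; apply: (le_trans (ler_wpM2r B0 (npow_le m0 s1))).
rewrite le_eqVlt; apply/orP; left; apply/eqP.
rewrite (npowD 1) (npowD a) npow_1r //.
have m0' : m%:R != 0 :> R by rewrite pnatr_eq0 -lt0n.
by field.
Qed.

(* Dyadic blocks up to the square of the frequency, the Euler-Maclaurin formula beyond. *)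
Lemma zapprox_dist_saving (s : R[i]) M0 U (B K a kap : R) : (4 <= M0)%N -> s != 1 ->
  1 - kap <= complex.Re s <= 1 -> 0 <= kap -> kap <= a -> a <= 1 / 2 ->
  (complex.Im s) ^+ 2 <= U%:R ->
  (forall m j, (M0 <= m)%N -> (m <= U)%N -> m%:R <= complex.Im s ^+ 2 -> (j <= m)%N ->
    cabs (\sum_(n < j) cis (`|complex.Im s| * ln (m + n)%:R)) <= B * m%:R * npow a m) ->
  8 <= K -> B + 3 + K * npow (a - kap) 2 <= K ->
  forall M k, (M0 <= M)%N -> cabs (zapprox (M + k) s - zapprox M s) <= K * npow (a - kap) M.
Proof.
move=> M04 s1 /andP[sk sle] k0 ka a2 tU H K8 KB M k; elim/ltn_ind: k M => k IH M M0M.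
have M4 : (4 <= M)%N by apply: leq_trans M0M.
have M0' : (0 < M)%N by apply: leq_trans M4.
have Mr : 0 < M%:R :> R by rewrite ltr0n.
set t := complex.Im s in tU H *; pose r : R := expR (ln M%:R / 2).
have r2 : r ^+ 2 = M%:R.
  by rewrite /r -expRM_natl mulrC divfK ?lnK ?posrE // pnatr_eq0.
have r0 : 0 < r by exact: expR_gt0.
have rge : 2 <= r.
  have h : 4 <= r ^+ 2 by rewrite r2 ler_nat.
  by rewrite leNgt; apply/negP => h2; move: h; rewrite expr2; nra.
have nhalf : npow (1 / 2) M = r^-1 by rewrite /npow /r -expRN; congr expR; field.
have npos := npow_gt0 (a - kap) M.
have nle : npow (1 / 2 - kap) M <= npow (a - kap) M by apply: npow_le => //; lra.
(* Beyond t^2 [zapprox_dist] suffices: |s| M^(- Re s) is of order |t| M^(- 1/2) times M^(kap -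
   1/2). *)
have [tM|Mt] := leP (t ^+ 2) M.+1%:R.
  have s12 : 1 / 2 <= complex.Re s by lra.
  apply: (le_trans (zapprox_dist k M0' s1 s12)).
  have cs : cabs s <= 1 + `|t|.
    by apply: (le_trans (cabs_le_ReIm s)); rewrite lerD2r ger0_norm //; lra.
  have tr : `|t| <= 6 / 5 * r.
    rewrite -(ler_pXn2r (isT : (0 < 2)%N)) ?nnegrE ?mulr_ge0 ?(ltW r0) //.
    rewrite real_normK ?num_real //; apply: (le_trans tM); rewrite -natr1 -r2 exprMn.
    by have : 4 <= r ^+ 2; [rewrite r2 ler_nat|lra].
  have h1 : npow (complex.Re s) M <= r^-1 * npow (1 / 2 - kap) M.
    by rewrite -nhalf -npowD; apply: npow_le => //; lra.
  apply: (@le_trans _ _ (3 * (1 + `|t|) * (r^-1 * npow (1 / 2 - kap) M))).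
    apply: ler_pM => //; first by rewrite mulr_ge0 ?cabs_ge0.
    - exact: ltW (npow_gt0 _ _).
    - by rewrite ler_wpM2l.
  have c8 : 3 * (1 + `|t|) * r^-1 <= 8 by rewrite ler_pdivrMr //; lra.
  have n0 := npow_gt0 (1 / 2 - kap) M.
  rewrite mulrA; apply: (@le_trans _ _ (8 * npow (1 / 2 - kap) M)); first by rewrite ler_wpM2r // ltW.
  by apply: (ler_pM _ (ltW n0) K8 nle); exact: ler0n.
have rt : r < `|t|.
  rewrite -(ltr_pXn2r (isT : (0 < 2)%N)) ?nnegrE ?(ltW r0) // real_normK ?num_real //.
  by rewrite r2; apply: lt_trans Mt; rewrite ltr_nat.
have t0 : 0 < `|t| by apply: lt_trans rt.
have MU : (M.+1 <= U)%N by rewrite -(ler_nat R); apply: le_trans tU; exact: ltW.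
have base j : (j <= M)%N -> cabs (zapprox (M + j) s - zapprox M s) <= (B + 3) * npow (a - kap) M.
  move=> jM; rewrite zapprox_sub; apply: (le_trans (cabsB _ _)); rewrite mulrDl; apply: lerD.
    have -> : \sum_(n < j) cpw (M + n).+1%:R s = \sum_(n < j) cpw (M.+1 + n)%:R s by apply: eq_bigr.
    have k1 : kap <= 1 by lra.
    have HB j' : (j' <= M.+1)%N -> cabs (\sum_(n < j') cis (`|t| * ln (M.+1 + n)%:R)) <= B * M.+1%:R * npow a M.+1.
      by move=> j'M; apply: H => //; [exact: leqW|exact: ltW].
    have B0 : 0 <= B.
      have := HB 0%N isT; rewrite big_ord0 cabs0 -mulrA pmulr_lge0 //.
      by rewrite mulr_gt0 ?npow_gt0 ?ltr0n.
    apply: (le_trans (power_block_sum (isT : (0 < M.+1)%N) sk k1 ka (leqW jM) HB)).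
    by rewrite ler_wpM2l // npow_anti ?M0' ?leqnSn //; lra.
  have hp n : (0 < n)%N -> cabs (cpw n%:R (s - 1)) <= npow (- kap) n.
    by move=> n0; rewrite cabs_cpwn; apply: npow_le => //; rewrite ReD ReN /=; lra.
  have m2 : cabs (cpw (M + j)%:R (s - 1)) <= 2 * npow (- kap) M.
    apply: (le_trans (hp _ _)); first by rewrite addn_gt0 M0'.
    apply: (@le_trans _ _ (npow (- kap) (2 * M))).
      rewrite /npow ler_expR !mulNr !opprK ler_wpM2l // ler_ln ?posrE ?ltr0n ?addn_gt0 ?muln_gt0 ?M0' //.
      by rewrite ler_nat mul2n -addnn leq_add2l.
    rewrite npowM // ler_wpM2r ?(ltW (npow_gt0 _ _)) // /npow mulNr opprK.
    rewrite -[leRHS](lnK (_ : 2 \is Num.pos)) ?posrE // ler_expR ler_piMl ?ln_ge0 ?ler1n //; lra.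
  have m1 := hp M M0'.
  have c1 : `|t| <= cabs (1 - s).
    by apply: le_trans (Im_le_cabs _); rewrite ImD ImN /= sub0r normrN.
  rewrite /pint cabsM cabsV ler_pdivrMr ?(lt_le_trans t0 c1) //.
  apply: (@le_trans _ _ (3 * npow (- kap) M)); first by have := cabsB (cpw (M + j)%:R (s - 1)) (cpw M%:R (s - 1)); lra.
  rewrite -mulrA ler_wpM2l //.
  have -> : npow (- kap) M = npow (1 / 2 - kap) M * r by rewrite npowD nhalf mulrC mulVKf ?lt0r_neq0 //.
  apply: ler_pM => //; [exact: ltW (npow_gt0 _ _)|exact: ltW|exact: le_trans (ltW rt) c1].
have [kM|kM] := leqP k M.
  apply: (le_trans (base k kM)); rewrite ler_wpM2r ?(ltW npos) //.
  have : 0 <= K * npow (a - kap) 2 by rewrite mulr_ge0 ?(ltW (npow_gt0 _ _)) //; lra.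
  by lra.
(* Peel off one block of length M and continue from 2 M. The hypothesis on K says that B + 3 for
   this block, plus K reduced by the factor 2^(kap - a), is again at most K. *)
have e : zapprox (M + k) s - zapprox M s =
   (zapprox (2 * M + (k - M)) s - zapprox (2 * M) s) + (zapprox (M + M) s - zapprox M s).
  have -> : (2 * M + (k - M) = M + k)%N by rewrite mul2n -addnn -addnA subnKC // ltnW.
  by rewrite mul2n -addnn; ring.
rewrite e; apply: (le_trans (cabsD _ _)).
have kM' : (k - M < k)%N by rewrite ltn_subrL M0' (leq_trans _ kM).
have M2 : (M0 <= 2 * M)%N by apply: (leq_trans M0M); rewrite leq_pmull.
apply: (le_trans (lerD (IH _ kM' _ M2) (base M (leqnn M)))).
rewrite npowM // mulrA -mulrDl ler_wpM2r ?(ltW npos) //; lra.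
Qed.

End BlockBound.

(** * Detection of zeros *)

Section LcmSums.
Variable R : realType.
Implicit Types (d e g k m n y z K N : nat).

Lemma sum_inv_multiples g z : (0 < g)%N ->
  \sum_(1 <= d < z.+1 | (g %| d)%N) d%:R^-1 <= harm R z / g%:R.
Proof.
move=> g0; rewrite (@sum_multiples R z g (fun d => d%:R^-1)) //.
rewrite mulrC /harm [in leRHS](big_cat_nat (n := (z %/ g).+1)) //=; last by rewrite ltnS leq_div.
rewrite mulrDr; apply: (@le_trans _ _ (g%:R^-1 * \sum_(1 <= i < (z %/ g).+1) i%:R^-1)).
  by rewrite mulr_sumr; apply: ler_sum => k _; rewrite natrM invfM.
by rewrite lerDl mulr_ge0 ?invr_ge0 // sumr_ge0 // => i _; rewrite invr_ge0.
Qed.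

(** 1 / lcm = gcd / (d e), and the gcd is bounded by the sum of all common divisors g; the multiples
    of g then contribute a factor 1/g to each of the two sums. *)
Lemma sum_inv_lcm z y :
  \sum_(1 <= d < z.+1) \sum_(1 <= e < y.+1) (lcmn d e)%:R^-1 <= harm R z * harm R y ^+ 2.
Proof.
apply: (@le_trans _ _ (\sum_(1 <= d < z.+1) \sum_(1 <= e < y.+1) \sum_(1 <= g < y.+1)
   g%:R * ((if (g %| d)%N then d%:R^-1 else 0) * (if (g %| e)%N then e%:R^-1 else 0)))).
  apply: ler_sum_nat => d /andP[d0 _]; apply: ler_sum_nat => e /andP[e0 ey].
  have t0 g : 0 <= g%:R * ((if (g %| d)%N then d%:R^-1 else 0) * (if (g %| e)%N then e%:R^-1 else 0)) :> R.
    by rewrite mulr_ge0 // mulr_ge0 //; case: ifP => // _; rewrite invr_ge0.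
  have g0 : (0 < gcdn d e)%N by rewrite gcdn_gt0 d0.
  rewrite (bigD1_seq (gcdn d e)) ?iota_uniq ?mem_index_iota ?g0 //=; last first.
    by rewrite (leq_ltn_trans _ ey) // dvdn_leq // dvdn_gcdr.
  rewrite dvdn_gcdl dvdn_gcdr.
  have -> : (gcdn d e)%:R * (d%:R^-1 / e%:R) = (lcmn d e)%:R^-1 :> R.
    have l0 : (lcmn d e)%:R != 0 :> R by rewrite pnatr_eq0 -lt0n lcmn_gt0 d0.
    have g0' : (gcdn d e)%:R != 0 :> R by rewrite pnatr_eq0 -lt0n.
    by rewrite -invfM -natrM -muln_lcm_gcd natrM; field; rewrite l0.
  by rewrite lerDl; apply: sumr_ge0.
apply: (@le_trans _ _ (\sum_(1 <= g < y.+1) g%:R * ((harm R z / g%:R) * (harm R y / g%:R)))); last first.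
  have -> : harm R z * harm R y ^+ 2 = \sum_(1 <= g < y.+1) harm R z * harm R y * g%:R^-1.
    by rewrite -mulr_sumr -/(harm R y) expr2 mulrA.
  apply: ler_sum_nat => g /andP[g0 _]; have g0' : g%:R != 0 :> R by rewrite pnatr_eq0 -lt0n.
  by rewrite le_eqVlt; apply/orP; left; apply/eqP; field.
rewrite [leLHS](_ : _ = \sum_(1 <= g < y.+1) g%:R * ((\sum_(1 <= d < z.+1 | (g %| d)%N) d%:R^-1) *
   \sum_(1 <= e < y.+1 | (g %| e)%N) e%:R^-1)).
  apply: ler_sum_nat => g /andP[g0 _]; rewrite ler_wpM2l //; apply: ler_pM; rewrite ?sum_inv_multiples //.
  - by apply: sumr_ge0 => i _; rewrite invr_ge0.
  - by apply: sumr_ge0 => i _; rewrite invr_ge0.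
under eq_bigr do rewrite exchange_big /=.
rewrite exchange_big /=; apply: eq_bigr => g _.
rewrite [X in _ = _ * (X * _)]big_mkcond [X in _ = _ * (_ * X)]big_mkcond /=.
rewrite mulr_suml mulr_sumr; apply: eq_bigr => d _; rewrite mulr_sumr mulr_sumr.
by apply: eq_bigr => e _.
Qed.

End LcmSums.

Section ApproxZero.
Variable R : realType.

Lemma truncn_div (x : R) (g : nat) : 0 <= x -> (0 < g)%N -> (Num.truncn x %/ g)%N = Num.truncn (x / g%:R).
Proof.
move=> x0 g0; have g0' : 0 < g%:R :> R by rewrite ltr0n.
have xg : 0 <= x / g%:R by rewrite divr_ge0.
have /andP[a1 a2] := truncn_itv x0; have /andP[b1 b2] := truncn_itv xg.
apply/eqP; rewrite eqn_leq; apply/andP; split.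
  rewrite -ltnS ltn_divLR // -(ltr_nat R); apply: (le_lt_trans a1).
  by rewrite natrM -ltr_pdivrMr.
rewrite leq_divRL // -ltnS -(ltr_nat R); apply: le_lt_trans a2.
by rewrite natrM -ler_pdivlMr.
Qed.

Lemma npow_shift (sg : R) (n : nat) : (0 < n)%N -> npow sg n = n%:R^-1 * expR ((1 - sg) * ln n%:R).
Proof. by move=> n0; rewrite -npow_1r // /npow -expRD; congr expR; ring. Qed.

(** The error of [zeta_zapprox] carries the factor |s|, but it is taken at M + k with k tending to
    infinity, where it vanishes. *)
Lemma zapprox_zero (zeta : Cplx R -> Cplx R) (s : R[i]) (M : nat) (eps : R) : is_riemann_zeta zeta -> zeta s = 0 ->
  0 < complex.Im s -> 9 / 10 <= complex.Re s -> (0 < M)%N ->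
  (forall k, cabs (zapprox (M + k) s - zapprox M s) <= eps) -> cabs (zapprox M s) <= eps.
Proof.
move=> zP z0 im re M0 H; apply/ler_addgt0Pr => e e0.
have s0 : 0 < cabs s by rewrite cabs_gt0; apply/eqP => sE; move: im; rewrite sE /= ltxx.
have C0 : 0 < 3 * cabs s / e by rewrite divr_gt0 // mulr_gt0.
pose x : R := expR (2 * `|ln (3 * cabs s / e)|).
pose k := Num.truncn x.
have kx : x < (M + k)%:R.
  have /andP[_ h] : k%:R <= x < k.+1%:R by apply: truncn_itv; exact: expR_ge0.
  apply: (lt_le_trans h); rewrite ler_nat; lia.
have Mk : (0 < M + k)%N by rewrite addn_gt0 M0.
have small : 3 * cabs s * npow (complex.Re s) (M + k) <= e.
  rewrite -ler_pdivlMl ?mulr_gt0 // -[leRHS](lnK (_ : _ \is Num.pos)); last first.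
    by rewrite posrE mulr_gt0 ?invr_gt0 ?mulr_gt0.
  have -> : (3 * cabs s)^-1 * e = (3 * cabs s / e)^-1 by rewrite invf_div mulrC.
  rewrite lnV ?posrE // /npow ler_expR lerN2.
  have lx : 2 * `|ln (3 * cabs s / e)| <= ln (M + k)%:R.
    by rewrite -[leLHS]expRK ler_ln ?posrE ?expR_gt0 ?ltr0n // ltW.
  have a0 := ler_norm (ln (3 * cabs s / e)); have n0 := normr_ge0 (ln (3 * cabs s / e)).
  have h : 9 / 10 * ln (M + k)%:R <= complex.Re s * ln (M + k)%:R by rewrite ler_wpM2r // ln_ge0 // ler1n.
  by lra.
have := zeta_zapprox zP im re Mk; rewrite z0 sub0r cabsN => h.
have -> : zapprox M s = zapprox (M + k) s - (zapprox (M + k) s - zapprox M s) by ring.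
apply: (le_trans (cabsB _ _)); rewrite addrC; apply: lerD; first exact: H.
exact: le_trans h small.
Qed.

End ApproxZero.

Section Detection.
Variables (R : realType) (K z y : nat) (l t : nat -> R).
Hypotheses (zK : (z <= K)%N) (yK : (y <= K)%N).
Hypotheses (l0 : forall d, (z < d)%N -> l d = 0) (l1 : forall d, (0 < d)%N -> `|l d| <= 1).
Hypotheses (t0 : forall e, (y < e)%N -> t e = 0) (t1 : forall e, (0 < e)%N -> `|t e| <= 1).
Implicit Types (s w : R[i]) (d e n N : nat).

Lemma weighted_lcm_sum (F : nat -> nat -> R[i]) (f : nat -> nat -> R) :
  (forall d e, (0 < d <= z)%N -> (0 < e <= y)%N -> cabs (F d e) <= f d e) ->
  cabs (\sum_(1 <= d < K.+1) \sum_(1 <= e < K.+1) (l d * t e)%:C * F d e) <=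
  \sum_(1 <= d < z.+1) \sum_(1 <= e < y.+1) f d e.
Proof.
move=> Ff.
have -> : \sum_(1 <= d < K.+1) \sum_(1 <= e < K.+1) (l d * t e)%:C * F d e =
    \sum_(1 <= d < z.+1) \sum_(1 <= e < y.+1) (l d * t e)%:C * F d e.
  rewrite (big_cat_nat (n := z.+1)) //= [X in _ + X]big_nat_cond [X in _ + X]big1 ?addr0; last first.
    move=> d /andP[/andP[zd _] _]; rewrite big1 // => e _; by rewrite l0 // mul0r mul0r.
  apply: eq_bigr => d _.
  rewrite (big_cat_nat (n := y.+1)) //= [X in _ + X]big_nat_cond [X in _ + X]big1 ?addr0 //.
  by move=> e /andP[/andP[ye _] _]; rewrite t0 // mulr0 mul0r.
apply: (le_trans (cabs_sum _ _ _)); apply: ler_sum_nat => d /andP[d0 dz].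
apply: (le_trans (cabs_sum _ _ _)); apply: ler_sum_nat => e /andP[e0 ey].
have dz' : (0 < d <= z)%N by rewrite d0.
have ey' : (0 < e <= y)%N by rewrite e0.
rewrite cabsM cabs_real normrM; apply: le_trans (Ff d e dz' ey'); rewrite -[leRHS]mul1r ler_wpM2r ?cabs_ge0 //.
by rewrite -[leRHS]mulr1; apply: ler_pM => //; [exact: l1|exact: t1].
Qed.

Lemma sum_div_sums_cpw (w : R[i]) N :
  \sum_(n < N) (div_sum K l n.+1 * div_sum K t n.+1)%:C * cpw n.+1%:R w =
  \sum_(1 <= d < K.+1) \sum_(1 <= e < K.+1) (l d * t e)%:C *
     (cpw (lcmn d e)%:R w * zsum w (N %/ lcmn d e)).
Proof.
transitivity (\sum_(1 <= n < N.+1) \sum_(1 <= d < K.+1) \sum_(1 <= e < K.+1)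
   (if (lcmn d e %| n)%N then (l d * t e)%:C * cpw n%:R w else 0)).
  rewrite big_add1 /= big_mkord; apply: eq_bigr => n _.
  have DE (f : nat -> R) m : div_sum K f m = \sum_(1 <= d < K.+1) (if (d %| m)%N then f d else 0).
    by rewrite /div_sum big_mkcond.
  rewrite !DE rmorphM !rmorph_sum /= mulr_suml mulr_suml; apply: eq_bigr => d _.
  rewrite mulr_sumr mulr_suml; apply: eq_bigr => e _; rewrite dvdn_lcm.
  by case: (d %| _)%N; case: (e %| _)%N; rewrite /= ?rmorph0 ?(mulr0, mul0r) ?rmorphM.
rewrite exchange_big /=; apply: eq_big_nat => d /andP[d0 _].
rewrite exchange_big /=; apply: eq_big_nat => e /andP[e0 _].
have g0 : (0 < lcmn d e)%N by rewrite lcmn_gt0 d0.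
rewrite -big_mkcond /= (sum_multiples _ (fun n => (l d * t e)%:C * cpw n%:R w)) //.
rewrite /zsum !mulr_sumr big_add1 /= big_mkord; apply: eq_bigr => k _.
by rewrite natrM cpwM ?ltr0n.
Qed.

Lemma lcm_le d e : (0 < d <= z)%N -> (0 < e <= y)%N -> (0 < lcmn d e <= z * y)%N.
Proof.
move=> /andP[d0 dz] /andP[e0 ey]; rewrite lcmn_gt0 d0 e0 /=.
apply: leq_trans (leq_mul dz ey); rewrite -muln_lcm_gcd leq_pmulr // gcdn_gt0 d0 //.
Qed.

(** At a zero the partial sum of n^(- s) is m^(1 - s) / (1 - s) up to eps, and the division by 1 - s
    gains T1. Ordered by the lcm g of d and e, a pair costs 1/g times a power with exponent at most
    eta, and [sum_inv_lcm] adds up the 1/g. *)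
Lemma detection_sum s M0 N (eps T1 eta : R) :
  (forall M, (M0 <= M)%N -> cabs (zapprox M s) <= eps) -> (0 < M0)%N -> (M0 * (z * y) <= N)%N ->
  1 - eta <= complex.Re s <= 1 -> 0 < T1 <= complex.Im s ->
  cabs (\sum_(n < N) (div_sum K l n.+1 * div_sum K t n.+1)%:C * cpw n.+1%:R s) <=
  harm R z * harm R y ^+ 2 * (eps * expR (eta * ln (z * y)%:R) + expR (eta * ln N%:R) / T1).
Proof.
move=> H M00 MN /andP[s1 s2] /andP[T10 T1s].
rewrite sum_div_sums_cpw.
set C := eps * _ + _.
have e0 : 0 <= eps by apply: le_trans (H M0 (leqnn _)); exact: cabs_ge0.
have C0 : 0 <= C.
  by apply: addr_ge0; [apply: mulr_ge0 => //; exact: expR_ge0|apply: divr_ge0; [exact: expR_ge0|exact: ltW]].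
apply: (le_trans (@weighted_lcm_sum _ (fun d e => (lcmn d e)%:R^-1 * C) _)); last first.
  under eq_bigr do rewrite -mulr_suml.
  by rewrite -mulr_suml ler_wpM2r // sum_inv_lcm.
move=> d e dz ey; have /andP[g0 gz] := lcm_le dz ey.
set g := lcmn d e in g0 gz *.
have eta0 : 0 <= eta by lra.
have gN : (M0 * g <= N)%N by apply: leq_trans MN; rewrite leq_mul2l gz orbT.
have Mg : (M0 <= N %/ g)%N by rewrite leq_divRL.
have m0 : (0 < N %/ g)%N by apply: leq_trans Mg.
have N0 : (0 < N)%N by apply: leq_trans gN; rewrite muln_gt0 M00.
set m := (N %/ g)%N in Mg m0 *.
have -> : zsum s m = zapprox m s + cpw m%:R (s - 1) / (1 - s) by rewrite /zapprox subrK.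
rewrite cabsM cabs_cpwn npow_shift // -mulrA ler_wpM2l ?invr_ge0 //.
set a := 1 - complex.Re s.
have a0 : 0 <= a by rewrite /a; lra.
have ae : a <= eta by rewrite /a; lra.
have lg0 : 0 <= ln g%:R :> R by rewrite ln_ge0 // ler1n.
have lN0 : 0 <= ln N%:R :> R by rewrite ln_ge0 // ler1n.
apply: (le_trans (ler_wpM2l (expR_ge0 _) (cabsD _ _))); rewrite mulrDr; apply: lerD.
  rewrite mulrC; apply: ler_pM; rewrite ?cabs_ge0 ?expR_ge0 ?H // ler_expR.
  apply: ler_pM => //; rewrite ler_ln ?posrE ?ltr0n ?ler_nat //; exact: leq_trans gz.
have i1 : T1 <= cabs (1 - s).
  apply: le_trans (Im_le_cabs _); rewrite ImD ImN /= sub0r normrN.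
  exact: le_trans T1s (ler_norm _).
rewrite cabsM cabsV cabs_cpwn mulrA; apply: ler_pM.
- by rewrite mulr_ge0 ?expR_ge0 // ltW ?npow_gt0.
- by rewrite invr_ge0 cabs_ge0.
- rewrite /npow -expRD ler_expR ReD ReN /=.
  have -> : a * ln g%:R + - ((complex.Re s - 1) * ln m%:R) = a * (ln g%:R + ln m%:R) by rewrite /a; ring.
  rewrite -lnM ?posrE ?ltr0n // -natrM.
  have gm : (g * m <= N)%N by rewrite mulnC leq_trunc_div.
  apply: (@le_trans _ _ (a * ln N%:R)); last by rewrite ler_wpM2r.
  by rewrite ler_wpM2l // ler_ln ?posrE ?ltr0n ?muln_gt0 ?g0 // ler_nat.
- by rewrite lef_pV2 ?posrE // (lt_le_trans T10).
Qed.

End Detection.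

Section QuadraticSums.
Variables (R : realType) (K y : nat) (t : nat -> R).
Hypotheses (y0 : (0 < y)%N) (yK : (y <= K)%N).
Hypotheses (t0 : forall e, (y < e)%N -> t e = 0) (t1 : forall e, (0 < e)%N -> `|t e| <= 1).

(** The pair (d, e) with lcm g contributes g^(- w) times a sum from a / g to b / g. By scaling, the
    corresponding integral is 1/g times the integral over [a, b], so the main terms add up to the
    lcm form. The condition a >= M0 y^2 keeps every inner sum beyond M0. *)
Lemma sum_sqr_cpw (w : R[i]) M0 (a b eps kap : R) : w != 1 -> 1 - kap <= complex.Re w <= 1 -> kap <= 1 ->
  (forall M k, (M0 <= M)%N -> cabs (zapprox (M + k) w - zapprox M w) <= eps) -> (0 < M0)%N ->
  (M0 * (y * y))%:R <= a -> a <= b ->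
  cabs (\sum_(n < Num.truncn b) (div_sum K t n.+1 ^+ 2)%:C * cpw n.+1%:R w -
        \sum_(n < Num.truncn a) (div_sum K t n.+1 ^+ 2)%:C * cpw n.+1%:R w -
        (lcm_form K t)%:C * pint w a b) <=
  harm R y ^+ 3 * (expR (kap * ln (y * y)%:R) * (eps + 2 * npow (1 - kap) M0)).
Proof.
move=> w1 /andP[wk wle] k1 H M00 Ma ab.
have yy : 0 < (M0 * (y * y))%:R :> R by rewrite ltr0n !muln_gt0 M00 y0.
have a0 : 0 < a by apply: lt_le_trans Ma.
have b0 : 0 < b by apply: lt_le_trans ab.
have w0 : 0 <= complex.Re w by lra.
under eq_bigr do rewrite expr2; under [X in _ - X - _]eq_bigr do rewrite expr2.
rewrite !sum_div_sums_cpw.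
set E := expR _ * _.
have e0 : 0 <= eps by apply: le_trans (H M0 0%N (leqnn _)); exact: cabs_ge0.
have E0 : 0 <= E by rewrite mulr_ge0 ?expR_ge0 // addr_ge0 // mulr_ge0 // ltW // npow_gt0.
have -> : (lcm_form K t)%:C * pint w a b = \sum_(1 <= d < K.+1) \sum_(1 <= e < K.+1) (t d * t e)%:C *
    (cpw (lcmn d e)%:R w * pint w (a / (lcmn d e)%:R) (b / (lcmn d e)%:R)).
  rewrite /lcm_form rmorph_sum mulr_suml; apply: eq_big_nat => d /andP[d0 _].
  rewrite rmorph_sum mulr_suml; apply: eq_big_nat => e /andP[e0' _].
  have g0 : (0 < (lcmn d e)%:R :> R) by rewrite ltr0n lcmn_gt0 d0.
  move: (lcmn d e)%:R g0 => g g0; rewrite rmorphM /= -mulrA; congr (_ * _).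
  have sc x : 0 < x -> cpw g w * cpw (x / g) (w - 1) = (g^-1)%:C * cpw x (w - 1).
    move=> x0; have xE : x = g * (x / g) by rewrite mulrC divfK // lt0r_neq0.
    rewrite [in RHS]xE cpwM ?divr_gt0 // mulrA; congr (_ * _).
    by rewrite -[in LHS](subrK 1 w) (cpwD g (w - 1) 1) mulrC cpw1.
  by rewrite /pint [LHS]mulrA [RHS]mulrA !mulrBr !sc.
rewrite -!sumrB; under eq_bigr do rewrite -!sumrB.
have -> : \sum_(1 <= i < K.+1) \sum_(1 <= e < K.+1) ((t i * t e)%:C * (cpw (lcmn i e)%:R w * zsum w (Num.truncn b %/ lcmn i e)) -
    (t i * t e)%:C * (cpw (lcmn i e)%:R w * zsum w (Num.truncn a %/ lcmn i e)) -
    (t i * t e)%:C * (cpw (lcmn i e)%:R w * pint w (a / (lcmn i e)%:R) (b / (lcmn i e)%:R))) =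
  \sum_(1 <= d < K.+1) \sum_(1 <= e < K.+1) (t d * t e)%:C * (cpw (lcmn d e)%:R w *
    (zsum w (Num.truncn b %/ lcmn d e) - zsum w (Num.truncn a %/ lcmn d e) - pint w (a / (lcmn d e)%:R) (b / (lcmn d e)%:R))).
  by apply: eq_bigr => d _; apply: eq_bigr => e _; ring.
apply: (le_trans (@weighted_lcm_sum R K y y t t yK yK t0 t1 t0 t1 _ (fun d e => (lcmn d e)%:R^-1 * E) _)); last first.
  under eq_bigr do rewrite -mulr_suml.
  by rewrite -mulr_suml ler_wpM2r // exprS sum_inv_lcm.
move=> d e dy ey; have /andP[g0 gy] := lcm_le dy ey.
set g := lcmn d e in g0 gy *.
have g0' : 0 < g%:R :> R by rewrite ltr0n.
rewrite !truncn_div ?(ltW a0) ?(ltW b0) //.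
have ag : 0 <= a / g%:R by rewrite divr_ge0 // ltW.
have bg : 0 <= b / g%:R by rewrite divr_ge0 // ltW.
set A := Num.truncn (a / g%:R); set B := Num.truncn (b / g%:R).
have /andP[A1 A2] : A%:R <= a / g%:R < A.+1%:R := truncn_itv ag.
have /andP[B1 B2] : B%:R <= b / g%:R < B.+1%:R := truncn_itv bg.
have MA : (M0 <= A)%N.
  rewrite -ltnS -(ltr_nat R); apply: le_lt_trans A2; rewrite ler_pdivlMr // -natrM.
  by apply: le_trans Ma; rewrite ler_nat leq_mul2l gy orbT.
have AB : (A <= B)%N.
  rewrite -ltnS -(ltr_nat R); apply: (le_lt_trans A1); apply: le_lt_trans B2.
  by rewrite ler_wpM2r // invr_ge0 ltW.
have A0 : (0 < A)%N by apply: leq_trans MA.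
have B0 : (0 < B)%N by apply: leq_trans AB.
rewrite cabsM cabs_cpwn npow_shift // -mulrA ler_wpM2l ?invr_ge0 //; apply: ler_pM.
- exact: expR_ge0.
- exact: cabs_ge0.
- rewrite ler_expR; apply: ler_pM.
  + by lra.
  + by rewrite ln_ge0 // ler1n.
  + by lra.
  + by rewrite ler_ln ?posrE ?ltr0n ?muln_gt0 ?y0 // ler_nat.
have -> : zsum w B - zsum w A - pint w (a / g%:R) (b / g%:R) =
   (zapprox (A + (B - A)) w - zapprox A w) + (pint w A%:R (a / g%:R) - pint w B%:R (b / g%:R)).
  by rewrite subnKC // /zapprox /pint; ring.
have P M x : (M0 <= M)%N -> M%:R <= x -> x < M.+1%:R -> cabs (pint w M%:R x) <= npow (1 - kap) M0.
  move=> MM Mx xM; have M0' : (0 < M)%N by apply: leq_trans MM.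
  have M0r : 0 < M%:R :> R by rewrite ltr0n.
  apply: (le_trans (cabs_pint_le w1 M0r Mx w0)); rewrite cabs_cpwn.
  apply: (@le_trans _ _ (npow (complex.Re w) M)).
    by rewrite ler_piMr ?(ltW (npow_gt0 _ _)) //; move: xM; rewrite -natr1; lra.
  apply: (le_trans (npow_le M0' wk)); apply: npow_anti; rewrite ?M00 //; lra.
apply: (le_trans (cabsD _ _)); apply: lerD; first exact: H.
apply: (le_trans (cabsB _ _)).
by have := P A _ MA A1 A2; have := P B _ (leq_trans MA AB) B1 B2; lra.
Qed.

End QuadraticSums.

(** * The large sieve for zeros *)

Section Halasz.
Variable R : realType.

(** Duality: factors c r of modulus at most 1 turn each sum into its modulus, Cauchy-Schwarz is
    applied in n, and the remaining square is expanded over pairs. W may be inserted only where it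
    is at least 1, so [y n] is set to 0 where alpha vanishes. *)
Lemma halasz_inequality (I : finType) (A : pred I) P (alpha beta W : nat -> R) (v : I -> nat -> R[i]) :
  (forall n, 0 <= W n) -> (forall n, (n < P)%N -> alpha n != 0 -> 1 <= W n) ->
  (\sum_(r | A r) cabs (\sum_(n < P) (alpha n * beta n)%:C * v r n)) ^+ 2 <=
  (\sum_(n < P) alpha n ^+ 2) *
  \sum_(r | A r) \sum_(s | A s) cabs (\sum_(n < P) (W n * beta n ^+ 2)%:C * (v r n * (v s n)^*)).
Proof.
move=> W0 W1.
pose F r := \sum_(n < P) (alpha n * beta n)%:C * v r n.
pose c r : R[i] := (F r)^* / (cabs (F r))%:C.
have cF r : c r * F r = (cabs (F r))%:C.
  have [F0|F0] := eqVneq (F r) 0; first by rewrite F0 cabs0 mulr0.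
  have n0 : (cabs (F r))%:C != 0 :> R[i].
    by apply/eqP => /(congr1 (@complex.Re R)) /= /eqP; rewrite cabs_eq0 (negbTE F0).
  by rewrite /c mulrAC [_ * F r]mulrC mulcJ expr2 rmorphM /= mulfK.
have c1 r : cabs (c r) <= 1.
  rewrite /c cabsM cabsJ cabsV cabs_real (ger0_norm (cabs_ge0 _)).
  by have [->|n0] := eqVneq (cabs (F r)) 0; [rewrite mul0r|rewrite divff].
pose U n := \sum_(r | A r) c r * v r n.
have FE : \sum_(r | A r) cabs (F r) = complex.Re (\sum_(n < P) (alpha n * beta n)%:C * U n).
  transitivity (complex.Re (\sum_(r | A r) c r * F r)).
    by rewrite (raddf_sum (@complex.Re R)); apply: eq_bigr => r _; rewrite cF.
  congr complex.Re; rewrite /F /U; under eq_bigr do rewrite mulr_sumr.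
  rewrite exchange_big /=; apply: eq_bigr => n _; rewrite mulr_sumr.
  by apply: eq_bigr => r _; rewrite mulrCA.
pose y n := if alpha n == 0 then 0 else `|beta n| * cabs (U n).
have y0 n : 0 <= y n by rewrite /y; case: ifP => // _; rewrite mulr_ge0 ?cabs_ge0.
have FS : \sum_(r | A r) cabs (F r) <= \sum_(n < P) `|alpha n| * y n.
  rewrite FE; apply: (le_trans (ReleC _)); apply: (le_trans (cabs_sum _ _ _)).
  apply: ler_sum => n _; rewrite cabsM cabs_real normrM -mulrA /y.
  by have [->|_] := eqVneq (alpha n) 0; rewrite ?normr0 ?mul0r.
apply: (@le_trans _ _ ((\sum_(n < P) `|alpha n| * y n) ^+ 2)).
  rewrite lerXn2r ?nnegrE // sumr_ge0 // => i _; first exact: cabs_ge0.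
  by rewrite mulr_ge0.
apply: (le_trans (sum_cauchy_schwarz _ _ _ _)).
have -> : \sum_(n < P) `|alpha n| ^+ 2 = \sum_(n < P) alpha n ^+ 2.
  by apply: eq_bigr => n _; rewrite real_normK // num_real.
rewrite ler_wpM2l; last first.
- apply: (@le_trans _ _ (\sum_(n < P) W n * beta n ^+ 2 * cabs (U n) ^+ 2)).
    apply: ler_sum => n _; rewrite /y; have [_|a0] := eqVneq (alpha n) 0.
      by rewrite [leLHS]expr0n; apply: mulr_ge0; [apply: mulr_ge0; [exact: W0|exact: sqr_ge0]|exact: sqr_ge0].
    rewrite exprMn real_normK ?num_real // ler_wpM2r ?sqr_ge0 //.
    by rewrite ler_peMl ?sqr_ge0 // W1.
  have -> : \sum_(n < P) W n * beta n ^+ 2 * cabs (U n) ^+ 2 =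
     complex.Re (\sum_(r | A r) \sum_(s | A s) c r * (c s)^* * \sum_(n < P) (W n * beta n ^+ 2)%:C * (v r n * (v s n)^*)).
    transitivity (complex.Re (\sum_(n < P) (W n * beta n ^+ 2)%:C * (U n * (U n)^*))).
      rewrite (raddf_sum (@complex.Re R)); apply: eq_bigr => n _.
      by rewrite mulcJ -rmorphM.
    congr complex.Re.
    transitivity (\sum_(n < P) \sum_(r | A r) \sum_(s | A s) c r * (c s)^* * ((W n * beta n ^+ 2)%:C * (v r n * (v s n)^*))).
      apply: eq_bigr => n _; rewrite /U rmorph_sum mulr_suml mulr_sumr; apply: eq_bigr => r _.
      rewrite !mulr_sumr; apply: eq_bigr => s _; rewrite rmorphM /=; ring.
    rewrite exchange_big; apply: eq_bigr => r _; rewrite exchange_big; apply: eq_bigr => s _.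
    by rewrite mulr_sumr.
  apply: (le_trans (ReleC _)); apply: (le_trans (cabs_sum _ _ _)); apply: ler_sum => r _.
  apply: (le_trans (cabs_sum _ _ _)); apply: ler_sum => s _.
  rewrite cabsM -[leRHS]mul1r ler_wpM2r ?cabs_ge0 // cabsM cabsJ -[leRHS]mul1r.
  by apply: ler_pM; rewrite ?cabs_ge0.
- by apply: sumr_ge0 => n _; rewrite sqr_ge0.
- by [].
Qed.

End Halasz.

(** * Averaged cutoffs and the kernel that they produce *)

Section SmoothKernel.
Variable R : realType.
Implicit Types (w : R[i]) (x a b xi om kap : R) (J j n : nat).

Lemma pint_scale w a b x : 0 < a -> 0 < b -> 0 < x ->
  pint w (a * x) (b * x) = pint w a b * cpw x (w - 1).
Proof. by move=> a0 b0 x0; rewrite /pint !cpwM // -mulrBl mulrAC. Qed.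

Lemma cpwX x w j : 0 < x -> cpw (x ^+ j) w = cpw x w ^+ j.
Proof.
move=> x0; elim: j => [|j IH]; first by rewrite !expr0 /cpw ln1 mulr0 oppr0 expC0.
by rewrite !exprS cpwM ?exprn_gt0 // IH.
Qed.

Lemma cabs_cpw1_le w a kap : 1 <= a -> 1 - kap <= complex.Re w -> cabs (cpw a (w - 1)) <= expR (kap * ln a).
Proof.
move=> a1 wk; rewrite cabs_cpw ler_expR ReD ReN /= -mulNr ler_wpM2r ?ln_ge0 //; lra.
Qed.

(** A geometric sum of ratio q = exp ((1 - w) om / J). The size of J makes this exponent at most
    1/80 in modulus, so |q - 1| is at least 9/10 of it, while |q^J - 1| <= 2 exp (kap om); 20/9 is 2
    / (9/10). *)
Lemma geometric_average w om kap J : 0 < om -> (0 < J)%N -> w != 1 -> 1 - kap <= complex.Re w -> 0 <= kap ->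
  80 * cabs (1 - w) * om <= J%:R ->
  cabs (\sum_(j < J) cpw (expR (om / J%:R)) (w - 1) ^+ j) / J%:R <= 20 / 9 * expR (kap * om) / (om * cabs (1 - w)).
Proof.
move=> om0 J0 w1 wk k0 HJ.
have J0' : 0 < J%:R :> R by rewrite ltr0n.
set q := cpw _ _; set d := cabs (1 - w) in HJ *.
have d0 : 0 < d by rewrite cabs_gt0 subr_eq0 eq_sym.
have h0 : 0 < om / J%:R by rewrite divr_gt0.
pose z := (1 - w) * (om / J%:R)%:C.
have qz : q = expC z by rewrite /q /cpw expRK /z; congr expC; ring.
have cz : cabs z = d * (om / J%:R) by rewrite /z cabsM cabs_real ger0_norm // ltW.
have cz1 : cabs z <= 1 / 80.
  by rewrite cz mulrA ler_pdivrMr //; lra.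
have qJ : cabs (q ^+ J) <= expR (kap * om).
  rewrite cabsX /q; have := @cabs_cpw1_le w (expR (om / J%:R)) kap _ wk; rewrite expRK => h.
  have e1 : 1 <= expR (om / J%:R) by apply: le_trans (expR_ge1Dx _); rewrite lerDl ltW.
  apply: (@le_trans _ _ (expR (kap * (om / J%:R)) ^+ J)).
    by rewrite lerXn2r ?nnegrE ?cabs_ge0 ?expR_ge0 ?h.
  rewrite -expRM_natl (_ : J%:R * (kap * (om / J%:R)) = kap * om) //.
  by field; rewrite lt0r_neq0.
have e1 : 1 <= expR (kap * om) by apply: le_trans (expR_ge1Dx _); rewrite lerDl mulr_ge0 // ltW.
have q1 : 9 / 10 * (d * (om / J%:R)) <= cabs (q - 1).
  rewrite -cz qz; have cz2 : cabs z <= 1 / 2 by lra.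
  have := expC_taylor1 cz2; have := cabs_ler_sub z (- (expC z - 1 - z)).
  rewrite opprK cabsN (_ : z + (expC z - 1 - z) = expC z - 1); last by ring.
  have h2 : cabs z ^+ 2 <= cabs z * (1 / 80) by rewrite expr2 ler_wpM2l ?cabs_ge0.
  by move: (cabs z) h2 => u h2; lra.
have geo : (\sum_(j < J) q ^+ j) * (q - 1) = q ^+ J - 1 by rewrite mulrC -subrX1.
have q1p : 0 < cabs (q - 1) by apply: lt_le_trans q1; apply: mulr_gt0; [lra|exact: mulr_gt0].
have -> : cabs (\sum_(j < J) q ^+ j) = cabs (q ^+ J - 1) / cabs (q - 1).
  by rewrite -geo cabsM mulfK // lt0r_neq0.
have top : cabs (q ^+ J - 1) <= 2 * expR (kap * om).
  by apply: (le_trans (cabsB _ _)); rewrite cabs1; lra.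
rewrite -mulrA -invfM ler_pdivrMr ?mulr_gt0 //; apply: (le_trans top).
rewrite mulrAC ler_pdivlMr ?mulr_gt0 //.
have -> : 2 * expR (kap * om) * (om * d) = 20 / 9 * expR (kap * om) * (9 / 10 * (d * (om / J%:R)) * J%:R).
  by field; rewrite lt0r_neq0.
by rewrite ler_wpM2l ?mulr_ge0 ?expR_ge0 // ler_wpM2r // ltW.
Qed.

(** An average of sharp cutoffs over a geometric progression takes the place of a smooth weight: its
    sum against n^(- w) is an average of integrals over dilated intervals, and the geometric sum of
    the dilation factors supplies a second 1 / |1 - w|. *)
Definition cutoff (X1 X3 xi : R) J n : R :=
  J%:R^-1 * \sum_(j < J) ((Num.truncn (X1 * xi ^+ j) <= n)%N && (n < Num.truncn (X3 * xi ^+ j))%N)%:R.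

Lemma cutoff_ge0 (X1 X3 xi : R) J n : 0 <= cutoff X1 X3 xi J n.
Proof. by rewrite /cutoff mulr_ge0 ?invr_ge0 // sumr_ge0. Qed.

Lemma cutoff_ge1 (X1 X3 xi : R) J n z N : (0 < J)%N -> 1 <= xi -> 0 < X1 -> (z <= n)%N -> (n < N)%N ->
  X1 * xi ^+ J <= z%:R -> N%:R <= X3 -> 1 <= cutoff X1 X3 xi J n.
Proof.
move=> J0 xi1 X10 zn nN Xz NX; rewrite /cutoff.
have xi0 : 0 <= xi by apply: le_trans xi1.
have -> : \sum_(j < J) ((Num.truncn (X1 * xi ^+ j) <= n)%N && (n < Num.truncn (X3 * xi ^+ j))%N)%:R = \sum_(j < J) (1 : R).
  apply: eq_bigr => j _.
  have x3 : 0 <= X3 * xi ^+ j by rewrite mulr_ge0 ?exprn_ge0 // (le_trans _ NX).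
  have -> : (Num.truncn (X1 * xi ^+ j) <= n)%N.
    rewrite -ltnS -(ltr_nat R); have x1 : 0 <= X1 * xi ^+ j by rewrite mulr_ge0 ?exprn_ge0 // ltW.
    have /andP[h _] := truncn_itv x1; apply: (le_lt_trans h).
    apply: (@le_lt_trans _ _ z%:R); last by rewrite ltr_nat ltnS.
    apply: le_trans Xz; rewrite ler_wpM2l ?(ltW X10) // ler_weXn2l // ltnW //.
  suff -> : (n < Num.truncn (X3 * xi ^+ j))%N by [].
  apply: (leq_trans nN); rewrite -ltnS -(ltr_nat R).
  have /andP[_ h] := truncn_itv x3; apply: le_lt_trans h; apply: (le_trans NX).
  by rewrite ler_peMr ?exprn_ege1 // (le_trans _ NX).
by rewrite sumr_const card_ord mulVf // pnatr_eq0 -lt0n.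
Qed.

Lemma sum_cutoff (X1 X3 xi : R) J P (f : nat -> R) (g : nat -> R[i]) : 1 <= xi -> 0 < X1 -> X1 <= X3 ->
  (forall j, (j < J)%N -> (Num.truncn (X3 * xi ^+ j) <= P)%N) ->
  \sum_(n < P) (cutoff X1 X3 xi J n * f n)%:C * g n =
  (J%:R^-1)%:C * \sum_(j < J) (\sum_(n < Num.truncn (X3 * xi ^+ j)) (f n)%:C * g n -
                                \sum_(n < Num.truncn (X1 * xi ^+ j)) (f n)%:C * g n).
Proof.
move=> xi1 X10 X13 HP; have xi0 : 0 <= xi by apply: le_trans xi1.
transitivity ((J%:R^-1)%:C * \sum_(n < P) \sum_(j < J)
   (((Num.truncn (X1 * xi ^+ j) <= n)%N && (n < Num.truncn (X3 * xi ^+ j))%N)%:R)%:C * ((f n)%:C * g n)).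
  rewrite mulr_sumr; apply: eq_bigr => n _; rewrite /cutoff !rmorphM /= rmorph_sum -mulr_suml.
  by rewrite !mulrA.
congr (_ * _); rewrite exchange_big; apply: eq_bigr => j _ /=.
set A := Num.truncn (X1 * xi ^+ j); set B := Num.truncn (X3 * xi ^+ j).
have AB : (A <= B)%N.
  have x1 : 0 <= X1 * xi ^+ j by rewrite mulr_ge0 ?exprn_ge0 // ltW.
  have x3 : X1 * xi ^+ j <= X3 * xi ^+ j by rewrite ler_wpM2r ?exprn_ge0.
  have /andP[a1 _] := truncn_itv x1; have /andP[_ b2] := truncn_itv (le_trans x1 x3).
  by rewrite -ltnS -(ltr_nat R); apply: (le_lt_trans a1); apply: le_lt_trans b2.
have BP : (B <= P)%N by exact: HP.
pose F n := (f n)%:C * g n.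
rewrite -(big_mkord xpredT F) -(big_mkord xpredT F).
rewrite -(big_mkord xpredT (fun n => (((A <= n)%N && (n < B)%N)%:R)%:C * F n)).
rewrite (big_cat_nat (n := A)) //=; last exact: leq_trans BP.
rewrite [X in X + _]big_nat_cond [X in X + _]big1 ?add0r; last first.
  by move=> n /andP[/andP[_ nA] _]; rewrite leqNgt nA /= mul0r.
rewrite (big_cat_nat (n := B)) //= [X in _ + X]big_nat_cond [X in _ + X]big1 ?addr0; last first.
  by move=> n /andP[/andP[Bn _] _]; rewrite [(n < B)%N]ltnNge Bn andbF mul0r.
rewrite [in RHS](big_cat_nat (n := A) (p := B)) //= addrAC subrr add0r.
by apply: eq_big_nat => n /andP[An nB]; rewrite An nB mul1r.
Qed.

(** 1 - exp (- v) <= v keeps the bound finite as x tends to 1, where the quotient defining [pint]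
    degenerates. *)
Lemma pint_real_le (x a b : R) : x < 1 -> 0 < a -> a <= b ->
  cabs (pint (x%:C) a b) <= expR ((1 - x) * ln b) * ln (b / a).
Proof.
move=> x1 a0 ab; have b0 : 0 < b by apply: lt_le_trans ab.
have e1 : (1 : R[i]) = (1 : R)%:C by [].
rewrite /pint e1 -!rmorphB /= !cpw_real -rmorphB /= -fmorphV -rmorphM cabs_real.
have c0 : 0 < 1 - x by rewrite subr_gt0.
have -> : - ((x - 1) * ln b) = (1 - x) * ln b by ring.
have -> : - ((x - 1) * ln a) = (1 - x) * ln b + - ((1 - x) * ln (b / a)).
  by rewrite ln_div ?posrE //; ring.
have l0 : 0 <= ln (b / a) by rewrite ln_ge0 // ler_pdivlMr // mul1r.
rewrite expRD -[X in X - _]mulr1 -mulrBr -mulrA normrM (ger0_norm (expR_ge0 _)).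
rewrite ler_wpM2l ?expR_ge0 //.
have h1 : expR (- ((1 - x) * ln (b / a))) <= 1 by rewrite -[leRHS]expR0 ler_expR oppr_le0 mulr_ge0 // ltW.
rewrite ger0_norm; last by rewrite divr_ge0 ?subr_ge0 // ltW.
rewrite ler_pdivrMr // [leRHS]mulrC; have := expR_ge1Dx (- ((1 - x) * ln (b / a))).
by move: ((1 - x) * ln (b / a)) => u; lra.
Qed.

Lemma inv_odd_sqr_sum n : \sum_(1 <= i < n) ((2 * i%:R - 1) ^- 2) <= 5 / 4 :> R.
Proof.
suff H k : \sum_(1 <= i < k.+2) ((2 * i%:R - 1) ^- 2) <= 5 / 4 - (4 * k.+1%:R)^-1 :> R.
  case: n => [|[|n]]; [by rewrite big_geq // divr_ge0|by rewrite big_geq // divr_ge0|].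
  by apply: (le_trans (H n)); rewrite gerBl invr_ge0 mulr_ge0.
elim: k => [|k IH]; first by rewrite big_nat1 !mulr1 (_ : 2 - 1 = 1 :> R) ?expr1n ?invr1; lra.
rewrite big_nat_recr //=; apply: (le_trans (lerD IH (lexx _))).
have k0 : 0 <= k%:R :> R by [].
have -> : k.+2%:R = k%:R + 2 :> R by rewrite -addn2 natrD.
have -> : k.+1%:R = k%:R + 1 :> R by rewrite -addn1 natrD.
rewrite -lerBrDl.
have -> : 5 / 4 - (4 * (k%:R + 2))^-1 - (5 / 4 - (4 * (k%:R + 1))^-1) = (4 * (k%:R + 1) * (k%:R + 2))^-1 :> R.
  by field; rewrite !lt0r_neq0 //; lra.
rewrite lef_pV2 ?posrE ?exprn_gt0 ?mulr_gt0 //; try lra.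
Qed.

(** Representatives of boxes of equal parity are 2 |m - k| - 1 box heights apart; 5/2 counts both
    sides of m. *)
Lemma inv_odd_dist_sum Q m : (m < Q)%N ->
  \sum_(k < Q | (k : nat) != m) ((2 * ((m - k) + (k - m))%:R - 1) ^- 2) <= 5 / 2 :> R.
Proof.
move=> mQ; have f0 i : 0 <= (2 * i%:R - 1) ^- 2 :> R by rewrite invr_ge0 sqr_ge0.
rewrite -(big_mkord (fun k => k != m) (fun k => (2 * ((m - k) + (k - m))%:R - 1) ^- 2)).
rewrite (big_cat_nat (n := m)) //=; last exact: ltnW.
have -> : 5 / 2 = 5 / 4 + 5 / 4 :> R by field.
apply: lerD.
  apply: le_trans (inv_odd_sqr_sum m.+1).
  rewrite big_mkcond big_nat_rev /= add0n [leRHS]big_add1 /=.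
  apply: ler_sum_nat => i /andP[_ im]; case: ifP => _ //.
  have -> : (m - (m - i.+1) + (m - i.+1 - m) = i.+1)%N by lia.
  by [].
apply: le_trans (inv_odd_sqr_sum (Q - m)).
rewrite big_ltn_cond // eqxx /=.
rewrite -{1}(addn1 m) addnC big_mkcond big_addn /=.
apply: ler_sum_nat => i /andP[_ ij]; case: ifP => _ //.
have -> : (m - (i + m) + (i + m - m) = i)%N by lia.
by [].
Qed.

End SmoothKernel.

(** * The number of well-spaced zeros *)

Section ZeroSpacing.
Variable R : realType.
Variable eta : R.
Hypotheses (eta0 : 0 <= eta) (eta1 : eta <= 1 / 10).
Let eta910 : 9 / 10 <= 1 - eta. Proof. have := eta1; lra. Qed.
Let le2eta : 1 - 2 * eta <= 1 - eta. Proof. have := eta0; lra. Qed.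
Let ge2eta : 0 <= 1 - 2 * eta. Proof. have := eta1; lra. Qed.
Variables (zeta : Cplx R -> Cplx R) (zP : is_riemann_zeta zeta).
Variables (M0 y z1 z2 N : nat) (eps T1 Tm om s0 : R).
Hypotheses (M00 : (0 < M0)%N) (y0 : (0 < y)%N) (z10 : (0 < z1)%N) (z12 : (z1 < z2)%N).
Hypotheses (MN : (M0 * (z2 * y) <= N)%N) (N1000 : (1000 <= N)%N).
Hypotheses (om0 : 0 < om) (s00 : 0 < s0) (T10 : 0 < T1).
(** The cutoffs begin at z1 exp (- om), which has to be at least M0 y^2 for [sum_sqr_cpw] to
    apply. *)
Hypothesis Mz : (M0 * (y * y))%:R * expR om <= z1%:R :> R.
Hypothesis HE : forall w : R[i], w != 1 -> 1 - 2 * eta <= complex.Re w <= 1 -> `|complex.Im w| <= Tm ->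
  forall M k, (M0 <= M)%N -> cabs (zapprox (M + k) w - zapprox M w) <= eps.

Let z2N : (z2 <= N)%N. Proof. by apply: leq_trans MN; rewrite mulnCA leq_pmulr // muln_gt0 M00. Qed.
Let yN : (y <= N)%N. Proof. by apply: leq_trans MN; rewrite mulnA leq_pmull // muln_gt0 M00 (leq_trans z10) // ltnW. Qed.
Let z20 : (0 < z2)%N. Proof. exact: leq_trans z10 (ltnW z12). Qed.

Let l := bv_weight R z1 z2.
Let t := selberg_weight R y.
Let Psi := div_sum N l.
Let Th := div_sum N t.
Let V := lcm_form N t.

Let l0 d : (z2 < d)%N -> l d = 0. Proof. exact: bv_weight_large. Qed.
Let l1 d : (0 < d)%N -> `|l d| <= 1. Proof. by move=> _; exact: bv_weight_le1. Qed.
Let t0 e : (y < e)%N -> t e = 0. Proof. exact: selberg_weight_large. Qed.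
Let t1 e : (0 < e)%N -> `|t e| <= 1. Proof. exact: selberg_weight_le1. Qed.

Definition sieve_mass : R := 6 * ln N%:R * (64 * harm R z2 / ln (z2%:R / z1%:R) ^+ 2 + N%:R^-1).
Definition detection_error : R :=
  harm R z2 * harm R y ^+ 2 * (eps * expR (eta * ln (z2 * y)%:R) + expR (eta * ln N%:R) / T1).
Definition kernel_error : R :=
  harm R y ^+ 3 * (expR (2 * eta * ln (y * y)%:R) * (eps + 2 * npow (1 - 2 * eta) M0)).

Let V0 : 0 <= V. Proof. exact: lcm_form_ge0. Qed.

Definition detector (s : R[i]) : R[i] := \sum_(n < N | (z1 <= n)%N) (Psi n.+1 * Th n.+1)%:C * cpw n.+1%:R s.

Lemma detector_ge (s : R[i]) : zeta s = 0 -> 1 - eta <= complex.Re s < 1 -> T1 <= complex.Im s <= Tm ->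
  1 - detection_error <= cabs (detector s).
Proof.
move=> zs /andP[s1 s2] /andP[T1s sT].
have im : 0 < complex.Im s by apply: lt_le_trans T1s.
have sn1 : s != 1 by apply/eqP => e; move: im; rewrite e /= ltxx.
have za M : (M0 <= M)%N -> cabs (zapprox M s) <= eps.
  move=> MM; have re := le_trans eta910 s1.
  have Mp : (0 < M)%N by apply: leq_trans MM.
  apply: (zapprox_zero zP zs im re Mp) => k; apply: HE => //; first by apply/andP; split; [exact: le_trans le2eta s1|exact: ltW].
  by rewrite ger0_norm // ltW.
have s12 : 1 - eta <= complex.Re s <= 1 by rewrite s1 ltW.
have T1s' : 0 < T1 <= complex.Im s by rewrite T10.
have D := detection_sum z2N yN l0 l1 t0 t1 za M00 MN s12 T1s'.
have NN : (0 < N)%N by apply: leq_trans N1000.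
have E : \sum_(n < N) (Psi n.+1 * Th n.+1)%:C * cpw n.+1%:R s = 1 + detector s.
  rewrite (bigID (fun n : 'I_N => (z1 <= n)%N)) /= addrC; congr (_ + _).
  rewrite (bigD1 (Ordinal NN)) /=; last by rewrite -ltnNge.
  rewrite big1 ?addr0.
    have -> : Psi 1 = 1.
      have h := @bv_sum_small R N z1 z2 z10 z12 z2N 1; rewrite z10 in h; exact: (h isT).
    have -> : Th 1 = 1.
      rewrite /Th /div_sum (big_mkcond) (bigD1_seq 1%N) ?iota_uniq ?mem_index_iota //= big1 ?addr0 /t ?selberg_weight1 //.
      by move=> d d1; rewrite dvdn1 (negbTE d1).
    by rewrite mulr1 mul1r /cpw ln1 mulr0 oppr0 expC0.
  move=> n /andP[nz n0]; have n1 : (n.+1 == 1)%N = false.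
    by apply/negP => /eqP [] e; move: n0; rewrite -val_eqE /= e eqxx.
  have -> : Psi n.+1 = (n.+1 == 1)%N%:R by apply: (bv_sum_small R z10 z12 z2N); rewrite /= ltnNge.
 
  by rewrite n1 mul0r mul0r.
rewrite -/Psi -/Th E in D.
have := cabs_ler_sub 1 (- detector s); rewrite opprK cabsN cabs1 => h.
by rewrite /detection_error; lra.
Qed.

Lemma sieve_mass_bound : \sum_(1 <= n < N.+1) Psi n ^+ 2 / n%:R <= sieve_mass.
Proof.
have lN d : (N < d)%N -> l d = 0 by move=> Nd; apply: l0; exact: leq_ltn_trans Nd.
apply: (le_trans (sum_div_sum_sqr_log N lN l1 N1000)).
rewrite /sieve_mass ler_wpM2l ?mulr_ge0 ?ln_ge0 ?ler1n ?(leq_trans _ N1000) // lerD2r.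
exact: bv_form_bound.
Qed.

Let X1 : R := z1%:R * expR (- om).
Let X3 : R := N%:R.
(** Twice eta, because the kernel is taken at rho plus the conjugate of rho' minus 1, of real part
    at least 1 - 2 eta. *)
Let kap : R := 2 * eta.
Let lnX4 : R := ln N%:R + om.

Let NN0 : 0 < N%:R :> R. Proof. by rewrite ltr0n (leq_trans _ N1000). Qed.
Let X1p : 0 < X1. Proof. by rewrite mulr_gt0 ?expR_gt0 ?ltr0n. Qed.
Let X1M : (M0 * (y * y))%:R <= X1.
Proof. by rewrite /X1 expRN ler_pdivlMr ?expR_gt0. Qed.
Let X11 : 1 <= X1. Proof. by apply: le_trans X1M; rewrite ler1n !muln_gt0 M00 y0. Qed.
Let X13 : X1 <= X3.
Proof.
apply: (@le_trans _ _ z1%:R); last by rewrite ler_nat (leq_trans _ z2N) // ltnW.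
by rewrite /X1 ler_piMr // expRN invf_le1 ?expR_gt0 // (le_trans _ (expR_ge1Dx _)) // lerDl ltW.
Qed.

Definition smooth_kernel J (w : R[i]) : R[i] :=
  \sum_(n < (Num.truncn (N%:R * expR om)).+1) (cutoff X1 X3 (expR (om / J%:R)) J n * Th n.+1 ^+ 2)%:C * cpw n.+1%:R w.

Lemma kernel_approx J (w : R[i]) : (0 < J)%N -> w != 1 -> 1 - kap <= complex.Re w <= 1 -> `|complex.Im w| <= Tm ->
  cabs (smooth_kernel J w - (V / J%:R)%:C * \sum_(j < J) pint w (X1 * expR (om / J%:R) ^+ j) (X3 * expR (om / J%:R) ^+ j)) <= kernel_error.
Proof.
move=> J0 w1 wk wT; set xi := expR (om / J%:R).
have J0' : 0 < J%:R :> R by rewrite ltr0n.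
have xi1 : 1 <= xi by apply: le_trans (expR_ge1Dx _); rewrite lerDl divr_ge0 // ltW.
have xi0 : 0 < xi by exact: expR_gt0.
have xiJ j : (j < J)%N -> xi ^+ j <= expR om.
  move=> jJ; rewrite -expRM_natl ler_expR mulrCA ler_piMr ?(ltW om0) // ler_pdivrMr // mul1r ler_nat ltnW //.
rewrite /smooth_kernel (@sum_cutoff R X1 X3 xi J _ (fun n => Th n.+1 ^+ 2) (fun n => cpw n.+1%:R w)) //; last first.
  move=> j jJ; apply: leqW; apply: le_truncn; rewrite /X3 ler_wpM2l // xiJ //.
have -> : (V / J%:R)%:C = (J%:R^-1)%:C * V%:C by rewrite mulrC rmorphM.
rewrite -mulrA -mulrBr mulr_sumr -sumrB cabsM cabs_real ger0_norm ?invr_ge0 //.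
rewrite ler_pdivrMl //; apply: (le_trans (cabs_sum _ _ _)).
rewrite -[J in leRHS]card_ord mulr_natl -sumr_const; apply: ler_sum => j _.
have k1 : kap <= 1 by rewrite /kap -subr_ge0.
have HEw := HE w1 wk wT.
have a1 : (M0 * (y * y))%:R <= X1 * xi ^+ j.
  by apply: (le_trans X1M); rewrite ler_peMr ?(ltW X1p) // exprn_ege1.
have a2 : X1 * xi ^+ j <= X3 * xi ^+ j by rewrite ler_wpM2r ?exprn_ge0 // ltW.
exact: (sum_sqr_cpw y0 yN t0 t1 w1 wk k1 HEw M00 a1 a2).
Qed.

Lemma kernel_diag J (x : R) : (0 < J)%N -> 0 <= Tm -> 1 - kap <= x < 1 ->
  cabs (smooth_kernel J (x%:C)) <= V * (expR (kap * lnX4) * ln (X3 / X1)) + kernel_error.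
Proof.
move=> J0 Tm0 /andP[x1 x2].
have w1 : x%:C != 1 :> R[i] by apply/eqP => /(congr1 (@complex.Re R)) /= e; move: x2; rewrite e ltxx.
have J0' : 0 < J%:R :> R by rewrite ltr0n.
have wk : 1 - kap <= complex.Re (x%:C) <= 1 by rewrite /= x1 ltW.
have := kernel_approx J0 w1 wk; rewrite /= normr0 => /(_ Tm0).
set S := \sum_(j < J) _ => h.
have Sb : cabs S <= J%:R * (expR (kap * lnX4) * ln (X3 / X1)).
  apply: (le_trans (cabs_sum _ _ _)); rewrite -[J in leRHS]card_ord mulr_natl -sumr_const; apply: ler_sum => j _.
  set xi := expR (om / J%:R).
  have xi0 : 0 < xi ^+ j by rewrite exprn_gt0 // expR_gt0.
  have a0 : 0 < X1 * xi ^+ j by rewrite mulr_gt0.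
  have b0 : 0 < X3 * xi ^+ j by rewrite mulr_gt0.
  apply: (le_trans (pint_real_le x2 a0 _)); first by rewrite ler_wpM2r // ltW.
  have -> : X3 * xi ^+ j / (X1 * xi ^+ j) = X3 / X1 by field; rewrite !lt0r_neq0.
  rewrite ler_wpM2r ?ln_ge0 ?ler_pdivlMr ?mul1r // ler_expR.
  have lb : ln (X3 * xi ^+ j) <= lnX4.
    rewrite lnM ?posrE // /lnX4 lerD2l -expRM_natl expRK mulrCA ler_piMr ?(ltW om0) //.
    by rewrite ler_pdivrMr // mul1r ler_nat ltnW.
  have lb0 : 0 <= ln (X3 * xi ^+ j).
    apply: ln_ge0; apply: (le_trans X11); apply: (le_trans X13); rewrite ler_peMr ?(ltW NN0) // exprn_ege1 //.
    by apply: le_trans (expR_ge1Dx _); rewrite lerDl divr_ge0 // ltW.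
  by apply: ler_pM => //; lra.
have c0 : 0 <= V / J%:R by rewrite divr_ge0.
have -> : smooth_kernel J x%:C = (V / J%:R)%:C * S + (smooth_kernel J x%:C - (V / J%:R)%:C * S) by ring.
apply: (le_trans (cabsD _ _)); apply: lerD => //.
rewrite cabsM cabs_real (ger0_norm c0) mulrAC ler_pdivrMr // -mulrA ler_wpM2l // mulrC //.
Qed.

(** One factor 1 / |Im w| comes from the integral over [X1, X3], the other from the geometric
    average, and 40/9 = 2 * 20/9. *)
Lemma kernel_off J (w : R[i]) : (0 < J)%N -> 1 - kap <= complex.Re w <= 1 -> 0 < `|complex.Im w| <= Tm ->
  80 * (1 + Tm) * om <= J%:R ->
  cabs (smooth_kernel J w) <= V * (40 / 9 * expR (kap * lnX4) / (om * complex.Im w ^+ 2)) + kernel_error.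
Proof.
move=> J0 wk /andP[i0 iT] HJ; have /andP[wk1 wk2] := wk.
have k0 : 0 <= kap by rewrite mulr_ge0.
have J0' : 0 < J%:R :> R by rewrite ltr0n.
have w1 : w != 1 by apply/eqP => e; move: i0; rewrite e /= normr0 ltxx.
have h := kernel_approx J0 w1 wk iT.
set xi := expR (om / J%:R) in h; have xi0 : 0 < xi by exact: expR_gt0.
set d := cabs (1 - w).
have id : `|complex.Im w| <= d.
  by apply: le_trans (Im_le_cabs _); rewrite ImD ImN /= sub0r normrN.
have d0 : 0 < d by apply: lt_le_trans id.
have dT : d <= 1 + Tm.
  apply: (le_trans (cabs_le_ReIm _)); rewrite ReD ImD ReN ImN /= sub0r normrN; apply: lerD => //.
  by rewrite ger0_norm ?subr_ge0 // gerBl; exact: le_trans ge2eta wk1.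
have HJ' : 80 * d * om <= J%:R.
  by apply: le_trans HJ; rewrite ler_wpM2r ?(ltW om0) // ler_wpM2l.
have G := geometric_average om0 J0 w1 wk1 k0 HJ'.
have SE : \sum_(j < J) pint w (X1 * xi ^+ j) (X3 * xi ^+ j) = pint w X1 X3 * \sum_(j < J) cpw xi (w - 1) ^+ j.
  rewrite mulr_sumr; apply: eq_bigr => j _; rewrite pint_scale ?cpwX ?exprn_gt0 //.
have P : cabs (pint w X1 X3) <= 2 * expR (kap * ln X3) / d.
  rewrite /pint cabsM cabsV ler_wpM2r ?invr_ge0 ?cabs_ge0 //; apply: (le_trans (cabsB _ _)).
  have X31 : 1 <= X3 by exact: le_trans X13.
  have q1 := cabs_cpw1_le X31 wk1; have q2 := cabs_cpw1_le X11 wk1.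
  have q3 : expR (kap * ln X1) <= expR (kap * ln X3) by rewrite ler_expR ler_wpM2l // ler_ln ?posrE //.
  by move: (cabs _) (cabs _) (expR _) (expR _) q1 q2 q3 => u1 u2 u3 u4; lra.
rewrite SE in h.
set S := \sum_(j < J) _ in h G.
have c0 : 0 <= V / J%:R by rewrite divr_ge0.
have -> : smooth_kernel J w = (V / J%:R)%:C * (pint w X1 X3 * S) + (smooth_kernel J w - (V / J%:R)%:C * (pint w X1 X3 * S)) by ring.
apply: (le_trans (cabsD _ _)); apply: lerD => //.
rewrite (cabsM (V / J%:R)%:C) (cabsM (pint w X1 X3)) cabs_real (ger0_norm c0).
have -> : V / J%:R * (cabs (pint w X1 X3) * cabs S) = V * (cabs (pint w X1 X3) * (cabs S / J%:R)) by ring.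
rewrite ler_wpM2l //.
apply: (@le_trans _ _ ((2 * expR (kap * ln X3) / d) * (20 / 9 * expR (kap * om) / (om * d)))).
  by apply: ler_pM; rewrite ?divr_ge0 ?cabs_ge0.
have -> : 2 * expR (kap * ln X3) / d * (20 / 9 * expR (kap * om) / (om * d)) = 40 / 9 * expR (kap * lnX4) / (om * d ^+ 2).
  by rewrite /lnX4 mulrDr expRD; field; rewrite !lt0r_neq0.
have i2 : 0 < complex.Im w ^+ 2 by rewrite -real_normK ?num_real // exprn_gt0.
have d2 : 0 < d ^+ 2 by rewrite exprn_gt0.
rewrite ler_wpM2l ?mulr_ge0 ?expR_ge0 // lef_pV2 ?posrE ?(mulr_gt0 om0) //.
by rewrite ler_wpM2l ?(ltW om0) // -[complex.Im w ^+ 2]real_normK ?num_real // lerXn2r ?nnegrE ?(ltW d0).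
Qed.

(** Halasz's inequality with alpha = Psi / sqrt n and beta = Theta sqrt n: the squares of alpha add
    up to the sieve mass, and the kernel carries Theta^2 alone. The spacing makes the off-diagonal
    terms summable, with 40/9 * 5/2 = 100/9 <= 12. *)
Theorem spaced_zeros_bound Q (act : pred 'I_Q) (rho : 'I_Q -> R[i]) : 0 <= Tm ->
  (forall m, act m -> zeta (rho m) = 0) ->
  (forall m, act m -> 1 - eta <= complex.Re (rho m) < 1) ->
  (forall m, act m -> T1 <= complex.Im (rho m) <= Tm) ->
  (forall m k, act m -> act k -> (k : nat) != m ->
     (2 * ((m - k) + (k - m))%:R - 1) * s0 <= `|complex.Im (rho m) - complex.Im (rho k)|) ->
  detection_error <= 1 / 10 -> sieve_mass * kernel_error <= 1 / 25 ->
  (\sum_(m | act m) 1) <= 13 / 10 * (sieve_mass * V * (expR (2 * eta * (ln N%:R + om)) *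
     (ln (N%:R / z1%:R) + om + 12 / (om * s0 ^+ 2)))) :> R.
Proof.
move=> Tm0 Z re im sp De Ke.
set X := \sum_(m | act m) _; set D := expR _ * _.
(* J only has to be large compared with Tm; none of the resulting bounds depends on it. *)
pose J := (Num.truncn (80 * (1 + Tm) * om)).+1.
have JT : 80 * (1 + Tm) * om <= J%:R by rewrite ltW // truncnS_gt.
pose P := (Num.truncn (N%:R * expR om)).+1.
have om1 : 1 <= expR om by rewrite (le_trans _ (expR_ge1Dx _)) // lerDl ltW.
have NP : (N <= P)%N.
  by apply: leqW; rewrite truncn_ge_nat ?mulr_ge0 ?expR_ge0 // ler_peMr.
pose sq n : R := Num.sqrt n.+1%:R.
have sq0 n : 0 < sq n by rewrite sqrtr_gt0 ltr0n.
have sq2 n : sq n ^+ 2 = n.+1%:R by rewrite sqr_sqrtr.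
pose alpha n := if (z1 <= n < N)%N then Psi n.+1 / sq n else 0.
pose beta n := Th n.+1 * sq n.
pose W n := cutoff X1 X3 (expR (om / J%:R)) J n.
have W1 n : (n < P)%N -> alpha n != 0 -> 1 <= W n.
  rewrite /alpha; case: ifP => [/andP[zn nN] _ _|]; last by rewrite eqxx.
  apply: (@cutoff_ge1 _ _ _ _ _ _ z1 N) => //.
  - by rewrite (le_trans _ (expR_ge1Dx _)) // lerDl divr_ge0 // ltW.
  - have -> : expR (om / J%:R) ^+ J = expR om by rewrite -expRM_natl mulrC divfK // pnatr_eq0.
    by rewrite /X1 -mulrA -expRD addNr expR0 mulr1.
have H := halasz_inequality act (P := P) beta (fun m n => cpw n.+1%:R (rho m)) (fun n => cutoff_ge0 X1 X3 (expR (om / J%:R)) J n) W1.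
have FE m : act m -> 9 / 10 <= cabs (\sum_(n < P) (alpha n * beta n)%:C * cpw n.+1%:R (rho m)).
  move=> am; have -> : \sum_(n < P) (alpha n * beta n)%:C * cpw n.+1%:R (rho m) = detector (rho m).
    rewrite /detector -(big_mkord xpredT (fun n => (alpha n * beta n)%:C * cpw n.+1%:R (rho m))).
    rewrite (big_cat_nat (n := N)) //= [X in _ + X]big_nat_cond [X in _ + X]big1 ?addr0; last first.
      by move=> n /andP[/andP[Nn _] _]; rewrite /alpha ltnNge Nn andbF !mul0r.
    rewrite big_mkord [RHS]big_mkcond; apply: eq_bigr => n _; rewrite /alpha /beta ltn_ord andbT.
    case: ifP => _; last by rewrite !mul0r.
    congr (_%:C * _); have := lt0r_neq0 (sq0 n); move: (sq n) => q q0; field; exact: q0.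
  by have := detector_ge (Z m am) (re m am) (im m am); lra.
have SA : \sum_(n < P) alpha n ^+ 2 <= sieve_mass.
  apply: le_trans sieve_mass_bound.
  rewrite -(big_mkord xpredT (fun n => alpha n ^+ 2)) (big_cat_nat (n := N)) //=.
  rewrite [X in _ + X]big_nat_cond [X in _ + X]big1 ?addr0; last first.
    by move=> n /andP[/andP[Nn _] _]; rewrite /alpha ltnNge Nn andbF expr0n.
  rewrite big_add1 /=; apply: ler_sum_nat => n _; rewrite /alpha.
  case: ifP => _; last by rewrite expr0n divr_ge0 ?sqr_ge0.
  by rewrite exprMn exprVn sq2.
pose w m k : R[i] := rho m + ((rho k)^*)%C - 1.
have KE m k : \sum_(n < P) (W n * beta n ^+ 2)%:C * (cpw n.+1%:R (rho m) * (cpw n.+1%:R (rho k))^*) = smooth_kernel J (w m k).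
  apply: eq_bigr => n _; transitivity ((W n * beta n ^+ 2)%:C * (cpw n.+1%:R (rho m) * cpw n.+1%:R (rho k)^*)).
    by congr (_ * (_ * _)); exact: esym (cpwJ _ _).
  have -> : cpw n.+1%:R (w m k) = cpw n.+1%:R (rho m) * cpw n.+1%:R (rho k)^* * n.+1%:R.
    by rewrite /w !cpwD cpwN cpw1 ?ltr0n // -fmorphV invrK rmorph_nat.
  have -> : beta n ^+ 2 = Th n.+1 ^+ 2 * n.+1%:R by rewrite /beta exprMn sq2.
  have nC : (n.+1%:R : R[i]) = (n.+1%:R : R)%:C by rewrite rmorph_nat.
  rewrite nC -/(W n); move: (W n) (Th _ ^+ 2) (_%:R : R) (cpw _ (rho m)) (cpw _ (_^*)) => a b c u v.
  have E : (a * (b * c))%:C = (a * b)%:C * c%:C by rewrite mulrA rmorphM.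
  by rewrite E; ring.
have wre m k : act m -> act k -> 1 - 2 * eta <= complex.Re (w m k) <= 1.
  move=> am ak; have /andP[a1 a2] := re m am; have /andP[b1 b2] := re k ak.
  have -> : complex.Re (w m k) = complex.Re (rho m) + complex.Re (rho k) - 1.
    by rewrite /w; case: (rho m) => ? ?; case: (rho k) => ? ? /=.
  move: (complex.Re (rho m)) (complex.Re (rho k)) a1 a2 b1 b2 => p q *; apply/andP; split; lra.
have wim m k : complex.Im (w m k) = complex.Im (rho m) - complex.Im (rho k).
  by rewrite /w; case: (rho m) => ? ?; case: (rho k) => ? ? /=; ring.
pose D1 := expR (kap * lnX4) * ln (X3 / X1); pose D2 := 40 / 9 * expR (kap * lnX4) / om.
have eD := expR_gt0 (kap * lnX4).
have row m : act m -> \sum_(k | act k) cabs (smooth_kernel J (w m k)) <=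
   V * (D1 + D2 * (5 / 2 * s0 ^- 2)) + X * kernel_error.
  move=> am.
  have Kb k : act k -> cabs (smooth_kernel J (w m k)) <=
     (V * (if (k : nat) == m then D1 else D2 * (((2 * ((m - k) + (k - m))%:R - 1) ^- 2) * s0 ^- 2))) + kernel_error.
    move=> ak; case: ifP => [/eqP km|/negbT km].
      have {km} km : k = m by apply: val_inj.
      have -> : w m k = (2 * complex.Re (rho m) - 1)%:C.
        by rewrite km /w; case: (rho m) => a b; apply: complex_ext => /=; ring.
      apply: kernel_diag => //; have /andP[a1 a2] := re m am; rewrite /kap.
      by move: (complex.Re (rho m)) a1 a2 => p *; apply/andP; split; lra.
    have sp' := sp m k am ak km.
    have d1 : 1 <= 2 * ((m - k) + (k - m))%:R - 1 :> R.
      have : (1 <= (m - k) + (k - m))%N by rewrite addn_gt0 !subn_gt0 -neq_ltn.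
      by rewrite -(ler_nat R); move: (_ + _)%:R => q; lra.
    set q := 2 * _ - 1 in d1 sp' *.
    have qs : 0 < q * s0 by rewrite mulr_gt0 // (lt_le_trans ltr01).
    have iw : q * s0 <= `|complex.Im (w m k)| by rewrite wim.
    have iT : 0 < `|complex.Im (w m k)| <= Tm.
      rewrite (lt_le_trans qs iw) /= wim; have /andP[a1 a2] := im m am; have /andP[b1 b2] := im k ak.
      move: (complex.Im (rho m)) (complex.Im (rho k)) a1 a2 b1 b2 => u v *.
      by have Tp := T10; rewrite ler_norml; apply/andP; split; lra.
    apply: (le_trans (kernel_off (isT : (0 < J)%N) (wre m k am ak) iT JT)); rewrite lerD2r ler_wpM2l //.
    have i2 : 0 < complex.Im (w m k) ^+ 2 by rewrite -real_normK ?num_real // exprn_gt0 //; case/andP: iT.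
    have q0 : q != 0 by rewrite lt0r_neq0 // (lt_le_trans ltr01).
    have -> : D2 * (q ^- 2 * s0 ^- 2) = 40 / 9 * expR (kap * lnX4) / (om * (q * s0) ^+ 2).
      by rewrite /D2; field; rewrite q0 !lt0r_neq0.
    rewrite ler_wpM2l ?mulr_ge0 ?expR_ge0 // lef_pV2 ?posrE ?(mulr_gt0 om0) ?(exprn_gt0 _ qs) // ler_wpM2l ?(ltW om0) //.
    by rewrite -(real_normK (num_real (complex.Im _))) lerXn2r ?nnegrE ?(ltW qs).
  apply: (le_trans (ler_sum _ Kb)); rewrite big_split /= -mulr_sumr; apply: lerD; last first.
    by rewrite /X mulr_suml le_eqVlt; apply/orP; left; apply/eqP; apply: eq_bigr => k _; rewrite mul1r.
  rewrite ler_wpM2l //.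
  have D20 : 0 <= D2 by rewrite /D2 divr_ge0 ?(ltW om0) // mulr_ge0 // ltW.
  have f0 (k : 'I_Q) : 0 <= D2 * (((2 * ((m - k) + (k - m))%:R - 1) ^- 2) * s0 ^- 2).
    by rewrite mulr_ge0 // mulr_ge0 // invr_ge0 sqr_ge0.
  rewrite (bigD1 m) //= eqxx lerD2l.
  apply: (@le_trans _ _ (\sum_(k < Q | (k : nat) != m) D2 * (((2 * ((m - k) + (k - m))%:R - 1) ^- 2) * s0 ^- 2))).
    rewrite big_mkcond [leRHS]big_mkcond; apply: ler_sum => k _.
    case: (act k) => /=; last by case: ifP.
    by rewrite -val_eqE /=; case: eqP.
  rewrite -mulr_sumr -mulr_suml ler_wpM2l // ler_wpM2r ?invr_ge0 ?sqr_ge0 //.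
  exact: inv_odd_dist_sum.
have X0 : 0 <= X by apply: sumr_ge0.
have S0 : 0 <= sieve_mass by apply: le_trans SA; apply: sumr_ge0 => n _; rewrite sqr_ge0.
have LHS : (9 / 10 * X) ^+ 2 <= (\sum_(m | act m) cabs (\sum_(n < P) (alpha n * beta n)%:C * cpw n.+1%:R (rho m))) ^+ 2.
  rewrite lerXn2r ?nnegrE ?mulr_ge0 ?sumr_ge0 //; last by rewrite /X mulr_sumr; apply: ler_sum => m am; rewrite mulr1 FE.
  by move=> m _; exact: cabs_ge0.
have RHS : \sum_(r | act r) \sum_(s | act s) cabs (\sum_(n < P) (W n * beta n ^+ 2)%:C * (cpw n.+1%:R (rho r) * (cpw n.+1%:R (rho s))^*)) <=
   X * (V * (D1 + D2 * (5 / 2 * s0 ^- 2)) + X * kernel_error).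
  rewrite {1}/X mulr_suml; apply: ler_sum => m am; rewrite mul1r.
  by under eq_bigr do rewrite KE; exact: row.
have DD : D1 + D2 * (5 / 2 * s0 ^- 2) <= D.
  have -> : D1 + D2 * (5 / 2 * s0 ^- 2) = expR (kap * lnX4) * (ln (X3 / X1) + 100 / 9 / (om * s0 ^+ 2)).
    by rewrite /D1 /D2; field; rewrite !lt0r_neq0.
  have -> : ln (X3 / X1) = ln (N%:R / z1%:R) + om.
    have n0 : 0 < N%:R :> R by rewrite ltr0n (leq_trans _ N1000).
    have zp : 0 < z1%:R :> R by rewrite ltr0n.
    have -> : X3 / X1 = N%:R / z1%:R * expR om.
      by rewrite /X3 /X1 expRN; field; rewrite !lt0r_neq0 ?expR_gt0.
    by rewrite lnM ?posrE ?divr_gt0 ?expR_gt0 // expRK.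
  rewrite /D -/lnX4 -/kap ler_wpM2l ?(ltW eD) // lerD2l ler_wpM2r //; last by lra.
  by rewrite invr_ge0 mulr_ge0 ?(ltW om0) ?sqr_ge0.
have {}H : (9 / 10 * X) ^+ 2 <= sieve_mass * (X * (V * D + X * kernel_error)).
  apply: (le_trans LHS); apply: (le_trans H); apply: ler_pM => //.
  - by apply: sumr_ge0 => n _; rewrite sqr_ge0.
  - by apply: sumr_ge0 => m _; apply: sumr_ge0 => k _; exact: cabs_ge0.
  - by apply: (le_trans RHS); rewrite ler_wpM2l // lerD2r ler_wpM2l.
have [->|Xn] := eqVneq X 0.
  have D0 : 0 <= D.
    apply: le_trans DD; rewrite addr_ge0 ?mulr_ge0 ?divr_ge0 ?invr_ge0 ?sqr_ge0 ?ln_ge0 ?(ltW eD) ?(ltW om0) //.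
    by rewrite ler_pdivlMr // mul1r.
  by apply: mulr_ge0 (mulr_ge0 (mulr_ge0 S0 V0) D0).
have Xp : 0 < X by rewrite lt_def Xn.
(* After division by X, (81/100 - 1/25) X is at most the main term, and 100/77 < 13/10. *)
have := H; have -> : (9 / 10 * X) ^+ 2 = X * (81 / 100 * X) by field.
have -> : sieve_mass * (X * (V * D + X * kernel_error)) = X * (sieve_mass * V * D + X * (sieve_mass * kernel_error)) by ring.
rewrite ler_pM2l // => {H} H.
have H2 : X * (sieve_mass * kernel_error) <= X * (1 / 25) by rewrite ler_wpM2l.
have SVD : 0 <= sieve_mass * V * D.
  move: H H2 Xp; move: (sieve_mass * V * D) (X * (sieve_mass * kernel_error)) (X) => a b x; lra.
move: H H2 SVD; move: (sieve_mass * V * D) (X * (sieve_mass * kernel_error)) (X) => a b x; lra.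
Qed.

End ZeroSpacing.

(** * Uniform approximation near the 1-line *)

Section UniformApproximation.
Variable R : realType.
Implicit Types (w : R[i]) (m M k : nat).

(** [zapprox_dist_saving] with a = De / 2. For m >= M0 >= exp (al L) every frequency up to exp L is
    at most m^(1 / al), so the alternatives for De are those of [exp_sum_saving] with tau = 1 / al.
    The condition on K is the geometric recursion, with 2^(- d) estimated through ln 2 >= 3/5. *)
Lemma zapprox_uniform (L al De kap B K : R) M0 w (d := De / 2 - kap) :
  (4 <= M0)%N -> 0 < al -> al * L <= ln M0%:R -> 1 <= De * (al * L) -> De <= 1 ->
  [\/ De <= 2 - al^-1, 3 * De <= 3 - al^-1 | 7 * De <= 4 - al^-1] ->
  0 <= kap -> 0 < d -> 0 <= B -> 1024 * (1 + 2 * L) <= B ^+ 2 -> 8 <= K ->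
  (B + 3) * (1 + 3 / 5 * d) <= K * (3 / 5 * d) ->
  w != 1 -> 1 - kap <= complex.Re w <= 1 -> `|complex.Im w| <= expR L ->
  forall M k, (M0 <= M)%N -> cabs (zapprox (M + k) w - zapprox M w) <= K * expR (- (d * (al * L))).
Proof.
move=> M4 al0 aL DL D1 Dt k0 d0 B0 HB K8 HK w1 wk wL M k MM.
have De0 : 0 < De by rewrite /d in d0; lra.
have M0p : (0 < M0)%N by apply: leq_trans M4.
have lnmono m : (M0 <= m)%N -> al * L <= ln m%:R.
  by move=> Mm; apply: (le_trans aL); rewrite ler_ln ?posrE ?ltr0n ?(leq_trans M0p) ?ler_nat.
pose U := (Num.truncn (expR (2 * L))).+1.
have i2 : complex.Im w ^+ 2 <= expR (2 * L).
  by rewrite -(real_normK (num_real _)) expRM_natl lerXn2r ?nnegrE ?expR_ge0.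
have tU : complex.Im w ^+ 2 <= U%:R by apply: (le_trans i2); rewrite ltW // truncnS_gt.
have K0 : 0 <= K by lra.
have kd : kap <= De / 2 by rewrite /d in d0; lra.
have d12 : De / 2 <= 1 / 2 by lra.
have block m j : (M0 <= m)%N -> (m <= U)%N -> m%:R <= complex.Im w ^+ 2 -> (j <= m)%N ->
    cabs (\sum_(n < j) cis (`|complex.Im w| * ln (m + n)%:R)) <= B * m%:R * npow (De / 2) m.
  move=> Mm _ mI jm.
  have m0 : (0 < m)%N by apply: leq_trans Mm.
  have m0' : 0 < m%:R :> R by rewrite ltr0n.
  have u0 : 0 < `|complex.Im w|.
    rewrite normr_gt0; apply/eqP => e; move: mI; rewrite e expr0n /= => h; lra.
  have mI' : m%:R <= `|complex.Im w| ^+ 2 by rewrite real_normK ?num_real.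
  have lu : ln `|complex.Im w| <= al^-1 * ln m%:R.
    rewrite mulrC ler_pdivlMr //; apply: le_trans (lnmono m Mm); rewrite mulrC ler_wpM2l ?(ltW al0) //.
    by rewrite -[leRHS]expRK ler_ln ?posrE ?expR_gt0.
  have Dm : 1 <= De * ln m%:R.
    by apply: (le_trans DL); rewrite ler_wpM2l ?(ltW De0) ?lnmono.
  have m3 : (3 <= m)%N by apply: leq_trans Mm; apply: leq_trans M4.
  have S2 := exp_sum_saving m3 jm u0 mI' lu D1 Dm Dt.
  have n0 := npow_gt0 (De / 2) m.
  rewrite -(@ler_pXn2r _ 2) ?nnegrE ?cabs_ge0 ?mulr_ge0 ?(ltW n0) //.
  apply: (le_trans S2); rewrite !exprMn.
  have -> : npow (De / 2) m ^+ 2 = expR (- (De * ln m%:R)).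
    by rewrite /npow -expRM_natl; congr expR; field.
  rewrite ler_wpM2r ?expR_ge0 // ler_wpM2r ?exprn_ge0 //.
  apply: (@le_trans _ _ (1024 * (1 + 2 * L)) _ _ _ HB); apply: ler_wpM2l; first exact: ler0n.
  apply: (le_trans (harm_le R m)); rewrite lerD2l.
  by rewrite -[leRHS]expRK ler_ln ?posrE ?expR_gt0 // (le_trans mI).
have HK2 : B + 3 + K * npow d 2 <= K.
  have e : 1 + 3 / 5 * d <= expR (d * ln 2).
    by apply: le_trans (expR_ge1Dx _); rewrite lerD2l mulrC ler_wpM2l ?ln2_ge ?(ltW d0).
  have q0 : 0 < 1 + 3 / 5 * d by lra.
  have q1 : npow d 2 <= (1 + 3 / 5 * d)^-1.
    by rewrite /npow expRN lef_pV2 ?posrE ?expR_gt0.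
  have q2 : K * npow d 2 <= K / (1 + 3 / 5 * d) by rewrite ler_wpM2l.
  have q3 : B + 3 <= K * (3 / 5 * d) / (1 + 3 / 5 * d) by rewrite ler_pdivlMr.
  have q4 : K * (3 / 5 * d) / (1 + 3 / 5 * d) + K / (1 + 3 / 5 * d) = K.
    rewrite -mulrDl; have -> : K * (3 / 5 * d) + K = K * (1 + 3 / 5 * d) by ring.
    by rewrite mulfK // lt0r_neq0.
  lra.
apply: (le_trans (zapprox_dist_saving M4 w1 wk k0 kd d12 tU block K8 HK2 _ MM)).
rewrite ler_wpM2l // /npow ler_expR lerN2 -/d ler_wpM2l ?(ltW d0) // lnmono //.
Qed.

End UniformApproximation.

(** * Zeros in a small disc *)

Section LowerBound.
Variable R : realType.
Implicit Types (s : R[i]) (k n N : nat).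

Lemma sum_mu_zsum s N : (0 < N)%N ->
  \sum_(1 <= k < N.+1) (mu R k)%:C * (cpw k%:R s * zsum s (N %/ k)) = 1.
Proof.
move=> N0.
transitivity (\sum_(1 <= k < N.+1) \sum_(1 <= n < N.+1) (if (k %| n)%N then (mu R k)%:C * cpw n%:R s else 0)).
  apply: eq_big_nat => k /andP[k0 _].
  rewrite -big_mkcond /= (sum_multiples _ (fun n => (mu R k)%:C * cpw n%:R s)) //.
  rewrite /zsum !mulr_sumr big_add1 /= big_mkord; apply: eq_bigr => j _.
  by rewrite natrM cpwM ?ltr0n.
rewrite exchange_big /=.
transitivity (\sum_(1 <= n < N.+1) (if n == 1%N then 1 else 0 : R[i])).
  apply: eq_big_nat => n /andP[n0 nN].
  transitivity ((\sum_(1 <= d < N.+1 | (d %| n)%N) mu R d)%:C * cpw n%:R s).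
    rewrite [in RHS]big_mkcond rmorph_sum mulr_suml; apply: eq_bigr => k _.
    by case: ifP => _; rewrite ?rmorph0 ?mul0r.
  rewrite sum_mu //; case: eqP => [->|_]; last by rewrite rmorph0 mul0r.
  by rewrite rmorph1 mul1r cpw_1.
rewrite big_ltn // big_nat_cond big1 ?addr0 //.
by move=> n /andP[/andP[n2 _] _]; case: eqP n2 => // ->.
Qed.

Lemma sum_npow_le (r : R) N : 0 < r -> \sum_(1 <= k < N.+1) npow (r + 1) k <= (1 + r) / r.
Proof.
move=> r0.
have H : (0 < N)%N -> r * \sum_(1 <= k < N.+1) npow (r + 1) k <= r + 1 - npow r N.
  case: N => // N _; elim: N => [|N IH]; first by rewrite big_nat1 !npow1; lra.
  rewrite big_nat_recr //= mulrDr; have := @npow_telescope R r N.+1 isT r0.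
  by move: IH; move: (r * _) (r * _) (npow r _) (npow r _) => a b c d; lra.
case: N H => [|N] H; first by rewrite big_geq // divr_ge0 ?ltW //; lra.
rewrite ler_pdivlMr // mulrC; apply: (le_trans (H isT)); have := npow_gt0 r N.+1; lra.
Qed.

Variables (zeta : Cplx R -> Cplx R) (zetaP : is_riemann_zeta zeta).

Lemma zeta_zsum_le s n : 1 < complex.Re s -> (0 < n)%N ->
  cabs (zeta s - zsum s n) <= ((complex.Re s - 1)^-1 + 3 * cabs s) * npow (complex.Re s - 1) n.
Proof.
move=> s1 n0; have h := zeta_right zetaP s1 n0.
have -> : zeta s - zsum s n = (zeta s - zapprox n s) - cpw n%:R (s - 1) / (1 - s).
  by rewrite /zapprox; ring.
apply: (le_trans (cabsB _ _)); rewrite mulrDl addrC; apply: lerD.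
  rewrite cabsM cabs_cpwn cabsV mulrC ReD ReN /= ler_wpM2r ?(ltW (npow_gt0 _ _)) //.
  have r0 : 0 < complex.Re s - 1 by lra.
  have e : complex.Re s - 1 <= cabs (1 - s).
    by rewrite cabs_subC; apply: le_trans (ReleC _); rewrite ReD ReN.
  by rewrite lef_pV2 ?posrE // (lt_le_trans r0).
apply: (le_trans h); rewrite ler_wpM2l ?mulr_ge0 ?cabs_ge0 // npow_le //; lra.
Qed.

(** The inverse of zeta is the series of mu k k^(- s), bounded by the sum of k^(- 1 - r). Only
    finite sums are used: the partial sums in [sum_mu_zsum] are replaced by zeta s, with a total
    error that tends to 0. *)
Lemma zeta_lower_bound s (r : R) : 0 < r -> complex.Re s = r + 1 -> r / (1 + r) <= cabs (zeta s).
Proof.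
move=> r0 sE; have s1 : 1 < complex.Re s by rewrite sE ltrDr.
have sr : complex.Re s - 1 = r by rewrite sE addrK.
set C := r^-1 + 3 * cabs s.
have C0 : 0 < C by rewrite ltr_wpDr ?invr_gt0 ?mulr_ge0 ?cabs_ge0.
have rr : 0 < (1 + r) / r by apply: divr_gt0 => //; apply: addr_gt0.
rewrite -[r / _]invf_div -[leLHS]div1r ler_pdivrMr //.
apply/ler_addgt0Pr => e e0.
(* The factor 2^(- r) enters because k times the integer part of N / k is at least N / 2. *)
pose E2 := npow r 2; have E20 : 0 < E2 by exact: npow_gt0.
pose C' := C / E2 * (1 + 2 / r).
have C'0 : 0 < C' by rewrite mulr_gt0 ?divr_gt0 // addr_gt0 ?divr_gt0.
have [N N0 small] : exists2 N, (0 < N)%N & C' * npow (r / 2) N <= e.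
  pose N := (Num.truncn (expR (2 / r * `|ln (C' / e)|))).+1; exists N => //.
  have lN : 2 / r * `|ln (C' / e)| <= ln N%:R.
    by rewrite -[leLHS]expRK ler_ln ?posrE ?expR_gt0 ?ltr0n // ltW // truncnS_gt.
  rewrite /npow expRN ler_pdivrMr ?expR_gt0 // mulrC -ler_pdivrMr //.
  rewrite -[leLHS]lnK ?posrE ?divr_gt0 // ler_expR; apply: (le_trans (ler_norm _)).
  have -> : `|ln (C' / e)| = r / 2 * (2 / r * `|ln (C' / e)|) by field; rewrite lt0r_neq0.
  by rewrite ler_wpM2l // divr_ge0 // ltW.
have lN0 : 0 <= ln N%:R :> R by rewrite ln_ge0 // ler1n.
have tail : \sum_(1 <= k < N.+1) npow (r + 1) k * (C * npow r (N %/ k)) <= e.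
  apply: le_trans small.
  apply: (@le_trans _ _ (\sum_(1 <= k < N.+1) C / E2 * npow r N * k%:R^-1)).
    apply: ler_sum_nat => k /andP[k0 kN].
    have q0 : (0 < N %/ k)%N by rewrite divn_gt0.
    have kq : (0 < k * (N %/ k))%N by rewrite muln_gt0 k0.
    have h : npow r k * npow r (N %/ k) <= npow r N / E2.
      rewrite ler_pdivlMr // -npowM // -npowM //; apply: npow_anti (ltW r0); rewrite N0 /=.
      rewrite {1}(divn_eq N k); have := ltn_pmod N k0; move: (N %/ k)%N q0 {kq} => [//|q] _; move: (N %% k)%N => p; nia.
    rewrite npowD npow_1r //.
    have -> : npow r k * k%:R^-1 * (C * npow r (N %/ k)) = C * (npow r k * npow r (N %/ k)) / k%:R by ring.
    rewrite ler_wpM2r ?invr_ge0 // -mulrA [E2^-1 * _]mulrC ler_wpM2l ?(ltW C0) //.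
  rewrite -mulr_sumr -/(harm R N) /C' -!mulrA ler_wpM2l ?(ltW C0) // ler_wpM2l ?invr_ge0 ?(ltW E20) //.
  have hr : r / 2 + r / 2 = r by lra.
  rewrite -[X in npow X N]hr npowD.
  rewrite -mulrA mulrC ler_wpM2r ?(ltW (npow_gt0 _ _)) //.
  apply: (@le_trans _ _ (npow (r / 2) N * (1 + ln N%:R))).
    by rewrite ler_wpM2l ?harm_le // ltW // npow_gt0.
  have h1 : npow (r / 2) N * 1 <= 1.
    by rewrite mulr1 /npow expRN invf_le1 ?expR_gt0 // (le_trans _ (expR_ge1Dx _)) // lerDl mulr_ge0 // ltW // divr_gt0.
  have h2 : npow (r / 2) N * ln N%:R <= 2 / r.
    rewrite /npow expRN mulrC ler_pdivrMr ?expR_gt0 //.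
    have := expR_ge1Dx (r / 2 * ln N%:R) => h.
    rewrite [leLHS](_ : _ = 2 / r * (r / 2 * ln N%:R)); last by field; rewrite lt0r_neq0.
    by rewrite ler_wpM2l ?divr_ge0 ?(ltW r0) //; move: (r / 2 * _) h => q h; lra.
  by rewrite mulrDr; apply: lerD.
have E := sum_mu_zsum s N0.
set A := \sum_(1 <= k < N.+1) (mu R k)%:C * (cpw k%:R s * zeta s).
have D : cabs (A - 1) <= \sum_(1 <= k < N.+1) npow (r + 1) k * (C * npow r (N %/ k)).
  rewrite -[X in A - X]E /A -sumrB; apply: (le_trans (cabs_sum _ _ _)); apply: ler_sum_nat => k /andP[k0 kN].
  have -> : (mu R k)%:C * (cpw k%:R s * zeta s) - (mu R k)%:C * (cpw k%:R s * zsum s (N %/ k)) =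
     (mu R k)%:C * (cpw k%:R s * (zeta s - zsum s (N %/ k))) by ring.
  rewrite cabsM cabs_real cabsM cabs_cpwn sE -[leRHS]mul1r.
  have q0 : (0 < N %/ k)%N by rewrite divn_gt0.
  apply: ler_pM; rewrite ?mulr_ge0 ?cabs_ge0 ?mu_le1 ?(ltW (npow_gt0 _ _)) //.
  by rewrite ler_wpM2l ?(ltW (npow_gt0 _ _)) //; have := zeta_zsum_le s1 q0; rewrite sr.
have A1 : cabs A <= (1 + r) / r * cabs (zeta s).
  apply: (@le_trans _ _ (\sum_(1 <= k < N.+1) npow (r + 1) k * cabs (zeta s))).
    apply: (le_trans (cabs_sum _ _ _)); apply: ler_sum_nat => k _.
    rewrite cabsM cabs_real cabsM cabs_cpwn sE -[leRHS]mul1r.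
    by apply: ler_pM; rewrite ?mulr_ge0 ?cabs_ge0 ?mu_le1 ?(ltW (npow_gt0 _ _)).
  by rewrite -mulr_suml ler_wpM2r ?cabs_ge0 // sum_npow_le.
have := cabsB A (A - 1); rewrite opprB addrC subrK cabs1 => h.
rewrite mulrC; apply: (le_trans h); apply: lerD => //; exact: le_trans D tail.
Qed.

End LowerBound.

(** * The number of zeros close to one another *)

Section Cluster.
Variable R : realType.
Variables (zeta : Cplx R -> Cplx R) (zetaP : is_riemann_zeta zeta).
Implicit Types (z c : R[i]) (M : nat).

(** For M = 1 the approximation is - z / (1 - z), with an error of at most 3 |z|. This keeps the
    discs of [zero_cluster] away from the pole. *)
Lemma zeta_zero_far_from_pole z : zeta z = 0 -> 0 < complex.Im z -> 9 / 10 <= complex.Re z ->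
  1 / 3 <= cabs (1 - z).
Proof.
move=> z0 im re; have := zeta_zapprox zetaP im re (isT : (0 < 1)%N).
rewrite z0 sub0r cabsN npow1 mulr1.
have n1 : 1 - z != 0 by rewrite subr_eq0 eq_sym; exact: neq1_Im.
have -> : zapprox 1 z = - (z / (1 - z)).
  by rewrite /zapprox /zsum big_ord_recr big_ord0 /= add0r !cpw_1; field.
rewrite cabsN cabsM cabsV; have p0 : 0 < cabs (1 - z) by rewrite cabs_gt0.
have q0 : 0 < cabs z by rewrite cabs_gt0; apply/eqP => e; move: im; rewrite e /= ltxx.
rewrite ler_pdivrMr // mulrAC -{1}[cabs z]mul1r ler_pM2r // => h; lra.
Qed.

Lemma zeta_upper_bound z M (kap : R) : 1 / 6 <= complex.Im z -> 9 / 10 <= complex.Re z ->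
  1 - kap <= complex.Re z -> 0 <= kap -> (0 < M)%N -> cabs z <= M%:R ->
  cabs (zeta z) <= expR (kap * ln M%:R) * (10 + ln M%:R).
Proof.
move=> im re rk k0 M0 zM; have im0 : 0 < complex.Im z by lra.
have M0' : 0 < M%:R :> R by rewrite ltr0n.
have lM0 : 0 <= ln M%:R :> R by rewrite ln_ge0 // ler1n.
set E := expR _; have E0 : 0 < E by exact: expR_gt0.
have E1 : 1 <= E by rewrite (le_trans _ (expR_ge1Dx _)) // lerDl mulr_ge0.
have nE n : (0 < n <= M)%N -> npow (complex.Re z) n <= n%:R^-1 * E.
  move=> /andP[n0 nM]; rewrite npow_shift // ler_wpM2l ?invr_ge0 // ler_expR.
  apply: (@le_trans _ _ (kap * ln n%:R)); first by rewrite ler_wpM2r ?ln_ge0 ?ler1n //; lra.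
  by rewrite ler_wpM2l // ler_ln ?posrE ?ltr0n // ler_nat.
have h := zeta_zapprox zetaP im0 re M0.
have -> : zeta z = (zeta z - zapprox M z) + zsum z M - cpw M%:R (z - 1) / (1 - z).
  by rewrite /zapprox; ring.
apply: (le_trans (cabsB _ _)).
have b1 : cabs (zeta z - zapprox M z + zsum z M) <= 3 * E + (1 + ln M%:R) * E.
  apply: (le_trans (cabsD _ _)); apply: lerD.
    apply: (le_trans h); rewrite -mulrA ler_wpM2l //.
    apply: (@le_trans _ _ (M%:R * (M%:R^-1 * E))); last by rewrite mulrA divff ?mul1r // lt0r_neq0.
    by apply: ler_pM; rewrite ?cabs_ge0 ?(ltW (npow_gt0 _ _)) // nE // M0 /=.
  apply: (le_trans (cabs_sum _ _ _)); apply: (@le_trans _ _ (harm R M * E)); last first.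
    by rewrite ler_wpM2r ?(ltW E0) // harm_le.
  rewrite /harm big_add1 /= big_mkord mulr_suml; apply: ler_sum => i _.
  by rewrite cabs_cpwn nE //=.
have b2 : cabs (cpw M%:R (z - 1) / (1 - z)) <= 6 * E.
  rewrite cabsM cabsV cabs_cpwn mulrC; apply: ler_pM; rewrite ?invr_ge0 ?cabs_ge0 ?(ltW (npow_gt0 _ _)) //.
    have q : 1 / 6 <= cabs (1 - z).
      apply: le_trans (Im_le_cabs _); rewrite ImD ImN /= sub0r normrN; exact: le_trans im (ler_norm _).
    have -> : 6 = (1 / 6)^-1 :> R by rewrite div1r invrK.
    by rewrite lef_pV2 ?posrE //; apply: lt_le_trans q; lra.
  rewrite /npow /E ler_expR ReD ReN /= -mulNr ler_wpM2r //; lra.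
apply: (le_trans (lerD b1 b2)); rewrite le_eqVlt; apply/orP; left; apply/eqP; ring.
Qed.

(** Jensen's inequality in the discs of radii r and 3 r about 1 + s0 / 2 + i g gives a factor 1/2
    per zero. The larger disc reaches left to 1 - kap, since 3 r - s0 / 2 = 3 eta + 13/8 s0. At the
    centre |zeta| is at least the inverse of 1 + 2 / s0, and 5/3 comes from ln 2 >= 3/5. *)
Lemma zero_cluster (zs : seq R[i]) (eta s0 g : R) M : uniq zs ->
  0 <= eta <= 73 / 100 / 100 -> 0 < s0 <= 48 / 1000 -> g + 2 <= M%:R ->
  (forall z, z \in zs -> [/\ zeta z = 0, 1 - eta <= complex.Re z < 1, 0 < complex.Im z &
     `|complex.Im z - g| <= s0 / 2]) ->
  (size zs)%:R <= 5 / 3 * ((3 * eta + 13 / 8 * s0) * ln M%:R + ln (10 + ln M%:R) + ln (1 + 2 / s0)).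
Proof.
move=> us /andP[eta0 eta1] /andP[s00 s01] gM Hz.
have ten_gt0 (l : R) : 0 <= l -> 0 < 10 + l by lra.
have fin (n e a : R) : 3 / 5 * n <= e -> e <= a -> n <= 5 / 3 * a by lra.
set kap := 3 * eta + _.
have k0 : 0 <= kap by rewrite /kap; lra.
have [->|zn] := eqVneq zs [::].
  have l1 : 0 <= ln (1 + 2 / s0) by rewrite ln_ge0 // lerDl divr_ge0 // ltW.
  have l2 : 0 <= ln M%:R :> R.
    by case: (M) => [|m]; [rewrite ln0|rewrite ln_ge0 // ler1n].
  have l3 : 0 <= ln (10 + ln M%:R) :> R by rewrite ln_ge0 //; lra.
  by rewrite /= mulr_ge0 ?addr_ge0 ?mulr_ge0.
have g0 : 3 / 10 <= g.
  case: zs zn Hz {us} => // z zs _ /(_ z (mem_head _ _)) [z0 /andP[r1 r2] i0].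
  rewrite ler_norml => /andP[_ i1].
  have re9 : 9 / 10 <= complex.Re z by lra.
  have := zeta_zero_far_from_pole z0 i0 re9; have := cabs_le_ReIm (1 - z).
  rewrite ReD ImD ReN ImN /= sub0r normrN (ger0_norm (ltW i0)) ger0_norm; last by lra.
  by move: (cabs _) => a; lra.
pose c : R[i] := (1 + s0 / 2) +i* g.
pose r : R := eta + 17 / 24 * s0.
have r0 : 0 < r by rewrite /r; lra.
have r3 : 3 * r <= 124 / 1000 by rewrite /r; lra.
have rr : r < 3 * r by lra.
have disc z : cabs (z - c) <= 3 * r -> 1 - kap <= complex.Re z /\ 1 / 6 <= complex.Im z.
  move=> zc; have a1 := le_trans (Re_le_cabs _) zc; have a2 := le_trans (Im_le_cabs _) zc.
  move: a1 a2; rewrite ReD ImD ReN ImN /= !ler_norml => /andP[a1 _] /andP[a2 _].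
  split; last by lra.
  by move: a1; rewrite /kap /r; lra.
have k1 : kap <= 1 / 10 by rewrite /kap; lra.
have M0 : (0 < M)%N by rewrite -(ltr_nat R); lra.
have Hd z : cabs (z - c) <= 3 * r -> cdiff zeta z.
  by move=> /disc[_ i6]; apply: cdiff_zeta zetaP _ _; apply: neq1_Im; lra.
pose Mx := expR (kap * ln M%:R) * (10 + ln M%:R).
have HM z : cabs (z - c) = 3 * r -> cabs (zeta z) <= Mx.
  move=> e; have zc : cabs (z - c) <= 3 * r by rewrite e.
  have [d1 d2] := disc z zc; apply: zeta_upper_bound => //; first by lra.
  have -> : z = (z - c) + c by rewrite subrK.
  have cc : cabs c <= `|1 + s0 / 2| + `|g| by exact: cabs_le_ReIm.
  apply: (le_trans (cabsD _ _)); rewrite e; move: cc; rewrite !ger0_norm; [|lra|lra].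
  by move: (cabs c) => a; lra.
have Hs z : z \in zs -> zeta z = 0 /\ cabs (z - c) <= r.
  move=> /Hz [z0 /andP[a1 a2] i0 i1]; split => //.
  rewrite cabsE -[leRHS](ger0_norm (ltW r0)) -sqrtr_sqr ler_wsqrtr // ReD ImD ReN ImN /=.
  have i2 : (complex.Im z - g) ^+ 2 <= (s0 / 2) ^+ 2.
    by rewrite -(real_normK (num_real _)) lerXn2r ?nnegrE //; lra.
  have e2 : (complex.Re z - (1 + s0 / 2)) ^+ 2 <= (eta + s0 / 2) ^+ 2.
    rewrite -(real_normK (num_real (_ - _))) lerXn2r ?nnegrE //; first by lra.
    by rewrite ler_norml; apply/andP; split; lra.
  have es : 0 <= eta * s0 by rewrite mulr_ge0 // ltW.
  have ss : 0 <= s0 * s0 by rewrite mulr_ge0 // ltW.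
  apply: (le_trans (lerD e2 i2)); rewrite /r.
  rewrite -subr_ge0.
  have -> : (eta + 17 / 24 * s0) ^+ 2 - ((eta + s0 / 2) ^+ 2 + (s0 / 2) ^+ 2) =
     5 / 12 * (eta * s0) + 1 / 576 * (s0 * s0) by field.
  by clear -es ss; move: es ss; move: (eta * s0) (s0 * s0) => p q; lra.
have ZC := zero_count r0 rr us Hd HM Hs.
have half : r / (3 * r - r) = 1 / 2.
  have -> : 3 * r - r = 2 * r by ring.
  by rewrite invfM mulrCA divff ?mulr1 ?div1r // lt0r_neq0.
have cE : complex.Re c = s0 / 2 + 1 by rewrite /= addrC.
have s2 : 0 < s0 / 2 by lra.
have low := zeta_lower_bound zetaP s2 cE.
rewrite half in ZC.
have l2 : 0 <= ln M%:R :> R by rewrite ln_ge0 // ler1n.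
have p1 := ten_gt0 _ l2.
have p2 : 0 < 1 + 2 / s0 by rewrite addr_gt0 ?divr_gt0.
have pow : 2 ^+ size zs <= Mx * (1 + 2 / s0).
  have h := le_trans low ZC.
  have n0 : 0 < (2 : R) ^+ size zs by rewrite exprn_gt0.
  have e1 : s0 / 2 / (1 + s0 / 2) = (1 + 2 / s0)^-1.
    by field; rewrite !lt0r_neq0 ?addr_gt0.
  by move: h; rewrite e1 expr_div_n expr1n mulrA mulr1 ler_pdivlMr // mulrC -ler_pdivlMr ?invr_gt0 // invrK.
have := pow; rewrite -ler_ln ?posrE ?exprn_gt0 ?mulr_gt0 ?expR_gt0 //.
rewrite lnXn // !lnM ?posrE ?mulr_gt0 ?expR_gt0 // expRK -[ln 2 *+ size zs]mulr_natl => h.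
have n0 : 0 <= (size zs)%:R :> R by [].
have h2 : 3 / 5 * (size zs)%:R <= (size zs)%:R * ln (2 : R).
  by rewrite mulrC ler_wpM2l // ln2_ge.
exact: fin h2 h.
Qed.

End Cluster.

(** * From clusters and well-spaced zeros to all zeros *)

Section Boxes.
Variable R : realType.

(** Boxes of height s0 are split by the parity of their index; within one parity one zero from each
    non-empty box forms a well-spaced set. So at most X boxes of each parity are non-empty, each
    with at most cl zeros. *)
Lemma count_by_boxes (S : seq R[i]) (s0 Tm cl X : R) : uniq S -> 0 < s0 -> 0 <= cl ->
  (forall z, z \in S -> 0 <= complex.Im z <= Tm) ->
  (forall (zs : seq R[i]) (g : R), uniq zs -> {subset zs <= S} -> g <= Tm + s0 ->
     (forall z, z \in zs -> `|complex.Im z - g| <= s0 / 2) -> (size zs)%:R <= cl) ->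
  (forall Q (act : pred 'I_Q) (rho : 'I_Q -> R[i]), (forall m, act m -> rho m \in S) ->
     (forall m k, act m -> act k -> (k : nat) != m ->
       (2 * ((m - k) + (k - m))%:R - 1) * s0 <= `|complex.Im (rho m) - complex.Im (rho k)|) ->
     \sum_(m | act m) 1 <= X) ->
  (size S)%:R <= 2 * (cl * X).
Proof.
move=> us s00 cl0 im Hc Hx.
pose box (z : R[i]) := Num.truncn (complex.Im z / s0).
have boxP z : z \in S -> (box z)%:R * s0 <= complex.Im z < (box z).+1%:R * s0.
  move=> /im /andP[i0 _]; have i1 : 0 <= complex.Im z / s0 by rewrite divr_ge0 // ltW.
  have /andP[a b] := truncn_itv i1.
  by rewrite -ler_pdivlMr // -ltr_pdivrMr // a b.
pose Q := (Num.truncn (Tm / s0)).+1.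
have boxQ z : z \in S -> (box z < Q)%N.
  by move=> zS; rewrite ltnS le_truncn // ler_wpM2r ?invr_ge0 ?(ltW s00) //; case/andP: (im z zS).
pose cnt (p : bool) (m : 'I_Q) := count (fun z => box z == (p + m.*2)%N) S.
have tot : (size S)%:R <= \sum_(p : bool) \sum_(m < Q) (cnt p m)%:R :> R.
  have ct p m : (cnt p m)%:R = \sum_(z <- S) (box z == (p + m.*2)%N)%:R :> R.
    by rewrite /cnt -sum1_count natr_sum big_mkcond; apply: eq_bigr => z _; case: eqP.
  under eq_bigr do under eq_bigr do rewrite ct.
  under eq_bigr do rewrite exchange_big /=.
  rewrite exchange_big /= -sum1_size natr_sum big_seq [leRHS]big_seq; apply: ler_sum => z zS.
  have hQ : ((box z)./2 < Q)%N by apply: leq_ltn_trans (boxQ z zS); rewrite -{2}(odd_double_half (box z)) -addnn addnA leq_addl.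
  rewrite (bigD1 (odd (box z))) //= (bigD1 (Ordinal hQ)) //= odd_double_half eqxx.
  rewrite -addrA lerDl addr_ge0 ?sumr_ge0 //.
  by move=> p _; apply: sumr_ge0.
have one p : \sum_(m < Q) (cnt p m)%:R <= cl * X.
  pose act (m : 'I_Q) := has (fun z => box z == (p + m.*2)%N) S.
  (* The default 0 is returned only for an empty box, which [act] excludes. *)
  pose rho (m : 'I_Q) := nth 0 S (find (fun z => box z == (p + m.*2)%N) S).
  have rS m : act m -> rho m \in S by move=> am; rewrite mem_nth // -has_find.
  have rB m : act m -> box (rho m) = (p + m.*2)%N by move=> am; apply/eqP; exact: (nth_find 0 am).
  have sp m k : act m -> act k -> (k : nat) != m ->
       (2 * ((m - k) + (k - m))%:R - 1) * s0 <= `|complex.Im (rho m) - complex.Im (rho k)|.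
    wlog lt_mk : m k / (m < k)%N => [H am ak km|am ak km].
      have [lt|lt|e] := ltngtP m k; first exact: H.
        by rewrite addnC distrC; apply: H => //; rewrite eq_sym.
      by rewrite e eqxx in km.
    have /andP[_ a] := boxP _ (rS m am); have /andP[b _] := boxP _ (rS k ak).
    rewrite (rB m am) in a; rewrite (rB k ak) in b.
    have -> : ((m - k) + (k - m))%:R = k%:R - m%:R :> R.
      by rewrite (eqP (ltnW lt_mk)) add0n natrB // ltnW.
    rewrite distrC; apply: le_trans (ler_norm _).
    move: a b; rewrite -natr1 !natrD -!mul2n !natrM; move: (complex.Im _) (complex.Im _) (p%:R) (m%:R) (k%:R) => u v q x y a b.
    have -> : (2 * (y - x) - 1) * s0 = (q + 2 * y) * s0 - (q + 2 * x + 1) * s0 by ring.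
    lra.
  have HX := Hx Q act rho rS sp.
  apply: (@le_trans _ _ (\sum_(m < Q | act m) cl)); last first.
    by rewrite -[cl in leLHS]mulr1 -mulr_sumr ler_wpM2l.
  rewrite [leRHS]big_mkcond; apply: ler_sum => m _.
  case: ifP => [am|/negbT na]; last by rewrite /cnt; move: na; rewrite /act has_count -leqNgt leqn0 => /eqP ->.
  rewrite /cnt -size_filter; apply: (Hc _ (((p + m.*2)%:R + 1 / 2) * s0)).
  - exact: filter_uniq.
  - by move=> z; rewrite mem_filter => /andP[].
  - have /andP[a _] := boxP _ (rS m am); have /andP[_ b] := im _ (rS m am).
    rewrite (rB m am) in a; rewrite mulrDl; apply: lerD; [exact: le_trans a b|lra].
  - move=> z; rewrite mem_filter => /andP[/eqP e zS].
    have /andP[a b] := boxP _ zS; rewrite e -natr1 in a b.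
    by rewrite ler_norml; apply/andP; split; move: a b; rewrite !mulrDl; lra.
apply: (le_trans tot); rewrite big_bool mulr_natl mulr2n; exact: lerD.
Qed.

End Boxes.

(** * Zeros in a long strip *)

Section Block.
Variable R : realType.

Lemma ln_ceil_le (x : R) : 10 <= x -> ln (Num.truncn x).+1%:R <= ln x + 1 / 10.
Proof.
move=> x10; have x0 : 0 < x by lra.
have -> : ln x + 1 / 10 = ln (x * expR (1 / 10)) by rewrite lnM ?posrE ?expR_gt0 // expRK.
rewrite ler_ln ?posrE ?mulr_gt0 ?expR_gt0 // -natr1.
have h : (Num.truncn x)%:R <= x by have /andP[] := truncn_itv (ltW x0).
have e := expR_ge1Dx (1 / 10 : R).
have m : x * (1 + 1 / 10) <= x * expR (1 / 10) by rewrite ler_wpM2l // ltW.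
by move: h m; move: (_%:R) (x * expR _) => a b; lra.
Qed.

Lemma ln_ceil_expR_add3 (L : R) : 40 <= expR L -> ln (Num.truncn (expR L + 3)).+1%:R <= L + 1 / 5.
Proof.
move=> L40; have x10 : 10 <= expR L + 3 by move: L40; clear; lra.
apply: (le_trans (ln_ceil_le x10)).
have h : ln (expR L + 3) <= L + 1 / 10.
  have p : 0 < expR L + 3 by move: L40; clear; lra.
  rewrite -[leRHS]expRK ler_ln ?posrE ?expR_gt0 // expRD.
  have h := expR_ge1Dx (1 / 10 : R).
  have m : expR L * (1 + 1 / 10) <= expR L * expR (1 / 10) by rewrite ler_wpM2l ?expR_ge0.
  by move: m L40; move: (expR L) (_ * expR _); clear=> u v; lra.
by move: h; move: (ln _); clear=> u; lra.
Qed.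

Lemma ln_ceil_ge (x : R) : 0 < x -> ln x <= ln (Num.truncn x).+1%:R.
Proof. by move=> x0; rewrite ler_ln ?posrE ?ltr0n // ltW // truncnS_gt. Qed.

Lemma ln_floor_le (x : R) : 1 <= x -> ln (Num.truncn x)%:R <= ln x.
Proof.
move=> x1; have x0 : 0 < x by lra.
have t0 : (0 < Num.truncn x)%N by rewrite truncn_gt0.
by rewrite ler_ln ?posrE ?ltr0n //; have /andP[] := truncn_itv (ltW x0).
Qed.

Lemma expR_ge_pow (x : R) n : 0 <= x -> (1 + x) ^+ n <= expR (n%:R * x).
Proof.
by move=> x0; rewrite expRM_natl lerXn2r ?nnegrE ?expR_ge0 ?expR_ge1Dx // addr_ge0.
Qed.

Lemma sqr_ge_of (x y z : R) : 0 <= x -> x <= y -> z <= x ^+ 2 -> z <= y ^+ 2.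
Proof. by move=> x0 xy /le_trans; apply; rewrite lerXn2r ?nnegrE // (le_trans x0). Qed.

Lemma expR8_ge : 1000 <= expR 8 :> R.
Proof.
have -> : 8 = 32%:R * (1 / 4) :> R by lra.
apply: le_trans (expR_ge_pow 32 _); last by lra.
have -> : (1 + 1 / 4) ^+ 32 = (((((1 + 1 / 4) ^+ 2) ^+ 2) ^+ 2) ^+ 2) ^+ 2 :> R by rewrite -!exprM.
apply: (@sqr_ge_of 33); [lra| |lra].
apply: (@sqr_ge_of (23 / 4)); [lra| |lra].
apply: (@sqr_ge_of (12 / 5)); [lra| |lra].
apply: (@sqr_ge_of (39 / 25)); [lra| |lra].
lra.
Qed.

(** Rounding up a number that is at least 10 costs at most 1/10 in its logarithm. Only y, which may
    be as small as 1, is rounded down, losing at most 1 when b > 1. *)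
Lemma sieve_parameters (a b c e : R) : 8 <= a -> 0 <= b -> 0 < c -> 0 < e ->
  exists M0 y z1 z2 : nat,
  [/\ (1000 <= M0)%N, (0 < y)%N, (0 < z1)%N, (z1 < z2)%N & (M0 * (y * y))%:R * expR c <= z1%:R :> R] /\
  [/\ a <= ln M0%:R, ln M0%:R <= a + 1 / 10, ln y%:R <= b & (1 < b -> b - 1 <= ln y%:R)] /\
  [/\ ln z1%:R <= a + 2 * b + c + 1 / 5, e <= ln (z2%:R / z1%:R) & ln (z2%:R / z1%:R) <= e + 1 / 10].
Proof.
move=> a8 b0 c0 e0.
have ea : 1000 <= expR a by apply: (le_trans expR8_ge); rewrite ler_expR.
have ten : (10 : R) <= 1000 by rewrite ler_nat.
pose M0 := (Num.truncn (expR a)).+1; pose y := Num.truncn (expR b).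
have M1 : (1000 <= M0)%N by apply: leqW; rewrite truncn_ge_nat ?expR_ge0.
have M0' : (0 < M0)%N by [].
have eb : 1 <= expR b by rewrite (le_trans _ (expR_ge1Dx _)) // lerDl.
have y0 : (0 < y)%N by rewrite truncn_gt0.
have la : a <= ln M0%:R by rewrite -[leLHS]expRK ln_ceil_ge // expR_gt0.
have la' : ln M0%:R <= a + 1 / 10 by rewrite -[a in leRHS]expRK ln_ceil_le // (le_trans ten).
have ly : ln y%:R <= b by rewrite -[leRHS]expRK ln_floor_le.
have Mp : 0 < M0%:R :> R by rewrite ltr0n.
have yp : 0 < y%:R :> R by rewrite ltr0n.
have c1 : 1 <= expR c by rewrite (le_trans _ (expR_ge1Dx _)) // lerDl ltW.
pose x := (M0 * (y * y))%:R * expR c.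
have x1000 : 1000 <= x.
  apply: (@le_trans _ _ (M0 * (y * y))%:R); first by rewrite ler_nat (leq_trans M1) // leq_pmulr // muln_gt0 y0.
  by rewrite ler_peMr.
have x0 : 0 < x by apply: lt_le_trans x1000; rewrite ltr0n.
pose z1 := (Num.truncn x).+1.
have z1x : x <= z1%:R by rewrite ltW // truncnS_gt.
have z1p : 0 < z1%:R :> R by rewrite ltr0n.
have lx : ln x = ln M0%:R + 2 * ln y%:R + c.
  by rewrite /x !natrM !lnM ?posrE ?mulr_gt0 ?expR_gt0 // expRK; ring.
have lz1 : ln z1%:R <= ln x + 1 / 10 by rewrite ln_ceil_le // (le_trans ten).
have e1 : 1 < expR e by rewrite (lt_le_trans _ (expR_ge1Dx _)) // ltrDl.
pose x2 := z1%:R * expR e.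
have x20 : z1%:R < x2 by rewrite ltr_pMr.
have x2p : 0 < x2 by rewrite (lt_trans z1p).
pose z2 := (Num.truncn x2).+1.
have z2p : 0 < z2%:R :> R by rewrite ltr0n.
have lz2 : ln (z2%:R / z1%:R) = ln z2%:R - ln z1%:R :> R by rewrite ln_div ?posrE.
have lx2 : ln x2 = ln z1%:R + e by rewrite lnM ?posrE ?expR_gt0 // expRK.
have g1 : ln x2 <= ln z2%:R by exact: ln_ceil_ge.
have g2 : ln z2%:R <= ln x2 + 1 / 10.
  by apply: ln_ceil_le; apply: (le_trans ten); apply: (le_trans x1000); rewrite (le_trans z1x) // ltW.
exists M0, y, z1, z2; split; [split=> //|split].
- by rewrite -(ltr_nat R) (lt_trans x20) // truncnS_gt.
- split => // b1.
  have ey : expR b - 1 <= y%:R by rewrite lerBlDr natr1 ltW // truncnS_gt.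
  have h2 : expR (b - 1) <= expR b - 1.
    have q : 1 <= expR (b - 1) by rewrite (le_trans _ (expR_ge1Dx _)) // lerDl subr_ge0 ltW.
    have -> : expR b = expR (b - 1) * expR 1 by rewrite -expRD subrK.
    have q2 : expR (b - 1) * 2 <= expR (b - 1) * expR 1.
      by rewrite ler_wpM2l ?expR_ge0 //; have := expR_ge1Dx (1 : R); clear; lra.
    by move: q q2; move: (expR (b - 1)) (_ * expR 1); clear=> u v; lra.
  by rewrite -[leLHS]expRK ler_ln ?posrE ?expR_gt0 // (le_trans h2).
- rewrite lz2; move: g1 g2 lz1 la' ly; rewrite lx2 lx.
  move: (ln z1%:R) (ln z2%:R) (ln M0%:R) (ln y%:R); clear=> *; split; lra.
Qed.

Definition eta_max : R := 73 / 100 / 100.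

Section Bounds.
Variables (L al ky k1 k2 De D K V : R).

(** The parameters are exponents relative to L = ln T: M0 = T^al, y = T^ky, om = k2 L and z2 / z1 =
    T^k1, while the spacing of the zeros is D / L. The summand 1 absorbs the roundings of
    [sieve_parameters]. *)
Definition ln_z_bound := (al + 2 * ky + k2 + k1) * L + 1.
Definition ln_y_bound := ky * L.
Definition ln_N_bound := (2 * al + 3 * ky + k2 + k1) * L + 1.
Definition ln_ratio_bound := (al + ky + k1 + k2) * L + 1.
Definition approx_error := K * expR (- ((De / 2 - 2 * eta_max) * (al * L))).
Definition sieve_mass_bound_ln := 384 * ln_N_bound * (2 + ln_z_bound) / (k1 * L) ^+ 2.
Definition cluster_bound (e : R) :=
  5 / 3 * (3 * (e * L) + 13 / 8 * D + 1 / 50 + ln (11 + L) + ln (1 + 2 * L / D)).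
Definition block_bound (e : R) := 2 * (cluster_bound e * (13 / 10 * (sieve_mass_bound_ln * V *
  (expR (2 * e * (ln_N_bound + k2 * L)) * (ln_ratio_bound + 12 * L / (k2 * D ^+ 2)))))).

End Bounds.

(** The product of the cluster bound and the bound for well-spaced zeros. Zeros below exp lam are
    left out because the pole enters the detection error as N^eta exp (- lam). V bounds the form of
    the Selberg weights. *)
Lemma zero_block (zeta : Cplx R -> Cplx R) (L lam eta al ky k1 k2 De D K B V : R) (S : seq R[i])
  (zetaP : is_riemann_zeta zeta) (eta0 : 0 <= eta) (eta1 : eta <= eta_max)
  (L10 : 10 <= L) (alL : 8 <= al * L) (al0 : 0 < al) (ky0 : 0 <= ky) (k10 : 0 < k1) (k20 : 0 < k2)
  (D0 : 0 < D) (DL : D <= 48 / 1000 * L)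
  (De1 : De <= 1) (DeL : 1 <= De * (al * L))
  (Det : [\/ De <= 2 - al^-1, 3 * De <= 3 - al^-1 | 7 * De <= 4 - al^-1])
  (d0 : 0 < De / 2 - 2 * eta_max) (B0 : 0 <= B) (BL : 1024 * (1 + 2 * L) <= B ^+ 2)
  (K8 : 8 <= K)
  (KB : (B + 3) * (1 + 3 / 5 * (De / 2 - 2 * eta_max)) <= K * (3 / 5 * (De / 2 - 2 * eta_max)))
  (VP : 1 <= V \/ 1 < ky * L /\ 2 / (ky * L - 1) <= V)
  (detection_small : (1 + (ln_z_bound L al ky k1 k2)) * (1 + (ln_y_bound L ky)) ^+ 2 *
  ((approx_error L al De K) * expR (eta_max * ((ln_z_bound L al ky k1 k2) + (ln_y_bound L ky))) + expR (eta_max * (ln_N_bound L al ky k1 k2) - lam)) <= 1 / 10)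
  (kernel_small : (sieve_mass_bound_ln L al ky k1 k2) * ((1 + (ln_y_bound L ky)) ^+ 3 * (expR (4 * eta_max * (ln_y_bound L ky)) *
  ((approx_error L al De K) + 2 * expR (- ((1 - 2 * eta_max) * (al * L)))))) <= 1 / 25) : uniq S ->
  (forall z, z \in S -> [/\ zeta z = 0, 1 - eta <= complex.Re z < 1 & expR lam <= complex.Im z <= expR L]) ->
  (size S)%:R <= block_bound L al ky k1 k2 D V eta.
Proof.
move=> us HS.
have coef_ge0 (u v : R) : 0 <= u -> 0 <= v -> 0 <= 3 * u + 13 / 8 * v by lra.
have L0 : 0 < L by have := L10; lra.
have em : 0 <= eta_max by exact: le_trans eta1.
have em1 : eta_max <= 1 / 100 by rewrite /eta_max; lra.
pose om := k2 * L; have om0 : 0 < om by exact: mulr_gt0.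
pose s0 := D / L; have s00 : 0 < s0 by exact: divr_gt0.
have s01 : s0 <= 48 / 1000 by rewrite ler_pdivrMr.
have b0 : 0 <= ky * L by rewrite mulr_ge0 // ltW.
have e0 : 0 < k1 * L by exact: mulr_gt0.
have [M0 [y [z1 [z2 [[M1 y0 z10 z12 Mz] [[lM lM' ly ly'] [lz1 lr lr']]]]]]] := sieve_parameters alL b0 om0 e0.
have M4 : (4 <= M0)%N by apply: leq_trans M1.
have M0p : (0 < M0)%N by apply: leq_trans M4.
have z20 : (0 < z2)%N by apply: leq_trans z12.
pose N := (M0 * (z2 * y))%N.
have N1 : (1000 <= N)%N by apply: (leq_trans M1); rewrite leq_pmulr // muln_gt0 z20.
have yN : (y <= N)%N by rewrite /N mulnA leq_pmull // muln_gt0 M0p.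
have [Mr yr z1r z2r Nr] : [/\ 0 < M0%:R :> R, 0 < y%:R :> R, 0 < z1%:R :> R, 0 < z2%:R :> R & 0 < N%:R :> R].
  by rewrite !ltr0n; split=> //; apply: leq_trans N1.
have ly0 : 0 <= ln y%:R :> R by rewrite ln_ge0 // ler1n.
have lz2 : ln z2%:R = ln z1%:R + ln (z2%:R / z1%:R) :> R by rewrite ln_div ?posrE // addrC subrK.
have lN : ln N%:R = ln M0%:R + ln z2%:R + ln y%:R :> R.
  by rewrite /N !natrM !lnM ?posrE ?mulr_gt0 // addrA.
have lNz : ln (N%:R / z1%:R) = ln M0%:R + ln y%:R + ln (z2%:R / z1%:R) :> R.
  by rewrite ln_div ?posrE // lN lz2; ring.
have lzy : ln (z2 * y)%:R = ln z2%:R + ln y%:R :> R by rewrite natrM lnM ?posrE.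
have lz20 : 0 <= ln z2%:R :> R by rewrite ln_ge0 // ler1n.
have lN0 : 0 <= ln N%:R :> R by rewrite ln_ge0 // ler1n; apply: leq_trans N1.
have lr0 : 0 <= ln (z2%:R / z1%:R) :> R := le_trans (ltW e0) lr.
have Zb : ln z2%:R <= (ln_z_bound L al ky k1 k2).
  by rewrite lz2 /ln_z_bound; move: lz1 lr'; rewrite /om; move: (ln z1%:R) (ln (_ / _)); clear=> u v; lra.
have Nb : ln N%:R <= (ln_N_bound L al ky k1 k2).
  rewrite lN lz2 /ln_N_bound; move: lz1 lr' lM' ly; rewrite /om.
  by move: (ln z1%:R) (ln (_ / _)) (ln M0%:R) (ln y%:R); clear=> u v w x; lra.
have Wb : ln (N%:R / z1%:R) + om <= (ln_ratio_bound L al ky k1 k2).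
  rewrite lNz /ln_ratio_bound; move: lr' lM' ly; rewrite /om.
  by move: (ln (_ / _)) (ln M0%:R) (ln y%:R); clear=> v w x; lra.
have hz : harm R z2 <= 1 + (ln_z_bound L al ky k1 k2) by apply: (le_trans (harm_le R z2)); rewrite lerD2l.
have hy : harm R y <= 1 + (ln_y_bound L ky) by apply: (le_trans (harm_le R y)); rewrite lerD2l.
have hz0 := harm_ge0 R z2; have hy0 := harm_ge0 R y.
have ae0 : 0 <= (approx_error L al De K) by rewrite mulr_ge0 ?expR_ge0 //; move: K8; clear; lra.
have HE (w : R[i]) : w != 1 -> 1 - 2 * eta <= complex.Re w <= 1 -> `|complex.Im w| <= expR L ->
    forall M k, (M0 <= M)%N -> cabs (zapprox (M + k) w - zapprox M w) <= (approx_error L al De K).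
  move=> w1 /andP[wk wk'] wL M k MM.
  have kp : 0 <= 2 * eta_max by rewrite mulr_ge0.
  apply: (zapprox_uniform M4 al0 lM DeL De1 Det kp d0 B0 BL K8 KB w1 _ wL) => //.
  by rewrite wk' andbT (le_trans _ wk) // lerD2l lerN2 ler_wpM2l.
have dS := detection_small; have kS := kernel_small.
move: ((approx_error L al De K)) ae0 HE dS kS => ae ae0 HE dS kS.
have SMb : sieve_mass R z1 z2 N <= (sieve_mass_bound_ln L al ky k1 k2).
  have sq0 : 0 < (k1 * L) ^+ 2 by rewrite exprn_gt0.
  have q1 : 64 * harm R z2 / ln (z2%:R / z1%:R) ^+ 2 <= 64 * (1 + (ln_z_bound L al ky k1 k2)) / (k1 * L) ^+ 2.
    apply: ler_pM; rewrite ?invr_ge0 ?sqr_ge0 ?mulr_ge0 //; first by rewrite ler_wpM2l.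
    by rewrite lef_pV2 ?posrE ?exprn_gt0 ?lerXn2r ?nnegrE ?(ltW e0) // ?(le_trans (ltW e0)) // (lt_le_trans e0).
  (* N is at least exp (k1 L), so the term 1 / N merely turns the factor 1 + ln z2 into 2 + ln
     z2. *)
  have q2 : N%:R^-1 <= 64 / (k1 * L) ^+ 2.
    have h : (k1 * L) ^+ 2 / 4 <= N%:R.
      apply: (@le_trans _ _ (expR (k1 * L))).
        have -> : expR (k1 * L) = expR (k1 * L / 2) ^+ 2 by rewrite -expRM_natl; congr expR; field.
        have -> : (k1 * L) ^+ 2 / 4 = (k1 * L / 2) ^+ 2 by field.
        rewrite lerXn2r ?nnegrE ?expR_ge0 ?divr_ge0 ?(ltW e0) //.
        by apply: le_trans (expR_ge1Dx _); rewrite lerDr.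
      rewrite -[N%:R]lnK ?posrE // ler_expR; apply: (le_trans lr); rewrite lN lz2.
      have : 0 <= ln z1%:R :> R by rewrite ln_ge0 // ler1n.
      have : 0 <= ln M0%:R :> R by rewrite ln_ge0 // ler1n.
      by move: ly0; move: (ln _) (ln _) (ln _) (ln _); clear=> p q r s; lra.
    rewrite -[leRHS]invrK lef_pV2 ?posrE ?invr_gt0 ?divr_gt0 // invf_div.
    by apply: le_trans h; rewrite ler_wpM2l ?sqr_ge0 // lef_pV2 ?posrE // ler_nat.
  apply: (@le_trans _ _ (6 * (ln_N_bound L al ky k1 k2) * (64 * (1 + (ln_z_bound L al ky k1 k2)) / (k1 * L) ^+ 2 + 64 / (k1 * L) ^+ 2))).
    apply: ler_pM; [exact: mulr_ge0|by rewrite addr_ge0 ?invr_ge0 ?divr_ge0 ?mulr_ge0 ?sqr_ge0| |].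
    - by rewrite ler_wpM2l.
    - exact: lerD.
  rewrite /sieve_mass_bound_ln le_eqVlt; apply/orP; left; apply/eqP.
  by move: ((k1 * L) ^+ 2) sq0 => u u0; field; rewrite lt0r_neq0.
have SM0 : 0 <= sieve_mass R z1 z2 N.
  by rewrite mulr_ge0 ?mulr_ge0 // addr_ge0 ?invr_ge0 ?divr_ge0 ?mulr_ge0 ?sqr_ge0.
have Zb0 : 0 <= (ln_z_bound L al ky k1 k2) := le_trans lz20 Zb.
have Nb0 : 0 <= (ln_N_bound L al ky k1 k2) := le_trans lN0 Nb.
have Yb0 : 0 <= (ln_y_bound L ky) by [].
have De_ok : detection_error eta y z2 N ae (expR lam) <= 1 / 10.
  apply: le_trans dS; rewrite /detection_error; apply: ler_pM.
  - by rewrite mulr_ge0 ?sqr_ge0.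
  - by apply: addr_ge0; [exact: mulr_ge0 ae0 (expR_ge0 _)|apply: divr_ge0; exact: expR_ge0].
  - by apply: ler_pM; rewrite ?sqr_ge0 ?lerXn2r ?nnegrE ?addr_ge0.
  - apply: lerD.
      rewrite ler_wpM2l // ler_expR lzy; apply: ler_pM; rewrite ?addr_ge0 //; exact: lerD.
    rewrite expRD expRN ler_wpM2r ?invr_ge0 ?expR_ge0 // ler_expR; exact: ler_pM.
have Ke_ok : sieve_mass R z1 z2 N * kernel_error eta M0 y ae <= 1 / 25.
  have ke0 : 0 <= kernel_error eta M0 y ae.
    by rewrite mulr_ge0 ?exprn_ge0 // mulr_ge0 ?expR_ge0 // addr_ge0 // mulr_ge0 // ltW // npow_gt0.
  apply: le_trans kS; apply: ler_pM => //.
  apply: ler_pM; rewrite ?exprn_ge0 ?mulr_ge0 ?expR_ge0 ?addr_ge0 ?mulr_ge0 ?(ltW (npow_gt0 _ _)) //.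
    by rewrite lerXn2r ?nnegrE ?addr_ge0.
  apply: ler_pM; rewrite ?expR_ge0 ?addr_ge0 ?mulr_ge0 ?(ltW (npow_gt0 _ _)) //.
    rewrite ler_expR natrM lnM ?posrE //.
    have -> : 2 * eta * (ln y%:R + ln y%:R) = 4 * (eta * ln y%:R) by ring.
    by rewrite -[leRHS]mulrA ler_wpM2l // ler_pM.
  rewrite lerD2l ler_wpM2l // /npow ler_expR lerN2; apply: ler_pM => //.
  - by move: em1; move: (eta_max); clear=> q; lra.
  - by move: alL; clear; lra.
  - by rewrite lerD2l lerN2 ler_wpM2l.
(* The bound 1 holds for every y and serves when ky = 0; otherwise ln y >= ky L - 1 after rounding
   down. *)
have LV : lcm_form N (selberg_weight R y) <= V.
  case: VP => [V1|[b1 V2]]; first exact: le_trans (selberg_form_le1 R y0 yN) V1.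
  have lyb := ly' b1.
  have lyp : 0 < ln y%:R :> R by apply: lt_le_trans lyb; rewrite subr_gt0.
  have y1 : (1 < y)%N by rewrite ltnNge; apply/negP => y1; move: lyp; rewrite (_ : y = 1%N) ?ln1 ?ltxx //; apply/eqP; rewrite eqn_leq y1.
  apply: (le_trans (selberg_form_le_ln R y0 yN y1)); apply: le_trans V2.
  by rewrite ler_wpM2l // lef_pV2 ?posrE // subr_gt0.
have LV0 : 0 <= lcm_form N (selberg_weight R y) by exact: lcm_form_ge0.
have cl0 : 0 <= (cluster_bound L D) eta.
  rewrite /cluster_bound; have q1 : 0 <= ln (11 + L) by rewrite ln_ge0 //; move: L10; clear; lra.
  have q2 : 0 <= ln (1 + 2 * L / D) by rewrite ln_ge0 // lerDl divr_ge0 ?mulr_ge0 ?ltW.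
  have q3 : 0 <= eta * L by rewrite mulr_ge0 // ltW.
  by move: q1 q2 q3 D0; move: (ln _) (ln _) (eta * L); clear=> u v w; lra.
have Tm0 : 0 <= expR L by exact: expR_ge0.
have im z : z \in S -> 0 <= complex.Im z <= expR L.
  by move=> /HS [_ _ /andP[h ->]]; rewrite andbT (le_trans _ h) // expR_ge0.
apply: (count_by_boxes us s00 cl0 im).
- move=> zs g uz zS gT Hz.
  pose M := (Num.truncn (expR L + 3)).+1.
  have gM : g + 2 <= M%:R.
    apply: (@le_trans _ _ (expR L + 3)); last by rewrite ltW // truncnS_gt.
    by move: gT s01; move: (expR L) (s0); clear=> u v; lra.
  have L40 : 40 <= expR L.
    have h := @expR_ge_pow (5 / 2) 4; have e4 : 4%:R * (5 / 2) = 10 :> R by clear; lra.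
    apply: (@le_trans _ _ (expR 10)); last by rewrite ler_expR.
    by rewrite -e4; apply: le_trans (h _); clear; lra.
  have lMb : ln M%:R <= L + 1 / 5 by exact: ln_ceil_expR_add3.
  have lM0 : 0 <= ln M%:R :> R by rewrite ln_ge0 // ler1n.
  have et : 0 <= eta <= 73 / 100 / 100 by rewrite eta0.
  have ss : 0 < s0 <= 48 / 1000 by rewrite s00.
  have H z : z \in zs -> [/\ zeta z = 0, 1 - eta <= complex.Re z < 1, 0 < complex.Im z & `|complex.Im z - g| <= s0 / 2].
    move=> zz; have [a1 a2 /andP[a3 _]] := HS z (zS z zz); split=> //; last exact: Hz.
    exact: lt_le_trans (expR_gt0 _) a3.
  apply: (le_trans (zero_cluster zetaP uz et ss gM H)).
  rewrite /cluster_bound ler_wpM2l ?divr_ge0 //; apply: lerD.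
    apply: lerD; last first.
      have q1 : 0 < 10 + ln M%:R :> R by move: lM0; move: (ln M%:R); clear=> u; lra.
      have q2 : 10 + ln M%:R <= 11 + L by move: lMb; move: (ln M%:R); clear=> u; lra.
      by rewrite ler_ln ?posrE // (lt_le_trans q1).
    have c0 : 0 <= 3 * eta + 13 / 8 * s0 := coef_ge0 _ _ eta0 (ltW s00).
    apply: (le_trans (ler_wpM2l c0 lMb)).
    have sL : s0 * L = D by rewrite /s0 divfK // lt0r_neq0.
    have -> : (3 * eta + 13 / 8 * s0) * (L + 1 / 5) = 3 * (eta * L) + 13 / 8 * (s0 * L) + (3 * eta + 13 / 8 * s0) / 5 by ring.
    rewrite sL lerD2l; have := eta1; rewrite /eta_max; move: s01; move: (s0) (eta); clear=> u v; lra.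
  by rewrite ler_ln ?posrE ?addr_gt0 ?divr_gt0 ?mulr_gt0 // lerD2l /s0 invf_div mulrA.
- move=> Q act rho rS sp.
  have Z m : act m -> zeta (rho m) = 0 by move=> /rS /HS [].
  have re m : act m -> 1 - eta <= complex.Re (rho m) < 1 by move=> /rS /HS [].
  have imm m : act m -> expR lam <= complex.Im (rho m) <= expR L by move=> /rS /HS [].
  have et10 : eta <= 1 / 10 by move: eta1 em1; clear; lra.
  have T10 := expR_gt0 lam.
  have Hb := spaced_zeros_bound eta0 et10 zetaP M0p y0 z10 z12 (leqnn N) N1 om0 s00 T10 Mz HE Tm0 Z re imm sp De_ok Ke_ok.
  apply: (le_trans Hb); rewrite ler_wpM2l ?divr_ge0 //.
  have w0 : 0 <= ln (N%:R / z1%:R) + om.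
    have lM00 : 0 <= ln M0%:R :> R by rewrite ln_ge0 // ler1n.
    by rewrite lNz; apply: addr_ge0 (ltW om0); apply: addr_ge0 lr0; exact: addr_ge0.
  have q0 : 0 <= 12 / (om * s0 ^+ 2) by rewrite divr_ge0 // mulr_ge0 ?(ltW om0) ?sqr_ge0.
  apply: ler_pM; [exact: mulr_ge0|by apply: mulr_ge0; [exact: expR_ge0|exact: addr_ge0]|exact: ler_pM|].
  apply: ler_pM; [exact: expR_ge0|exact: addr_ge0| |].
    by rewrite ler_expR ler_wpM2l ?mulr_ge0 // lerD2r.
  apply: lerD => //; rewrite /om /s0 le_eqVlt; apply/orP; left; apply/eqP.
  by field; rewrite !lt0r_neq0.
Qed.

End Block.

(** * Reduction of the conditions to the left end of a range of L *)

Section BlockRegime.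
Variable R : realType.

Lemma expR1_ge : 27 / 10 <= expR 1 :> R.
Proof.
have -> : 1 = 128%:R * (1 / 128) :> R by lra.
apply: le_trans (expR_ge_pow 128 _); last by lra.
have -> : (1 + 1 / 128) ^+ 128 = ((((((1 + 1 / 128) ^+ 2) ^+ 2) ^+ 2) ^+ 2) ^+ 2 ^+ 2) ^+ 2 :> R by rewrite -!exprM.
apply: (@sqr_ge_of _ (16437 / 10000)); [lra| |lra].
apply: (@sqr_ge_of _ (12821 / 10000)); [lra| |lra].
apply: (@sqr_ge_of _ (11323 / 10000)); [lra| |lra].
apply: (@sqr_ge_of _ (10641 / 10000)); [lra| |lra].
apply: (@sqr_ge_of _ (10316 / 10000)); [lra| |lra].
apply: (@sqr_ge_of _ (10156 / 10000 + 8 / 100 / 1000)); [lra| |lra].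
lra.
Qed.

Lemma expR_nat_ge m : (27 / 10) ^+ m <= expR m%:R :> R.
Proof.
by rewrite -[m%:R]mulr1 expRM_natl lerXn2r ?nnegrE ?expR_ge0 ?expR1_ge // divr_ge0.
Qed.

(** Numerical facts are reduced to rational ones: exponentials are bounded below by powers of 27/10
    and above by powers of 9/7, one for each quarter. Here exp (- 1/4) is at least (127/128)^32,
    evaluated by repeated squaring. *)
Lemma expR_quarter_le : expR (1 / 4) <= 9 / 7 :> R.
Proof.
have h : 7 / 9 <= expR (- (1 / 4)) :> R.
  have -> : - (1 / 4) = 32%:R * (- (1 / 128)) :> R by lra.
  rewrite expRM_natl.
  have q : 127 / 128 <= expR (- (1 / 128)) :> R by apply: le_trans (expR_ge1Dx _); lra.
  apply: (@le_trans _ _ ((127 / 128) ^+ 32)); last by rewrite lerXn2r ?nnegrE ?expR_ge0 //; lra.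
  have -> : (127 / 128) ^+ 32 = (((((127 / 128) ^+ 2) ^+ 2) ^+ 2) ^+ 2) ^+ 2 :> R by rewrite -!exprM.
  apply: (@sqr_ge_of _ (882 / 1000)); [lra| |lra].
  apply: (@sqr_ge_of _ (9391 / 10000 + 5 / 100 / 1000)); [lra| |lra].
  apply: (@sqr_ge_of _ (9691 / 10000)); [lra| |lra].
  apply: (@sqr_ge_of _ (9844 / 10000 + 3 / 100 / 1000)); [lra| |lra].
  lra.
have -> : expR (1 / 4) = (expR (- (1 / 4)))^-1 :> R by rewrite expRN invrK.
by rewrite -[9 / 7]invf_div lef_pV2 ?posrE ?expR_gt0 // divr_gt0.
Qed.

Lemma expR_quarters_le q : expR (q%:R / 4) <= (9 / 7) ^+ q :> R.
Proof.
rewrite (_ : q%:R / 4 = q%:R * (1 / 4)); last by rewrite div1r.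
rewrite expRM_natl.
by rewrite lerXn2r ?nnegrE ?expR_ge0 ?divr_ge0 // expR_quarter_le.
Qed.

Lemma ln_le_nat (x : R) m : 0 < x -> x <= (27 / 10) ^+ m -> ln x <= m%:R.
Proof.
move=> x0 xm; rewrite -[leRHS]expRK ler_ln ?posrE ?expR_gt0 //.
exact: le_trans xm (expR_nat_ge m).
Qed.

Lemma affine_growth (a b L0 rho : R) : 0 <= a -> 1 <= rho -> a + b * (L0 * rho) <= (a + b * L0) * rho.
Proof. by move=> a0 r1; rewrite mulrDl mulrA lerD2r ler_peMr. Qed.

(** As rho <= exp (rho - 1), the power costs 4 (rho - 1) in the exponent, and e L0 >= 4 pays for it.
    So a condition with a polynomial factor of degree at most 4 in L need only be checked at L0. *)
Lemma poly_exp_decay (e L0 rho : R) : 4 <= e * L0 -> 1 <= rho ->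
  rho ^+ 4 * expR (- (e * (L0 * rho))) <= expR (- (e * L0)).
Proof.
move=> e4 r1; have r : rho <= expR (rho - 1) by apply: le_trans (expR_ge1Dx _); rewrite addrC subrK.
apply: (@le_trans _ _ (expR (rho - 1) ^+ 4 * expR (- (e * (L0 * rho))))).
  by rewrite ler_wpM2r ?expR_ge0 // lerXn2r ?nnegrE ?expR_ge0 // (le_trans _ r1).
rewrite -expRM_natl -expRD ler_expR mulrA.
have : 0 <= (e * L0 - 4) * (rho - 1) by rewrite mulr_ge0 ?subr_ge0.
by move: (e * L0) => p; rewrite mulrBl !mulrBr; lra.
Qed.

Lemma small_product (G e t P : R) m : 0 <= G -> G * P <= (27 / 10) ^+ m -> m%:R + t <= e -> 0 < P ->
  G * expR (- e + t) <= P^-1.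
Proof.
move=> G0 Gm me P0; rewrite -[leRHS]mul1r ler_pdivlMr // mulrAC.
apply: (@le_trans _ _ (expR m%:R * expR (- e + t))).
  by rewrite ler_wpM2r ?expR_ge0 // (le_trans Gm) // expR_nat_ge.
by rewrite -expRD -[leRHS]expR0 ler_expR; lra.
Qed.

(** With rho = L / L0, the constants B and K are replaced by B rho and K rho; the polynomial factors
    in front of the approximation error then grow at most like rho^4, which [poly_exp_decay]
    absorbs. The exponent of T is compared with 1.448, and exp E stands for the excess. *)
Lemma zero_block_regime (zeta : Cplx R -> Cplx R) (zetaP : is_riemann_zeta zeta)
  (L0 L lam eta al ky k1 k2 De D B K V S0 C Q E b n z d : R) (m1 m3 q : nat) (S : seq R[i]) :
  d = De / 2 - 2 * eta_max R ->
  n = 2 * al + 3 * ky + k2 + k1 -> z = al + 2 * ky + k2 + k1 ->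
  0 <= eta -> eta <= eta_max R -> 10 <= L0 -> L0 <= L -> 8 <= al * L0 ->
  0 < al -> 0 <= ky -> 0 < k1 -> 0 < k2 -> 0 < D -> D <= 48 / 1000 * L0 -> De <= 1 -> 1 <= De * (al * L0) ->
  [\/ De <= 2 - al^-1, 3 * De <= 3 - al^-1 | 7 * De <= 4 - al^-1] ->
  0 < d -> 0 <= B -> 1024 * (1 + 2 * L0) <= B ^+ 2 -> 8 <= K -> (B + 3) * (1 + 3 / 5 * d) <= K * (3 / 5 * d) ->
  1 <= V \/ 1 < ky * L /\ 2 / (ky * L - 1) <= V ->
  384 * (n + 1 / L0) * (z + 3 / L0) / k1 ^+ 2 <= S0 ->
  (2 + z * L0) * (1 + ky * L0) ^+ 2 * K * 20 <= (27 / 10) ^+ m1 ->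
  m1%:R + eta_max R <= (d * al - eta_max R * (z + ky)) * L0 -> 4 <= (d * al - eta_max R * (z + ky)) * L0 ->
  S0 * ((1 + ky * L0) ^+ 3 * (K + 2)) * 25 <= (27 / 10) ^+ m3 ->
  m3%:R <= (d * al - 4 * eta_max R * ky) * L0 -> 4 <= (d * al - 4 * eta_max R * ky) * L0 ->
  (2 + z * L) * (1 + ky * L) ^+ 2 * 20 <= expR (lam - eta_max R * (n * L + 1)) ->
  13 / 8 * D + 1 / 50 + ln (11 + L) + ln (1 + 2 * L / D) <= C -> 0 < C ->
  V * ((al + ky + k1 + k2) * L + 1 + 12 * L / (k2 * D ^+ 2)) <= Q ->
  (2 * (n + k2) + 3 / C - 1448 / 1000) * (eta * L) <= E -> E + 2 * eta_max R <= q%:R / 4 ->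
  10 / 3 * (13 / 10) * C * S0 * Q * (9 / 7) ^+ q <= b ->
  uniq S ->
  (forall s, s \in S -> [/\ zeta s = 0, 1 - eta <= complex.Re s < 1 & expR lam <= complex.Im s <= expR L]) ->
  (size S)%:R <= b * expR (1448 / 1000 * (eta * L)).
Proof.
move=> dE nE zE et0 et1 L10 LL aL al0 ky0 k10 k20 D0 DL De1 DeL Det d0 B0 BL K8 KB VP hS h1 m1e e14 h3 m3e e34 h2 hC C0 hQ hE hq hb us HS.
have em0 : 0 <= eta_max R by exact: le_trans et1.
have em1 : eta_max R <= 1 / 100 by rewrite /eta_max; clear; lra.
have L0p : 0 < L0 by move: L10; clear; lra.
have Lp : 0 < L by exact: lt_le_trans LL.
have [rho LE r1] : exists2 rho, L = L0 * rho & 1 <= rho.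
  by exists (L / L0); [rewrite mulrC divfK // lt0r_neq0|rewrite ler_pdivlMr // mul1r].
have r0 : 0 <= rho by exact: le_trans r1.
have rr : rho <= rho ^+ 2 by rewrite expr2 ler_peMl.
have z0 : 0 <= z by rewrite zE; move: al0 ky0 k10 k20; clear; lra.
have K0 : 0 <= K by move: K8; clear; lra.
have S00 : 0 <= S0.
  apply: le_trans hS; apply: divr_ge0 (sqr_ge0 _); apply: mulr_ge0.
    apply: mulr_ge0; [exact: ler0n|apply: addr_ge0; last by rewrite divr_ge0 // ltW].
    by rewrite nE; move: al0 ky0 k10 k20; clear; lra.
  by apply: (addr_ge0 z0); rewrite divr_ge0 // ltW.
have mono u : 0 <= u -> u * L0 <= u * L by move=> u0; rewrite ler_wpM2l.
have y1 : 0 <= 1 + ky * L0 by rewrite addr_ge0 // mulr_ge0 // ltW.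
have y1L : 0 <= 1 + ky * L by rewrite addr_ge0 // mulr_ge0 // ltW.
have z1 : 0 <= 2 + z * L0 by rewrite addr_ge0 // mulr_ge0 // ltW.
have z1L : 0 <= 2 + z * L by rewrite addr_ge0 // mulr_ge0 // ltW.
have yg : 1 + ky * L <= (1 + ky * L0) * rho by rewrite LE affine_growth.
have zg : 2 + z * L <= (2 + z * L0) * rho by rewrite LE affine_growth.
have nb : ln_N_bound L al ky k1 k2 = n * L + 1 by rewrite /ln_N_bound nE.
have zb : ln_z_bound L al ky k1 k2 = z * L + 1 by rewrite /ln_z_bound zE.
have yb : ln_y_bound L ky = ky * L by [].
have SMb : sieve_mass_bound_ln L al ky k1 k2 <= S0.
  apply: le_trans hS; rewrite /sieve_mass_bound_ln nb zb.
  have -> : 384 * (n * L + 1) * (2 + (z * L + 1)) / (k1 * L) ^+ 2 = 384 * (n + 1 / L) * (z + 3 / L) / k1 ^+ 2.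
    by field; rewrite !lt0r_neq0.
  have n0 : 0 <= n by rewrite nE; move: al0 ky0 k10 k20; clear; lra.
  have i1 : 0 <= 1 / L by rewrite divr_ge0 // ltW.
  have i3 : 0 <= 3 / L by rewrite divr_ge0 // ltW.
  have iL u : 0 <= u -> u / L <= u / L0 by move=> u0; rewrite ler_wpM2l // lef_pV2 ?posrE.
  rewrite ler_wpM2r ?invr_ge0 ?sqr_ge0 //; apply: ler_pM.
  - by apply: mulr_ge0; [exact: ler0n|exact: addr_ge0].
  - exact: addr_ge0.
  - by apply: ler_wpM2l; [exact: ler0n|rewrite lerD2l iL].
  - by rewrite lerD2l iL.
have Kr8 : 8 <= K * rho by apply: (le_trans K8); rewrite ler_peMr.
have KrB : (B * rho + 3) * (1 + 3 / 5 * d) <= K * rho * (3 / 5 * d).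
  apply: (@le_trans _ _ ((B + 3) * (1 + 3 / 5 * d) * rho)); last by rewrite [leRHS]mulrAC ler_wpM2r.
  rewrite [leRHS]mulrAC ler_wpM2r //; first by move: (d) d0; clear=> *; lra.
  by rewrite mulrDl lerD2l ler_peMr.
have BrL : 1024 * (1 + 2 * L) <= (B * rho) ^+ 2.
  rewrite exprMn; apply: (@le_trans _ _ (B ^+ 2 * rho)); last by rewrite ler_wpM2l ?sqr_ge0.
  apply: (@le_trans _ _ (1024 * (1 + 2 * L0) * rho)); last by rewrite ler_wpM2r.
  by rewrite -[leRHS]mulrA; apply: ler_wpM2l; [exact: ler0n|rewrite LE affine_growth].
have Br0 : 0 <= B * rho by rewrite mulr_ge0.
have De0 : 0 < De by move: em0 d0; rewrite dE; move: (eta_max R); clear=> *; lra.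
have DeL' : 1 <= De * (al * L) by apply: (le_trans DeL); rewrite ler_wpM2l ?(ltW De0) // mono // ltW.
have L10' : 10 <= L by exact: le_trans LL.
have aL' : 8 <= al * L by apply: (le_trans aL); rewrite mono // ltW.
have DL' : D <= 48 / 1000 * L by apply: (le_trans DL); apply: mono; apply: divr_ge0; exact: ler0n.
have dd : d <= 1 - 2 * eta_max R by move: em1 De1; rewrite dE; move: (eta_max R); clear=> *; lra.
have det : (1 + ln_z_bound L al ky k1 k2) * (1 + ln_y_bound L ky) ^+ 2 *
  (approx_error L al De (K * rho) * expR (eta_max R * (ln_z_bound L al ky k1 k2 + ln_y_bound L ky)) +
   expR (eta_max R * ln_N_bound L al ky k1 k2 - lam)) <= 1 / 10.
  rewrite nb zb yb /approx_error -dE.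
  have -> : 1 + (z * L + 1) = 2 + z * L by ring.
  have P0 : 0 <= (2 + z * L) * (1 + ky * L) ^+ 2 by rewrite mulr_ge0 // exprn_ge0.
  have t2 : (2 + z * L) * (1 + ky * L) ^+ 2 * expR (eta_max R * (n * L + 1) - lam) <= 1 / 20.
    rewrite -opprB expRN ler_pdivrMr ?expR_gt0 //.
    by move: h2; move: (expR _) ((2 + z * L) * _ ^+ 2); clear=> u v; lra.
  have t1 : (2 + z * L) * (1 + ky * L) ^+ 2 * (K * rho * expR (- (d * (al * L))) * expR (eta_max R * (z * L + 1 + ky * L))) <= 1 / 20.
    have -> : (2 + z * L) * (1 + ky * L) ^+ 2 * (K * rho * expR (- (d * (al * L))) * expR (eta_max R * (z * L + 1 + ky * L))) =
      (2 + z * L) * (1 + ky * L) ^+ 2 * (K * rho) * (expR (- ((d * al - eta_max R * (z + ky)) * L)) * expR (eta_max R)).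
      have EE : expR (- (d * (al * L))) * expR (eta_max R * (z * L + 1 + ky * L)) =
          expR (- ((d * al - eta_max R * (z + ky)) * L)) * expR (eta_max R).
        by rewrite -!expRD; congr expR; ring.
      by rewrite -[K * rho * _ * _]mulrA EE !mulrA.
    set e1 := d * al - _ in m1e e14 *.
    apply: (@le_trans _ _ ((2 + z * L0) * (1 + ky * L0) ^+ 2 * K * (rho ^+ 4 * expR (- (e1 * L)) * expR (eta_max R)))).
      have -> : (2 + z * L0) * (1 + ky * L0) ^+ 2 * K * (rho ^+ 4 * expR (- (e1 * L)) * expR (eta_max R)) =
         ((2 + z * L0) * rho) * ((1 + ky * L0) * rho) ^+ 2 * (K * rho) * (expR (- (e1 * L)) * expR (eta_max R)) by ring.
      rewrite ler_wpM2r ?mulr_ge0 ?expR_ge0 // ler_wpM2r ?mulr_ge0 //; apply: ler_pM; rewrite ?exprn_ge0 //.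
      by rewrite lerXn2r ?nnegrE // mulr_ge0.
    apply: (@le_trans _ _ ((2 + z * L0) * (1 + ky * L0) ^+ 2 * K * expR (- (e1 * L0) + eta_max R))).
      rewrite expRD ler_wpM2l ?mulr_ge0 ?exprn_ge0 // ler_wpM2r ?expR_ge0 // LE; exact: poly_exp_decay.
    rewrite div1r; apply: (small_product _ h1 m1e); first by rewrite !mulr_ge0 ?exprn_ge0.
    by clear; lra.
  by rewrite mulrDr; apply: (le_trans (lerD t1 t2)); clear; lra.
have ker : sieve_mass_bound_ln L al ky k1 k2 * ((1 + ln_y_bound L ky) ^+ 3 * (expR (4 * eta_max R * ln_y_bound L ky) *
  (approx_error L al De (K * rho) + 2 * expR (- ((1 - 2 * eta_max R) * (al * L)))))) <= 1 / 25.
  rewrite yb /approx_error -dE.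
  set e3 := d * al - _ in m3e e34.
  have r2 : expR (- ((1 - 2 * eta_max R) * (al * L))) <= expR (- (d * (al * L))).
    by rewrite ler_expR lerN2 ler_wpM2r // mulr_ge0 ?ltW.
  have t3 : expR (4 * eta_max R * (ky * L)) * (K * rho * expR (- (d * (al * L))) + 2 * expR (- ((1 - 2 * eta_max R) * (al * L)))) <=
      (K + 2) * rho * expR (- (e3 * L)).
    have -> : expR (- (e3 * L)) = expR (4 * eta_max R * (ky * L)) * expR (- (d * (al * L))).
      by rewrite -expRD /e3; congr expR; ring.
    rewrite [leRHS]mulrCA ler_wpM2l ?expR_ge0 // [(K + 2) * rho]mulrDl [leRHS]mulrDl lerD2l -[leRHS]mulrA ler_wpM2l //.
    by apply: (le_trans r2); rewrite ler_peMl ?expR_ge0.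
  apply: (@le_trans _ _ (S0 * (((1 + ky * L0) * rho) ^+ 3 * ((K + 2) * rho * expR (- (e3 * L)))))).
    have q0 : 0 <= (1 + ky * L) ^+ 3 * (expR (4 * eta_max R * (ky * L)) *
       (K * rho * expR (- (d * (al * L))) + 2 * expR (- ((1 - 2 * eta_max R) * (al * L))))).
      rewrite mulr_ge0 ?exprn_ge0 // mulr_ge0 ?expR_ge0 // addr_ge0 ?mulr_ge0 ?expR_ge0 //.
    apply: (@le_trans _ _ (S0 * ((1 + ky * L) ^+ 3 * (expR (4 * eta_max R * (ky * L)) *
       (K * rho * expR (- (d * (al * L))) + 2 * expR (- ((1 - 2 * eta_max R) * (al * L)))))))); first by rewrite ler_wpM2r.
    rewrite ler_wpM2l //; apply: ler_pM => //; rewrite ?exprn_ge0 //.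
      by rewrite mulr_ge0 ?expR_ge0 // addr_ge0 ?mulr_ge0 ?expR_ge0.
    by rewrite lerXn2r ?nnegrE // mulr_ge0.
  have -> : S0 * (((1 + ky * L0) * rho) ^+ 3 * ((K + 2) * rho * expR (- (e3 * L)))) =
     S0 * ((1 + ky * L0) ^+ 3 * (K + 2)) * (rho ^+ 4 * expR (- (e3 * L))) by ring.
  have G0 : 0 <= S0 * ((1 + ky * L0) ^+ 3 * (K + 2)) by rewrite mulr_ge0 // mulr_ge0 ?exprn_ge0 // addr_ge0.
  apply: (@le_trans _ _ (S0 * ((1 + ky * L0) ^+ 3 * (K + 2)) * expR (- (e3 * L0) + 0))).
    by rewrite addr0 ler_wpM2l // LE; exact: poly_exp_decay.
  rewrite div1r; apply: (small_product G0 h3); last by clear; lra.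
  by rewrite addr0.
have Q00 : 0 <= (al + ky + k1 + k2) * L + 1 + 12 * L / (k2 * D ^+ 2).
  apply: addr_ge0.
    by apply: addr_ge0 => //; apply: mulr_ge0 (ltW Lp); move: al0 ky0 k10 k20; clear; lra.
  by apply: divr_ge0; [rewrite mulr_ge0 // ltW|apply: mulr_ge0 (sqr_ge0 _); exact: ltW].
have V0 : 0 <= V.
  case: VP => [V1|[b1 V2]]; first exact: le_trans V1.
  by apply: le_trans V2; rewrite divr_ge0 // subr_ge0 ltW.
have x0 : 0 <= eta * L by rewrite mulr_ge0 // ltW.
have d00 := d0; have KrB0 := KrB; rewrite dE in d00 KrB0.
have Hb := zero_block zetaP et0 et1 L10' aL' al0 ky0 k10 k20 D0 DL' De1 DeL' Det d00 Br0 BrL Kr8 KrB0 VP det ker us HS.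
apply: (le_trans Hb); rewrite /block_bound nb /cluster_bound /ln_ratio_bound.
set c := _ + ln (1 + 2 * L / D).
(* The cluster bound grows linearly in eta L; C (1 + v) <= C exp v turns this growth into the small
   addition 3 / C to the exponent. *)
have cC : c <= C * expR (3 / C * (eta * L)).
  have e1 := expR_ge1Dx (3 / C * (eta * L)).
  have e2 : C * (1 + 3 / C * (eta * L)) <= C * expR (3 / C * (eta * L)) by rewrite ler_wpM2l // ltW.
  apply: le_trans e2; rewrite mulrDr mulr1 mulrA [C * (3 / C)]mulrC divfK ?lt0r_neq0 //.
  by move: hC; rewrite /c; move: (ln _) (ln _) (eta * L); clear=> u v w; lra.
have W0 : 0 <= V * ((al + ky + k1 + k2) * L + 1 + 12 * L / (k2 * D ^+ 2)) by exact: mulr_ge0.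
have Q0 : 0 <= Q by exact: le_trans hQ.
have SM0 : 0 <= sieve_mass_bound_ln L al ky k1 k2.
  rewrite /sieve_mass_bound_ln nb zb divr_ge0 ?sqr_ge0 // mulr_ge0 ?mulr_ge0 //.
  - by rewrite addr_ge0 // mulr_ge0 ?(ltW Lp) // nE; move: al0 ky0 k10 k20; clear; lra.
  - by rewrite addr_ge0 // addr_ge0 // mulr_ge0 // ltW.
move: hQ W0; set W := _ + 12 * L / _ => hQ W0.
set Ex := expR (2 * eta * _).
have Ex0 : 0 <= Ex by exact: expR_ge0.
have c00 : 0 <= C * expR (3 / C * (eta * L)) by rewrite mulr_ge0 ?expR_ge0 // ltW.
have s1 : sieve_mass_bound_ln L al ky k1 k2 * V * (Ex * W) <= S0 * Q * Ex.
  have -> : sieve_mass_bound_ln L al ky k1 k2 * V * (Ex * W) = sieve_mass_bound_ln L al ky k1 k2 * (V * W) * Ex by ring.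
  by rewrite ler_wpM2r //; apply: ler_pM.
have s10 : 0 <= sieve_mass_bound_ln L al ky k1 k2 * V * (Ex * W) by exact: mulr_ge0 (mulr_ge0 SM0 V0) (mulr_ge0 Ex0 Q00).
have n53 : 0 <= 5 / 3 :> R by apply: divr_ge0; exact: ler0n.
have n13 : 0 <= 13 / 10 :> R by apply: divr_ge0; exact: ler0n.
apply: (@le_trans _ _ (2 * (5 / 3 * (C * expR (3 / C * (eta * L))) * (13 / 10 * (S0 * Q * Ex))))).
  apply: ler_wpM2l; first exact: ler0n.
  apply: (@le_trans _ _ (5 / 3 * (C * expR (3 / C * (eta * L))) * (13 / 10 * (sieve_mass_bound_ln L al ky k1 k2 * V * (Ex * W))))).
    by apply: ler_wpM2r; [exact: mulr_ge0|exact: ler_wpM2l].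
  by apply: ler_wpM2l; [exact: mulr_ge0|exact: ler_wpM2l].
have ExE : Ex * expR (3 / C * (eta * L)) <= (9 / 7) ^+ q * expR (1448 / 1000 * (eta * L)).
  apply: (@le_trans _ _ (expR (q%:R / 4) * expR (1448 / 1000 * (eta * L)))); last first.
    by rewrite ler_wpM2r ?expR_ge0 // expR_quarters_le.
  rewrite /Ex -!expRD ler_expR.
  have -> : 2 * eta * (n * L + 1 + k2 * L) = 2 * (n + k2) * (eta * L) + 2 * eta by ring.
  move: hE hq; rewrite mulrBl mulrDl; move: (2 * (n + k2) * _) (3 / C * _) (1448 / 1000 * _) (q%:R / 4) et1; clear.
  by move: (eta_max R) => em u v w x *; lra.
have -> : 2 * (5 / 3 * (C * expR (3 / C * (eta * L))) * (13 / 10 * (S0 * Q * Ex))) =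
   10 / 3 * (13 / 10) * C * S0 * Q * (Ex * expR (3 / C * (eta * L))).
  by move: (expR _) => u; field.
apply: (@le_trans _ _ (10 / 3 * (13 / 10) * C * S0 * Q * ((9 / 7) ^+ q * expR (1448 / 1000 * (eta * L))))).
  by apply: ler_wpM2l ExE; apply: mulr_ge0 Q0; apply: mulr_ge0 S00; apply: mulr_ge0 (ltW C0); apply: mulr_ge0 n13; apply: divr_ge0; exact: ler0n.
by rewrite mulrA ler_wpM2r ?expR_ge0.
Qed.

End BlockRegime.

(** * Numerical conditions for a range of heights *)

Section RegimeBounds.
Variable R : realType.

(** For L0 <= L <= L1, without Selberg weights (ky = 0). The exponent of T may exceed 1.448 here,
    since the excess is at most a constant times eta_max L1 and is paid for by (9/7)^q in [fr_E].
    The integers m1, m2, m3, ma and mb are exponents of 27/10 < e in place of logarithms. *)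
Record finite_regime (L0 L1 lam al k1 k2 D De B K C Q S0 b : R) (m1 m2 m3 ma mb q : nat) : Prop := FiniteRegime {
  fr_L0 : 10 <= L0;
  fr_pos : [/\ 0 < al, 0 < k1, 0 < k2, 0 < D & 0 < C];
  fr_al : 8 <= al * L0;
  fr_D : D <= 48 / 1000 * L0;
  fr_De1 : De <= 1;
  fr_De : 1 <= De * (al * L0);
  fr_Det : [\/ De <= 2 - al^-1, 3 * De <= 3 - al^-1 | 7 * De <= 4 - al^-1];
  fr_d : 0 < De / 2 - 2 * eta_max R;
  fr_B : 0 <= B;
  fr_BL : 1024 * (1 + 2 * L0) <= B ^+ 2;
  fr_K8 : 8 <= K;
  fr_KB : (B + 3) * (1 + 3 / 5 * (De / 2 - 2 * eta_max R)) <= K * (3 / 5 * (De / 2 - 2 * eta_max R));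
  fr_S0 : 384 * (2 * al + k2 + k1 + 1 / L0) * (al + k2 + k1 + 3 / L0) / k1 ^+ 2 <= S0;
  fr_1 : (2 + (al + k2 + k1) * L0) * K * 20 <= (27 / 10) ^+ m1;
  fr_m1 : m1%:R + eta_max R <= ((De / 2 - 2 * eta_max R) * al - eta_max R * (al + k2 + k1)) * L0;
  fr_m14 : 4 <= ((De / 2 - 2 * eta_max R) * al - eta_max R * (al + k2 + k1)) * L0;
  fr_3 : S0 * (K + 2) * 25 <= (27 / 10) ^+ m3;
  fr_m3 : m3%:R <= (De / 2 - 2 * eta_max R) * al * L0;
  fr_m34 : 4 <= (De / 2 - 2 * eta_max R) * al * L0;
  fr_2 : (2 + (al + k2 + k1) * L1) * 20 <= (27 / 10) ^+ m2;
  fr_m2 : m2%:R + eta_max R * ((2 * al + k2 + k1) * L1 + 1) <= lam;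
  fr_ma : 11 + L1 <= (27 / 10) ^+ ma;
  fr_mb : 1 + 2 * L1 / D <= (27 / 10) ^+ mb;
  fr_C : 13 / 8 * D + 1 / 50 + ma%:R + mb%:R <= C;
  fr_Q : (al + k1 + k2) * L1 + 1 + 12 * L1 / (k2 * D ^+ 2) <= Q;
  fr_E : (2 * (2 * al + k2 + k1 + k2) + 3 / C - 1448 / 1000) * (eta_max R * L1) + 2 * eta_max R <= q%:R / 4;
  fr_q : 2 * eta_max R <= q%:R / 4;
  fr_b : 10 / 3 * (13 / 10) * C * S0 * Q * (9 / 7) ^+ q <= b
}.

Definition block_le (zeta : Cplx R -> Cplx R) (eta lam L b : R) := forall S : seq R[i], uniq S ->
  (forall s, s \in S -> [/\ zeta s = 0, 1 - eta <= complex.Re s < 1 & expR lam <= complex.Im s <= expR L]) ->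
  (size S)%:R <= b * expR (1448 / 1000 * (eta * L)).

Definition zeros_upto (zeta : Cplx R -> Cplx R) (eta L b : R) := forall S : seq R[i], uniq S ->
  (forall s, s \in S -> [/\ zeta s = 0, 1 - eta <= complex.Re s < 1 & 0 < complex.Im s <= expR L]) ->
  (size S)%:R <= b * expR (1448 / 1000 * (eta * L)).

Lemma block_finite_regime (zeta : Cplx R -> Cplx R) (zetaP : is_riemann_zeta zeta) (eta : R) (eta0 : 0 <= eta) (eta1 : eta <= eta_max R)
    L0 L1 lam al k1 k2 D De B K C Q S0 b m1 m2 m3 ma mb q L :
  finite_regime L0 L1 lam al k1 k2 D De B K C Q S0 b m1 m2 m3 ma mb q -> L0 <= L -> L <= L1 ->
  block_le zeta eta lam L b.
Proof.
case=> L10 [al0 k10 k20 D0 C0] aL DL De1 DeL Det d0 B0 BL K8 KB hS h1 m1e e14 h3 m3e e34 h2 m2e hma hmb hC hQ hE hq hb LL LL1 S us HS.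
have em0 : 0 <= eta_max R by exact: le_trans eta1.
have Lp : 0 < L by move: L10 LL; clear; lra.
have L1p : 0 < L1 by exact: lt_le_trans LL1.
have zp : 0 <= al + k2 + k1 by move: al0 k10 k20; clear; lra.
have np : 0 <= 2 * al + k2 + k1 by move: al0 k10 k20; clear; lra.
have kD : 0 < k2 * D ^+ 2 by rewrite mulr_gt0 // exprn_gt0.
have x0 : 0 <= eta * L by rewrite mulr_ge0 // ltW.
have x1 : eta * L <= eta_max R * L1 by rewrite ler_pM // ltW.
have nE : 2 * al + k2 + k1 = 2 * al + 3 * 0 + k2 + k1 by ring.
have zE : al + k2 + k1 = al + 2 * 0 + k2 + k1 by ring.
apply: (@zero_block_regime R zeta zetaP L0 L lam eta al 0 k1 k2 De D B K 1 S0 C Q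
  (q%:R / 4 - 2 * eta_max R) b _ _ _ m1 m3 q S (erefl _) nE zE eta0 eta1 L10 LL aL al0 (lexx 0) k10 k20 D0 DL
  De1 DeL Det d0 B0 BL K8 KB) => //.
- by left.
- by rewrite mul0r addr0 expr1n mulr1.
- by rewrite addr0.
- by rewrite addr0.
- by rewrite mul0r addr0 expr1n mul1r.
- by rewrite mulr0 subr0.
- by rewrite mulr0 subr0.
- rewrite mul0r addr0 expr1n mulr1.
  apply: (@le_trans _ _ ((2 + (al + k2 + k1) * L1) * 20)).
    by apply: ler_wpM2r; [exact: ler0n|rewrite lerD2l ler_wpM2l].
  apply: (le_trans h2); apply: (le_trans (expR_nat_ge R m2)); rewrite ler_expR lerBrDr.
  by apply: le_trans m2e; rewrite lerD2l ler_wpM2l // lerD2r ler_wpM2l.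
- have a1 : ln (11 + L) <= ma%:R.
    apply: ln_le_nat; first by move: Lp; clear; lra.
    by apply: le_trans hma; rewrite lerD2l.
  have a2 : ln (1 + 2 * L / D) <= mb%:R.
    apply: ln_le_nat; first by apply: addr_gt0 => //; apply: divr_gt0 => //; exact: mulr_gt0.
    by apply: le_trans hmb; rewrite lerD2l ler_wpM2r ?invr_ge0 ?(ltW D0) // ler_wpM2l.
  by apply: le_trans hC; apply: lerD => //; rewrite lerD2l.
- rewrite mul1r addr0; apply: le_trans hQ; apply: lerD.
    by rewrite lerD2r ler_wpM2l // addr_ge0 ?ltW // addr_gt0.
  by rewrite ler_wpM2r ?invr_ge0 ?(ltW kD) // ler_wpM2l // ler0n.
- move: hE hq; set c := _ - 1448 / 1000; set t := q%:R / 4 => hE hq.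
  have [c0|c0] := leP c 0.
    apply: (@le_trans _ _ 0); first by rewrite mulr_le0_ge0.
    by rewrite subr_ge0.
  by rewrite lerBrDr; apply: le_trans hE; rewrite lerD2r ler_wpM2l // ltW.
- by rewrite subrK.
Qed.

(** For L0 <= L <= Lm, where Lm enters only through the two logarithms of the cluster bound. The
    exponent has to satisfy [lr_E] outright, the lower height is T^nu, and Selberg weights offset
    the factor L in the number of well-spaced zeros. *)
Record large_regime (L0 Lm nu al ky k1 k2 D De B K C Q S0 b : R) (m1 m2 m3 ma mb q : nat) : Prop := LargeRegime {
  lr_L0 : 10 <= L0;
  lr_pos : [/\ 0 < al, 0 < k1, 0 < k2, 0 < D & 0 < C];
  lr_ky : 0 < ky;
  lr_ky1 : 1 < ky * L0;
  lr_al : 8 <= al * L0;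
  lr_D : D <= 48 / 1000 * L0;
  lr_De1 : De <= 1;
  lr_De : 1 <= De * (al * L0);
  lr_Det : [\/ De <= 2 - al^-1, 3 * De <= 3 - al^-1 | 7 * De <= 4 - al^-1];
  lr_d : 0 < De / 2 - 2 * eta_max R;
  lr_B : 0 <= B;
  lr_BL : 1024 * (1 + 2 * L0) <= B ^+ 2;
  lr_K8 : 8 <= K;
  lr_KB : (B + 3) * (1 + 3 / 5 * (De / 2 - 2 * eta_max R)) <= K * (3 / 5 * (De / 2 - 2 * eta_max R));
  lr_S0 : 384 * (2 * al + 3 * ky + k2 + k1 + 1 / L0) * (al + 2 * ky + k2 + k1 + 3 / L0) / k1 ^+ 2 <= S0;
  lr_1 : (2 + (al + 2 * ky + k2 + k1) * L0) * (1 + ky * L0) ^+ 2 * K * 20 <= (27 / 10) ^+ m1;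
  lr_m1 : m1%:R + eta_max R <= ((De / 2 - 2 * eta_max R) * al - eta_max R * (al + 2 * ky + k2 + k1 + ky)) * L0;
  lr_m14 : 4 <= ((De / 2 - 2 * eta_max R) * al - eta_max R * (al + 2 * ky + k2 + k1 + ky)) * L0;
  lr_3 : S0 * ((1 + ky * L0) ^+ 3 * (K + 2)) * 25 <= (27 / 10) ^+ m3;
  lr_m3 : m3%:R <= ((De / 2 - 2 * eta_max R) * al - 4 * eta_max R * ky) * L0;
  lr_m34 : 4 <= ((De / 2 - 2 * eta_max R) * al - 4 * eta_max R * ky) * L0;
  lr_2 : (2 + (al + 2 * ky + k2 + k1) * L0) * (1 + ky * L0) ^+ 2 * 20 <= (27 / 10) ^+ m2;
  lr_m2 : m2%:R + eta_max R <= (nu - eta_max R * (2 * al + 3 * ky + k2 + k1)) * L0;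
  lr_m24 : 4 <= (nu - eta_max R * (2 * al + 3 * ky + k2 + k1)) * L0;
  lr_ma : 11 + Lm <= (27 / 10) ^+ ma;
  lr_mb : 1 + 2 * Lm / D <= (27 / 10) ^+ mb;
  lr_C : 13 / 8 * D + 1 / 50 + ma%:R + mb%:R <= C;
  lr_Q : 2 * ((al + ky + k1 + k2) * L0 + 1 + 12 * L0 / (k2 * D ^+ 2)) <= Q * (ky * L0 - 1);
  lr_Qky : 2 * (al + ky + k1 + k2 + 12 / (k2 * D ^+ 2)) <= Q * ky;
  lr_E : 2 * (2 * al + 3 * ky + k2 + k1 + k2) + 3 / C - 1448 / 1000 <= 0;
  lr_q : 2 * eta_max R <= q%:R / 4;
  lr_b : 10 / 3 * (13 / 10) * C * S0 * Q * (9 / 7) ^+ q <= b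
}.

Lemma block_large_regime (zeta : Cplx R -> Cplx R) (zetaP : is_riemann_zeta zeta) (eta : R) (eta0 : 0 <= eta) (eta1 : eta <= eta_max R)
    L0 Lm nu al ky k1 k2 D De B K C Q S0 b m1 m2 m3 ma mb q L :
  large_regime L0 Lm nu al ky k1 k2 D De B K C Q S0 b m1 m2 m3 ma mb q -> L0 <= L -> L <= Lm ->
  block_le zeta eta (nu * L) L b.
Proof.
case=> L10 [al0 k10 k20 D0 C0] ky0 ky1 aL DL De1 DeL Det d0 B0 BL K8 KB hS h1 m1e e14 h3 m3e e34 h2 m2e e24 hma hmb hC hQ hQk hE hq hb LL LLm S us HS.
have em0 : 0 <= eta_max R by exact: le_trans eta1.
have L0p : 0 < L0 by move: L10; clear; lra.
have Lp : 0 < L by exact: lt_le_trans LL.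
have kD : 0 < k2 * D ^+ 2 by rewrite mulr_gt0 // exprn_gt0.
have x0 : 0 <= eta * L by rewrite mulr_ge0 // ltW.
have kyL : 1 < ky * L by apply: (lt_le_trans ky1); rewrite ler_wpM2l // ltW.
have kyLp : 0 < ky * L - 1 by rewrite subr_gt0.
have VP : 1 <= 2 / (ky * L - 1) \/ 1 < ky * L /\ 2 / (ky * L - 1) <= 2 / (ky * L - 1) by right.
have [n nE] : exists n, n = 2 * al + 3 * ky + k2 + k1 by exists (2 * al + 3 * ky + k2 + k1).
have [z zE] : exists z, z = al + 2 * ky + k2 + k1 by exists (al + 2 * ky + k2 + k1).
rewrite -nE in hS m2e e24 hE; rewrite -zE in hS h1 m1e e14 h2.
have z0 : 0 <= z by rewrite zE; move: al0 ky0 k10 k20; clear; lra.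
apply: (@zero_block_regime R zeta zetaP L0 L (nu * L) eta al ky k1 k2 De D B K (2 / (ky * L - 1)) S0 C Q
  (q%:R / 4 - 2 * eta_max R) b n z _ m1 m3 q S (erefl _) nE zE eta0 eta1 L10 LL aL al0 (ltW ky0) k10 k20 D0 DL
  De1 DeL Det d0 B0 BL K8 KB VP hS h1 m1e e14 h3 m3e e34) => //.
- have [e2 e2E] : exists e2, e2 = nu - eta_max R * n by exists (nu - eta_max R * n).
  rewrite -e2E in m2e e24.
  have [rho LE r1] : exists2 rho, L = L0 * rho & 1 <= rho.
    by exists (L / L0); [rewrite mulrC divfK // lt0r_neq0|rewrite ler_pdivlMr // mul1r].
  have r0 : 0 <= rho by exact: le_trans r1.
  have c1 : 0 <= 2 + z * L0 by rewrite addr_ge0 // mulr_ge0 // ltW.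
  have c2 : 0 <= 1 + ky * L0 by rewrite addr_ge0 // mulr_ge0 // ltW.
  have g1 : 2 + z * L <= (2 + z * L0) * rho by rewrite LE affine_growth.
  have g2 : 1 + ky * L <= (1 + ky * L0) * rho by rewrite LE affine_growth.
  have a1 : 0 <= 2 + z * L by rewrite addr_ge0 // mulr_ge0 // ltW.
  have a2 : 0 <= 1 + ky * L by rewrite addr_ge0 // mulr_ge0 // ltW.
  have dec := poly_exp_decay e24 r1; rewrite -LE in dec.
  have P : (2 + z * L) * (1 + ky * L) ^+ 2 <= (2 + z * L0) * (1 + ky * L0) ^+ 2 * rho ^+ 4.
    have -> : (2 + z * L0) * (1 + ky * L0) ^+ 2 * rho ^+ 4 = ((2 + z * L0) * rho) * (((1 + ky * L0) * rho) ^+ 2 * rho) by ring.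
    apply: ler_pM => //; first exact: sqr_ge0.
    apply: (@le_trans _ _ (((1 + ky * L0) * rho) ^+ 2)).
      by rewrite lerXn2r ?nnegrE //; exact: mulr_ge0.
    by rewrite ler_peMr ?sqr_ge0.
  have G : (2 + z * L0) * (1 + ky * L0) ^+ 2 * 20 <= expR (e2 * L0 - eta_max R).
    by apply: (le_trans h2); apply: (le_trans (expR_nat_ge R m2)); rewrite ler_expR lerBrDr.
  apply: (@le_trans _ _ ((2 + z * L0) * (1 + ky * L0) ^+ 2 * 20 * rho ^+ 4)).
    by rewrite [leRHS]mulrAC ler_wpM2r // ler0n.
  apply: (@le_trans _ _ (expR (e2 * L0 - eta_max R) * rho ^+ 4)); first by rewrite ler_wpM2r ?exprn_ge0.
  have -> : expR (nu * L - eta_max R * (n * L + 1)) = expR (e2 * L0 - eta_max R) * (expR (- (e2 * L0)) / expR (- (e2 * L))).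
    by rewrite -[(expR (- (e2 * L)))^-1]expRN -!expRD; congr expR; rewrite e2E; ring.
  by rewrite ler_wpM2l ?expR_ge0 // ler_pdivlMr ?expR_gt0.
- have b1 : ln (11 + L) <= ma%:R.
    apply: ln_le_nat; first by move: Lp; clear; lra.
    by apply: le_trans hma; rewrite lerD2l.
  have b2 : ln (1 + 2 * L / D) <= mb%:R.
    apply: ln_le_nat; first by apply: addr_gt0 => //; apply: divr_gt0 => //; exact: mulr_gt0.
    by apply: le_trans hmb; rewrite lerD2l ler_wpM2r ?invr_ge0 ?(ltW D0) // ler_wpM2l.
  by apply: le_trans hC; apply: lerD => //; rewrite lerD2l.
- rewrite mulrAC ler_pdivrMr //.
  (* The inequality is affine in L: [lr_Q] is the case L = L0, and [lr_Qky] compares the slopes. *)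
  have h : 0 <= (L - L0) * (Q * ky - 2 * (al + ky + k1 + k2 + 12 / (k2 * D ^+ 2))) by rewrite mulr_ge0 ?subr_ge0.
  move: h hQ; have -> : 12 * L / (k2 * D ^+ 2) = L * (12 / (k2 * D ^+ 2)) by move: (k2 * D ^+ 2)^-1 => v; ring.
  have -> : 12 * L0 / (k2 * D ^+ 2) = L0 * (12 / (k2 * D ^+ 2)) by move: (k2 * D ^+ 2)^-1 => v; ring.
  move: (12 / _); clear=> u; lra.
- apply: (@le_trans _ _ 0); first by rewrite mulr_le0_ge0.
  by rewrite subr_ge0.
- by rewrite subrK.
Qed.

Lemma zeros_upto_step (zeta : Cplx R -> Cplx R) (eta : R) (eta0 : 0 <= eta) (lam L f b : R) : lam <= L -> 0 <= f -> zeros_upto zeta eta lam f -> block_le zeta eta lam L b ->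
  zeros_upto zeta eta L (f + b).
Proof.
move=> lL f0 Zf Bb S us HS; pose p (s : R[i]) := complex.Im s < expR lam.
rewrite -(count_predC p S) natrD mulrDl -!size_filter; apply: lerD.
  apply: (@le_trans _ _ (f * expR (1448 / 1000 * (eta * lam)))).
    apply: Zf; first exact: filter_uniq.
    move=> s; rewrite mem_filter => /andP[ps /HS [a1 a2 /andP[a3 _]]]; split=> //.
    by rewrite a3 /= ltW.
  rewrite ler_wpM2l // ler_expR; apply: ler_wpM2l; first by apply: divr_ge0; exact: ler0n.
  exact: ler_wpM2l.
apply: Bb; first exact: filter_uniq.
move=> s; rewrite mem_filter => /andP[ps /HS [a1 a2 /andP[_ a4]]]; split=> //.
by rewrite a4 andbT leNgt.
Qed.

Lemma zeros_upto_le (zeta : Cplx R -> Cplx R) (eta L f g : R) : f <= g -> zeros_upto zeta eta L f -> zeros_upto zeta eta L g.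
Proof. by move=> fg Z S us HS; apply: (le_trans (Z S us HS)); rewrite ler_wpM2r ?expR_ge0. Qed.

(** About 1.5 10^9 boxes of height 48/1000, the largest that [zero_cluster] admits, hold at most
    33/2 zeros each. *)
Lemma zeros_upto_18 (zeta : Cplx R -> Cplx R) (zetaP : is_riemann_zeta zeta) (eta : R) (eta0 : 0 <= eta) (eta1 : eta <= eta_max R) : zeros_upto zeta eta 18 (27 * 10 ^+ 9).
Proof.
move=> S us HS.
have em0 : 0 <= eta_max R by exact: le_trans eta1.
pose Q := (Num.truncn (expR 18 * (1000 / 48) : R)).+1.
pose box (z : R[i]) := Num.truncn (complex.Im z * (1000 / 48)).
have c48 : 0 <= 1000 / 48 :> R by clear; lra.
have boxQ z : z \in S -> (box z < Q)%N.
  by move=> /HS [_ _ /andP[_ h]]; rewrite ltnS le_truncn // ler_wpM2r.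
have e18 : expR 18 <= (9 / 7) ^+ 72 :> R.
  by have := expR_quarters_le R 72; rewrite (_ : 72%:R / 4 = 18) //; clear; lra.
have e40 : 40 <= expR 18 :> R.
  by apply: le_trans (expR_nat_ge R 18); clear; lra.
pose M := (Num.truncn (expR 18 + 3 : R)).+1.
have lM : ln M%:R <= 18 + 1 / 5 :> R by exact: ln_ceil_expR_add3.
have lM0 : 0 <= ln M%:R :> R by rewrite ln_ge0 // ler1n.
have box_le m : (count (fun z => box z == m) S)%:R <= 33 / 2 :> R.
  rewrite -size_filter; set zs := [seq z <- S | box z == m].
  pose g : R := (m%:R + 1 / 2) * (48 / 1000).
  have et : 0 <= eta <= 73 / 100 / 100 by rewrite eta0.
  have ss : 0 < (48 / 1000 : R) <= 48 / 1000 by apply/andP; split; clear; lra.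
  have Hb z : z \in zs -> [/\ z \in S, m%:R <= complex.Im z * (1000 / 48) & complex.Im z * (1000 / 48) < m%:R + 1].
    rewrite mem_filter => /andP[/eqP <- zS]; have [_ _ /andP[i0 _]] := HS z zS.
    have /truncn_itv/andP[b1 b2] : 0 <= complex.Im z * (1000 / 48) by rewrite mulr_ge0 // ltW.
    by split=> //; rewrite natr1.
  have [->|zn] := eqVneq zs [::]; first by rewrite /=; clear; lra.
  have gM : g + 2 <= M%:R.
    case: (zs) zn Hb => // z zs' _ /(_ z (mem_head _ _)) [zS b1 _].
    have [_ _ /andP[_ i1]] := HS z zS.
    apply: (@le_trans _ _ (expR 18 + 3)); last by rewrite ltW // truncnS_gt.
    by move: b1 i1; rewrite /g; move: (complex.Im z) (m%:R) (expR 18); clear=> u v w; lra.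
  have H z : z \in zs -> [/\ zeta z = 0, 1 - eta <= complex.Re z < 1, 0 < complex.Im z & `|complex.Im z - g| <= 48 / 1000 / 2].
    move=> /Hb [zS b1 b2]; have [a1 a2 /andP[a3 _]] := HS z zS; split=> //.
    by rewrite ler_norml /g; move: b1 b2; move: (complex.Im z) (m%:R); clear=> u v *; apply/andP; split; lra.
  apply: (le_trans (zero_cluster zetaP (filter_uniq _ us) et ss gM H)).
  have q1 : ln (10 + ln M%:R) <= 4%:R :> R.
    by apply: ln_le_nat; move: lM lM0; move: (ln M%:R); clear=> u; lra.
  have q2 : ln (1 + 2 / (48 / 1000)) <= 4%:R :> R by apply: ln_le_nat; clear; lra.
  have q3 : (3 * eta + 13 / 8 * (48 / 1000)) * ln M%:R <= (3 * (73 / 100 / 100) + 13 / 8 * (48 / 1000)) * (18 + 1 / 5).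
    by apply: ler_pM; [move: eta0; clear; lra|exact: lM0|move: eta1; rewrite /eta_max; clear; lra|exact: lM].
  by move: q1 q2 q3; move: (ln (10 + _)) (ln (1 + _)) (_ * ln _); clear=> u v w; lra.
have tot : (size S)%:R <= Q%:R * (33 / 2) :> R.
  have -> : (size S)%:R = \sum_(m < Q) (count (fun z => box z == m) S)%:R :> R.
    have ct m : (count (fun z => box z == m) S)%:R = \sum_(z <- S) (box z == m)%:R :> R.
      by rewrite -sum1_count natr_sum big_mkcond; apply: eq_bigr => z _; case: eqP.
    under eq_bigr do rewrite ct.
    rewrite exchange_big /= -sum1_size natr_sum big_seq [RHS]big_seq; apply: eq_bigr => z zS.
    rewrite (bigD1 (Ordinal (boxQ z zS))) //= eqxx big1 ?addr0 //.
    by move=> m; rewrite -val_eqE /= eq_sym => /negbTE ->.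
  apply: (@le_trans _ _ (\sum_(m < Q) (33 / 2))); first by apply: ler_sum => m _; exact: box_le.
  by rewrite sumr_const card_ord [Q%:R * _]mulr_natl.
have Qb : Q%:R <= expR 18 * (1000 / 48) + 1 :> R.
  have -> : Q%:R = (Num.truncn (expR 18 * (1000 / 48) : R))%:R + 1 :> R by rewrite natr1.
  by rewrite lerD2r; have /andP[] := @truncn_itv _ (expR 18 * (1000 / 48) : R) (mulr_ge0 (expR_ge0 _) c48).
have fin : Q%:R * (33 / 2) <= 27 * 10 ^+ 9 :> R.
  by move: Qb e18; move: (expR 18) (Q%:R); clear=> u v *; lra.
apply: (le_trans tot); apply: (le_trans fin); rewrite ler_peMr //.
apply: (le_trans _ (expR_ge1Dx _)); rewrite lerDl; apply: mulr_ge0; first by clear; lra.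
by apply: mulr_ge0 => //; clear; lra.
Qed.

End RegimeBounds.

(** * Admissible parameters for each range *)

Section RegimeTable.
Variable R : realType.
Local Notation finite_regime := (@finite_regime R).
Local Notation large_regime := (@large_regime R).

Ltac regime_tac := constructor; rewrite /eta_max;
  first [lra | by split; lra | by constructor 1; lra | by constructor 2; lra | by constructor 3; lra].

(** In each range De is the best of the three savings for al, rounded down, or 1 as here. The first
    order is best up to L = 150, the second up to 600, the third beyond. D is at or close to its cap
    48/1000 L0 as long as L0 <= 1400. *)
Lemma regime_18 : finite_regime 18 42 18 (2061 / 1000) (2366 / 1000) (4995 / 10000) (86 / 100) (1000 / 1000) 195 (879) (1043 / 100) 1573 (2462) (13 * 10 ^+ 9) 17 15 18 4 5 17.
Proof. by regime_tac. Qed.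

Lemma regime_42 : finite_regime 42 80 18 (9666 / 10000) (1146 / 1000) (2578 / 10000) (201 / 100) (9654 / 10000) 296 (1365) (1330 / 100) 1113 (2401) (95 * 10 ^+ 9) 18 16 19 5 5 14.
Proof. by regime_tac. Qed.

Lemma regime_80 : finite_regime 80 150 18 (7612 / 10000) (5344 / 10000) (1429 / 10000) (384 / 100) (6862 / 10000) 407 (2492) (1727 / 100) 1072 (4393) (95 * 10 ^+ 9) 19 15 20 6 5 15.
Proof. by regime_tac. Qed.

Lemma regime_150 : finite_regime 150 280 18 (6318 / 10000) (3621 / 10000) (646 / 10000) (720 / 100) (4724 / 10000) 556 (4765) (2273 / 100) 1302 (5363) (95 * 10 ^+ 9) 19 14 21 6 5 18.
Proof. by regime_tac. Qed.

Lemma regime_280 : finite_regime 280 440 18 (5053 / 10000) (2200 / 10000) (347 / 10000) (1344 / 100) (3403 / 10000) 758 (8916) (3387 / 100) 1179 (7763) (95 * 10 ^+ 9) 20 13 22 7 5 16.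
Proof. by regime_tac. Qed.

Lemma regime_440 : finite_regime 440 600 18 (4465 / 10000) (2015 / 10000) (260 / 10000) (2111 / 100) (2534 / 10000) 950 (1513 * 10) (4633 / 100) 1028 (7234) (95 * 10 ^+ 9) 19 13 22 7 5 16.
Proof. by regime_tac. Qed.

Lemma regime_600 : finite_regime 600 800 18 (4049 / 10000) (1478 / 10000) (196 / 10000) (2880 / 100) (2186 / 10000) 1109 (2069 * 10) (5883 / 100) 1050 (9939) (95 * 10 ^+ 9) 20 12 23 7 5 14.
Proof. by regime_tac. Qed.

Lemma regime_800 : finite_regime 800 1050 18 (3696 / 10000) (1256 / 10000) (169 / 10000) (3794 / 100) (1849 / 10000) 1281 (2878 * 10) (7468 / 100) 1058 (1110 * 10) (95 * 10 ^+ 9) 20 11 23 8 5 12.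
Proof. by regime_tac. Qed.

Lemma regime_1050 : finite_regime 1050 1400 18 (3479 / 10000) (781 / 10000) (81 / 10000) (5040 / 100) (1608 / 10000) 1467 (3871 * 10) (9493 / 100) 1426 (2155 * 10) (95 * 10 ^+ 9) 20 10 24 8 5 7.
Proof. by regime_tac. Qed.

(** Here N^eta_max is too large for the lower height exp 18 in [fr_m2], so exp 42 is used. The
    coefficient 82 leaves room for the 40 already spent below exp 42. *)
Lemma regime_1400 : finite_regime 1400 2100 42 (3294 / 10000) (541 / 10000) (73 / 10000) (6720 / 100) (1377 / 10000) 1694 (5384 * 10) (12223 / 100) 1587 (3719 * 10) (82 * 10 ^+ 9) 21 30 25 8 5 2.
Proof. by regime_tac. Qed.

Lemma regime_2100 : finite_regime 2100 6000 42 (3128 / 10000) (737 / 10000) (82 / 10000) (7479 / 100) (1147 / 10000) 2075 (8310 * 10) (13656 / 100) 3941 (1984 * 10) (82 * 10 ^+ 9) 22 11 28 9 6 1.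
Proof. by regime_tac. Qed.

(** In [lr_E] the exponent is about 1.4475, against 1.448. The integers 30 and 26 bound ln (11 + L)
    and ln (1 + 2 L / D) for all L up to 6.7 10^12. *)
Lemma regime_6000 : large_regime 6000 (67 / 10 * 10 ^+ 12) (1 / 50) (2944 / 10000) (128 / 10000) (764 / 10000) (72 / 10000) 126 (861 / 10000) 3506 (2091 * 100) 261 79 (1892 * 10) (3 * 10 ^+ 9) 32 20 48 30 26 1.
Proof. by regime_tac. Qed.

End RegimeTable.

(** * Assembling the ranges *)

Section Conclusion.
Variable R : realType.

Lemma block_large (zeta : Cplx R -> Cplx R) (zetaP : is_riemann_zeta zeta) (eta : R) (eta0 : 0 <= eta) (eta1 : eta <= eta_max R) L :
  6000 <= L -> L <= 67 / 10 * 10 ^+ 12 -> block_le zeta eta (1 / 50 * L) L (3 * 10 ^+ 9).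
Proof. exact: (block_large_regime zetaP eta0 eta1 (regime_6000 R)). Qed.

Lemma zeros_upto_6000 (zeta : Cplx R -> Cplx R) (zetaP : is_riemann_zeta zeta) (eta : R) (eta0 : 0 <= eta) (eta1 : eta <= eta_max R) L :
  28 <= L -> L <= 6000 -> zeros_upto zeta eta L (122 * 10 ^+ 9).
Proof.
move=> L28 L6.
have Z18 := zeros_upto_18 zetaP eta0 eta1.
have f0 : 0 <= 27 * 10 ^+ 9 :> R by clear; lra.
have blk := block_finite_regime zetaP eta0 eta1.
have L18 : 18 <= L by move: L28; clear; lra.
have from18 b : b <= 95 * 10 ^+ 9 -> block_le zeta eta 18 L b -> zeros_upto zeta eta L (122 * 10 ^+ 9).
  move=> hb B; apply: zeros_upto_le (zeros_upto_step eta0 L18 f0 Z18 B).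
  by move: hb; clear; lra.
(* In units of 10^9: 27 below exp 18 and 13 from [regime_18]. *)
have Z42 : zeros_upto zeta eta 42 (40 * 10 ^+ 9).
  have B := blk _ _ _ _ _ _ _ _ _ _ _ _ _ _ _ _ _ _ _ _ 42 (regime_18 R) _ (lexx _).
  apply: zeros_upto_le (zeros_upto_step eta0 _ f0 Z18 (B _)); by clear; lra.
have from42 b : 42 <= L -> b <= 82 * 10 ^+ 9 -> block_le zeta eta 42 L b -> zeros_upto zeta eta L (122 * 10 ^+ 9).
  move=> L42 hb B; have f42 : 0 <= 40 * 10 ^+ 9 :> R by clear; lra.
  apply: zeros_upto_le (zeros_upto_step eta0 L42 f42 Z42 B).
  by move: hb; clear; lra.
have [l1|l1] := leP L 42; first by apply: (from18 _ _ (blk _ _ _ _ _ _ _ _ _ _ _ _ _ _ _ _ _ _ _ _ L (regime_18 R) L18 l1)); clear; lra.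
have [l2|l2] := leP L 80; first by apply: (from18 _ _ (blk _ _ _ _ _ _ _ _ _ _ _ _ _ _ _ _ _ _ _ _ L (regime_42 R) (ltW l1) l2)); clear; lra.
move: l2 => {l1} l1.
have [l2|l2] := leP L 150; first by apply: (from18 _ _ (blk _ _ _ _ _ _ _ _ _ _ _ _ _ _ _ _ _ _ _ _ L (regime_80 R) (ltW l1) l2)); clear; lra.
move: l2 => {l1} l1.
have [l2|l2] := leP L 280; first by apply: (from18 _ _ (blk _ _ _ _ _ _ _ _ _ _ _ _ _ _ _ _ _ _ _ _ L (regime_150 R) (ltW l1) l2)); clear; lra.
move: l2 => {l1} l1.
have [l2|l2] := leP L 440; first by apply: (from18 _ _ (blk _ _ _ _ _ _ _ _ _ _ _ _ _ _ _ _ _ _ _ _ L (regime_280 R) (ltW l1) l2)); clear; lra.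
move: l2 => {l1} l1.
have [l2|l2] := leP L 600; first by apply: (from18 _ _ (blk _ _ _ _ _ _ _ _ _ _ _ _ _ _ _ _ _ _ _ _ L (regime_440 R) (ltW l1) l2)); clear; lra.
move: l2 => {l1} l1.
have [l2|l2] := leP L 800; first by apply: (from18 _ _ (blk _ _ _ _ _ _ _ _ _ _ _ _ _ _ _ _ _ _ _ _ L (regime_600 R) (ltW l1) l2)); clear; lra.
move: l2 => {l1} l1.
have [l2|l2] := leP L 1050; first by apply: (from18 _ _ (blk _ _ _ _ _ _ _ _ _ _ _ _ _ _ _ _ _ _ _ _ L (regime_800 R) (ltW l1) l2)); clear; lra.
move: l2 => {l1} l1.
have [l2|l2] := leP L 1400; first by apply: (from18 _ _ (blk _ _ _ _ _ _ _ _ _ _ _ _ _ _ _ _ _ _ _ _ L (regime_1050 R) (ltW l1) l2)); clear; lra.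
move: l2 => {l1} l1.
have [l2|l2] := leP L 2100.
  apply: (from42 _ _ _ (blk _ _ _ _ _ _ _ _ _ _ _ _ _ _ _ _ _ _ _ _ L (regime_1400 R) _ l2)); last exact: ltW.
    by move: l1; clear; lra.
  by clear; lra.
apply: (from42 _ _ _ (blk _ _ _ _ _ _ _ _ _ _ _ _ _ _ _ _ _ _ _ _ L (regime_2100 R) (ltW l2) L6)); last by clear; lra.
by move: l2; clear; lra.
Qed.

(** Each use of [block_large] leaves only the zeros up to T^(1/50), so k uses bring ln T from 6000 *
    50^k down to 6000, at a cost of 3 10^9 each. *)
Lemma zeros_upto_large (zeta : Cplx R -> Cplx R) (zetaP : is_riemann_zeta zeta) (eta : R) (eta0 : 0 <= eta) (eta1 : eta <= eta_max R) k L :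
  28 <= L -> L <= 6000 * 50 ^+ k -> L <= 67 / 10 * 10 ^+ 12 ->
  zeros_upto zeta eta L (122 * 10 ^+ 9 + k%:R * (3 * 10 ^+ 9)).
Proof.
elim: k L => [|k IH] L L28 Lk LL.
  by rewrite mul0r addr0; apply: zeros_upto_6000 => //; move: Lk; rewrite expr0 mulr1.
have c0 : 0 <= 3 * 10 ^+ 9 :> R by clear; lra.
have c1 : 0 <= 122 * 10 ^+ 9 :> R by clear; lra.
have [l6|l6] := leP L 6000.
  apply: zeros_upto_le (zeros_upto_6000 zetaP eta0 eta1 L28 l6).
  by rewrite lerDl mulr_ge0.
have B := block_large zetaP eta0 eta1 (ltW l6) LL.
have E (a c : R) : a + k.+1%:R * c = a + k%:R * c + c by rewrite -natr1 mulrDl mul1r addrA.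
rewrite E; have lL : 1 / 50 * L <= L by move: l6; clear; lra.
have fk : 0 <= 122 * 10 ^+ 9 + k%:R * (3 * 10 ^+ 9) :> R by rewrite addr_ge0 // mulr_ge0.
apply: (zeros_upto_step eta0 lL fk _ B); apply: IH.
- by move: l6; clear; lra.
- by rewrite mulrC mul1r ler_pdivrMr // -mulrA -exprSr.
- by move: l6 LL; clear; lra.
Qed.

(** An infinite set would contain a finite subset with more than b elements. *)
Lemma counting_le (T : choiceType) (A : set T) (b : R) : 0 <= b ->
  (forall S : seq T, uniq S -> (forall x, x \in S -> A x) -> (size S)%:R <= b) ->
  (counting A <= b%:E)%E.
Proof.
move=> b0 H; rewrite /counting; case: asboolP => [fA|iA].
  rewrite lee_fin; apply: H; first exact: finmap.fset_uniq.
  by move=> x; rewrite in_fset_set // inE.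
have [B BA nB] := infinite_set_fset (Num.truncn b).+1 iA.
have := H (finmap.enum_fset B) (finmap.fset_uniq _) (fun x xB => BA x xB).
rewrite leNgt => /negP[]; apply: (lt_le_trans (truncnS_gt b)).
by rewrite ler_nat.
Qed.

End Conclusion.

Theorem mainTheorem2 (R : realType) (zeta : Cplx R -> Cplx R)
    (zetaP : is_riemann_zeta zeta) (T sigma : R)
    (T_gt : 3 * 10 ^+ 12 < T) (T_le : T <= expR (67 / 10 * 10 ^+ 12))
    (sigma_ge : 9927 / 10 ^+ 4 <= sigma) (sigma_le : sigma <= 1) :
  (Nzeros zeta sigma T <=
   (162 / 100 * 10 ^+ 11 * T `^ (1448 / 1000 * (1 - sigma)))%:E)%E.
Proof.
have eta0 : 0 <= 1 - sigma by rewrite subr_ge0.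
have eta1 : 1 - sigma <= eta_max R by rewrite /eta_max; move: sigma_ge; clear; lra.
have T0 : 0 < T by move: T_gt; clear; lra.
have TE : expR (ln T) = T by rewrite lnK ?posrE.
have L28 : 28 <= ln T.
  rewrite -ler_expR TE; apply: le_trans (ltW T_gt).
  have := expR_quarters_le R 112; rewrite (_ : 112%:R / 4 = 28); last by clear; lra.
  by move=> h; apply: (le_trans h); clear; lra.
have LL : ln T <= 67 / 10 * 10 ^+ 12 by rewrite -ler_expR TE.
(* 6 is the least exponent that suffices, and 122 + 6 * 3 = 140 <= 162. *)
have L50 : ln T <= 6000 * 50 ^+ 6 by apply: (le_trans LL); clear; lra.
have Z := zeros_upto_large zetaP eta0 eta1 L28 L50 LL.
rewrite /Nzeros /powR gt_eqF //; apply: counting_le.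
  by rewrite mulr_ge0 ?expR_ge0 //; clear; lra.
move=> S us HS; rewrite -[1448 / 1000 * _ * _]mulrA.
apply: (le_trans (Z S us _)) => [s /HS [z0 [/andP[i0 i1] /andP[r0 r1]]]|].
  split=> //; first by rewrite opprB addrCA subrr addr0 ltW.
  by rewrite TE i0 ltW.
by rewrite ler_wpM2r ?expR_ge0 //; clear; lra.
Qed.
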